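(* Let $M$ be a free $\mathcal{O}$-module of rank $n\ge2$ with a continuous $\mathcal{O}$-linear action of $\operatorname{Gal}(\bar{\mathbb{Q}}/\mathbb{Q})$ such that (i) only finitely many primes ramify in $M$; (ii) $M_K=M\otimes_{\mathcal{O}}K$ is irreducible; (iii) there is a $G_p$-stable $K$-subspace $W\subset M_K$ of dimension $d^+$ with $G_p$ acting on $M_K/W$ unramifiedly; and assume $S_A(\mathbb{Q}_\infty)$ is a cotorsion $\Lambda$-module. Suppose that $\bar C$ does not contain a non-zero $\operatorname{Gal}(\bar{\mathbb{Q}}/\mathbb{Q}_\infty)$-submodule of $\bar A$, and that the image of the restriction map $S_{\bar A}(L_\infty)^G\to\operatorname{Hom}(I_\beta,\bar C)$ is finite. Then: (1) $S_{\bar A}(\mathbb{Q}_\infty)/S^0_{\bar A}(\mathbb{Q}_\infty)$ is finite; (2) the $\mu$-invariant of $S_A(\mathbb{Q}_\infty)$ vanishes if and only if the $\mu$-invariant of $S^0_A(\mathbb{Q}_\infty)$ vanishes.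
   Context: $p$ odd prime; $K/\mathbb{Q}_p$ finite with valuation ring $\mathcal{O}$, uniformizer $\varpi$. Fix $\iota_p:\bar{\mathbb{Q}}\hookrightarrow\bar{\mathbb{Q}}_p$, giving $G_p=\operatorname{Gal}(\bar{\mathbb{Q}}_p/\mathbb{Q}_p)\subset\operatorname{Gal}(\bar{\mathbb{Q}}/\mathbb{Q})$. $d^+$ is the dimension of the $+1$-eigenspace of complex conjugation on $M_K$. $\mathbb{Q}_\infty$: cyclotomic $\mathbb{Z}_p$-extension of $\mathbb{Q}$; $\Lambda=\mathcal{O}[[\operatorname{Gal}(\mathbb{Q}_\infty/\mathbb{Q})]]$; $\eta_p$ the unique prime of $\mathbb{Q}_\infty$ above $p$ with inertia group $I_{\eta_p}$. $A=M_K/M$, $C$ the image of $W$ in $A$, $D=A/C$, $\bar A=A[\varpi]$, $\bar C=C[\varpi]$, $\bar D=\bar A/\bar C$. $\Sigma$ is a finite set of primes containing $p$ and the primes ramified in $M$; $\mathbb{Q}_\Sigma$ the maximal extension of $\mathbb{Q}$ unramified outside $\Sigma$. $S_A(\mathbb{Q}_\infty)=\ker\big(H^1(\operatorname{Gal}(\mathbb{Q}_\Sigma/\mathbb{Q}_\infty),A)\to\bigoplus_{\ell\in\Sigma,\ell\ne p}\prod_{\eta\mid\ell}H^1(\mathbb{Q}_{\infty,\eta},A)\oplus H^1(\mathbb{Q}_{\infty,\eta_p},A)/L_{\eta_p}\big)$, $L_{\eta_p}=\ker(H^1(\mathbb{Q}_{\infty,\eta_p},A)\to H^1(I_{\eta_p},D))$;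 $S_{\bar A}(\mathbb{Q}_\infty)$ is the same with $\bar A,\bar D$. Fine Selmer groups $S^0_A(\mathbb{Q}_\infty)$, $S^0_{\bar A}(\mathbb{Q}_\infty)$ are the kernels of $H^1(\operatorname{Gal}(\mathbb{Q}_\Sigma/\mathbb{Q}_\infty),-)\to\bigoplus_{\ell\in\Sigma}\prod_{\eta\mid\ell}H^1(\mathbb{Q}_{\infty,\eta},-)$. Let $L$ be the fixed field of the kernel of the action on $\bar A$, $L_\infty=L\mathbb{Q}_\infty$, $G=\operatorname{Gal}(L_\infty/\mathbb{Q}_\infty)$, $\beta$ the prime of $L_\infty$ above $p$ determined by $\iota_p$ and $I_\beta\subset\operatorname{Gal}(\mathbb{Q}_\Sigma/L_\infty)$ its inertia group. $S_{\bar A}(L_\infty)$ is the set of homomorphisms $\psi:\operatorname{Gal}(\mathbb{Q}_\Sigma/L_\infty)\to\bar A$ that vanish on the decomposition groups of all primes of $L_\infty$ above primes of $\Sigma\setminus\{p\}$ and satisfy $\psi(I_\beta)\subseteq\bar C$; $G$ acts by $(g\psi)(x)=g^{-1}\psi(\tilde gx\tilde g^{-1})$ ($\tilde g$ a lift to $\operatorname{Gal}(\mathbb{Q}_\Sigma/\mathbb{Q}_\infty)$), and $S_{\bar A}(L_\infty)^G$ denotes the invariants. The $\mu$-invariant of a cofinitely generated cotorsion $\Lambda$-module is $\sum_i\mu_i$ where its Pontryagin dual is pseudo-isomorphic to $\bigoplus_i\Lambda/(\varpi^{\mu_i})\oplus\bigoplus_j\Lambda/(f_j^{\lambda_j})$.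 *)

(* Defs.v *)
From HB Require Import structures.
From mathcomp Require Import all_boot all_order all_algebra all_field.
From mathcomp Require Import boolp classical_sets functions cardinality fsbigop.

Set Implicit Arguments.
Unset Strict Implicit.
Unset Printing Implicit Defensive.

Import Order.TTheory GRing.Theory Num.Theory.

Local Open Scope quotient_scope.
Local Open Scope classical_set_scope.
Local Open Scope ring_scope.

Record autom (F : fieldType) := Autom {
  aut_fun :> F -> F;
  aut_inv : F -> F;
  aut_funK : cancel aut_fun aut_inv;
  aut_invK : cancel aut_inv aut_fun;
  aut_add : {morph aut_fun : x y / x + y};
  aut_mul : {morph aut_fun : x y / x * y} }.

HB.instance Definition _ F := gen_eqMixin (autom F).
HB.instance Definition _ F := gen_choiceMixin (autom F).

Section AutomGroup.
Variable F : fieldType.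
Implicit Types s t u : autom F.

Lemma autom_eq s t : s =1 t -> s = t.
Proof.
case: s t => [f f' fK f'K fD fM] [g g' gK g'K gD gM] /= /funext efg.
subst g; have efg' : f' = g'.
  by apply/funext=> x; rewrite -{1}(g'K x) fK.
by subst g'; congr Autom; apply: Prop_irrelevance.
Qed.

Definition autom_one : autom F.
Proof. by apply: (@Autom F id id). Defined.

Definition autom_inv s : autom F.
Proof.
apply: (@Autom F (aut_inv s) s (@aut_invK F s) (@aut_funK F s)) => x y;
  apply: (can_inj (@aut_funK F s)).
  by rewrite aut_add !aut_invK.
by rewrite aut_mul !aut_invK.
Defined.

Definition autom_mul s t : autom F.
Proof.
apply: (@Autom F (s \o t) (aut_inv t \o aut_inv s)).
- exact: can_comp (@aut_funK F s) (@aut_funK F t).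
- exact: can_comp (@aut_invK F t) (@aut_invK F s).
- by move=> x y /=; rewrite !aut_add.
- by move=> x y /=; rewrite !aut_mul.
Defined.

Lemma autom_mulA : associative autom_mul.
Proof. by move=> s t u; apply: autom_eq. Qed.
Lemma autom_mul1 : left_id autom_one autom_mul.
Proof. by move=> s; apply: autom_eq. Qed.
Lemma autom_mulr1 : right_id autom_one autom_mul.
Proof. by move=> s; apply: autom_eq. Qed.
Lemma autom_mulV : left_inverse autom_one autom_inv autom_mul.
Proof. by move=> s; apply: autom_eq => x /=; rewrite aut_funK. Qed.
Lemma autom_mulrV : right_inverse autom_one autom_inv autom_mul.
Proof. by move=> s; apply: autom_eq => x /=; rewrite aut_invK. Qed.

HB.instance Definition _ := isGroup.Build (autom F)
  autom_mulA autom_mul1 autom_mulr1 autom_mulV autom_mulrV.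

Definition fixing (E : set F) : set (autom F) :=
  [set s | forall x, E x -> s x = x].

Definition fixedfield (H : set (autom F)) : set F :=
  [set x | forall s, H s -> s x = x].

End AutomGroup.

(* algC is an algebraic closure of Q, and every ring automorphism fixes Q. *)
Definition galQ := autom algC.
HB.instance Definition _ := Choice.on galQ.
HB.instance Definition _ := Group.on galQ.

Definition complex_conj : galQ :=
  @Autom algC Num.conj Num.conj (@conjCK _) (@conjCK _)
    (@rmorphD _ _ Num.conj) (@rmorphM _ _ Num.conj).

(* Equality on a finite set of algebraic numbers: a basic neighbourhood in the
   Krull topology. *)
Definition agree (s : seq algC) (g h : galQ) := forall x, x \in s -> g x = h x.

Record prime_above (l : nat) (P : set algC) : Prop := PrimeAbove {
  prime_above_sub : forall x, P x -> x \in Aint;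
  prime_above_res : P l%:R;
  prime_above_add : forall x y, P x -> P y -> P (x + y);
  prime_above_mul : forall x y, x \in Aint -> P y -> P (x * y);
  prime_above_proper : ~ P 1;
  prime_above_prime : forall x y,
    x \in Aint -> y \in Aint -> P (x * y) -> P x \/ P y }.

Definition decomposition (P : set algC) : set galQ :=
  [set g | forall x, P (g x) <-> P x].

Definition inertia (P : set algC) : set galQ :=
  [set g | decomposition P g /\ forall x, x \in Aint -> P (g x - x)].

(* Fixed field of the torsion subgroup of Gal(Q(mu_{p^oo})/Q). *)
Definition cyclotomic_Zp_ext (p : nat) : set algC :=
  fixedfield [set g : galQ | exists2 k, (0 < k)%N &
    forall (m : nat) (z : algC), z ^+ (p ^ m) = 1 -> (g ^+ k)%g z = z].

(* Ramification is only restricted at the finite primes. *)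
Definition max_unramified_ext (Sigma : seq nat) : set algC :=
  fixedfield [set g : galQ | exists l P,
    [/\ prime l, l \notin Sigma, prime_above l P & inertia P g]].

(* The completion of Q at p: a complete ultrametric field in which Q is dense
   and whose absolute value is normalised by |p| = 1/p. *)
Record padicField (p : nat) := PadicField {
  padic_sort :> fieldType;
  pabs : padic_sort -> rat;
  pabs_ge0 : forall x, 0 <= pabs x;
  pabs_eq0 : forall x, (pabs x == 0) = (x == 0);
  pabsM : forall x y, pabs (x * y) = pabs x * pabs y;
  pabsD : forall x y, pabs (x + y) <= Num.max (pabs x) (pabs y);
  pabs_p : pabs p%:R = p%:R^-1;
  padic_dense : forall x (eps : rat), 0 < eps ->
    exists q : rat, pabs (x - ratr q) < eps;
  padic_complete : forall u : nat -> padic_sort,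
    (forall eps : rat, 0 < eps -> exists N, forall i j,
       (N <= i)%N -> (N <= j)%N -> pabs (u i - u j) < eps) ->
    exists x, forall eps : rat, 0 < eps -> exists N, forall i,
       (N <= i)%N -> pabs (u i - x) < eps }.

Section PadicIntegers.
Variables (p : nat) (Qp : padicField p).

Definition padic_int_pred : {pred Qp} := [pred x | pabs x <= 1].

Lemma pabs1 : pabs (1 : Qp) = 1.
Proof.
have n0 : pabs (1 : Qp) != 0 by rewrite pabs_eq0 oner_eq0.
by apply: (mulfI n0); rewrite -pabsM !mulr1.
Qed.

Lemma pabsN (x : Qp) : pabs (- x) = pabs x.
Proof.
have : pabs (-1 : Qp) ^+ 2 = 1 by rewrite expr2 -pabsM mulrNN mulr1 pabs1.
move/eqP; rewrite sqrf_eq1 => /orP[/eqP e1|/eqP eN].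
  by rewrite -mulN1r pabsM e1 mul1r.
by have := pabs_ge0 (-1 : Qp); rewrite eN.
Qed.

Lemma padic_int_subring : subring_closed padic_int_pred.
Proof.
split=> [|x y xZ yZ|x y]; rewrite !inE ?pabs1 //.
  by apply: le_trans (pabsD _ _) _; rewrite ge_max pabsN; apply/andP.
by move=> xZ yZ; rewrite pabsM mulr_ile1 ?pabs_ge0.
Qed.

HB.instance Definition _ :=
  GRing.isSubringClosed.Build Qp padic_int_pred padic_int_subring.

Record padic_int := PadicInt { padic_int_val : Qp;
                               _ : padic_int_val \in padic_int_pred }.
HB.instance Definition _ := [isSub for padic_int_val].
HB.instance Definition _ := [Choice of padic_int by <:].
HB.instance Definition _ := [SubChoice_isSubComNzRing of padic_int by <:].

Definition padic_quot := {ideal_quot padic_int_pred}.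
HB.instance Definition _ := GRing.Zmodule.on padic_quot.

End PadicIntegers.

Record padicClosure (p : nat) (Qp : padicField p) := PadicClosure {
  pclosure_sort :> closedFieldType;
  pclosure_emb : {rmorphism Qp -> pclosure_sort};
  pclosure_alg : forall x, algebraicOver pclosure_emb x }.

Section LocalGalois.
Variables (p : nat) (Qp : padicField p) (Qpb : padicClosure Qp).
Variable iota : {rmorphism algC -> Qpb}.

Definition pclosure_int (x : Qpb) :=
  integralOver (pclosure_emb Qpb \o @padic_int_val p Qp) x.

Definition pclosure_maxideal (x : Qpb) :=
  pclosure_int x /\ ~ (x != 0 /\ pclosure_int x^-1).

Definition local_gal : set (autom Qpb) := fixing (range (pclosure_emb Qpb)).

Definition local_inertia : set (autom Qpb) :=
  [set s | local_gal s /\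
           forall x, pclosure_int x -> pclosure_maxideal (s x - x)].

(* Image in galQ of a subgroup of Gal(Qpb/Qp), by restriction along iota. *)
Definition restrict_gal (H : set (autom Qpb)) : set galQ :=
  [set g | exists2 s, H s & forall x, iota (g x) = s (iota x)].

Definition Gp := restrict_gal local_gal.
Definition Ip := restrict_gal local_inertia.

End LocalGalois.

Section ValuationRing.
Variables (p : nat) (Qp : padicField p) (K : fieldExtType Qp).

(* The valuation ring of K is the integral closure of Z_p. *)
Definition valring_pred : {pred K} :=
  fun x => `[< integralOver (in_alg K \o @padic_int_val p Qp) x >].

Lemma valring_subring : subring_closed valring_pred.
Proof.
split=> [|x y /asboolP xO /asboolP yO|x y /asboolP xO /asboolP yO];
  apply/asboolP.
- exact: (@integral1 _ _ (in_alg K \o val)).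
- exact: (@integral_sub _ _ (in_alg K \o val)).
- exact: (@integral_mul _ _ (in_alg K \o val)).
Qed.

HB.instance Definition _ :=
  GRing.isSubringClosed.Build K valring_pred valring_subring.

Record valring := ValRing { valring_val : K;
                            _ : valring_val \in valring_pred }.
HB.instance Definition _ := [isSub for valring_val].
HB.instance Definition _ := [Choice of valring by <:].
HB.instance Definition _ := [SubChoice_isSubComNzRing of valring by <:].

Definition uniformizer (varpi : valring) :=
  forall x : valring, (exists y, x * y = 1) <-> ~ (exists y, x = varpi * y).

End ValuationRing.
Arguments valring_pred {p Qp} K.

Section Lattice.
Variables (p : nat) (Qp : padicField p) (K : fieldExtType Qp).
Variables (n : nat) (MK : vectType K) (e : n.-tuple MK).

(* The O-span of e, when e is a basis of MK. *)
Definition lattice : {pred MK} :=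
  fun v => [forall i, coord e i v \in valring_pred K].

Lemma lattice_zmod : zmod_closed lattice.
Proof.
split=> [|u v /forallP uM /forallP vM]; apply/forallP=> i.
  by rewrite linear0 rpred0.
by rewrite linearB; apply: rpredB; [exact: uM | exact: vM].
Qed.

HB.instance Definition _ := GRing.isZmodClosed.Build MK lattice lattice_zmod.

Definition Amod := {ideal_quot lattice}.
HB.instance Definition _ := GRing.Zmodule.on Amod.

Definition Aproj (v : MK) : Amod := \pi_({ideal_quot lattice}) v.

Lemma AprojD : {morph Aproj : u v / u + v}.
Proof. by move=> u v; rewrite /Aproj raddfD. Qed.

Lemma Aproj_repr (a : Amod) : Aproj (repr a) = a.
Proof. exact: reprK. Qed.

Lemma Aproj_eq u v : (Aproj u == Aproj v) = (u - v \in lattice).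
Proof. by rewrite -Quotient.equivE -Quotient.idealrBE. Qed.

Definition Ascale (x : valring K) (a : Amod) : Amod := Aproj (val x *: repr a).

Lemma AscaleE x v : Ascale x (Aproj v) = Aproj (val x *: v).
Proof.
apply/eqP; rewrite /Ascale Aproj_eq -scalerBr; apply/forallP=> i.
have /forallP/(_ i) : repr (Aproj v) - v \in lattice.
  by rewrite -Aproj_eq Aproj_repr.
by rewrite linearZ => h; rewrite rpredM ?(valP x).
Qed.

Lemma AscaleA x y a : Ascale x (Ascale y a) = Ascale (x * y) a.
Proof. by rewrite -[a]Aproj_repr !AscaleE scalerA. Qed.
Lemma Ascale1 : left_id 1 Ascale.
Proof. by move=> a; rewrite -[a]Aproj_repr AscaleE scale1r. Qed.
Lemma AscaleDr : right_distributive Ascale +%R.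
Proof.
move=> x a b; rewrite -[a]Aproj_repr -[b]Aproj_repr -AprojD !AscaleE.
by rewrite scalerDr AprojD.
Qed.
Lemma AscaleDl a : {morph Ascale^~ a : x y / x + y}.
Proof.
by move=> x y; rewrite -[a]Aproj_repr !AscaleE -AprojD -scalerDl.
Qed.

HB.instance Definition _ := GRing.Zmodule_isLmodule.Build (valring K) Amod
  AscaleA Ascale1 AscaleDr AscaleDl.

Variables (varpi : valring K) (rho : galQ -> 'End(MK)).

Definition lattice_pow (k : nat) (v : MK) := val varpi ^- k *: v \in lattice.

(* rho stands for the K-linear extension to MK of an O-linear action on M;
   M carries the varpi-adic topology. *)
Record continuous_action : Prop := ContinuousAction {
  action1 : forall v, rho 1%g v = v;
  actionM : forall g h v, rho (g * h)%g v = rho g (rho h v);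
  action_lattice : forall g v, v \in lattice -> rho g v \in lattice;
  action_continuous : forall g v k, v \in lattice ->
    exists s j, forall h w, w \in lattice ->
      agree s h g -> lattice_pow j (w - v) ->
      lattice_pow k (rho h w - rho g v) }.

Definition irreducible_action := forall U : {vspace MK},
  (forall g, (rho g @: U <= U)%VS) -> U = 0%VS \/ U = fullv.

Definition unramified_at (l : nat) := forall P g v,
  prime_above l P -> inertia P g -> rho g v = v.

Definition Aact (g : galQ) (a : Amod) : Amod := Aproj (rho g (repr a)).

(* The subgroups A[varpi], C (the image of W) and C[varpi] of A; below, the
   Galois module A[varpi] is treated as a subset of A. *)
Definition Abar : set Amod := [set a | varpi *: a = 0].
Definition Csub (W : {vspace MK}) : set Amod := [set Aproj w | w in [set` W]].
Definition Cbar (W : {vspace MK}) : set Amod := Csub W `&` Abar.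

Record submodule (H : set galQ) (B : set Amod) : Prop := Submodule {
  submodule0 : B 0;
  submoduleD : forall a b, B a -> B b -> B (a + b);
  submoduleZ : forall (x : valring K) a, B a -> B (x *: a);
  submodule_act : forall g a, H g -> B a -> B (Aact g a) }.

(* Continuous 1-cocycles of H/N with values in the coefficient module B,
   represented as functions on all of galQ with arbitrary values off H. *)
Record cocycle (H N : set galQ) (B : set Amod) (c : galQ -> Amod) : Prop :=
  Cocycle {
  cocycle_val : forall g, H g -> B (c g);
  cocycleM : forall g h, H g -> H h -> c (g * h)%g = c g + Aact g (c h);
  cocycle_inf : forall g h, H g -> N h -> c (g * h)%g = c g;
  cocycle_cont : forall g, H g ->
    exists s, forall h, H h -> agree s h g -> c h = c g }.

Definition coboundary (H : set galQ) (B : set Amod) : set (galQ -> Amod) :=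
  [set c | exists2 b, B b & forall g, H g -> c g = Aact g b - b].

(* Coboundary after reduction of the coefficients modulo C. *)
Definition coboundary_mod (H : set galQ) (B C : set Amod) :
    set (galQ -> Amod) :=
  [set c | exists2 b, B b & forall g, H g -> C (c g - (Aact g b - b))].

Definition conj_act (g : galQ) (c : galQ -> Amod) : galQ -> Amod :=
  fun x => Aact g (c (g^-1 * x * g)%g).

End Lattice.
Arguments Abar {p Qp K n MK} e varpi.
Arguments Csub {p Qp K n MK} e W.
Arguments Cbar {p Qp K n MK} e varpi W.

(* The quotient Z / N of additive groups, as a set of cosets. *)
Definition quotient_set (V : zmodType) (Z N : set V) : set (set V) :=
  [set [set z | N (z - x)] | x in Z].

Section Selmer.
Variables (p : nat) (Qp : padicField p) (Qpb : padicClosure Qp).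
Variable iota : {rmorphism algC -> Qpb}.
Variables (K : fieldExtType Qp) (n : nat) (MK : vectType K) (e : n.-tuple MK).
Variable rho : galQ -> 'End(MK).
Variable Sigma : seq nat.

Definition GQinf : set galQ := fixing (cyclotomic_Zp_ext p).
Definition GQSigma : set galQ := fixing (max_unramified_ext Sigma).

(* Cocycles whose classes are in the kernel of the restriction to
   H^1(Q_{oo,eta}, B) for all eta above the primes of Sigma other than p;
   the absolute Galois group of Q_{oo,eta} is the decomposition group in GQinf
   of a prime of Qbar above eta. *)
Definition away_from_p (B : set (Amod e)) : set (galQ -> Amod e) :=
  [set c | cocycle rho GQinf GQSigma B c /\
    forall l P, l \in Sigma -> l != p -> prime_above l P ->
      coboundary rho (decomposition P `&` GQinf) B c].

(* In these two sets of cocycles the classes form S_B and S^0_B; C is the local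
   submodule of B at p. *)
Definition selmer (B C : set (Amod e)) : set (galQ -> Amod e) :=
  [set c | away_from_p B c /\ coboundary_mod rho (Ip iota `&` GQinf) B C c].

Definition fine_selmer (B : set (Amod e)) : set (galQ -> Amod e) :=
  [set c | away_from_p B c /\ coboundary rho (Gp iota `&` GQinf) B c].

Variables (varpi : valring K) (W : {vspace MK}).

Definition field_L : set algC :=
  fixedfield [set g | forall a, Abar e varpi a -> Aact rho g a = a].

(* Gal(Qbar / L_oo), with L_oo the compositum of L and Q_oo. *)
Definition GLinf : set galQ := fixing (field_L `|` cyclotomic_Zp_ext p).

Definition Ibeta : set galQ := Ip iota `&` GLinf.

(* S_{A[varpi]}(L_oo): homomorphisms of Gal(Q_Sigma / L_oo), as functions on
   galQ with arbitrary values off GLinf. *)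
Record selmer_L (psi : galQ -> Amod e) : Prop := SelmerL {
  selmer_L_val : forall x, GLinf x -> Abar e varpi (psi x);
  selmer_L_hom : forall x y, GLinf x -> GLinf y ->
    psi (x * y)%g = psi x + psi y;
  selmer_L_inf : forall x y, GLinf x -> GQSigma y -> psi (x * y)%g = psi x;
  selmer_L_cont : forall x, GLinf x ->
    exists s, forall y, GLinf y -> agree s y x -> psi y = psi x;
  selmer_L_away : forall l P x, l \in Sigma -> l != p -> prime_above l P ->
    decomposition P x -> GLinf x -> psi x = 0;
  selmer_L_p : forall x, Ibeta x -> Cbar e varpi W (psi x) }.

Definition selmer_L_invariant (psi : galQ -> Amod e) :=
  selmer_L psi /\ forall g x, GQinf g -> GLinf x ->
    Aact rho g^-1%g (psi (g * x * g^-1)%g) = psi x.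

Definition restrict_Ibeta (psi : galQ -> Amod e) : {x | Ibeta x} -> Amod e :=
  fun x => psi (sval x).

End Selmer.
Arguments restrict_Ibeta {p Qp Qpb} iota {K n MK e} rho varpi psi.

Record open_subgroup (H : set galQ) := OpenSubgroup {
  osub_set :> set galQ;
  osub1 : osub_set 1%g;
  osubM : forall g h, osub_set g -> osub_set h -> osub_set (g * h)%g;
  osubV : forall g, osub_set g -> osub_set g^-1%g;
  osub_ge : H `<=` osub_set;
  osub_open : exists s, forall g, agree s g 1%g -> osub_set g }.

HB.instance Definition _ H := gen_eqMixin (open_subgroup H).
HB.instance Definition _ H := gen_choiceMixin (open_subgroup H).

Definition osubT (H : set galQ) : open_subgroup H.
Proof. by apply: (@OpenSubgroup H setT) => //; exists [::]. Defined.

Definition lcoset (U : set galQ) (g : galQ) : set galQ :=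
  [set (g * u)%g | u in U].
Definition cosets (U : set galQ) : set (set galQ) := range (lcoset U).
Definition coset_rep (C : set galQ) : galQ := xget 1%g C.

Section Iwasawa.
Variables (R : nzRingType) (H : set galQ).

(* [lam U g] is the coefficient of the coset gU in the image of lam in the
   group ring R[galQ/U]. *)
Definition iwfun := open_subgroup H -> galQ -> R.
HB.instance Definition _ := GRing.Zmodule.on iwfun.
Implicit Types (lam mu nu : iwfun).

(* The inverse limit of the R[galQ/U]. *)
Record iwasawa lam : Prop := Iwasawa {
  iwasawa_inv : forall (U : open_subgroup H) g u, osub_set U u ->
    lam U (g * u)%g = lam U g;
  iwasawa_compat : forall U U' : open_subgroup H, U `<=` U' -> forall g,
    lam U' g =
    \sum_(C \in [set C | cosets U C /\ C `<=` lcoset U' g]) lam U (coset_rep C)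
  }.

Definition iwmul lam mu : iwfun := fun U g =>
  \sum_(C \in cosets U) lam U (coset_rep C) * mu U ((coset_rep C)^-1 * g)%g.

Definition iwconst (a : R) : iwfun := fun U g => if `[< osub_set U g >] then a else 0.

Definition iwexp lam (k : nat) : iwfun := iter k (iwmul lam) (iwconst 1).

Definition iwdvd lam mu := exists2 nu, iwasawa nu & mu = iwmul lam nu.

Definition iwprime lam :=
  [/\ iwasawa lam, lam <> 0, ~ iwdvd lam (iwconst 1) &
      forall mu nu, iwasawa mu -> iwasawa nu ->
        iwdvd lam (iwmul mu nu) -> iwdvd lam mu \/ iwdvd lam nu].

(* A module over the Iwasawa algebra, presented as a subquotient num / den of
   an additive group; the action need only be meaningful on num modulo den. *)
Record iwmodule := IwModule {
  iw_sort : zmodType;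
  iw_num : set iw_sort;
  iw_den : set iw_sort;
  iw_act : iwfun -> iw_sort -> iw_sort }.

Definition iw_torsion (X : iwmodule) := forall x : iw_sort X, iw_num x ->
  exists lam, [/\ iwasawa lam, lam <> 0 & iw_den (iw_act lam x)].

Record pseudo_iso (X Y : iwmodule) (f : iw_sort X -> iw_sort Y) : Prop :=
  PseudoIso {
  pseudo_iso_num : forall x, iw_num x -> iw_num (f x);
  pseudo_iso_den : forall x, iw_num x -> iw_den x -> iw_den (f x);
  pseudo_iso_add : forall x y, iw_num x -> iw_num y ->
    iw_den (f (x + y) - (f x + f y));
  pseudo_iso_act : forall lam x, iwasawa lam -> iw_num x ->
    iw_den (f (iw_act lam x) - iw_act lam (f x));
  pseudo_iso_ker : finite_set
    (quotient_set [set x | iw_num x /\ iw_den (f x)] (@iw_den X));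
  pseudo_iso_coker : finite_set
    (quotient_set (@iw_num Y) [set y | exists2 x, iw_num x & iw_den (y - f x)])
  }.

(* The direct sum over i of the cyclic modules modulo (gen i). *)
Definition elementary_module (I : finType) (gen : I -> iwfun) : iwmodule :=
  @IwModule (I -> iwfun)
    [set v | forall i, iwasawa (v i)]
    [set v | forall i, iwdvd (gen i) (v i)]
    (fun lam v i => iwmul lam (v i)).

(* By Weierstrass preparation, the primes f j not associated to varpi are, up to
   units, the irreducible distinguished polynomials. *)
Definition has_mu_invariant (varpi : R) (X : iwmodule) (m : nat) :=
  exists (k r : nat) (mus : 'I_k -> nat) (f : 'I_r -> iwfun) (l : 'I_r -> nat),
    [/\ forall j, iwprime (f j) /\ ~ iwdvd (iwconst varpi) (f j),
        exists phi, @pseudo_iso X (elementary_module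
          (fun i : 'I_k + 'I_r => match i with
             | inl i => iwconst (varpi ^+ mus i)
             | inr j => iwexp (f j) (l j)
             end)) phi &
        m = (\sum_(i < k) mus i)%N].

(* Z / N is a discrete module with a smooth R-linear action act of galQ that is
   trivial on H; T is the divisible group in which characters take values.
   The algebra acts on characters by lam.phi = phi(lam^* -), where lam^* is the
   image of lam under inversion. *)
Variables (V : lmodType R) (Z N : set V) (act : galQ -> V -> V).

Definition iw_coact lam (v : V) : V :=
  let U := xget (osubT H)
    [set U : open_subgroup H | forall g, osub_set U g -> N (act g v - v)] in
  \sum_(C \in cosets U) lam U (coset_rep C) *: act (coset_rep C)^-1%g v.

Definition pontryagin_dual (T : zmodType) : iwmodule :=
  @IwModule (V -> T)
    [set phi | (forall u v, Z u -> Z v -> phi (u + v) = phi u + phi v) /\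
               (forall v, Z v -> N v -> phi v = 0)]
    [set phi | forall v, Z v -> phi v = 0]
    (fun lam phi v => phi (iw_coact lam v)).

End Iwasawa.

(* The dual of the group of classes of the cocycles in Z over Q_oo with
   coefficients in A, as a module over O[[Gal(Q_oo/Q)]]. *)
Definition cocycle_dual (p : nat) (Qp : padicField p) (K : fieldExtType Qp)
    (n : nat) (MK : vectType K) (e : n.-tuple MK) (rho : galQ -> 'End(MK))
    (Z : set (galQ -> Amod e)) : iwmodule (valring K) (GQinf p) :=
  pontryagin_dual (GQinf p) Z (coboundary rho (GQinf p) [set: Amod e])
    (conj_act rho) (padic_quot Qp).

(* Main.v *)
Require Import Defs.
From HB Require Import structures.
From mathcomp Require Import all_boot all_order all_algebra all_field.
From mathcomp Require Import cyclic.
From mathcomp Require Import algebraics_fundamentals.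
From mathcomp Require Import boolp classical_sets functions cardinality fsbigop.
From mathcomp Require Import filter.
From mathcomp Require Import zify ring.

Set Implicit Arguments.
Unset Strict Implicit.
Unset Printing Implicit Defensive.

Import Order.TTheory GRing.Theory Num.Theory.

Local Open Scope classical_set_scope.
Local Open Scope ring_scope.

(** The mu-invariant of the dual of a discrete torsion module S over
    O[[Gal(Q_oo/Q)]] vanishes if and only if S[varpi] is finite: if S[varpi] is
    finite then, up to finite modules, the dual is a lattice on which a
    topological generator acts with a characteristic polynomial that is
    distinguished after translation, and a primary decomposition of that
    endomorphism gives the elementary module.

    A cocycle c in S_{A[varpi]}(Q_oo) restricts to an element of
    S_{A[varpi]}(L_oo)^G.  Hence, up to finitely many possibilities, c vanishes
    on I_beta; as I_beta has finite index in the inertia group at p over Q_oo,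
    and the quotient of the decomposition group by inertia is procyclic, c
    vanishes on the whole decomposition group up to finitely many
    possibilities, and is then in the fine Selmer group.

    A class of S_A[varpi] is represented by a cocycle with values in A[varpi].
    At a prime l <> p the obstruction to its lying in S_{A[varpi]} is in
    M / varpi M with M the invariants of A under the local group; this is
    finite, and there are finitely many primes of Q_oo above l.  So S_A[varpi]
    is finite if and only if S^0_A[varpi] is. *)

(** * Automorphisms of algebraic closures *)

(** No profinite topology is set up: each compactness argument is an ultrafilter limit, on [nat] for
    towers of levels and on finite sequences for statements about all algebraic numbers. This gives
    automorphisms with prescribed behaviour, and limits in the valuation ring and in the Iwasawa
    algebra. Finitely many algebraic numbers are packed into the coefficients of one polynomial, so
    that a single automorphism serves all of them.

    As Q_oo is given as a fixed field, its tower has to be recovered: the open subgroups above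
    [GQinf p] form a chain of indices p^n, and the Iwasawa algebra becomes the limit of the
    R[X]/(X^(p^n) - 1), X being a topological generator. Weierstrass theory uses T = X - 1:
    distinguished means monic and congruent to a power of X - 1 modulo varpi.

    Characters take values in Q_p/Z_p, whose divisibility makes duality exact by Baer's argument.
    The elementary module is found over K; passing back to the valuation ring costs a fixed power of
    varpi, which is harmless because finitely generated modules are finite modulo such a power. *)

Lemma ultra_pick (I : Type) (T : eqType) (F : set_system I) (f : I -> T)
    (s : seq T) : UltraFilter F -> F [set i | f i \in s] ->
  exists2 y, y \in s & F [set i | f i = y].
Proof.
move=> FU; elim: s => [|y s IHs] Fs.
  by have [i] := filter_ex Fs.
have [Fy|Fny] := in_ultra_setVsetC [set i | f i = y] FU.
  by exists y; rewrite ?mem_head.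
have [z zs Fz] : exists2 y, y \in s & F [set i | f i = y].
  apply: IHs; apply: filterS (filterI Fs Fny) => i [] /=.
  by rewrite inE => /orP[/eqP|].
by exists z => //; rewrite inE zs orbT.
Qed.

Lemma ultra_directed (I J : Type) (B : J -> set I) (j0 : J) :
  (forall j k, exists l, B l `<=` B j `&` B k) -> (forall j, B j !=set0) ->
  exists F : set_system I, UltraFilter F /\ forall j, F (B j).
Proof.
move=> Bdir B0; pose F0 := filter_from setT B.
have PF0 : ProperFilter F0.
  apply: filter_from_proper; last by move=> j _; apply: B0.
  apply: filter_from_filter; first by exists j0.
  by move=> j k _ _; have [l lP] := Bdir j k; exists l.
have [F [FU sF]] := ultraFilterLemma PF0.
by exists F; split=> // j; apply: sF; exists j.
Qed.

(** With such an ultrafilter, choices made separately for each finite set of elements have a limit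
    that is valid for all elements at once. *)
Lemma ultra_seq (T : eqType) :
  exists F : set_system (seq T), UltraFilter F /\ forall z, F [set s : seq T | z \in s].
Proof.
have [||F [FU sF]] := @ultra_directed (seq T) (seq T)
    (fun s : seq T => [set t : seq T | {subset s <= t}]) [::].
- move=> s t; exists (s ++ t) => u /= su.
  by split=> z zs; apply: su; rewrite mem_cat zs ?orbT.
- by move=> s; exists s => z.
exists F; split=> // z; apply: filterS (sF [:: z]) => t /=; apply.
exact: mem_head.
Qed.

Lemma ultra_nat :
  exists F : set_system nat, UltraFilter F /\ forall n, F [set m | (n <= m)%N].
Proof.
have [||F [FU sF]] := @ultra_directed nat nat (fun n => [set m | (n <= m)%N]) 0.
- move=> j k; exists (maxn j k) => m /=; rewrite geq_max => /andP[jm km].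
  by split.
- by move=> j; exists j => /=.
by exists F.
Qed.

Section AutomMorphism.
Variables (F : fieldType) (s : autom F).

Lemma autom0 : s 0 = 0.
Proof. by apply: (addrI (s 0)); rewrite -aut_add !addr0. Qed.
Lemma autom1 : s 1 = 1.
Proof.
have s1 : s 1 != 0.
  apply/eqP=> s1; case/eqP: (oner_neq0 F).
  by apply: (can_inj (@aut_funK _ s)); rewrite s1 autom0.
by apply: (mulfI s1); rewrite -aut_mul !mulr1.
Qed.
Lemma automN : {morph s : x / - x}.
Proof. by move=> x; apply: (addrI (s x)); rewrite -aut_add !subrr autom0. Qed.

Definition autom_morph := aut_fun s.
Fact autom_morph_zmod : zmod_morphism autom_morph.
Proof. by move=> x y; rewrite /autom_morph aut_add automN. Qed.
Fact autom_morph_monoid : monoid_morphism autom_morph.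
Proof. by split; [exact: autom1 | exact: aut_mul]. Qed.
HB.instance Definition _ :=
  GRing.isZmodMorphism.Build F F autom_morph autom_morph_zmod.
HB.instance Definition _ :=
  GRing.isMonoidMorphism.Build F F autom_morph autom_morph_monoid.
Lemma autom_morphE x : s x = autom_morph x. Proof. by []. Qed.

Lemma autom_inj : injective s.
Proof. exact: can_inj (@aut_funK _ s). Qed.
Lemma automX k : {morph s : x / x ^+ k}.
Proof. by move=> x; rewrite !autom_morphE rmorphXn. Qed.
Lemma automB : {morph s : x y / x - y}.
Proof. by move=> x y; rewrite !autom_morphE rmorphB. Qed.
End AutomMorphism.

Lemma automVK (F : fieldType) (s : autom F) x : s (s^-1%g x) = x.
Proof. exact: aut_invK. Qed.
Lemma automKV (F : fieldType) (s : autom F) x : s^-1%g (s x) = x.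
Proof. exact: aut_funK. Qed.
Lemma automM (F : fieldType) (s t : autom F) x : (s * t)%g x = s (t x).
Proof. by []. Qed.
Lemma automI (F : fieldType) x : (1%g : autom F) x = x.
Proof. by []. Qed.

Section AlgebraicClosure.
Variables (F : fieldType) (L : closedFieldType) (emb : {rmorphism F -> L}).
Hypothesis algL : forall x, algebraicOver emb x.
Local Notation "p ^emb" := (map_poly emb p) (at level 2).

Definition root_seq (p : {poly L}) : seq L :=
  sval (closed_field_poly_normal p).

Lemma root_seqP (p : {poly L}) x : p != 0 -> (x \in root_seq p) = root p x.
Proof.
rewrite /root_seq; case: closed_field_poly_normal => rs /= Dp p0.
by rewrite Dp rootZ ?root_prod_XsubC // lead_coef_eq0.
Qed.

(** An injective endomorphism over [F] permutes the finitely many roots of a polynomial over [F],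
    and every element of [L] is such a root; hence surjectivity. *)
Lemma autom_of_endo (f : L -> L) : {morph f : x y / x + y} ->
  {morph f : x y / x * y} -> (forall c, f (emb c) = emb c) ->
  exists s : autom L, s =1 f.
Proof.
move=> fD fM fF.
have f0 : f 0 = 0 by rewrite -(rmorph0 emb) fF.
have f1 : f 1 = 1 by rewrite -(rmorph1 emb) fF.
have fN x : f (- x) = - f x by apply: (addrI (f x)); rewrite -fD !subrr f0.
have finj : injective f.
  move=> x y fxy; apply/eqP; rewrite -subr_eq0; apply/negP=> /negP nz.
  have := oner_neq0 L; rewrite -f1 -(divff nz) fM fD fN fxy subrr mul0r.
  by rewrite eqxx.
have fP (q : {poly F}) x : f ((q^emb).[x]) = (q^emb).[f x].
  elim/poly_ind: q => [|q c IHq]; first by rewrite rmorph0 !horner0.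
  by rewrite rmorphD rmorphM /= map_polyX map_polyC !hornerE fD fM fF IHq.
have fsurj y : exists x, f x = y.
  have [q q0 qy] := algL y.
  have q0' : q^emb != 0 by rewrite map_poly_eq0.
  pose s := undup (root_seq q^emb).
  have sP x : (x \in s) = root (q^emb) x by rewrite mem_undup root_seqP.
  have us : uniq (map f s) by rewrite map_inj_uniq ?undup_uniq.
  have sub : {subset map f s <= s}.
    move=> _ /mapP[x xs ->]; move: xs; rewrite !sP !rootE -fP.
    by move/eqP->; rewrite f0.
  have [_ eq_s] := uniq_min_size us sub (eq_leq (esym (size_map f s))).
  have : y \in map f s by rewrite eq_s sP.
  by case/mapP=> x _ ->; exists x.
have [g gK] := choice fsurj.
by exists (@Autom L f g (fun x => finj _ _ (gK (f x))) gK fD fM).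
Qed.

Definition over : set (autom L) := fixing (range emb).

Lemma overP (s : autom L) : over s <-> forall c, s (emb c) = emb c.
Proof.
split=> [os c|oc _ [c _ <-]]; last exact: oc.
by apply: os; exists c.
Qed.

Lemma over_horner (s : autom L) (q : {poly F}) x :
  over s -> s ((q^emb).[x]) = (q^emb).[s x].
Proof.
move/overP=> sF; elim/poly_ind: q => [|q c IHq].
  by rewrite rmorph0 !horner0 autom0.
by rewrite rmorphD rmorphM /= map_polyX map_polyC !hornerE aut_add aut_mul IHq sF.
Qed.

(** A finite list containing all conjugates of [x]. It may be larger than the orbit, since the
    annihilating polynomial is an arbitrary one. *)
Definition conjs (x : L) : seq L := root_seq ((sval (cid2 (algL x)))^emb).

Lemma conjsP (s : autom L) x : over s -> s x \in conjs x.
Proof.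
rewrite /conjs; case: cid2 => q /= q0 qx os.
rewrite root_seqP ?map_poly_eq0 // rootE -over_horner // (rootP qx).
by rewrite autom0.
Qed.

(** Compactness of the Galois group: at each point the values lie in the finite list [conjs], so the
    ultrafilter selects one of them, and the selected values form an endomorphism. *)
Lemma autom_ultralim (I : Type) (U : set_system I) (g : I -> autom L) :
  UltraFilter U -> (forall i, over (g i)) ->
  exists2 h : autom L, over h & forall x, U [set i | g i x = h x].
Proof.
move=> UU gF.
have /choice[f fP] : forall x, exists y, U [set i | g i x = y].
  move=> x; have [|y _ Uy] := @ultra_pick I L U (g^~ x) (conjs x) UU.
  - by apply: filterS filterT => i _; apply: conjsP.
  - by exists y.
have [x y|x y|c|h hf] := @autom_of_endo f.
- have [i [[/= <- <-] <-]] := filter_ex (filterI (filterI (fP x) (fP y)) (fP (x + y))).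
  by rewrite aut_add.
- have [i [[/= <- <-] <-]] := filter_ex (filterI (filterI (fP x) (fP y)) (fP (x * y))).
  by rewrite aut_mul.
- by have [i /= <-] := filter_ex (fP (emb c)); have /overP-> := gF i.
exists h => [|x]; last by rewrite hf; apply: fP.
apply/overP=> c; rewrite hf; have [i /= <-] := filter_ex (fP (emb c)).
by have /overP-> := gF i.
Qed.

Lemma irr_root_dvdp (m q : {poly F}) x : irreducible_poly m ->
  root (m^emb) x -> root (q^emb) x -> m %| q.
Proof.
move=> irr_m mx qx; apply/negPn/negP=> nmq.
have : coprimep m q.
  rewrite coprimep_def; apply/eqP; have [_ irr] := irr_m.
  apply/eqP; apply: contraNT nmq => sz.
  have /eqp_dvdl <- := irr _ sz (dvdp_gcdl m q).
  exact: dvdp_gcdr.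
rewrite -(coprimep_map emb) => /coprimep_root/(_ mx).
by rewrite (rootP qx) eqxx.
Qed.

Hypothesis charF : [pchar F] =i pred0.

Lemma primitive_elt (s : seq L) : exists t, forall z, z \in s ->
  exists q : {poly F}, (q^emb).[t] = z.
Proof.
elim: s => [|z s [t tP]]; first by exists 0.
have [p p0 pt] := algL t; have [q q0 qz] := algL z.
have [k [[pt' Dt] [pz' Dz]]] := pchar0_PET p0 pt q0 qz charF.
exists (z *+ k - t) => y; rewrite inE => /orP[/eqP->|/tP[r <-]].
  by exists pz'.
by exists (r \Po pt'); rewrite map_comp_poly horner_comp Dt.
Qed.

Lemma irr_separable (m : {poly F}) : irreducible_poly m -> separable_poly m.
Proof.
move=> [m1 irr]; rewrite unlock coprimep_def.
have m0 : m != 0 by rewrite -size_poly_gt0 ltnW.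
apply/eqP/eqP; apply: contraT => sz.
have /eqp_dvdl dv := irr _ sz (dvdp_gcdl m m^`()).
have := dvdp_gcdr m m^`(); rewrite dv => /dvdp_leq.
have m'0 : m^`() != 0.
  apply/eqP=> /(congr1 (fun q : {poly F} => q`_(size m).-2)).
  rewrite coef_deriv coef0 -mulr_natr => /eqP; rewrite mulf_eq0.
  have -> : ((size m).-2.+1 = (size m).-1)%N by case: (size m) m1 => [|[]].
  rewrite -/(lead_coef m) lead_coef_eq0 (negPf m0) /=.
  move/pcharf0P: charF => ->; by case: (size m) m1 => [|[]].
by move=> /(_ m'0); rewrite leqNgt lt_size_deriv.
Qed.

(* A hom F(t) -> L moving x, for every finite subset of L contained in F(t); an
   ultrafilter on the finite subsets glues these homs. *)
Lemma autom_moves x : ~ range emb x -> exists2 s : autom L, over s & s x != x.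
Proof.
move=> nx.
have ex_f (s : seq L) : exists f : L -> L, exists t u,
   (f x != x /\ (forall z, z \in x :: s -> exists q, (q^emb).[t] = z)) /\
   (forall q, f (q^emb).[t] = (q^emb).[u]).
  have [t tP] := primitive_elt (x :: s).
  have [] := @minPoly_decidable_closure F L emb t.
  - by move=> y; apply: pselect.
  - by apply/integral_algebraic.
  move=> m [mon_m mt irr_m].
  have m0 := monic_neq0 mon_m.
  have [p0 Dx0] := tP x (mem_head _ _).
  pose p := p0 %% m.
  have Dx : (p^emb).[t] = x.
    rewrite -Dx0 (divp_eq p0 m) -/p rmorphD rmorphM /= !hornerE.
    by rewrite (rootP mt) mulr0 add0r.
  have szp : (size p < size m)%N by rewrite ltn_modp.
  (* If every root [u] of [m] gave the value [x], the separable [m] would divide [p^emb - x%:P],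
     which has smaller size; the difference would be 0 and [x] would come from [F]. *)
  have [u mu pu] : exists2 u, root (m^emb) u & (p^emb).[u] != x.
    apply: contrapT => nex; apply: nx.
    have mu u : root (m^emb) u -> root (p^emb - x%:P) u.
      move=> ru; rewrite rootE !hornerE subr_eq0.
      by apply: contrapT => pu; apply: nex; exists u => //; apply/negP.
    have [rs Drs] := closed_field_poly_normal (m^emb).
    have um : uniq rs.
      rewrite -separable_prod_XsubC.
      have : separable_poly (m^emb) by rewrite separable_map irr_separable.
      by rewrite Drs lead_coef_map (monicP mon_m) rmorph1 scale1r.
    have : m^emb %| p^emb - x%:P.
      rewrite Drs lead_coef_map (monicP mon_m) rmorph1 scale1r.
      apply: uniq_roots_dvdp; last by rewrite uniq_rootsE.
      apply/allP=> r rrs; apply: mu; rewrite Drs lead_coef_map (monicP mon_m).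
      by rewrite rmorph1 scale1r root_prod_XsubC.
    have [|nz /dvdp_leq] := eqVneq (p^emb - x%:P) 0.
      move/eqP; rewrite subr_eq0 => /eqP/(congr1 (fun q : {poly L} => q`_0)).
      by rewrite coef_map coefC /= => <-; exists p`_0.
    move=> /(_ nz); rewrite size_map_poly leqNgt.
    rewrite (leq_ltn_trans (size_polyD _ _)) // gtn_max size_map_poly szp /=.
    rewrite size_polyN (leq_ltn_trans (size_polyC_leq1 _)) //.
    by case: irr_m.
  (* The embedding of F(t) sending [t] to [u]. The default outside F(t) disappears in the limit,
     where each element eventually lies in F(t). *)
  pose f z := if pselect (exists q, (q^emb).[t] = z) is left e
              then ((sval (cid e))^emb).[u] else z.
  have fP q : f (q^emb).[t] = (q^emb).[u].
    rewrite /f; case: pselect => [e|]; last by case; exists q.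
    case: cid => r /= Er; apply/eqP; rewrite -subr_eq0 -hornerN -hornerD.
    rewrite -rmorphB /= -rootE.
    have /dvdpP[c ->] : m %| r - q.
      apply: irr_root_dvdp mt _ => //.
      by rewrite rootE rmorphB /= !hornerE Er subrr.
    by rewrite rmorphM rootM /= mu orbT.
  exists f, t, u; split=> //; split=> //.
  by rewrite -{1}Dx fP.
have [f fP] := choice ex_f.
have [U [UU Us]] := ultra_seq L.
have /choice[g gP] : forall z, exists y, U [set s | f s z = y].
  move=> z; have [q q0 qz] := algL z.
  have [|y _ Uy] := @ultra_pick _ L U (f^~ z) (root_seq q^emb) UU; last by exists y.
  apply: filterS (Us z) => s zs /=.
  have [t [u [[_ sP] tu]]] := fP s.
  have [|r Er] := sP z; first by rewrite inE zs orbT.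
  rewrite -Er tu root_seqP ?map_poly_eq0 // rootE.
  rewrite -horner_comp -map_comp_poly -tu map_comp_poly horner_comp Er (rootP qz).
  by have := tu 0; rewrite rmorph0 !horner0 => ->.
have hom z1 z2 : U [set s | exists t u q1 q2,
   [/\ (q1^emb).[t] = z1, (q2^emb).[t] = z2 & forall q, f s (q^emb).[t] = (q^emb).[u]]].
  apply: filterS (filterI (Us z1) (Us z2)) => s [/= s1 s2].
  have [t [u [[_ sP] tu]]] := fP s.
  have [|q1 E1] := sP z1; first by rewrite inE s1 orbT.
  have [|q2 E2] := sP z2; first by rewrite inE s2 orbT.
  by exists t, u, q1, q2.
have [z1 z2|z1 z2|c|h hg] := @autom_of_endo g.
- have [s [[[/= <- <-] <-] [t [u [q1 [q2 [<- <- tu]]]]]]] :=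
    filter_ex (filterI (filterI (filterI (gP z1) (gP z2)) (gP (z1 + z2))) (hom z1 z2)).
  by rewrite -hornerD -rmorphD !tu rmorphD hornerD.
- have [s [[[/= <- <-] <-] [t [u [q1 [q2 [<- <- tu]]]]]]] :=
    filter_ex (filterI (filterI (filterI (gP z1) (gP z2)) (gP (z1 * z2))) (hom z1 z2)).
  by rewrite -hornerM -rmorphM !tu rmorphM hornerM.
- have [s /= <-] := filter_ex (gP (emb c)).
  have [t [u [_ tu]]] := fP s.
  by have := tu c%:P; rewrite map_polyC !hornerC.
exists h.
  apply/overP=> c; rewrite hg; have [s /= <-] := filter_ex (gP (emb c)).
  have [t [u [_ tu]]] := fP s.
  by have := tu c%:P; rewrite map_polyC !hornerC.
rewrite hg; have [s /= <-] := filter_ex (gP x).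
by have [t [u [[]]]] := fP s.
Qed.

Lemma fixed_over x : (forall s, over s -> s x = x) -> exists c, x = emb c.
Proof.
move=> fx; apply: contrapT => nex.
have [[c _ Ec]|s os /eqP] := @autom_moves x; first by apply: nex; exists c.
by apply; apply: fx.
Qed.

End AlgebraicClosure.

(** The representatives are taken in [A] itself, while [L] only bounds the values. Most finiteness
    arguments below go through this form. *)
Lemma finite_reps (T K : eqType) (A : set T) (f : T -> K) (L : seq K) :
  (forall t, A t -> f t \in L) ->
  exists ts : seq T, (forall t, t \in ts -> A t) /\
    forall t, A t -> exists2 t', t' \in ts & f t = f t'.
Proof.
elim: L A => [|k L IHL] A AL.
  by exists [::]; split=> // t /AL.
have [|ts [tsA tsP]] := IHL [set t | A t /\ f t <> k].
  by move=> t [/AL]; rewrite inE => /orP[/eqP|].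
have [[t0 At0 ft0]|nex] := pselect (exists2 t, A t & f t = k).
  exists (t0 :: ts); split=> [t|t At].
    by rewrite inE => /orP[/eqP->//|/tsA[]].
  have [ft|nft] := pselect (f t = k).
    by exists t0; rewrite ?mem_head ?ft.
  by have [|t' t'ts ->] := tsP t; [|exists t' => //; rewrite inE t'ts orbT].
exists ts; split=> [t /tsA[]//|t At]; apply: tsP; split=> // ft.
by apply: nex; exists t.
Qed.

Section Orbits.
Variables (F : fieldType) (N : set (autom F)) (E : eqType).
Variable to : autom F -> E -> E.
Hypotheses (to1 : forall x, to 1%g x = x)
           (toM : forall g h x, to (g * h)%g x = to g (to h x)).
Hypothesis NM : forall g h, N g -> N h -> N (g * h)%g.

(** [N] is merely closed under products; each of its elements maps the finite orbit injectively into
    itself, hence permutes it. *)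
Lemma orbit_list x (L : seq E) : (forall h, N h -> to h x \in L) ->
  exists O : seq E, [/\ uniq O, forall y, (y \in O) <-> exists2 h, N h & y = to h x &
    forall h, N h -> perm_eq (map (to h) O) O].
Proof.
move=> xL; pose O := [seq y <- undup L | `[<exists2 h, N h & y = to h x>]].
have OP y : (y \in O) <-> exists2 h, N h & y = to h x.
  rewrite mem_filter mem_undup; split=> [/andP[/asboolP]//|[h Nh ->]].
  by rewrite xL // andbT; apply/asboolP; exists h.
have uO : uniq O by rewrite filter_uniq ?undup_uniq.
exists O; split=> // h Nh.
have inj : injective (to h).
  by move=> y z /(congr1 (to h^-1%g)); rewrite -!toM mulVg !to1.
have sub : {subset map (to h) O <= O}.
  move=> _ /mapP[y /OP[k Nk ->] ->]; apply/OP; exists (h * k)%g.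
    exact: NM.
  by rewrite toM.
have um : uniq (map (to h) O) by rewrite map_inj_uniq.
have [_ eqO] := uniq_min_size um sub (eq_leq (esym (size_map _ O))).
exact: uniq_perm.
Qed.

End Orbits.

Lemma galQ_over (g : galQ) : over (ratr : {rmorphism rat -> algC}) g.
Proof. by apply/overP=> c; rewrite autom_morphE fmorph_rat. Qed.

Lemma algC_algebraic (x : algC) : algebraicOver (ratr : {rmorphism rat -> algC}) x.
Proof.
have [p [Dp mon_p] rp] := minCpolyP x; exists p; first exact: monic_neq0.
by rewrite rp.
Qed.

Definition gconj (x : algC) : seq algC := conjs algC_algebraic x.

Lemma gconjP (g : galQ) x : g x \in gconj x.
Proof. exact/conjsP/galQ_over. Qed.

Lemma galQ_ultralim (I : Type) (U : set_system I) (g : I -> galQ) :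
  UltraFilter U -> exists h : galQ, forall x, U [set i | g i x = h x].
Proof.
move=> UU; have [|h _ hP] := autom_ultralim algC_algebraic (g := g) UU.
  by move=> i; apply: galQ_over.
by exists h.
Qed.

Lemma galQ_fixed (x : algC) : (forall g : galQ, g x = x) -> x \in Crat.
Proof.
move=> fx.
have [|c ->] := fixed_over algC_algebraic (@pchar_num _) (x := x).
  by move=> s _; apply: fx.
exact: Crat_rat.
Qed.

Lemma galQ_reps (s : seq algC) : exists gs : seq galQ,
  forall g : galQ, exists2 h, h \in gs & agree s g h.
Proof.
have [L LP] : exists L : seq (seq algC), forall g : galQ, map g s \in L.
  elim: s => [|x s [L LP]]; first by exists [:: [::]].
  exists [seq y :: t | y <- gconj x, t <- L] => g /=.
  by apply/allpairsP; exists (g x, map g s); rewrite gconjP LP.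
have [gs [_ gsP]] := @finite_reps galQ _ setT (fun g : galQ => map g s) L (fun g _ => LP g).
exists gs => g; have [//|h hgs /eq_in_map gh] := gsP g.
by exists h => // x xs; apply: gh.
Qed.

Lemma agree_mulV s (g h : galQ) : agree s g h -> agree s (h^-1 * g)%g 1%g.
Proof. by move=> gh x xs; rewrite automM gh // automKV. Qed.

(** One half of the Galois correspondence, for an open submonoid. Let [x] generate the field of the
    neighbourhood [s]. The polynomial whose roots are the [N]-conjugates of [x] is fixed by [S], so
    [g] permutes its roots; hence g x = h x with [h] in [N], and h^-1 g lies in the
    neighbourhood. *)
Lemma Krull_open (N S : set galQ) s : N 1%g ->
  (forall g h, N g -> N h -> N (g * h)%g) ->
  (forall g, agree s g 1%g -> N g) -> S `<=` N ->
  fixing (fixedfield S) `<=` N.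
Proof.
move=> N1 NM Ns SN g gS.
have [x xP] := primitive_elt algC_algebraic (@pchar_num _) s.
have [|||O [uO OP Oh]] := @orbit_list algC N algC (fun h => h) _ _ NM x (gconj x).
- by [].
- by [].
- by move=> h _; apply: gconjP.
pose G := \prod_(y <- O) ('X - y%:P).
have GN h : N h -> map_poly (autom_morph h) G = G.
  move=> Nh; rewrite rmorph_prod; apply: etrans (perm_big _ (Oh h Nh)).
  rewrite big_map; apply: eq_bigr => y _.
  by rewrite rmorphB /= map_polyX map_polyC.
have Gg : map_poly (autom_morph g) G = G.
  apply/polyP=> i; rewrite coef_map /= -autom_morphE; apply: gS => h /SN Nh.
  by rewrite autom_morphE -coef_map GN.
have /OP[h Nh gx] : g x \in O.
  have xO : x \in O by apply/OP; exists 1%g.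
  rewrite -root_prod_XsubC -/G -Gg autom_morphE.
  by rewrite rmorph_root // root_prod_XsubC.
have -> : g = (h * (h^-1 * g))%g by apply: autom_eq => z; rewrite !automM automVK.
apply: NM => //; apply: Ns => z /xP[q <-].
by rewrite over_horner ?automM ?gx ?automKV //; apply: galQ_over.
Qed.

(** * The p-adic integers and the valuation ring of K *)

(** Compactness of the pi-adic topology in ultrafilter form: every family has a limit along every
    ultrafilter. *)
Definition adic_compact (R : comNzRingType) (pi : R) :=
  forall (I : Type) (U : set_system I), UltraFilter U -> forall y : I -> R,
  exists y0, forall n, U [set i | exists z, y i - y0 = pi ^+ n * z].

Definition adic_separated (R : comNzRingType) (pi : R) :=
  forall x : R, (forall n, exists z, x = pi ^+ n * z) -> x = 0.

Lemma poly_ultralim (R : comNzRingType) (pi : R) : adic_compact pi ->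
  forall (I : Type) (U : set_system I), UltraFilter U ->
  forall (d : nat) (y : I -> {poly R}), (forall i, size (y i) <= d)%N ->
  exists2 y0 : {poly R}, (size y0 <= d)%N &
    forall n, U [set i | exists z, y i - y0 = pi ^+ n *: z].
Proof.
move=> cR I U UU d y szy.
have /choice[c cP] : forall j, exists y0, forall n,
    U [set i | exists z, (y i)`_j - y0 = pi ^+ n * z].
  by move=> j; apply: cR.
exists (\poly_(j < d) c j); first exact: size_poly.
move=> n.
have H : U [set i | forall j, (j < d)%N -> exists z, (y i)`_j - c j = pi ^+ n * z].
  elim: (d) => [|k IHk]; first by apply: filterS filterT.
  apply: filterS (filterI IHk (cP k n)) => i [/= h1 h2] j.
  by rewrite ltnS leq_eqVlt => /orP[/eqP->|/h1].
apply: filterS H => i /= h.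
have /choice[z zP] : forall j, exists z, (j < d)%N -> (y i)`_j - c j = pi ^+ n * z.
  by move=> j; case: (ltnP j d) => [/h[z]|_]; [exists z|exists 0].
exists (\poly_(j < d) z j); apply/polyP=> j.
rewrite coefB coefZ !coef_poly; case: ltnP => [/zP//|dj].
by rewrite mulr0 subr0 nth_default // (leq_trans (szy i)).
Qed.

Section Padic.
Variables (p : nat) (Qp : padicField p).
Hypothesis p_pr : prime p.
Local Notation ZZ := (padic_int Qp).
Local Notation ip := (p%:R^-1 : rat).

Let p0 : 0 < p%:R :> rat. Proof. by rewrite ltr0n prime_gt0. Qed.
Let ip0 : 0 < ip. Proof. by rewrite invr_gt0. Qed.
Let ip1 : ip < 1.
Proof. by rewrite invf_lt1 // ltr1n prime_gt1. Qed.

Lemma small_pow (eps : rat) : 0 < eps -> exists n, ip ^+ n < eps.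
Proof.
move=> e0; pose n := Num.bound eps^-1; exists n.
have en : eps^-1 < n%:R by apply: archi_boundP; rewrite invr_ge0 ltW.
rewrite exprVn invf_plt ?posrE ?exprn_gt0 //.
apply: lt_trans en _; rewrite -natrX ltr_nat.
exact/ltn_expl/prime_gt1.
Qed.

Lemma pabs_int (z : int) : pabs (z%:~R : Qp) <= 1.
Proof. by have := rpred_int (@padic_int_pred p Qp) z; rewrite inE. Qed.

Lemma pabs_nat (k : nat) : pabs (k%:R : Qp) <= 1.
Proof. by have := rpred_nat (@padic_int_pred p Qp) k; rewrite inE. Qed.

Lemma pabsB (x y : Qp) : pabs (x - y) <= Num.max (pabs x) (pabs y).
Proof. by rewrite -(pabsN y) pabsD. Qed.

Lemma pabsX (x : Qp) n : pabs (x ^+ n) = pabs x ^+ n.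
Proof. by elim: n => [|n IHn]; rewrite ?expr0 ?pabs1 // !exprS pabsM IHn. Qed.

Lemma pabsV (x : Qp) : x != 0 -> pabs x^-1 = (pabs x)^-1.
Proof.
move=> x0; have n0 : pabs x != 0 by rewrite pabs_eq0.
by apply: (mulfI n0); rewrite -pabsM !mulfV ?pabs1.
Qed.

Lemma pabs_coprime (l : nat) : coprime l p -> pabs (l%:R : Qp) = 1.
Proof.
move=> co; apply/eqP; rewrite eq_le pabs_nat /= leNgt; apply/negP=> l1.
have [u [v e]] : exists u v : int, u * l%:Z + v * p%:Z = 1.
  have [u [v e]] := Bezoutz l%:Z p%:Z; exists u, v; rewrite e.
  by move: co; rewrite /coprime /gcdz /= => /eqP->.
have : pabs (1 : Qp) < 1.
  have -> : (1 : Qp) = u%:~R * l%:R + v%:~R * p%:R.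
    by rewrite -[LHS]/(1%:~R) -e rmorphD !rmorphM.
  apply: le_lt_trans (pabsD _ _) _; rewrite gt_max !pabsM.
  have lt a b : 0 <= a -> a <= 1 -> 0 <= b -> b < 1 -> a * b < 1 :> rat.
    by move=> a0 a1 b0 b1; apply: le_lt_trans b1; rewrite ler_piMl.
  by rewrite !lt ?pabs_ge0 ?pabs_int //= pabs_p.
by rewrite pabs1 ltxx.
Qed.

Lemma pabs_pow_p n : pabs ((p ^ n)%:R : Qp) = ip ^+ n.
Proof. by rewrite natrX pabsX pabs_p. Qed.

Lemma p_neq0 : (p%:R : Qp) != 0.
Proof. by rewrite -pabs_eq0 pabs_p gt_eqF. Qed.

Lemma padic_nat_eq0 (k : nat) : (k%:R == 0 :> Qp) = (k == 0)%N.
Proof.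
have [->|k0] := posnP k; first by rewrite eqxx.
apply/negbTE.
have [m co ->] := pfactor_coprime p_pr k0.
rewrite natrM mulf_neq0 // ?natrX ?expf_neq0 ?p_neq0 //.
by rewrite -pabs_eq0 pabs_coprime ?oner_eq0 // coprime_sym.
Qed.

Lemma padic_char0 : [pchar Qp] =i pred0.
Proof. by apply/pcharf0P => k; rewrite padic_nat_eq0. Qed.

(** A nearby rational number also has absolute value at most 1, so its denominator is prime to p and
    can be inverted modulo p^n by Bezout. *)
Lemma padic_approx (x : Qp) n : pabs x <= 1 ->
  exists2 c, (c < p ^ n)%N & pabs (x - c%:R) <= ip ^+ n.
Proof.
move=> x1; have e0 : 0 < ip ^+ n by rewrite exprn_gt0.
have [q xq] := padic_dense x e0.
have q1 : pabs (ratr q : Qp) <= 1.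
  have -> : ratr q = x - (x - ratr q) by rewrite opprB addrC subrK.
  apply: le_trans (pabsB _ _) _; rewrite ge_max x1 (le_trans (ltW xq)) //.
  by rewrite exprn_ile1 // ltW.
have dE : (denq q)%:~R = `|denq q|%N%:R :> Qp.
  by rewrite pmulrn gez0_abs // denq_ge0.
have d0 : (denq q)%:~R != 0 :> Qp by rewrite dE padic_nat_eq0 absz_eq0 denq_neq0.
have cod : coprime `|denq q| p.
  rewrite coprime_sym prime_coprime //; apply/negP=> pd.
  have cn : coprime `|numq q| p.
    rewrite coprime_sym prime_coprime //; apply/negP=> pn.
    have := coprime_num_den q; rewrite /coprime => /eqP g1.
    have : (p %| gcdn `|numq q| `|denq q|)%N by rewrite dvdn_gcd pn pd.
    by rewrite g1 dvdn1 => /eqP p1; have := p_pr; rewrite p1.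
  have an : pabs ((numq q)%:~R : Qp) = 1.
    case: (numq q) cn => k cn; first by rewrite -pmulrn pabs_coprime.
    by rewrite NegzE rmorphN /= pabsN pabs_coprime.
  have ad : pabs ((denq q)%:~R : Qp) <= ip.
    rewrite dE; case/dvdnP: pd => k ->.
    by rewrite natrM pabsM pabs_p ler_piMl ?pabs_nat // ltW.
  move: q1; rewrite /ratr pabsM pabsV // an mul1r invf_le1 ?lt_neqAle ?pabs_ge0.
    by move=> d1; have := le_lt_trans (le_trans d1 ad) ip1; rewrite ltxx.
  by rewrite eq_sym pabs_eq0 d0.
have [u [v uv]] : exists u v : int, u * denq q + v * (p ^ n)%:Z = 1.
  have [u [v e]] := Bezoutz (denq q) (p ^ n)%:Z; exists u, v; rewrite e.
  by have := coprimeXr n cod; rewrite /coprime /gcdz /= => /eqP->.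
pose c := ((numq q * u) %% (p ^ n)%:Z)%Z.
have pn0 : (p ^ n)%:Z != 0 by rewrite eqz_nat -lt0n expn_gt0 prime_gt0.
have c0 : 0 <= c by rewrite modz_ge0.
have cE : c = `|c|%N by rewrite gez0_abs.
exists `|c|%N.
  by rewrite -ltz_nat -cE ltz_pmod // ltz_nat expn_gt0 prime_gt0.
have -> : x - `|c|%N%:R = (x - ratr q) + (ratr q - `|c|%N%:R) by rewrite addrA subrK.
apply: le_trans (pabsD _ _) _; rewrite ge_max (ltW xq) /=.
have -> : ratr q - `|c|%N%:R = (numq q - c * denq q)%:~R / (denq q)%:~R :> Qp.
  by rewrite rmorphB rmorphM /= mulrBl mulfK // {2}cE -pmulrn.
rewrite pabsM pabsV // dE pabs_coprime // invr1 mulr1.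
have -> : numq q - c * denq q =
   (numq q * v + (numq q * u %/ (p ^ n)%:Z)%Z * denq q) * (p ^ n)%:Z.
  have := divz_eq (numq q * u) (p ^ n)%:Z; rewrite -/c => E.
  have {1}-> : numq q = numq q * (u * denq q + v * (p ^ n)%:Z) by rewrite uv mulr1.
  by rewrite mulrDr mulrA {1}E; ring.
rewrite rmorphM /= pabsM -pmulrn pabs_pow_p ler_piMl ?pabs_int // ltW //.
Qed.

(** The absolute value is discrete: modulo p the element is congruent to a digit, and a non-zero
    digit is a unit. *)
Lemma pabs_lt1 (x : Qp) : pabs x < 1 -> pabs x <= ip.
Proof.
move=> x1; have [[|c] cp xc] := padic_approx 1 (ltW x1).
  by rewrite subr0 expr1 in xc.
rewrite expn1 in cp; have co : coprime c.+1 p.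
  by rewrite coprime_sym prime_coprime // gtnNdvd.
have : pabs (c.+1%:R : Qp) < 1.
  have -> : c.+1%:R = x - (x - c.+1%:R) by rewrite opprB addrC subrK.
  apply: le_lt_trans (pabsB _ _) _; rewrite gt_max x1 /=.
  by apply: le_lt_trans xc _; rewrite expr1.
by rewrite pabs_coprime // ltxx.
Qed.

Lemma pabs_dvd (x : ZZ) n : (exists z, x = p%:R ^+ n * z) <-> pabs (val x) <= ip ^+ n.
Proof.
split=> [[z ->]|xn].
  rewrite rmorphM rmorphXn rmorph_nat pabsM pabsX pabs_p.
  by apply: ler_piMr; [rewrite exprn_ge0 // ltW | exact: (valP z)].
have zP : val x / p%:R ^+ n \in @padic_int_pred p Qp.
  rewrite inE pabsM pabsV ?expf_neq0 ?p_neq0 // pabsX pabs_p.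
  by rewrite ler_pdivrMr ?exprn_gt0 // mul1r.
exists (PadicInt zP); apply: val_inj.
by rewrite rmorphM rmorphXn rmorph_nat /= mulrC divfK // expf_neq0 ?p_neq0.
Qed.

Lemma padic_separated : adic_separated (p%:R : ZZ).
Proof.
move=> x xp; apply: val_inj => /=; apply/eqP; apply/negPn/negP=> x0.
have [|n] := @small_pow (pabs (val x)).
  by rewrite lt_neqAle pabs_ge0 eq_sym pabs_eq0 x0.
by rewrite ltNge; have /pabs_dvd-> := xp n.
Qed.

(** For each n the ultrafilter selects a residue modulo p^n; the selected residues form a Cauchy
    sequence, and completeness provides the limit. *)
Lemma padic_compact : adic_compact (p%:R : ZZ).
Proof.
move=> I U UU y.
have /choice[c cP] : forall n, exists c : nat,
    U [set i | pabs (val (y i) - c%:R) <= ip ^+ n].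
  move=> n.
  have /choice[r rP] : forall i, exists c : nat,
     (c < p ^ n)%N /\ pabs (val (y i) - c%:R) <= ip ^+ n.
    by move=> i; have [c] := padic_approx n (valP (y i)); exists c.
  have [|c _ Uc] := @ultra_pick I _ U r (iota 0 (p ^ n)) UU.
    by apply: filterS filterT => i _ /=; rewrite mem_iota add0n; case: (rP i).
  by exists c; apply: filterS Uc => i /= <-; case: (rP i).
have ip_le i j : (i <= j)%N -> ip ^+ j <= ip ^+ i.
  by move=> ij; rewrite ler_wiXn2l // ltW.
have cC i j N : (N <= i)%N -> (N <= j)%N -> pabs ((c i)%:R - (c j)%:R : Qp) <= ip ^+ N.
  move=> Ni Nj; have [k [/= ki kj]] := filter_ex (filterI (cP i) (cP j)).
  have -> : (c i)%:R - (c j)%:R = (val (y k) - (c j)%:R) - (val (y k) - (c i)%:R).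
    by ring.
  apply: le_trans (pabsB _ _) _.
  by rewrite ge_max (le_trans kj (ip_le _ _ Nj)) (le_trans ki (ip_le _ _ Ni)).
have [|x xP] := @padic_complete p Qp (fun n => (c n)%:R).
  move=> eps /small_pow[N eN]; exists N => i j Ni Nj.
  exact: le_lt_trans (cC _ _ _ Ni Nj) eN.
have xc n : pabs (x - (c n)%:R) <= ip ^+ n.
  have [N NP] := xP _ (exprn_gt0 n ip0).
  have /NP xN := leq_maxl N n.
  have -> : x - (c n)%:R = ((c (maxn N n))%:R - (c n)%:R) - ((c (maxn N n))%:R - x).
    by ring.
  apply: le_trans (pabsB _ _) _; rewrite ge_max (ltW xN) andbT.
  by apply: cC => //; apply: leq_maxr.
have x1 : x \in @padic_int_pred p Qp.
  rewrite inE; have -> : x = (x - (c 0)%:R) + (c 0)%:R by rewrite subrK.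
  apply: le_trans (pabsD _ _) _; rewrite ge_max pabs_nat andbT.
  by have := xc 0; rewrite expr0.
exists (PadicInt x1) => n; apply: filterS (cP n) => i /= yi; apply/pabs_dvd.
rewrite rmorphB /=.
have -> : val (y i) - x = (val (y i) - (c n)%:R) - (x - (c n)%:R).
  by ring.
by apply: le_trans (pabsB _ _) _; rewrite ge_max yi xc.
Qed.

End Padic.

(** * Integral closure of the p-adic integers in a field *)

Section PadicIntegrality.
Import Pdiv.RingMonic.

Section IntegralOverPadic.
Variables (p : nat) (Qp : padicField p).
Hypothesis p_pr : prime p.
Local Notation ZZ := (padic_int Qp).

Lemma padic_unit (x : ZZ) : pabs (val x) = 1 -> exists u, x * u = 1.
Proof.
move=> x1; have x0 : val x != 0 by rewrite -pabs_eq0 x1 oner_eq0.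
have iP : (val x)^-1 \in @padic_int_pred p Qp by rewrite inE pabsV // x1 invr1.
by exists (PadicInt iP); apply: val_inj; rewrite rmorphM /= mulfV.
Qed.

Lemma padic_unit_1p (x y : ZZ) : pabs (val x) = 1 -> exists u, (x + p%:R * y) * u = 1.
Proof.
move=> x1; apply: padic_unit.
have lt1 : pabs (val (p%:R * y)) < 1.
  rewrite rmorphM rmorph_nat pabsM pabs_p.
  apply: le_lt_trans (_ : p%:R^-1 < 1).
    by apply: ler_piMr; [rewrite invr_ge0 | exact: (valP y)].
  by rewrite invf_lt1 ?ltr1n ?ltr0n ?prime_gt1 ?prime_gt0.
apply/eqP; rewrite eq_le [_ <= 1](valP (x + _)) /= leNgt; apply/negP=> lt2.
have : pabs (val x) < 1.
  have -> : val x = val (x + p%:R * y) - val (p%:R * y) by rewrite rmorphD addrK.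
  by apply: le_lt_trans (pabsB _ _) _; rewrite gt_max lt1 lt2.
by rewrite x1 ltxx.
Qed.

Variables (E : fieldType) (phi : {rmorphism ZZ -> E}).
Local Notation int := (integralOver phi).
Local Notation "q ^phi" := (map_poly phi q) (at level 2).

Lemma int_horner (q : {poly ZZ}) x : int x -> int (q^phi).[x].
Proof.
move=> ix; apply: integral_horner => //; apply/integral_poly => i.
by rewrite coef_map; apply: integral_id.
Qed.

(** The reciprocal polynomial of [q], rescaled by [u], is monic with root x^-1. *)
Lemma inv_integral (q : {poly ZZ}) (u : ZZ) x : q`_0 * u = 1 ->
  root (q^phi) x -> x != 0 /\ int x^-1.
Proof.
move=> q0u qx; have x0 : x != 0.
  apply/eqP=> x0; have := rootP qx; rewrite x0 horner_coef0 coef_map => /eqP.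
  apply/negP; apply/eqP=> e0; have := congr1 phi q0u.
  by rewrite rmorphM rmorph1 e0 mul0r => /eqP; rewrite eq_sym oner_eq0.
split=> //; set s := size q.
have s0 : (0 < s)%N.
  rewrite lt0n size_poly_eq0; apply/eqP=> e0; move/eqP: q0u.
  by rewrite e0 coef0 mul0r eq_sym oner_eq0.
pose r := \poly_(i < s) (u * q`_(s.-1 - i)).
have rs : r`_s.-1 = 1.
  by rewrite coef_poly prednK // leqnn subnn mulrC.
have szr : size r = s.
  apply/eqP; rewrite eqn_leq size_poly /=.
  rewrite -(prednK s0) ltnNge; apply/negP=> sz; move/eqP: rs.
  by rewrite nth_default // eq_sym oner_eq0.
exists r; first by rewrite monicE lead_coefE szr rs.
rewrite rootE (@horner_coef_wide _ s) -?szr ?size_poly // szr.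
have -> : \sum_(i < s) (r^phi)`_i * x^-1 ^+ i =
   phi u * x ^- s.-1 * \sum_(i < s) (q^phi)`_i * x ^+ i.
  rewrite mulr_sumr (reindex_inj rev_ord_inj); apply: eq_bigr => i _ /=.
  rewrite !coef_map coef_poly /= ltn_subrL s0 /=.
  have -> : (s.-1 - (s - i.+1) = i)%N by have := ltn_ord i; lia.
  rewrite rmorphM /= -!mulrA; congr (_ * _).
  rewrite exprVn mulrCA; congr (_ * _).
  have -> : s.-1 = (s - i.+1 + i)%N by have := ltn_ord i; lia.
  by rewrite exprD invfM mulrVK // unitfE expf_neq0.
by rewrite -horner_coef_wide ?size_poly // (rootP qx) mulr0.
Qed.

Definition iunit x := x != 0 /\ int x^-1.

Lemma iunit_1p b : int b -> iunit (1 + p%:R * b).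
Proof.
move=> [h mh hb]; set z := 1 + _; pose s := size h.
have s0 : (0 < s)%N by rewrite size_poly_gt0 monic_neq0.
(* This is p^(s-1) h((X - 1)/p): it has the root [z], and modulo p its constant coefficient is
   (-1)^(s-1), a unit. *)
pose q : {poly ZZ} := \sum_(i < s) (h`_i * p%:R ^+ (s.-1 - i)) *: ('X - 1) ^+ i.
have qz : root (q^phi) z.
  rewrite rootE /q rmorph_sum horner_sum.
  have -> : \sum_(i < s) ((h`_i * p%:R ^+ (s.-1 - i)) *: ('X - 1) ^+ i)^phi.[z] =
     p%:R ^+ s.-1 * \sum_(i < s) (h^phi)`_i * b ^+ i.
    rewrite mulr_sumr; apply: eq_bigr => i _.
    rewrite linearZ /= rmorphXn rmorphB /= map_polyX rmorph1 hornerZ horner_exp.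
    rewrite !hornerE (_ : z - 1 = p%:R * b); last by rewrite /z; ring.
    rewrite rmorphM rmorphXn rmorph_nat coef_map exprMn.
    have -> : p%:R ^+ s.-1 = p%:R ^+ (s.-1 - i) * p%:R ^+ i :> E.
      by rewrite -exprD; congr (_ ^+ _); have := ltn_ord i; lia.
    by rewrite /= !mulrA; congr (_ * _); rewrite -!mulrA mulrC -mulrA.
  by rewrite -horner_coef_wide ?size_poly // (rootP hb) mulr0.
have [c q0] : exists c, q`_0 = (-1) ^+ s.-1 + p%:R * c.
  rewrite -horner_coef0 /q horner_sum -(prednK s0) big_ord_recr /=.
  have hs : h`_s.-1 = 1 by have := monicP mh; rewrite lead_coefE.
  exists (\sum_(i < s.-1) h`_i * p%:R ^+ (s.-1 - i).-1 * (-1) ^+ i).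
  rewrite addrC mulr_sumr; congr (_ + _).
    by rewrite subnn hs !hornerE ?sub0r ?expr0 ?mul1r.
  apply: eq_bigr => i _; rewrite hornerZ horner_exp !hornerE.
  have -> : (s.-1 - i = (s.-1 - i).-1.+1)%N by have := ltn_ord i; lia.
  by rewrite exprS /=; ring.
have [|u uP] := @padic_unit_1p ((-1) ^+ s.-1) c.
  by rewrite rmorphXn rmorphN1 pabsX pabsN pabs1 expr1n.
by apply: (@inv_integral q u) => //; rewrite q0.
Qed.

Lemma iunit_mul x y : int x -> int y -> iunit (x * y) -> iunit x.
Proof.
move=> ix iy [xy0 ixy]; move: (xy0); rewrite mulf_eq0 negb_or => /andP[x0 y0].
split=> //; have -> : x^-1 = y * (x * y)^-1 by rewrite invfM mulrCA mulfV ?mulr1.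
exact: integral_mul.
Qed.

(* The idempotent r(w) = lim w^(m!) of the complete ring ZZ[w] is 0 or 1, as it
   lies in a field. *)
Lemma int_pow_01 w : int w -> exists N e b, [/\ (0 < N)%N, int b &
  (e = 0 \/ e = 1) /\ w ^+ N = e + p%:R * b].
Proof.
move=> iw; have [f mf fw] := iw.
have [U [UU Ule]] := ultra_nat.
have cZ := padic_compact (Qp := Qp) p_pr.
pose cong n (P Q : {poly ZZ}) := exists A B, P - Q = f * A + p%:R ^+ n *: B.
have congR n P : cong n P P by exists 0, 0; rewrite subrr mulr0 scaler0 addr0.
have congS n P Q : cong n P Q -> cong n Q P.
  by move=> [A [B e]]; exists (- A), (- B); rewrite -opprB e; ring.
have congT n P Q T : cong n P Q -> cong n Q T -> cong n P T.
  move=> [A [B e]] [A' [B' e']]; exists (A + A'), (B + B').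
  by rewrite -(subrK Q P) -addrA e e' scalerDr; ring.
have congM n P Q P' Q' : cong n P Q -> cong n P' Q' -> cong n (P * P') (Q * Q').
  move=> [A [B e]] [A' [B' e']]; exists (A * P' + Q * A'), (B * P' + Q * B').
  have -> : P * P' - Q * Q' = (P - Q) * P' + Q * (P' - Q') by ring.
  by rewrite e e' -!mul_polyC; ring.
have congX n P Q k : cong n P Q -> cong n (P ^+ k) (Q ^+ k).
  by move=> c; elim: k => [|k IHk]; rewrite ?expr0 // !exprS; apply: congM.
have congB n P Q P' Q' : cong n P Q -> cong n P' Q' -> cong n (P - P') (Q - Q').
  move=> [A [B e]] [A' [B' e']]; exists (A - A'), (B - B').
  have -> : P - P' - (Q - Q') = (P - Q) - (P' - Q') by ring.
  by rewrite e e' -!mul_polyC; ring.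
pose r (P : {poly ZZ}) := Pdiv.CommonRing.rmodp P f.
have cr n P : cong n (r P) P.
  exists (- Pdiv.CommonRing.rdivp P f), 0; rewrite {2}(rdivp_eq mf P) -/(r P).
  by rewrite scaler0 addr0; ring.
have szr P : (size (r P) <= size f)%N.
  by apply: ltnW; apply: Pdiv.CommonRing.ltn_rmodpN0; rewrite monic_neq0.
(* Pigeonhole by compactness: the remainders of the X^i have a limit along the ultrafilter, so two
   different powers agree modulo f and p^n. *)
have pig n : exists a c, (0 < c)%N /\ cong n ('X^a) ('X^(a + c)).
  have [y0 _ /(_ n) Uy] := poly_ultralim cZ UU (fun i => szr 'X^i).
  have [a /= [z az]] := filter_ex Uy.
  have [b /= [[z' bz] ab]] := filter_ex (filterI Uy (Ule a.+1)).
  exists a, (b - a)%N; rewrite subn_gt0 ab subnKC ?(ltnW ab) //; split=> //.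
  apply: congT (congS _ _ _ (cr n _)) (congT _ _ _ _ _ (cr n _)).
  exists 0, (z - z'); rewrite mulr0 add0r.
  by rewrite scalerBr -az -bz; ring.
(* For large m the number m! is a multiple of the period [c] and lies beyond the preperiod [a], so
   the power of X with this exponent is idempotent. *)
have idem n : exists M, forall m, (M <= m)%N -> cong n ('X^(m`!)) ('X^(m`! + m`!)).
  have [a [c [c0 ac]]] := pig n; exists (maxn a c) => m; rewrite geq_max => /andP[am cm].
  have am' : (a <= m`!)%N.
    by apply: leq_trans am _; case: (m) => // k; rewrite factS leq_pmulr ?fact_gt0.
  have step k : (a <= k)%N -> cong n ('X^k) ('X^(k + c)).
    move=> ak; rewrite -(subnK ak) -addnA exprD [X in cong _ _ X]exprD.
    exact: congM.
  have steps t k : (a <= k)%N -> cong n ('X^k) ('X^(k + t * c)).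
    move=> ak; elim: t => [|t IHt]; first by rewrite mul0n addn0.
    apply: congT IHt _; rewrite mulSn [(c + _)%N]addnC addnA; apply: step.
    by rewrite (leq_trans ak) ?leq_addr.
  have /dvdnP[t Et] : (c %| m`!)%N by rewrite dvdn_fact // c0.
  by rewrite {3}Et; apply: steps.
have [y0 szy Uy] := poly_ultralim cZ UU (fun m => szr 'X^(m`!)).
have cy n : U [set m | cong n y0 ('X^(m`!))].
  apply: filterS (Uy n) => m /= [z mz].
  apply: congT (cr n _); apply: congS; exists 0, z.
  by rewrite mulr0 add0r.
have idy n : cong n (y0 * y0 - y0) 0.
  have [M MP] := idem n.
  have [m [/= cm Mm]] := filter_ex (filterI (cy n) (Ule M)).
  apply: congT (congB _ _ _ _ _ (congM _ _ _ _ _ cm cm) cm) _.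
  have [A [B e]] := congS _ _ _ (MP m Mm); exists A, B.
  by rewrite subr0 -exprD.
have fy : r (y0 * y0 - y0) = 0.
  apply/polyP=> i; rewrite coef0; apply: (padic_separated p_pr) => n.
  have [A [B]] := idy n; rewrite subr0 => e.
  exists (r B)`_i; rewrite -coefZ; congr (_`_i); rewrite e /r.
  by rewrite rmodpD // rmodpZ // [f * A]mulrC rmodp_mull // add0r.
pose ev (P : {poly ZZ}) := (P^phi).[w].
have evr P : ev (r P) = ev P.
  rewrite /ev [P in RHS](rdivp_eq mf) -/(r P) rmorphD rmorphM /= hornerD hornerM.
  by rewrite (rootP fw) mulr0 add0r.
have e01 : ev y0 = 0 \/ ev y0 = 1.
  have : ev (y0 * y0 - y0) = 0 by rewrite -evr fy /ev rmorph0 horner0.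
  rewrite /ev rmorphB rmorphM /= hornerD hornerN hornerM.
  rewrite -[X in _ - X]mulr1 -mulrBr => /eqP; rewrite mulf_eq0 subr_eq0.
  by case/orP=> /eqP->; [left|right].
have [m /= [z mz]] := filter_ex (Uy 1).
exists m`!, (ev y0), (ev z); split; [exact: fact_gt0 | exact: int_horner | split=> //].
have : ev (r 'X^(m`!) - y0) = ev (p%:R ^+ 1 *: z) by rewrite mz.
rewrite /ev linearZ rmorphB /= hornerD hornerN hornerZ -/(ev (r _)) evr expr1 rmorph_nat.
rewrite /ev map_polyXn hornerXn => <-; by rewrite addrC subrK.
Qed.

Lemma intX x k : int x -> int (x ^+ k).
Proof.
move=> ix; elim: k => [|k IHk]; first by rewrite expr0; apply: integral1.
by rewrite exprS; apply: integral_mul.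
Qed.

(** The integral closure is local. Some w^N is 0 or 1 modulo p: in the first case 1 - w divides the
    unit 1 - w^N, in the second w divides the unit w^N. *)
Lemma int_local w : int w -> iunit w \/ iunit (1 - w).
Proof.
move=> iw; have [N [e [b [N0 ib [e01 wN]]]]] := int_pow_01 iw.
case: e01 wN => -> wN; [right|left].
  apply: (@iunit_mul _ (\sum_(i < N) w ^+ i)).
  - by apply: integral_sub => //; apply: integral1.
  - by apply: big_ind => [|x y|i _]; [exact: integral0 | exact: integral_add | exact: intX].
  rewrite -opprB mulNr -subrX1 opprB wN add0r -mulrN; apply: iunit_1p.
  exact: integral_opp.
apply: (@iunit_mul _ (w ^+ N.-1)) => //; first exact: intX.
by rewrite -exprS prednK // wN; apply: iunit_1p.
Qed.

Definition imax x := int x /\ ~ iunit x.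

(** If x + y were a unit, x/(x + y) and y/(x + y) would be integral with sum 1, so one of them, and
    then x or y, would be a unit. *)
Lemma imax_add x y : imax x -> imax y -> imax (x + y).
Proof.
move=> [ix nx] [iy ny]; split; first exact: integral_add.
move=> [u0 iu]; have iw : int (x / (x + y)) by exact: integral_mul.
have E1 : 1 - x / (x + y) = y / (x + y).
  by rewrite -[1](mulfV u0) -mulrBl addrC addKr.
case: (int_local iw) => [|]; rewrite ?E1 => un.
  by apply: nx; apply: (iunit_mul (y := (x + y)^-1)).
by apply: ny; apply: (iunit_mul (y := (x + y)^-1)).
Qed.

Lemma imax_mul x y : int x -> imax y -> imax (x * y).
Proof.
move=> ix [iy ny]; split; first exact: integral_mul.
by rewrite mulrC => /iunit_mul; auto.
Qed.

Lemma iunit1 : iunit 1.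
Proof. by split; rewrite ?oner_eq0 // invr1; apply: integral1. Qed.

Lemma imax1 : ~ imax 1. Proof. by case=> _; apply; apply: iunit1. Qed.

Lemma imax_prime x y : int x -> int y -> imax (x * y) -> imax x \/ imax y.
Proof.
move=> ix iy [ixy nxy].
have [[x0 ux]|nx] := pselect (iunit x); last by left.
right; split=> // -[y0 uy]; apply: nxy; split; first exact: mulf_neq0.
by rewrite invfM; apply: integral_mul.
Qed.

(** If the absolute value of [c] exceeded 1, the leading term of a monic integral equation would
    dominate all the others. *)
Lemma padic_int_closed (c : Qp) (emb : {rmorphism Qp -> E}) :
  (forall x : ZZ, phi x = emb (val x)) -> int (emb c) -> pabs c <= 1.
Proof.
move=> phiE [f mf fc]; rewrite leNgt; apply/negP=> c1.
have c0 : c != 0 by rewrite -pabs_eq0 gt_eqF // (lt_trans ltr01).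
pose s := size f; have s0 : (0 < s)%N by rewrite size_poly_gt0 monic_neq0.
have : \sum_(i < s) val f`_i * c ^+ i = 0.
  apply: (fmorph_inj emb); rewrite rmorph0 -(rootP fc).
  rewrite (@horner_coef_wide _ s) ?size_poly // rmorph_sum.
  by apply: eq_bigr => i _; rewrite rmorphM rmorphXn coef_map -phiE.
have hs : f`_s.-1 = 1 by have := monicP mf; rewrite lead_coefE.
rewrite -(prednK s0) big_ord_recr /= hs (_ : padic_int_val 1 = 1) // mul1r => /eqP.
rewrite addr_eq0 => /eqP E1.
have : pabs (c ^+ s.-1) < pabs (c ^+ s.-1); last by rewrite ltxx.
have c10 : 0 < pabs c by apply: lt_trans c1.
rewrite -[X in X < _]pabsN -E1.
apply: (big_ind (fun x => pabs x < pabs (c ^+ s.-1))) => [|x y hx hy|i _].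
- have -> : pabs (0 : Qp) = 0 by apply/eqP; rewrite pabs_eq0.
  by rewrite pabsX exprn_gt0.
- by apply: le_lt_trans (pabsD _ _) _; rewrite gt_max hx hy.
rewrite pabsM !pabsX; apply: le_lt_trans (_ : pabs c ^+ i < _).
  by apply: ler_piMl; [rewrite exprn_ge0 // ltW | exact: (valP f`_i)].
by rewrite ltr_eXn2l.
Qed.

Lemma imax_p (emb : {rmorphism Qp -> E}) :
  (forall x : ZZ, phi x = emb (val x)) -> imax p%:R.
Proof.
move=> phiE; split; first exact: integral_nat.
move=> [_]; rewrite -(rmorph_nat emb) -fmorphV => /padic_int_closed-/(_ phiE).
rewrite pabsV ?p_neq0 // pabs_p invrK leNgt ltr1n.
by rewrite prime_gt1.
Qed.

End IntegralOverPadic.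
End PadicIntegrality.

Lemma filter_all_fin (I : Type) (T : finType) (U : set_system I) (A : T -> set I) :
  Filter U -> (forall k, U (A k)) -> U [set j | forall k, A k j].
Proof.
move=> UF UA.
suff H (s : seq T) : U [set j | forall k, k \in s -> A k j].
  by apply: filterS (H (enum T)) => j /= h k; apply: h; rewrite mem_enum.
elim: s => [|t s IHs]; first by apply: filterS filterT.
apply: filterS (filterI IHs (UA t)) => j [/= h1 h2] k.
by rewrite inE => /orP[/eqP->|/h1].
Qed.

(** As over a field: a root [c] modulo [pi] splits off the factor X - c up to a constant divisible
    by [pi], and primality of [pi] passes every other root to the quotient. *)
Lemma finite_roots_mod (R : comNzRingType) (pi : R) (Q : {poly R}) :
  (forall x y, (exists z, x * y = pi * z) ->
     (exists z, x = pi * z) \/ (exists z, y = pi * z)) ->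
  (exists i, ~ exists z, Q`_i = pi * z) ->
  exists ls : seq R, forall x, (exists z, Q.[x] = pi * z) ->
    exists2 c, c \in ls & exists z, x - c = pi * z.
Proof.
move=> pi_pr; have [n] := ubnP (size Q); elim: n Q => // n IHn Q szQ [i Qi].
have [[c [z cz]]|nex] := pselect (exists c, exists z, Q.[c] = pi * z); last first.
  by exists [::] => x xz; case: nex; exists x.
have /factor_theorem[Q1 DQ] : root (Q - Q.[c]%:P) c by rewrite rootE !hornerE subrr.
have DQ' : Q = Q1 * ('X - c%:P) + Q.[c]%:P by rewrite -DQ subrK.
have [||ls lsP] := IHn Q1.
- have [->|Q10] := eqVneq Q1 0.
    have Q0 : Q != 0 by apply/eqP=> Q0; apply: Qi; exists 0; rewrite Q0 coef0 mulr0.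
    by rewrite size_poly0; move: Q0 szQ; rewrite -size_poly_gt0; lia.
  rewrite -ltnS; apply: leq_trans szQ; rewrite ltnS.
  have : size (Q - Q.[c]%:P) = (size Q1).+1 by rewrite DQ size_Mmonic ?monicXsubC // size_XsubC addn2.
  have s1 : (0 < size Q1)%N by rewrite size_poly_gt0.
  have := size_polyD Q (- Q.[c]%:P); rewrite size_polyN => le1 E1.
  move: le1; rewrite E1 leq_max => /orP[//|].
  by rewrite leqNgt (leq_ltn_trans (size_polyC_leq1 _)).
- apply: contrapT => nex; apply: Qi.
  have {}nex j : exists z, Q1`_j = pi * z.
    by apply: contrapT => nj; apply: nex; exists j.
  rewrite DQ' coefD coefC mulrBr coefB coefMC coefMX.
  have [w ->] := nex i; have [v ->] := nex i.-1; rewrite cz.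
  by case: (i == 0)%N; eexists; rewrite ?addr0 ?sub0r -?mulrA -?mulrN -?mulrDr.
exists (c :: ls) => x [w xw].
have : exists z, (x - c) * Q1.[x] = pi * z.
  exists (w - z); rewrite mulrBr -xw -cz [in RHS]DQ'.
  by rewrite !hornerE; ring.
move=> /pi_pr[xc|/lsP[d dls xd]]; first by exists c; rewrite ?mem_head.
by exists d => //; rewrite inE dls orbT.
Qed.

(** * The valuation ring of K: uniformizer, finite residue field, compactness *)

Section ValRing.
Variables (p : nat) (Qp : padicField p) (K : fieldExtType Qp) (varpi : valring K).
Hypotheses (p_pr : prime p) (varpi_unif : uniformizer varpi).
Local Notation ZZ := (padic_int Qp).
Local Notation R := (valring K).

Definition phiK : {rmorphism ZZ -> K} := (in_alg K \o val).
Local Notation intK := (integralOver phiK).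

Lemma valringP (x : R) : intK (val x).
Proof. by case: x => x /= /asboolP. Qed.

Definition mkR (x : K) (ix : intK x) : R := ValRing (introT (asboolP _) ix : x \in valring_pred K).

Lemma phiKE (x : ZZ) : phiK x = in_alg K (val x). Proof. by []. Qed.

Lemma valring_unit (x : R) : (exists y, x * y = 1) <-> iunit phiK (val x).
Proof.
split=> [[y xy]|[x0 ix]].
  have E1 : val x * val y = 1 by rewrite -rmorphM xy rmorph1.
  have x0 : val x != 0.
    by apply/eqP=> x0; move/eqP: E1; rewrite x0 mul0r eq_sym oner_eq0.
  split=> //; have -> : (val x)^-1 = val y by apply: (mulfI x0); rewrite mulfV.
  exact: valringP.
by exists (mkR ix); apply: val_inj; rewrite rmorphM /= mulfV.
Qed.

Lemma varpi_dvdP (x : R) : ~ (exists y, x * y = 1) <-> exists y, x = varpi * y.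
Proof.
split=> [nu|ex]; last by move=> u; have /varpi_unif := u.
by apply: contrapT => nex; apply: nu; apply/varpi_unif.
Qed.

Lemma valring_eq0M (x y : R) : x * y = 0 -> x = 0 \/ y = 0.
Proof.
move=> /(congr1 val); rewrite rmorphM rmorph0 => /eqP; rewrite mulf_eq0.
by case/orP=> /eqP e; [left|right]; apply: val_inj.
Qed.

Lemma valring_mulI (a x y : R) : a <> 0 -> a * x = a * y -> x = y.
Proof.
move=> a0 e; have [||] := @valring_eq0M a (x - y); first by rewrite mulrBr e subrr.
  by [].
by move/eqP; rewrite subr_eq0 => /eqP.
Qed.

Lemma varpi_nunit : ~ exists y, varpi * y = 1.
Proof. by apply/varpi_dvdP; exists 1; rewrite mulr1. Qed.

Lemma varpi_p : exists c : R, p%:R = varpi * c.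
Proof.
apply/varpi_dvdP => /valring_unit; rewrite rmorph_nat.
by have [_] := imax_p p_pr (emb := in_alg K) phiKE.
Qed.

Lemma K_nat_eq0 k : (k%:R == 0 :> K) = (k == 0)%N.
Proof. by rewrite -(rmorph_nat (in_alg K)) fmorph_eq0 padic_nat_eq0. Qed.

Lemma varpi_neq0 : val varpi != 0.
Proof.
have [c pc] := varpi_p.
have e : p%:R = val varpi * val c by rewrite -rmorphM -pc rmorph_nat.
apply/eqP=> v0; move/eqP: e; rewrite v0 mul0r K_nat_eq0.
by rewrite gtn_eqF // prime_gt0.
Qed.

Lemma varpi_neq0R : varpi <> 0.
Proof. by move=> v0; have := varpi_neq0; rewrite v0 rmorph0 eqxx. Qed.

Lemma varpiX_neq0 n : varpi ^+ n <> 0.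
Proof.
move=> /(congr1 val); rewrite rmorphXn rmorph0 => /eqP.
by rewrite expf_eq0 (negPf varpi_neq0) andbF.
Qed.

Lemma varpi_prime (x y : R) : (exists z, x * y = varpi * z) ->
  (exists z, x = varpi * z) \/ (exists z, y = varpi * z).
Proof.
move=> xy; have [ux|] := pselect (exists u, x * u = 1); last by move/varpi_dvdP; left.
right; have [u xu] := ux; have [z e] := xy; exists (u * z).
by rewrite mulrCA -e mulrA [u * x]mulrC xu mul1r.
Qed.

(** By [int_pow_01] a power of [varpi] is 0 or 1 modulo p, and the second case would make [varpi] a
    unit. With [varpi_p] this compares the two adic topologies. *)
Lemma p_dvd_varpiX : exists N b, varpi ^+ N = p%:R * b.
Proof.
have [N [e [b [N0 ib [e01 wN]]]]] := int_pow_01 p_pr (valringP varpi).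
case: e01 wN => -> wN.
  exists N, (mkR ib); apply: val_inj.
  by rewrite rmorphXn rmorphM rmorph_nat /= wN add0r.
case: varpi_nunit; apply/valring_unit.
apply: (@iunit_mul _ _ _ _ _ (val (varpi ^+ N.-1))); try exact: valringP.
by rewrite -rmorphM -exprS prednK // rmorphXn wN; apply: iunit_1p.
Qed.

Lemma Qp_dependent (z : K) : exists2 c : 'I_(\dim {:K}).+1 -> Qp,
  (exists i, c i != 0) & \sum_i c i *: z ^+ i = 0.
Proof.
pose X := [tuple z ^+ (i : nat) | i < (\dim {:K}).+1].
have : ~~ free X.
  rewrite /free size_tuple neq_ltn; apply/orP; left; rewrite ltnS.
  exact/dimvS/subvf.
move/negP=> nf; apply: contrapT => nex; apply: nf; apply/freeP => c c0 i.
apply: contrapT => /eqP ci; apply: nex; exists c; first by exists i.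
by rewrite -[RHS]c0; apply: eq_bigr => j _; rewrite nth_mktuple.
Qed.

Lemma K_algebraic (z : K) : algebraicOver (in_alg K) z.
Proof.
have [c [i ci] c0] := Qp_dependent z.
pose d := (\dim {:K}).+1.
exists (\poly_(j < d) c (inord j)).
  apply/eqP=> /(congr1 (fun q : {poly Qp} => q`_i)).
  by rewrite coef_poly ltn_ord inord_val coef0 => /eqP; apply/negP.
rewrite rootE (@horner_coef_wide _ d) ?size_map_poly ?size_poly //.
rewrite -[X in _ == X]c0; apply/eqP; apply: eq_bigr => j _.
by rewrite coef_map coef_poly ltn_ord inord_val /= mulr_algl.
Qed.

Lemma K_denominator (z : K) : exists n, intK (p%:R ^+ n * z).
Proof.
have /integral_algebraic[q mq qz] := K_algebraic z.
pose s := size q; have s0 : (0 < s)%N by rewrite size_poly_gt0 monic_neq0.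
have [n nP] : exists n, forall i, pabs (p%:R ^+ n * q`_i) <= 1.
  have bnd (x : Qp) : exists n, forall m, (n <= m)%N -> pabs (p%:R ^+ m * x) <= 1.
    have [->|x0] := eqVneq x 0.
      by exists 0 => m _; rewrite mulr0 (eqP (_ : pabs (0 : Qp) == 0)) ?pabs_eq0.
    have x1 : 0 < pabs x by rewrite lt_neqAle pabs_ge0 eq_sym pabs_eq0 x0.
    have [|n nP] := small_pow p_pr (eps := (pabs x)^-1); first by rewrite invr_gt0.
    exists n => m nm; rewrite pabsM pabsX pabs_p.
    rewrite -ler_pdivlMr // div1r; apply: le_trans (ltW nP).
    rewrite ler_wiXn2l ?invr_ge0 // invf_le1 ?ler1n ?ltr0n prime_gt0 //.
  have H k : exists n, forall i, (i < k)%N -> forall m, (n <= m)%N -> pabs (p%:R ^+ m * q`_i) <= 1.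
    elim: k => [|k [n nP]]; first by exists 0.
    have [m mP] := bnd q`_k; exists (maxn n m) => i; rewrite ltnS leq_eqVlt.
    move=> /orP[/eqP->|ik] j; rewrite geq_max => /andP[nj mj]; [exact: mP | exact: nP].
  have [n nP] := H s; exists n => i; have [si|is_] := leqP s i; last exact: nP.
  by rewrite nth_default // mulr0 (eqP (_ : pabs (0 : Qp) == 0)) ?pabs_eq0.
exists n.
(* Passing from the root z to p^n z multiplies the coefficient of index i by p^(n (s-1-i)), which
   makes it integral for i < s-1 by the choice of [n]. *)
have aP i : exists a : ZZ, (i < s)%N -> val a = p%:R ^+ (n * (s.-1 - i)) * q`_i.
  have [is_|si] := ltnP i s; last by exists 0.
  have [Ei|ni] := eqVneq i s.-1.
    exists 1 => _; rewrite Ei subnn muln0 mul1r rmorph1.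
    by have := monicP mq; rewrite lead_coefE.
  have h : p%:R ^+ (n * (s.-1 - i)) * q`_i \in @padic_int_pred p Qp.
    have -> : (n * (s.-1 - i) = n * (s.-1 - i).-1 + n)%N by nia.
    rewrite exprD -mulrA inE pabsM mulr_ile1 ?pabs_ge0 ?nP // pabsX exprn_ile1 ?pabs_ge0 //.
    exact: pabs_nat.
  by exists (PadicInt h).
have [a aE] := choice aP.
exists (\poly_(i < s) a i).
  have as1 : a s.-1 = 1.
    apply: val_inj; rewrite aE ?prednK // subnn muln0 mul1r rmorph1.
    by have := monicP mq; rewrite lead_coefE.
  have sz : size (\poly_(i < s) a i) = s.
    rewrite -(prednK s0) size_poly_eq //.
    by rewrite as1 oner_neq0.
  by rewrite monicE lead_coefE sz coef_poly prednK // leqnn as1.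
rewrite rootE (@horner_coef_wide _ s); last first.
  by apply: leq_trans (size_poly _ _) _; apply: size_poly.
have -> : \sum_(i < s) (map_poly phiK (\poly_(i0 < s) a i0))`_i * (p%:R ^+ n * z) ^+ i =
   p%:R ^+ (n * s.-1) * \sum_(i < s) (map_poly (in_alg K) q)`_i * z ^+ i.
  rewrite mulr_sumr; apply: eq_bigr => i _.
  rewrite !coef_map coef_poly ltn_ord -[X in X * _ = _]/(in_alg K (val (a i))) aE // rmorphM rmorphXn rmorph_nat.
  rewrite exprMn mulrACA -exprM -exprD; congr (_ ^+ _ * _).
  have := ltn_ord i; rewrite -mulnDr => ?; congr (_ * _)%N; lia.
by rewrite -horner_coef_wide ?size_map_poly // (rootP qz) mulr0.
Qed.

Lemma valring_separated_p : adic_separated (p%:R : R).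
Proof.
move=> x xp; apply: contrapT => x0.
have x0' : val x != 0 by apply/eqP=> e; apply: x0; apply: val_inj.
have [m im] := K_denominator (val x)^-1.
have [w xw] := xp m.+1.
have : intK (p%:R^-1).
  have -> : p%:R^-1 = (p%:R ^+ m * (val x)^-1) * val w.
    have pn : p%:R != 0 :> K by rewrite K_nat_eq0 gtn_eqF // prime_gt0.
    have xw' : val x = p%:R ^+ m.+1 * val w by rewrite xw rmorphM rmorphXn rmorph_nat.
    have w0 : val w != 0 by move: x0'; rewrite xw' mulf_eq0 negb_or => /andP[].
    rewrite xw' exprS; move: (_ ^+ m) (expf_neq0 m pn) => q q0.
    by field; rewrite pn q0 w0.
  by apply: integral_mul => //; apply: valringP.
move=> ip; have [_] := imax_p p_pr (emb := in_alg K) phiKE; apply.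
by split=> //; rewrite K_nat_eq0 gtn_eqF // prime_gt0.
Qed.

Lemma valring_separated : adic_separated varpi.
Proof.
move=> x xv; apply: valring_separated_p => n.
have [N [b Nb]] := p_dvd_varpiX; have [z ->] := xv (N * n)%N.
by exists (b ^+ n * z); rewrite exprM Nb exprMn mulrA.
Qed.

Lemma K_denominator_varpi (z : K) : exists n (x : R), val varpi ^+ n * z = val x.
Proof.
have [m im] := K_denominator z; have [N [b Nb]] := p_dvd_varpiX.
exists (N * m)%N, (b ^+ m * mkR im).
have vb : val varpi ^+ N = p%:R * val b by rewrite -rmorphXn Nb rmorphM rmorph_nat.
by rewrite exprM vb rmorphM rmorphXn exprMn [RHS]mulrCA mulrA.
Qed.

(** A linear relation over [Qp] between powers of x, divided by a coefficient of maximal absolute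
    value, is integral with one coefficient equal to 1. Replacing its coefficients by digits modulo
    p makes x a root modulo varpi of one of finitely many polynomials that do not vanish modulo
    varpi. *)
Lemma residue_finite : exists ls : seq R, forall x, exists2 c, c \in ls & exists z, x - c = varpi * z.
Proof.
pose d := (\dim {:K}).+1.
pose Qt (t : {ffun 'I_d -> 'I_p}) : {poly R} := \poly_(i < d) (t (inord i) : nat)%:R.
have lt (t : {ffun 'I_d -> 'I_p}) : exists ls : seq R, (exists i, (t i : nat) != 0%N) ->
   forall x, (exists z, (Qt t).[x] = varpi * z) -> exists2 c, c \in ls & exists z, x - c = varpi * z.
  have [[i ti]|nex] := pselect (exists i, (t i : nat) != 0%N); last by exists [::].
  have [|ls lsP] := finite_roots_mod (pi := varpi) (Q := Qt t) varpi_prime; last by exists ls.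
  exists i; rewrite coef_poly ltn_ord inord_val => -[z tz].
  have co : coprime (t i) p by rewrite coprime_sym prime_coprime // gtnNdvd // lt0n.
  have [c pc] := varpi_p; apply: varpi_nunit.
  have [u [v e]] := Bezoutz (t i)%:Z p%:Z.
  exists (z * u%:~R + c * v%:~R).
  rewrite mulrDr !mulrA -tz -pc.
  have -> : (t i)%:R * u%:~R + p%:R * v%:~R = (u * (t i)%:Z + v * p%:Z)%:~R :> R.
    by rewrite rmorphD !rmorphM /= [_ * (t i)%:R]mulrC [_ * p%:R]mulrC.
  by rewrite e /gcdz /=; move: co; rewrite /coprime => /eqP->.
have [f fP] := choice lt.
exists (flatten [seq f t | t <- enum {: {ffun 'I_d -> 'I_p}}]) => x.
have [c [i1 ci1] c0] := Qp_dependent (val x).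
pose i0 := [arg max_(i > i1) pabs (c i)]%O.
have cmax i : pabs (c i) <= pabs (c i0) by rewrite /i0; case: arg_maxP => // j _ /(_ i); apply.
have ci0 : c i0 != 0.
  rewrite -pabs_eq0 gt_eqF // (lt_le_trans _ (cmax i1)) //.
  by rewrite lt_neqAle pabs_ge0 eq_sym pabs_eq0 ci1.
have ai1 i : pabs (c i / c i0) <= 1.
  rewrite pabsM pabsV // ler_pdivrMr ?mul1r ?cmax //.
  by rewrite lt_neqAle pabs_ge0 eq_sym pabs_eq0 ci0.
have tP i : exists t : 'I_p, exists b : ZZ, c i / c i0 = (t : nat)%:R + p%:R * val b.
  have [t tp bnd] := padic_approx p_pr 1 (ai1 i); rewrite expn1 in tp.
  have tZ : c i / c i0 - t%:R \in @padic_int_pred p Qp.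
    by rewrite inE; apply: le_trans (pabsB _ _) _; rewrite ge_max ai1 pabs_nat.
  have /pabs_dvd[//|b Eb] : pabs (val (PadicInt tZ)) <= p%:R^-1 ^+ 1 by [].
  exists (Ordinal tp), b; rewrite /= -[LHS](subrK t%:R) addrC; congr (_ + _).
  by rewrite -[LHS]/(val (PadicInt tZ)) Eb rmorphM rmorphXn rmorph_nat expr1.
have [t {}tP] := choice tP; have [b tb] := choice tP.
pose T := [ffun i => t i].
have [||y yT xy] := fP T _ x.
- exists i0; rewrite ffunE; apply/eqP=> t0; have := tb i0.
  rewrite divff // t0 add0r => /(congr1 (@pabs _ _)); rewrite pabs1 pabsM pabs_p => e.
  have : (p%:R^-1 * pabs (val (b i0)) : rat) < 1.
    apply: le_lt_trans (_ : p%:R^-1 < 1).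
      by apply: ler_piMr; [rewrite invr_ge0 | exact: (valP (b i0))].
    by rewrite invf_lt1 ?ltr1n ?ltr0n ?prime_gt1 ?prime_gt0.
  by rewrite -e ltxx.
- have ib : intK (- \sum_i phiK (b i) * val x ^+ i).
    apply: integral_opp; apply: big_ind => [|u v|i _].
    + exact: integral0.
    + exact: integral_add.
    by apply: integral_mul; [exact: integral_id | apply: intX; exact: valringP].
  have [w pw] := varpi_p; exists (w * mkR ib); rewrite mulrA -pw.
  apply: val_inj; rewrite rmorphM rmorph_nat /=.
  have -> : valring_val (Qt T).[x] = \sum_(i < d) ((t i)%:R : K) * val x ^+ i.
    rewrite (@horner_coef_wide _ d) ?size_poly // [LHS](rmorph_sum (val : {rmorphism R -> K})).
    apply: eq_bigr => i _.
    by rewrite coef_poly ltn_ord inord_val ffunE rmorphM rmorphXn rmorph_nat.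
  have c0' : \sum_i (c i / c i0) *: val x ^+ i = 0.
    under eq_bigr => i _ do rewrite mulrC -scalerA.
    by rewrite -scaler_sumr c0 scaler0.
  apply/eqP; rewrite mulrN -addr_eq0 -[X in _ == X]c0' mulr_sumr -big_split /=.
  apply/eqP; apply: eq_bigr => i _.
  rewrite tb scalerDl scaler_nat mulr_natl; congr (_ + _).
  by rewrite -scalerA scaler_nat mulr_natl; congr (_ *+ _); rewrite mulr_algl.
exists y => //; apply/flattenP; exists (f T) => //.
by apply/mapP; exists T; rewrite // mem_enum.
Qed.

Lemma residue_pow_finite n : exists ls : seq R, forall x,
  exists2 c, c \in ls & exists z, x - c = varpi ^+ n * z.
Proof.
elim: n => [|n [ls lsP]].
  by exists [:: 0] => x; exists 0; rewrite ?mem_head //; exists x; rewrite subr0 expr0 mul1r.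
have [l1 l1P] := residue_finite.
exists [seq a + varpi ^+ n * b | a <- ls, b <- l1] => x.
have [a als [z az]] := lsP x; have [b bl [w bw]] := l1P z.
exists (a + varpi ^+ n * b); first by apply/allpairsP; exists (a, b).
exists w; rewrite exprSr -mulrA -bw mulrBr -az; ring.
Qed.

Definition incl (a : ZZ) : R := mkR (integral_id phiK a).
Lemma inclD : {morph incl : a b / a + b}.
Proof. by move=> a b; apply: val_inj; rewrite rmorphD /= scalerDl. Qed.
Lemma inclM : {morph incl : a b / a * b}.
Proof. by move=> a b; apply: val_inj; rewrite rmorphM /= -[RHS]scalerAl mul1r scalerA. Qed.

Lemma incl0 : incl 0 = 0.
Proof. by apply: val_inj; rewrite /= scale0r. Qed.
Lemma incl1 : incl 1 = 1.
Proof. by apply: val_inj; rewrite /= scale1r. Qed.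
Lemma incl_pX n : incl (p%:R ^+ n) = p%:R ^+ n.
Proof.
apply: val_inj; rewrite rmorphXn rmorph_nat.
by rewrite -[LHS]/(phiK (p%:R ^+ n)) rmorphXn rmorph_nat.
Qed.

(** Representatives modulo varpi^N, a multiple of p, generate: expansion in powers of p with these
    digits gives coefficients correct modulo p^j for every j, and compactness of [ZZ] gives their
    limit. *)
Lemma valring_fg : exists s (xs : 'I_s -> R), forall x, exists a : 'I_s -> ZZ,
  x = \sum_k incl (a k) * xs k.
Proof.
have [N [b Nb]] := p_dvd_varpiX; have [ls lsP] := residue_pow_finite N.
exists (size ls), (fun i => ls`_i) => x.
have H j : forall x, exists a : 'I_(size ls) -> ZZ, exists y,
    x = \sum_k incl (a k) * ls`_k + p%:R ^+ j * y.
  elim: j => [|j IHj] {}x.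
    exists (fun=> 0), x; rewrite big1 ?add0r ?expr0 ?mul1r // => k _.
    by rewrite incl0 mul0r.
  have [c cls [z xz]] := lsP x; have [a [y zy]] := IHj (b * z).
  have kP : (index c ls < size ls)%N by rewrite index_mem.
  exists (fun k => (k == Ordinal kP)%:R + p%:R * a k), y.
  have -> : x = c + p%:R * (b * z) by rewrite mulrA -Nb -xz addrC subrK.
  rewrite zy mulrDr exprS mulrA addrA mulr_sumr; congr (_ + _).
  under [RHS]eq_bigr => k _ do rewrite inclD mulrDl.
  rewrite big_split /=; congr (_ + _).
    rewrite (bigD1 (Ordinal kP)) //= eqxx big1 => [|k /negPf->].
      by rewrite addr0 incl1 mul1r nth_index.
    by rewrite incl0 mul0r.
  apply: eq_bigr => k _; rewrite inclM mulrA; congr (_ * _ * _).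
  by have := incl_pX 1; rewrite !expr1.
have /choice[a aP] := fun j => H j x.
have [U [UU Ule]] := ultra_nat.
have /choice[a0 a0P] : forall k, exists a0, forall n, U [set j | exists z, a j k - a0 = p%:R ^+ n * z].
  by move=> k; apply: padic_compact.
exists a0; apply/eqP; rewrite -subr_eq0; apply/eqP; apply: valring_separated_p => n.
have : U [set j | forall k, exists z, a j k - a0 k = p%:R ^+ n * z].
  by apply: filter_all_fin => k; apply: a0P.
move=> Un; have [j [/= hj nj]] := filter_ex (filterI Un (Ule n)).
have [z zP] := choice hj; have [y xy] := aP j.
exists (\sum_k incl (z k) * ls`_k + p%:R ^+ (j - n) * y).
rewrite xy mulrDr mulrA -exprD subnKC // mulr_sumr addrAC; congr (_ + _).
rewrite -sumrB; apply: eq_bigr => k _.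
rewrite -mulrBl mulrA; congr (_ * _).
have -> : a j k = a0 k + p%:R ^+ n * z k by rewrite -zP addrC subrK.
by rewrite inclD addrAC subrr add0r inclM incl_pX.
Qed.

Lemma valring_compact : adic_compact varpi.
Proof.
move=> I U UU y; have [s [xs xsP]] := valring_fg.
have /choice[a aP] := fun i => xsP (y i).
have /choice[a0 a0P] : forall k, exists a0, forall n, U [set j | exists z, a j k - a0 = p%:R ^+ n * z].
  by move=> k; apply: padic_compact.
exists (\sum_k incl (a0 k) * xs k) => n.
have : U [set j | forall k, exists z, a j k - a0 k = p%:R ^+ n * z].
  by apply: filter_all_fin => k; apply: a0P.
apply: filterS => i /= hi; have [z zP] := choice hi; have [c pc] := varpi_p.
exists (c ^+ n * \sum_k incl (z k) * xs k).
rewrite aP mulrA -exprMn -pc mulr_sumr -sumrB; apply: eq_bigr => k _.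
rewrite -mulrBl mulrA; congr (_ * _).
have -> : a i k = a0 k + p%:R ^+ n * z k by rewrite -zP addrC subrK.
by rewrite inclD addrAC subrr add0r inclM incl_pX.
Qed.

End ValRing.

(** * Primes above l *)

(** The main instances are the algebraic integers with a prime above l, and the integers of [Qpb]
    with their maximal ideal. *)
Record prime_ideal (F : fieldType) (O P : set F) : Prop := PrimeIdeal {
  pi_O1 : O 1;
  pi_OB : forall x y, O x -> O y -> O (x - y);
  pi_OM : forall x y, O x -> O y -> O (x * y);
  pi_sub : forall x, P x -> O x;
  pi_0 : P 0;
  pi_D : forall x y, P x -> P y -> P (x + y);
  pi_M : forall x y, O x -> P y -> P (x * y);
  pi_1 : ~ P 1;
  pi_prime : forall x y, O x -> O y -> P (x * y) -> P x \/ P y }.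

Section PrimeIdeal.
Variables (F : fieldType) (O P : set F).
Hypothesis PP : prime_ideal O P.

Lemma pi_O0 : O 0. Proof. exact/(pi_sub PP)/(pi_0 PP). Qed.
Lemma pi_ON x : O x -> O (- x).
Proof. by move=> Ox; rewrite -sub0r; apply: (pi_OB PP) => //; apply: pi_O0. Qed.
Lemma pi_OD x y : O x -> O y -> O (x + y).
Proof. by move=> Ox Oy; rewrite -[y]opprK; apply: (pi_OB PP) => //; apply: pi_ON. Qed.
Lemma pi_OX x k : O x -> O (x ^+ k).
Proof.
move=> Ox; elim: k => [|k IHk]; first by rewrite expr0; apply: (pi_O1 PP).
by rewrite exprS; apply: (pi_OM PP).
Qed.
Lemma pi_N x : P x -> P (- x).
Proof.
move=> Px; rewrite -mulN1r; apply: (pi_M PP) => //.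
exact/pi_ON/(pi_O1 PP).
Qed.
Lemma pi_B x y : P x -> P y -> P (x - y).
Proof. by move=> Px Py; apply: (pi_D PP) => //; apply: pi_N. Qed.
Lemma pi_Mr x y : P x -> O y -> P (x * y).
Proof. by move=> Px Oy; rewrite mulrC; apply: (pi_M PP). Qed.
Lemma pi_sum (I : Type) (r : seq I) (Q : pred I) (f : I -> F) :
  (forall i, Q i -> P (f i)) -> P (\sum_(i <- r | Q i) f i).
Proof. by move=> h; apply: big_ind => //; [exact: (pi_0 PP) | exact: (pi_D PP)]. Qed.
Lemma pi_Osum (I : Type) (r : seq I) (Q : pred I) (f : I -> F) :
  (forall i, Q i -> O (f i)) -> O (\sum_(i <- r | Q i) f i).
Proof. by move=> h; apply: big_ind => //; [exact: pi_O0 | exact: pi_OD]. Qed.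
Lemma pi_Onat k : O k%:R.
Proof. by elim: k => [|k IHk]; [exact: pi_O0 | rewrite -natr1; apply: pi_OD => //; apply: (pi_O1 PP)]. Qed.
Lemma pi_X x k : O x -> P (x ^+ k) -> P x.
Proof.
move=> Ox; elim: k => [|k IHk]; first by rewrite expr0 => /(pi_1 PP).
by rewrite exprS => /(pi_prime PP)[]//; apply: pi_OX.
Qed.
Lemma pi_prod (I : eqType) (r : seq I) (f : I -> F) : (forall i, i \in r -> O (f i)) ->
  P (\prod_(i <- r) f i) -> exists2 i, i \in r & P (f i).
Proof.
elim: r => [|i r IHr] rO; first by rewrite big_nil => /(pi_1 PP).
rewrite big_cons => /(pi_prime PP)[||Pi|/IHr[|j jr Pj]].
- exact/rO/mem_head.
- rewrite big_seq; apply: big_ind; [exact: (pi_O1 PP) | exact: (pi_OM PP) |].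
  by move=> j jr; apply: rO; rewrite inE jr orbT.
- by exists i => //; apply: mem_head.
- by move=> j jr; apply: rO; rewrite inE jr orbT.
by exists j => //; rewrite inE jr orbT.
Qed.

Definition polyO (f : {poly F}) := forall i, O f`_i.
Definition polyI (f : {poly F}) := forall i, P f`_i.

Lemma polyOM f g : polyO f -> polyO g -> polyO (f * g).
Proof. by move=> Of Og i; rewrite coefM; apply: pi_Osum => j _; apply: (pi_OM PP). Qed.
Lemma polyOD f g : polyO f -> polyO g -> polyO (f + g).
Proof. by move=> Of Og i; rewrite coefD; apply: pi_OD. Qed.
Lemma polyOB f g : polyO f -> polyO g -> polyO (f - g).
Proof. by move=> Of Og i; rewrite coefB; apply: (pi_OB PP). Qed.
Lemma polyID f g : polyI f -> polyI g -> polyI (f + g).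
Proof. by move=> Of Og i; rewrite coefD; apply: (pi_D PP). Qed.
Lemma polyIN f : polyI f -> polyI (- f).
Proof. by move=> Of i; rewrite coefN; apply: pi_N. Qed.
Lemma polyIM f g : polyO f -> polyI g -> polyI (f * g).
Proof. by move=> Of Og i; rewrite coefM; apply: pi_sum => j _; apply: (pi_M PP). Qed.
Lemma polyI_O f : polyI f -> polyO f.
Proof. by move=> Pf i; apply: (pi_sub PP). Qed.
(** Gauss's lemma: the product is examined at the sum of the two first indices where the
    coefficients leave [P]. *)
Lemma polyI_prime f g : polyO f -> polyO g -> polyI (f * g) -> polyI f \/ polyI g.
Proof.
move=> Of Og Pfg; apply: contrapT => /not_orP[/existsNP[i0 fi0] /existsNP[j0 gj0]].
have exf : exists i, `[< ~ P f`_i >] by exists i0; apply/asboolP.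
have exg : exists j, `[< ~ P g`_j >] by exists j0; apply/asboolP.
case: (ex_minnP exf) => i /asboolP fi imin; case: (ex_minnP exg) => j /asboolP gj jmin.
have := Pfg (i + j)%N; rewrite coefM.
have ii : (i < (i + j).+1)%N by rewrite ltnS leq_addr.
rewrite (bigD1 (Ordinal ii)) //= addKn => Ps.
suff : P (f`_i * g`_j) by move/(pi_prime PP) => [].
rewrite -[_ * _](addrK (\sum_(k < (i + j).+1 | k != Ordinal ii) f`_k * g`_(i + j - k))).
apply: pi_B => //; apply: pi_sum => k ki.
have [ltki|leik] := ltnP k i.
  apply: pi_Mr => //; apply: contrapT => nk.
  by have := imin k (introT (asboolP _) nk); rewrite leqNgt ltki.
apply: (pi_M PP) => //; apply: contrapT => nk.
have := jmin _ (introT (asboolP _) nk); apply/negP; rewrite -ltnNge.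
have : (k : nat) != i by [].
have := ltn_ord k; move: leik; lia.
Qed.

Lemma polyI_prod (r : seq {poly F}) : (forall f, f \in r -> polyO f) ->
  polyI (\prod_(f <- r) f) -> exists2 f, f \in r & polyI f.
Proof.
elim: r => [|f r IHr] rO.
  by rewrite big_nil => /(_ 0); rewrite coef1 => /(pi_1 PP).
rewrite big_cons => /polyI_prime[||Pf|/IHr[|g gr Pg]].
- exact/rO/mem_head.
- rewrite big_seq; apply: big_ind; [|exact: polyOM|].
    by move=> i; rewrite coef1; apply: pi_Onat.
  by move=> g gr; apply: rO; rewrite inE gr orbT.
- by exists f => //; apply: mem_head.
- by move=> g gr; apply: rO; rewrite inE gr orbT.
by exists g => //; rewrite inE gr orbT.
Qed.

(** * Frobenius congruences modulo a prime containing l *)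

Section Frobenius.
Variable l : nat.
Hypotheses (l_pr : prime l) (Pl : P l%:R).

Lemma frobD x y : O x -> O y -> P ((x + y) ^+ l - (x ^+ l + y ^+ l)).
Proof.
move=> Ox Oy; have l0 := prime_gt0 l_pr.
rewrite exprDn -(prednK l0) big_ord_recr big_ord_recl /= !subn0 !subnn !bin0 binn.
rewrite !expr0 !mulr1 !mulr1n mul1r (prednK l0).
have -> (a b c : F) : a + b + c - (a + c) = b by ring.
apply: pi_sum => i _; rewrite /bump /= add1n.
have /dvdnP[c ->] : (l %| 'C(l, i.+1))%N by apply: prime_dvd_bin => //; have := ltn_ord i; lia.
rewrite mulrnA -mulr_natr; apply: (pi_M PP) => //.
by rewrite -mulr_natr; do !apply: (pi_OM PP); try exact: pi_OX; apply: pi_Onat.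
Qed.

Lemma frob_sum (I : Type) (r : seq I) (f : I -> F) : (forall i, O (f i)) ->
  P ((\sum_(i <- r) f i) ^+ l - \sum_(i <- r) f i ^+ l).
Proof.
move=> fO; elim: r => [|i r IHr].
  by rewrite !big_nil expr0n gtn_eqF ?prime_gt0 // subrr; apply: (pi_0 PP).
rewrite !big_cons; have := pi_D PP (frobD (fO i) (pi_Osum r (Q := xpredT) (fun j _ => fO j))) IHr.
by congr P; ring.
Qed.

Lemma frobN x : O x -> P ((- x) ^+ l + x ^+ l).
Proof.
move=> Ox; have := frobD (pi_ON Ox) Ox; rewrite addNr expr0n gtn_eqF ?prime_gt0 //.
by rewrite sub0r => /pi_N; rewrite opprK.
Qed.

(** The variable is left unchanged, so that [fr] acts on the encoded family of coefficients just as
    an automorphism does through [gmap]. *)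
Definition fr (f : {poly F}) := \poly_(i < size f) f`_i ^+ l.

Lemma coef_fr f i : (fr f)`_i = f`_i ^+ l.
Proof.
rewrite coef_poly; case: ltnP => // si.
by rewrite nth_default // expr0n gtn_eqF ?prime_gt0.
Qed.

Lemma polyO_fr f : polyO f -> polyO (fr f).
Proof. by move=> Of i; rewrite coef_fr; apply: pi_OX. Qed.

Lemma frD f g : polyO f -> polyO g -> polyI (fr (f + g) - (fr f + fr g)).
Proof. by move=> Of Og i; rewrite coefB coefD !coef_fr coefD; apply: frobD. Qed.

Lemma frM f g : polyO f -> polyO g -> polyI (fr (f * g) - fr f * fr g).
Proof.
move=> Of Og i; rewrite coefB coef_fr !coefM.
under [X in _ - X]eq_bigr => j _ do rewrite !coef_fr -exprMn.
by apply: frob_sum => j; apply: (pi_OM PP).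
Qed.

(** Frobenius is additive and multiplicative modulo [P], hence commutes with the evaluation of a [G]
    whose coefficients it fixes; it sends roots of [G] to roots modulo [P]. *)
Lemma fr_horner (G : {poly {poly F}}) (x : {poly F}) :
  (forall k, polyO G`_k) -> (forall k, polyI (fr G`_k - G`_k)) -> polyO x ->
  polyI (fr G.[x] - G.[fr x]) /\ polyO G.[x].
Proof.
elim/poly_ind: G => [|G c IHG] GO Gfr Ox.
  rewrite !horner0; split=> i.
    by rewrite coefB coef_fr coef0 expr0n gtn_eqF ?prime_gt0 // subrr; apply: (pi_0 PP).
  by rewrite coef0; apply: pi_O0.
have GS k : (G * 'X + c%:P)`_k.+1 = G`_k by rewrite coefD coefMX coefC addr0.
have G0 : (G * 'X + c%:P)`_0 = c by rewrite coefD coefMX coefC add0r.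
have [||Pfr OG] := IHG _ _ Ox.
- by move=> k; rewrite -GS.
- by move=> k; rewrite -GS.
have Oc : polyO c by rewrite -G0.
have Pc : polyI (fr c - c) by rewrite -G0.
rewrite !hornerMXaddC; split; last by apply: polyOD => //; apply: polyOM.
have h1 := frD (polyOM OG Ox) Oc.
have h2 := frM OG Ox.
have h3 : polyI ((fr G.[x] - G.[fr x]) * fr x).
  by rewrite mulrC; apply: polyIM => //; apply: polyO_fr.
have := polyID (polyID h1 h2) (polyID h3 Pc).
by congr polyI; ring.
Qed.

End Frobenius.
End PrimeIdeal.

Lemma galQ_Aint (g : galQ) x : (g x \in Aint) = (x \in Aint).
Proof. by rewrite autom_morphE Aint_aut. Qed.

Lemma prime_above_ideal l (P : set algC) : Defs.prime_above l P -> prime_ideal [set x | x \in Aint] P.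
Proof.
move=> PP; split=> /=.
- exact: rpred1.
- by move=> x y Ox Oy; apply: rpredB.
- by move=> x y Ox Oy; apply: rpredM.
- exact: (prime_above_sub PP).
- rewrite -(mul0r (l%:R)); apply: (prime_above_mul PP); first exact: rpred0.
  exact: (prime_above_res PP).
- exact: (prime_above_add PP).
- exact: (prime_above_mul PP).
- exact: (prime_above_proper PP).
exact: (prime_above_prime PP).
Qed.

Definition gmap (g : galQ) (q : {poly algC}) := map_poly (autom_morph g) q.

(** A finite family of algebraic integers is encoded as one polynomial [q], whose Galois orbit is
    finite. Symmetric expressions in the orbit are integral and fixed by all automorphisms, hence
    rational integers. *)
Lemma gal_poly_orbit (q : {poly algC}) : polyO [set x | x \in Aint] q ->
  exists O : seq {poly algC},
  [/\ q \in O, forall y, y \in O -> exists g, y = gmap g q &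
   forall k i, (\prod_(y <- O) ('X - y%:P))`_k`_i \in Num.int /\
     (\prod_(y <- O) y)`_i \in Num.int].
Proof.
move=> qO; have [gs gsP] := galQ_reps q.
have [|||O [uO OP Oh]] := @orbit_list algC setT _ gmap _ _ (fun _ _ _ _ => I) q [seq gmap h q | h <- gs].
- by move=> f; rewrite /gmap map_poly_id.
- by move=> g h f; rewrite /gmap -map_poly_comp.
- move=> g _; have [h hgs gh] := gsP g; apply/mapP; exists h => //.
  apply/polyP=> i; rewrite !coef_map; have [iq|qi] := ltnP i (size q).
    by apply: gh; apply: mem_nth.
  by rewrite nth_default // !raddf0.
have OA y : y \in O -> polyO [set x | x \in Aint] y.
  by move=> /OP[g _ ->] i; rewrite /gmap coef_map /= -autom_morphE galQ_Aint; apply: qO.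
have int z : z \in Aint -> (forall g : galQ, g z = z) -> z \in Num.int.
  by move=> zA /galQ_fixed zQ; apply: Cint_rat_Aint.
(* The zero ideal gives access to the closure lemmas on [polyO]. *)
have A0 : prime_ideal [set x | x \in Aint] [set (0 : algC)].
  split=> //=; rewrite ?rpred1 //.
  - by move=> x y Ox Oy; apply: rpredB.
  - by move=> x y Ox Oy; apply: rpredM.
  - by move=> x ->; apply: rpred0.
  - by move=> x y -> ->; rewrite addr0.
  - by move=> x y _ ->; rewrite mulr0.
  - by move/eqP; rewrite oner_eq0.
  by move=> x y _ _ /eqP; rewrite mulf_eq0 => /orP[]/eqP; auto.
exists O; split.
- by apply/OP; exists 1%g => //; rewrite /gmap map_poly_id.
- by move=> y /OP[g _ ->]; exists g.
move=> k i; split; apply: int.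
- move: k i; suff : forall k, polyO [set x | x \in Aint] (\prod_(y <- O) ('X - y%:P))`_k by [].
  rewrite big_seq; apply: (big_ind (fun G : {poly {poly algC}} => forall k, polyO [set x | x \in Aint] G`_k)).
  + move=> k i; rewrite coef1; case: (k == 0)%N; rewrite ?coef0 ?coef1; last exact: rpred0.
    by case: (i == 0)%N; [exact: rpred1 | exact: rpred0].
  + move=> G H OG OH k i; rewrite coefM coef_sum; apply: rpred_sum => j _.
    exact: (polyOM A0 (OG j) (OH (k - j)%N) i).
  move=> y /OA Oy k; rewrite coefB coefX coefC; apply: (polyOB A0).
    by move=> i; case: (k == 1)%N; rewrite ?coef1 ?coef0; [case: (i == 0)%N; [exact: rpred1 | exact: rpred0] | exact: rpred0].
  by case: (k == 0)%N => // i; rewrite coef0; apply: rpred0.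
- move=> g; have {2}<- : map_poly (gmap g) (\prod_(y <- O) ('X - y%:P)) = \prod_(y <- O) ('X - y%:P).
    rewrite -[gmap g]/(map_poly (autom_morph g)) rmorph_prod.
    apply: etrans (perm_big _ (Oh g I)); rewrite big_map; apply: eq_bigr => y _.
    by rewrite rmorphB /= map_polyX map_polyC.
  by rewrite -[gmap g]/(map_poly (autom_morph g)) !coef_map.
- move: i; suff : polyO [set x | x \in Aint] (\prod_(y <- O) y) by [].
  rewrite big_seq; apply: big_ind => //; last exact: (polyOM A0).
  by move=> i; rewrite coef1; case: (i == 0)%N; [exact: rpred1 | exact: rpred0].
move=> g; have {2}<- : gmap g (\prod_(y <- O) y) = \prod_(y <- O) y.
  rewrite /gmap rmorph_prod.
  by apply: etrans (perm_big _ (Oh g I)); rewrite big_map.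
by rewrite /gmap coef_map.
Qed.

Section Above.
Variables (l : nat) (P : set algC).
Hypotheses (l_pr : prime l) (PP : Defs.prime_above l P).
Let PI := prime_above_ideal PP.

Lemma above_int (c : int) : P c%:~R -> (l %| `|c|)%N.
Proof.
move=> Pc; apply: contrapT => /negP nl; apply: (pi_1 PI).
have co : coprime l `|c| by rewrite prime_coprime.
have [u [v e]] := Bezoutz l%:Z c.
have {e} e : u * l%:Z + v * c = 1 by rewrite e /gcdz /=; move: co; rewrite /coprime => /eqP->.
rewrite -[1]/(1%:~R) -e rmorphD !rmorphM /=.
apply: (pi_D PI); apply: (pi_M PI) => //.
- exact: Aint_int.
- exact: (prime_above_res PP).
exact: Aint_int.
Qed.

Lemma above_dvd (c : int) : (l %| `|c|)%N -> P c%:~R.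
Proof.
move=> /dvdnP[k kc]; have -> : c = (if c < 0 then - k%:Z else k%:Z) * l%:Z.
  by case: ifP; lia.
rewrite rmorphM /=; apply: (pi_M PI); first exact: Aint_int.
exact: (prime_above_res PP).
Qed.

Lemma above_fermat (c : int) : P (c%:~R ^+ l - c%:~R).
Proof.
have nat k : P (k%:R ^+ l - k%:R).
  have := fermat_little k l_pr => /eqP.
  have kl : (k <= k ^ l)%N.
    by case: (k) => // m; have := @leq_pexp2l m.+1 1 l isT (prime_gt0 l_pr); rewrite expn1.
  rewrite eqn_mod_dvd // => d.
  by rewrite -natrX -natrB // -[_%:R]/((k ^ l - k)%:Z%:~R); apply: above_dvd.
case: c => k; first exact: nat.
rewrite NegzE rmorphN /= opprK.
have := pi_B PI (frobN PI l_pr (prime_above_res PP) (pi_Onat PI k.+1)) (nat k.+1).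
by congr P; ring.
Qed.

(** The orbit polynomial [G] of [q] has integer coefficients, which Frobenius fixes modulo l by
    Fermat. From G(q) = 0 follows G(fr q) = 0 modulo [P], and by primality one factor fr q - g(q)
    lies in [P]. *)
Lemma frobenius_family (q : {poly algC}) : polyO [set x | x \in Aint] q ->
  exists g : galQ, polyI P (fr l q - gmap g q).
Proof.
move=> Oq; have [O [qO OP intO]] := gal_poly_orbit Oq.
pose G := \prod_(y <- O) ('X - y%:P).
have iA (z : algC) : z \in Num.int -> z \in Aint by apply: Aint_Cint.
have [|||PG _] := fr_horner PI l_pr (prime_above_res PP) (G := G) (x := q).
- by move=> k i; apply: iA; case: (intO k i).
- move=> k i; rewrite coefB coef_fr //; have [/intrP[c ->] _] := intO k i.
  exact: above_fermat.
- by [].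
have Gq : G.[q] = 0.
  by apply/rootP; rewrite root_prod_XsubC.
rewrite Gq in PG.
have : polyI P (\prod_(f <- [seq fr l q - y | y <- O]) f).
  rewrite big_map; have -> : \prod_(y <- O) (fr l q - y) = G.[fr l q].
    by rewrite horner_prod; apply: eq_bigr => y _; rewrite hornerXsubC.
  have -> : G.[fr l q] = - (fr l 0 - G.[fr l q]).
    suff -> : fr l (0 : {poly algC}) = 0 by rewrite sub0r opprK.
    by apply/polyP=> i; rewrite coef_fr // coef0 expr0n gtn_eqF ?prime_gt0.
  exact: (polyIN PI).
case/(polyI_prod PI) => [f /mapP[y /OP[g ->] ->]|_ /mapP[y /OP[g ->] ->] Pf].
  apply: (polyOB PI); first exact: (polyO_fr PI).
  by move=> i; rewrite /gmap coef_map /= -autom_morphE galQ_Aint; apply: Oq.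
by exists g.
Qed.

Lemma Poly_O (s : seq algC) : (forall x, x \in s -> x \in Aint) -> polyO [set x | x \in Aint] (Poly s).
Proof.
move=> sA i; rewrite coef_Poly; have [is_|si] := ltnP i (size s).
  by apply: sA; apply: mem_nth.
by rewrite nth_default //; apply: rpred0.
Qed.

(** The automorphisms found for finite families have a limit. It stabilises [P] because [P] contains
    an integral x exactly when it contains x^l. *)
Lemma frobenius_exists : exists g : galQ, decomposition P g /\
  forall x, x \in Aint -> P (x ^+ l - g x).
Proof.
have [U [UU Us]] := ultra_seq algC.
have /choice[g gP] : forall s : seq algC, exists g : galQ,
   forall x, x \in s -> x \in Aint -> P (x ^+ l - g x).
  move=> s; have [|g gP] := @frobenius_family (Poly [seq x <- s | x \in Aint]).
    by apply: Poly_O => x; rewrite mem_filter => /andP[].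
  exists g => x xs xA.
  have xf : x \in [seq x <- s | x \in Aint] by rewrite mem_filter xA.
  have := gP (index x [seq x <- s | x \in Aint]).
  by rewrite coefB coef_fr // /gmap coef_map coef_Poly nth_index.
have [h hP] := galQ_ultralim g UU.
have hF x : x \in Aint -> P (x ^+ l - h x).
  move=> xA; have [s [/= <- xs]] := filter_ex (filterI (hP x) (Us x)).
  exact: gP.
exists h; split=> // x; split=> [Phx|Px].
  have xA : x \in Aint by rewrite -(galQ_Aint h); apply: (pi_sub PI).
  apply: (pi_X PI (k := l)) => //; rewrite -(subrK (h x) (x ^+ l)).
  by apply: (pi_D PI) => //; apply: hF.
have xA := pi_sub PI Px.
have -> : h x = x ^+ l - (x ^+ l - h x) by ring.
apply: (pi_B PI); last exact: hF.
by rewrite -(prednK (prime_gt0 l_pr)) exprS; apply: (pi_Mr PI) => //; apply: (pi_OX PI).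
Qed.

(** [P] is maximal. An integral equation of [z] has a coefficient prime to l. As long as the
    constant term is divisible by l it is dropped and a factor [z], which is outside [P], is
    removed; a constant term prime to l then gives the inverse. *)
Lemma above_inverse z : z \in Aint -> ~ P z -> exists2 w, w \in Aint & P (z * w - 1).
Proof.
move=> zA nPz.
have evA (f : {poly int}) : (map_poly intr f).[z] \in Aint.
  elim/poly_ind: f => [|f c IHf]; first by rewrite rmorph0 horner0 rpred0.
  rewrite rmorphD rmorphM /= map_polyX map_polyC !hornerE.
  by rewrite rpredD ?rpredM ?Aint_int.
suff H (f : {poly int}) : (exists i, ~~ (l %| `|(f`_i)%R|)%N) ->
    P (map_poly intr f).[z] -> exists2 w, w \in Aint & P (z * w - 1).
  have [q Dq] := floorpP (zA : minCpoly z \is a polyOver Num.int).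
  apply: (H q).
    exists (size q).-1; have := monicP (minCpoly_monic z).
    rewrite Dq lead_coef_map_inj ?rmorph0 //; last exact: intr_inj.
    rewrite -[1]/(1%:~R) => /intr_inj; rewrite lead_coefE => ->; rewrite dvdn1; apply/eqP=> l1; have := l_pr; rewrite l1 //.
  by rewrite -Dq (rootP (root_minCpoly z)); apply: (pi_0 PI).
elim/poly_ind: f => [[i]|f c IHf [i fi]]; first by rewrite coef0 dvdn0.
rewrite rmorphD rmorphM /= map_polyX map_polyC !hornerE /= => Pf.
have [lc|nlc] := boolP (l %| `|c|)%N.
  apply: IHf.
    case: i fi => [|i]; rewrite coefD coefMX coefC /= ?add0r ?addr0 ?lc // => fi.
    by exists i.
  have [|//|//] := pi_prime PI (x := (map_poly intr f).[z]) (y := z) (evA f) zA.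
  have -> : (map_poly intr f).[z] * z = (map_poly intr f).[z] * z + c%:~R - c%:~R by ring.
  by apply: (pi_B PI) => //; apply: above_dvd.
have co : coprime l `|c| by rewrite prime_coprime.
have [u [v e]] := Bezoutz l%:Z c.
have {e} e : u * l%:Z + v * c = 1 by rewrite e /gcdz /=; move: co; rewrite /coprime => /eqP->.
exists (- v%:~R * (map_poly intr f).[z]).
  by rewrite rpredM ?rpredN ?Aint_int.
have -> : z * (- v%:~R * (map_poly intr f).[z]) - 1 =
   - (v%:~R * ((map_poly intr f).[z] * z + c%:~R)) - u%:~R * l%:R.
  have E1 : 1 = u%:~R * l%:R + v%:~R * c%:~R :> algC.
    by rewrite -[LHS]/(1%:~R) -e rmorphD !rmorphM.
  by rewrite [X in _ - X = _]E1; ring.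
apply: (pi_B PI).
  by apply: (pi_N PI); apply: (pi_M PI) => //; apply: Aint_int.
by apply: (pi_M PI); [apply: Aint_int | apply: (prime_above_res PP)].
Qed.

End Above.

(** For a polynomial with coefficients in [Q], the product of its conjugates has integer
    coefficients in [Q], so divisible by l and in [P]; hence one conjugate has all its coefficients
    in [P]. A limit over finite families maps [Q] into [P], and maximality of [Q] gives equality. *)
Lemma prime_above_transitive l (P Q : set algC) : prime l ->
  Defs.prime_above l P -> Defs.prime_above l Q ->
  exists g : galQ, forall x, Q x <-> P (g x).
Proof.
move=> l_pr PP PQ; have PI := prime_above_ideal PP; have QI := prime_above_ideal PQ.
have fam (q : {poly algC}) : polyI Q q -> exists g : galQ, polyI P (gmap g q).
  move=> Qq; have Oq := polyI_O QI Qq; have [O [qO OP intO]] := gal_poly_orbit Oq.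
  have OA y : y \in O -> polyO [set x | x \in Aint] y.
    by move=> /OP[g ->] i; rewrite /gmap coef_map /= -autom_morphE galQ_Aint; apply: Oq.
  have OAp (r : seq {poly algC}) : {subset r <= O} -> polyO [set x | x \in Aint] (\prod_(y <- r) y).
    move=> rO; rewrite big_seq; apply: big_ind; [|exact: (polyOM PI)|].
      by move=> i; rewrite coef1; apply: (pi_Onat PI).
    by move=> y yr; apply/OA/rO.
  have : polyI P (\prod_(y <- O) y).
    move=> i; have [_ /intrP[c Ec]] := intO 0%N i; rewrite Ec.
    apply: (above_dvd l_pr PP); apply: (above_int l_pr PQ); rewrite -Ec.
    suff : polyI Q (\prod_(y <- O) y) by [].
    rewrite (big_rem q) //= mulrC; apply: (polyIM QI) => //; apply: OAp => y.
    exact: mem_rem.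
  case/(polyI_prod PI) => [f /OA//|_ /OP[g ->] Pf].
  by exists g.
have [U [UU Us]] := ultra_seq algC.
have /choice[g gP] : forall s : seq algC, exists g : galQ,
   forall x, x \in s -> Q x -> P (g x).
  move=> s; pose t := [seq x <- s | `[<Q x>]].
  have [|g gP] := fam (Poly t).
    move=> i; rewrite coef_Poly; have [it|ti] := ltnP i (size t).
      by have := mem_nth 0 it; rewrite mem_filter => /andP[/asboolP].
    by rewrite nth_default //; apply: (pi_0 QI).
  exists g => x xs Qx.
  have xt : x \in t by rewrite mem_filter xs andbT; apply/asboolP.
  by have := gP (index x t); rewrite /gmap coef_map coef_Poly nth_index.
have [h hP] := galQ_ultralim g UU.
have hF x : Q x -> P (h x).
  move=> Qx; have [s [/= <- xs]] := filter_ex (filterI (hP x) (Us x)).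
  exact: gP.
exists h => x; split=> [/hF//|Phx].
have xA : x \in Aint by rewrite -(galQ_Aint h); apply: (pi_sub PI).
apply: contrapT => nQx; have [w wA Qw] := above_inverse l_pr PQ xA nQx.
apply: (pi_1 PI); have := hF _ Qw; rewrite automB aut_mul autom1 => Pw.
have -> : 1 = h x * h w - (h x * h w - 1) :> algC by ring.
apply: (pi_B PI) => //; apply: (pi_Mr PI) => //.
by rewrite /= galQ_Aint.
Qed.

(** * The cyclotomic Z_p-extension *)

Section Modular.
Local Open Scope nat_scope.

Lemma modn1_dvd y d : 0 < y -> (y = 1 %[mod d]) <-> d %| y.-1.
Proof.
move=> y0; split=> [/eqP|dy]; first by rewrite eqn_mod_dvd // subn1.
by apply/eqP; rewrite eqn_mod_dvd // subn1.
Qed.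

Lemma modn_inverse a d : 0 < d -> coprime a d -> exists u, u * a = 1 %[mod d].
Proof.
move=> d0 co; have [c _ /dvdnP[k kE]] := Bezoutl a d0.
exists (c * d.-1); rewrite gcdnC (eqP co) in kE.
have [d1|d1] : d = 1 \/ 1 < d by lia.
  by rewrite d1 !modn1.
have k0 : k <= c * a by nia.
have -> : c * d.-1 * a = (c * a - k) * d + 1.
  rewrite mulnBl -kE; have -> : c * d.-1 * a = c * a * d - c * a.
    by rewrite -subn1 mulnBr muln1 mulnBl mulnAC.
  have : 1 + c * a <= c * a * d by rewrite kE leq_mul2r k0 orbT.
  lia.
by rewrite modnMDl.
Qed.

Lemma modn_cancel c x d : coprime d c -> 0 < x -> c * x = c %[mod d] -> x = 1 %[mod d].
Proof.
move=> co x0; rewrite -{2}[c]muln1 => /eqP.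
rewrite eqn_mod_dvd ?leq_mul2l ?x0 ?orbT // -mulnBr Gauss_dvdr // => dx.
by apply/eqP; rewrite eqn_mod_dvd.
Qed.

End Modular.

(** * Powers modulo p^n of integers congruent to 1 modulo p *)

Section LTE.
Variable p : nat.
Hypotheses (p_pr : prime p) (p_odd : odd p).
Local Open Scope nat_scope.

(** With y = 1 + p z the sum is p + p z C(p, 2) modulo p^2, and oddness of p makes p divide C(p,
    2). *)
Lemma geom_p y : y = 1 %[mod p] -> 0 < y ->
  exists w, \sum_(i < p) y ^ i = p * (1 + p * w).
Proof.
move=> y1 y0; have /dvdnP[z zE] : p %| y.-1 by apply/modn1_dvd.
have {}zE : y = 1 + p * z by lia.
have /choice[c cP] : forall i, exists c, y ^ i = 1 + i * (p * z) + p * p * c.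
  elim=> [|i [c IHi]]; first by exists 0; rewrite expn0; lia.
  exists (c + i * z * z + c * (p * z)); rewrite expnS IHi zE; ring.
under eq_bigr => i _ do rewrite cP.
rewrite !big_split /= sum_nat_const card_ord muln1 -big_distrl -big_distrr /=.
rewrite -(big_mkord xpredT (fun i => i)) bin2_sum.
have /dvdnP[k ->] : p %| 'C(p, 2) by apply: prime_dvd_bin => //; rewrite /= odd_prime_gt2.
exists (k * z + \sum_(i < p) c i); ring.
Qed.

Lemma coprime_1p w : coprime p (1 + p * w).
Proof. by rewrite addnC mulnC /coprime gcdnMDl gcdn1. Qed.

Lemma pth_root_1 y a : y = 1 %[mod p] -> 0 < y ->
  y ^ p = 1 %[mod p ^ a.+1] -> y = 1 %[mod p ^ a].
Proof.
move=> y1 y0; have [w wE] := geom_p y1 y0.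
rewrite !modn1_dvd ?expn_gt0 ?y0 // predn_exp wE expnSr mulnCA [p ^ a * p]mulnC.
rewrite dvdn_pmul2l ?prime_gt0 // => d.
by rewrite -(@Gauss_dvdl _ _ (1 + p * w)) // coprimeXl // coprime_1p.
Qed.

Lemma pth_power_1 y a : y = 1 %[mod p ^ a.+1] -> 0 < y -> y ^ p = 1 %[mod p ^ a.+2].
Proof.
move=> ya y0; have y1 : y = 1 %[mod p].
  move: ya; rewrite !modn1_dvd // => d; apply: dvdn_trans d.
  by rewrite expnS dvdn_mulr.
have [w wE] := geom_p y1 y0.
move: ya; rewrite !modn1_dvd ?expn_gt0 ?y0 // predn_exp wE => d.
by rewrite [p ^ a.+2]expnSr; apply: dvdn_mul => //; apply: dvdn_mulr.
Qed.

Lemma coprime_root_1 y k a : y = 1 %[mod p] -> 0 < y -> coprime k p ->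
  y ^ k = 1 %[mod p ^ a] -> y = 1 %[mod p ^ a].
Proof.
move=> y1 y0 co; rewrite !modn1_dvd ?expn_gt0 ?y0 // predn_exp.
rewrite Gauss_dvdl // coprimeXl // coprime_sym /coprime -gcdn_modl.
have -> : (\sum_(i < k) y ^ i) %% p = k %% p.
  rewrite -modn_summ.
  rewrite (eq_bigr (fun=> 1 %% p)); last first.
    by move=> i _; rewrite -modnXm y1 modnXm exp1n.
  by rewrite modn_summ sum_nat_const card_ord muln1.
by rewrite gcdn_modl.
Qed.

(** Removing a factor p from the exponent costs one power of p in the modulus; removing a factor
    prime to p costs nothing. *)
Lemma LTE y k a : y = 1 %[mod p] -> 0 < y -> 0 < k ->
  y ^ k = 1 %[mod p ^ (a + logn p k)] -> y = 1 %[mod p ^ a].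
Proof.
move=> y1 y0 k0; have [m co ->] := pfactor_coprime p_pr k0.
have m0 : 0 < m.
  rewrite lt0n; apply/eqP=> m0; move: co; rewrite m0 /coprime gcdn0 => /eqP p1.
  by move: p_pr; rewrite p1.
rewrite lognM ?expn_gt0 ?(prime_gt0 p_pr) //.
rewrite pfactorK // (logn_coprime co) add0n.
elim: (logn p k) a => [|t IHt] a; first by rewrite expn0 muln1 addn0; apply: coprime_root_1; rewrite // coprime_sym.
rewrite addnS expnSr mulnA expnM => /pth_root_1 h.
apply: IHt; apply: h; last by rewrite expn_gt0 y0.
by rewrite -modnXm y1 modnXm exp1n.
Qed.

Lemma order_1p n j : ((1 + p) ^ j = 1 %[mod p ^ n.+1]) <-> p ^ n %| j.
Proof.
have y1 : 1 + p = 1 %[mod p] by rewrite modnDr.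
have p0 := prime_gt0 p_pr.
split=> [h|/dvdnP[k ->]].
  have [->//|j0] := posnP j; rewrite pfactor_dvdn //; rewrite leqNgt; apply/negP=> lt.
  have : 1 + p = 1 %[mod p ^ 2].
    apply: (LTE (k := j)) => //; move: h; rewrite !modn1_dvd ?expn_gt0 // => d.
    by apply: dvdn_trans d; rewrite dvdn_exp2l //; lia.
  rewrite modn1_dvd // /= => /dvdn_leq; rewrite add0n p0 => /(_ isT).
  by rewrite leqNgt -{1}[p]expn1 ltn_exp2l // prime_gt1.
have h : (1 + p) ^ (p ^ n) = 1 %[mod p ^ n.+1].
  elim: n => [|n IHn]; first by rewrite expn0 !expn1.
  by rewrite expnSr expnM; apply: pth_power_1; rewrite ?expn_gt0.
by rewrite mulnC expnM -modnXm h modnXm exp1n.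
Qed.

Lemma expn1p_mod n a b : a = b %[mod p ^ n] -> (1 + p) ^ a = (1 + p) ^ b %[mod p ^ n.+1].
Proof.
wlog ab : a b / a <= b.
  by move=> h e; case: (leqP a b) => [/h->//|/ltnW/h->].
move=> /esym/eqP; rewrite eqn_mod_dvd // => /order_1p e.
by rewrite -(subnKC ab) expnD -modnMmr e modnMmr muln1.
Qed.

(** By counting: the first p^n powers of 1 + p are distinct modulo p^(n+1), and there are only p^n
    residues congruent to 1 modulo p. *)
Lemma log_1p n y : y = 1 %[mod p] -> exists2 j, j < p ^ n & y = (1 + p) ^ j %[mod p ^ n.+1].
Proof.
move=> y1; have p0 := prime_gt0 p_pr; have pn0 : 0 < p ^ n by rewrite expn_gt0 p0.
have form x : x = 1 %[mod p] -> exists2 q : 'I_(p ^ n), True & x %% p ^ n.+1 = 1 + p * q.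
  move=> x1; pose r := x %% p ^ n.+1.
  have r1 : r = 1 %[mod p] by rewrite /r modn_dvdm // expnS dvdn_mulr.
  have r0 : 0 < r.
    by rewrite lt0n; apply/eqP=> e; move: r1; rewrite e mod0n modn_small // prime_gt1.
  have /dvdnP[q qE] : p %| r.-1 by apply/modn1_dvd.
  have rlt : r < p * p ^ n by rewrite -expnS ltn_mod expn_gt0 p0.
  have qlt : q < p ^ n by nia.
  by exists (Ordinal qlt) => //; rewrite -/r /=; lia.
have /choice[f fP] : forall j : 'I_(p ^ n), exists q : 'I_(p ^ n), (1 + p) ^ j %% p ^ n.+1 = 1 + p * q.
  move=> j; have [|q _ qE] := form ((1 + p) ^ j); last by exists q.
  by rewrite -modnXm modnDr modnXm exp1n.
have finj : injective f.
  move=> i j fij; apply/val_inj; wlog ij : i j fij / i <= j.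
    by move=> h; case: (leqP i j) => [/h->//|/ltnW/h->].
  have : (1 + p) ^ i = (1 + p) ^ j %[mod p ^ n.+1] by rewrite !fP fij.
  rewrite -[X in _ = (1 + p) ^ X %[mod _]](subnKC ij) expnD => /esym/eqP.
  move/eqP/modn_cancel; rewrite expn_gt0 /= => /(_ _ isT) h.
  have /order_1p d : (1 + p) ^ (j - i) = 1 %[mod p ^ n.+1].
    apply: h; rewrite coprimeXl // coprimeXr // -{2}[p]muln1; exact: coprime_1p.
  apply/eqP; rewrite eqn_leq ij /=.
  rewrite leqNgt; apply/negP=> lt.
  have := dvdn_leq _ d; rewrite subn_gt0 lt => /(_ isT).
  by have := ltn_ord j; lia.
have [q _ qE] := form y y1.
have [j _ jE] : exists2 j, True & f j = q.
  by exists (invF finj q) => //; rewrite f_invF.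
by exists j => //; rewrite qE fP jE.
Qed.

End LTE.

Section Cyclotomic.
Variable p : nat.
Hypotheses (p_pr : prime p) (p_odd : odd p).
Local Notation H := (GQinf p).

Let p0 := prime_gt0 p_pr.
Let pX0 m : (0 < p ^ m)%N. Proof. by rewrite expn_gt0 p0. Qed.

Definition zeta m : algC := sval (C_prim_root_exists (pX0 m)).
Lemma zetaP m : (p ^ m).-primitive_root (zeta m).
Proof. by rewrite /zeta; case: C_prim_root_exists. Qed.

Lemma chi_exists m (g : galQ) : exists a : nat, g (zeta m) = zeta m ^+ a.
Proof.
have /(prim_rootP (zetaP m))[i ->] : g (zeta m) ^+ (p ^ m) = 1.
  by rewrite -automX (prim_expr_order (zetaP m)) autom1.
by exists i.
Qed.

(** The cyclotomic character modulo p^m. Its value is a chosen exponent, meaningful only as a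
    residue, so it is always compared by congruences. *)
Definition chi m (g : galQ) := sval (cid (chi_exists m g)).
Lemma chiE m (g : galQ) : g (zeta m) = zeta m ^+ chi m g.
Proof. by rewrite /chi; case: cid. Qed.

Lemma chi_mod m (g : galQ) a : g (zeta m) = zeta m ^+ a -> chi m g = a %[mod p ^ m].
Proof. by rewrite chiE => /eqP; rewrite (eq_prim_root_expr (zetaP m)) => /eqP. Qed.

Lemma chiP m (g : galQ) z : z ^+ (p ^ m) = 1 -> g z = z ^+ chi m g.
Proof.
by move=> /(prim_rootP (zetaP m))[i ->]; rewrite automX chiE -!exprM mulnC.
Qed.

Lemma chiM m g h : chi m (g * h)%g = (chi m g * chi m h)%N %[mod p ^ m].
Proof. by apply: chi_mod; rewrite automM chiE automX chiE -exprM. Qed.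

Lemma chi1 m : chi m 1%g = 1%N %[mod p ^ m].
Proof. by apply: chi_mod; rewrite expr1. Qed.

Lemma chi_le m n g : (m <= n)%N -> chi n g = chi m g %[mod p ^ m].
Proof.
move=> mn; apply/esym/chi_mod; apply: chiP.
rewrite -(subnK mn) expnD mulnC exprM (prim_expr_order (zetaP m)).
by rewrite expr1n.
Qed.

Lemma chi_coprime m g : coprime (chi m.+1 g) p.
Proof.
have e : (chi m.+1 g * chi m.+1 g^-1%g = 1 %[mod p])%N.
  have := chiM m.+1 g g^-1%g; rewrite mulgV => E.
  have d : (p %| p ^ m.+1)%N by rewrite expnS dvdn_mulr.
  by rewrite -(modn_dvdm _ d) -E (modn_dvdm _ d) -(modn_dvdm _ d) chi1 modn_dvdm.
rewrite coprime_sym prime_coprime //; apply/negP=> pd.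
have : (p %| chi m.+1 g * chi m.+1 g^-1%g)%N by apply: dvdn_mulr.
by rewrite /dvdn e modn_small ?prime_gt1.
Qed.

(* Up to torsion, the cyclotomic character modulo p ^ n.+1. *)
Definition cc n (g : galQ) := (chi n.+1 g ^ p.-1 %% p ^ n.+1)%N.

Lemma ccM n g h : cc n (g * h)%g = (cc n g * cc n h %% p ^ n.+1)%N.
Proof. by rewrite /cc modnMm -expnMn -modnXm chiM modnXm. Qed.
Lemma cc1 n : cc n 1%g = (1 %% p ^ n.+1)%N.
Proof. by rewrite /cc -modnXm chi1 modnXm exp1n. Qed.
Lemma ccX n (g : galQ) k : cc n (g ^+ k)%g = (cc n g ^ k %% p ^ n.+1)%N.
Proof.
elim: k => [|k IHk]; first by rewrite expg0 cc1 expn0.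
by rewrite expgS ccM IHk modnMmr -expnS.
Qed.
Lemma cc_mod n g : (cc n g %% p ^ n.+1 = cc n g)%N.
Proof. by rewrite /cc modn_mod. Qed.
Lemma cc_le m n g : (m <= n)%N -> (cc n g %% p ^ m.+1)%N = cc m g.
Proof.
move=> mn; rewrite /cc modn_dvdm ?dvdn_exp2l //.
by rewrite -modnXm (chi_le (m := m.+1)) // modnXm.
Qed.
Lemma cc_agree n (g h : galQ) : g (zeta n.+1) = h (zeta n.+1) -> cc n g = cc n h.
Proof. by rewrite (chiE _ h) => /chi_mod e; rewrite /cc -modnXm e modnXm. Qed.
Lemma cc_p n g : cc n g = 1%N %[mod p].
Proof.
rewrite /cc modn_dvdm ?expnS ?dvdn_mulr //.
have co := chi_coprime n g; have := fermat_little (chi n.+1 g) p_pr.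
rewrite -{1}(prednK p0) expnS => /modn_cancel; apply; first by rewrite coprime_sym.
rewrite expn_gt0 lt0n; apply/orP; left; apply/eqP=> c0.
by move: co; rewrite c0 /coprime gcd0n => /eqP p1; move: p_pr; rewrite p1.
Qed.

(** The subgroup of index p^n belonging to the n-th layer of Q_oo. *)
Definition Un n : set galQ := [set g | cc n g = 1%N %[mod p ^ n.+1]].

Lemma UnP n g : Un n g <-> cc n g = (1 %% p ^ n.+1)%N.
Proof. by rewrite /Un /= cc_mod. Qed.
Lemma Un1 n : Un n 1%g. Proof. by apply/UnP; rewrite cc1. Qed.
Lemma UnM n g h : Un n g -> Un n h -> Un n (g * h)%g.
Proof. by move=> /UnP gU /UnP hU; apply/UnP; rewrite ccM gU hU modnMm. Qed.
Lemma Un_eq n g h : Un n (g^-1 * h)%g <-> cc n g = cc n h.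
Proof.
split=> [/UnP e|e].
  have <- : (g * (g^-1 * h) = h)%g by rewrite mulVKg.
  by rewrite ccM e modnMmr muln1 cc_mod.
by apply/UnP; rewrite ccM -e -ccM mulVg cc1.
Qed.
Lemma UnV n g : Un n g -> Un n g^-1%g.
Proof. by move=> gU; rewrite -[g^-1%g]mulg1; apply/Un_eq; rewrite cc1; apply/UnP. Qed.
Lemma Un_normal n g h : Un n h -> Un n (g * h * g^-1)%g.
Proof.
move=> /UnP hU; apply/UnP; rewrite !ccM hU modnMmr muln1 cc_mod -ccM mulgV.
exact: cc1.
Qed.
Lemma Un_open n g : agree [:: zeta n.+1] g 1%g -> Un n g.
Proof. by move=> h; apply/UnP; rewrite (@cc_agree n g 1%g) ?cc1 //; apply: h; rewrite mem_head. Qed.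
Lemma Un_le m n : (m <= n)%N -> Un n `<=` Un m.
Proof.
move=> mn g /UnP e; apply/UnP; rewrite -(cc_le g mn) e modn_dvdm //.
by rewrite dvdn_exp2l.
Qed.

Definition torsion : set galQ := [set g : galQ | exists2 k, (0 < k)%N &
    forall (m : nat) (z : algC), z ^+ (p ^ m) = 1 -> (g ^+ k)%g z = z].

Lemma torsion_Un n : torsion `<=` Un n.
Proof.
(* Taking out the exponent [k] lowers the level by the p-adic valuation of [k]; hence the start at
   level [M]. *)
move=> g [k k0 gk]; pose M := (n + logn p k)%N.
have e : (cc M g ^ k = 1 %[mod p ^ M.+1])%N.
  rewrite -ccX (@cc_agree M _ 1%g) ?cc1 ?modn_mod //.
  exact/gk/(prim_expr_order (zetaP _)).
have c0 : (0 < cc M g)%N.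
  rewrite lt0n; apply/eqP=> c0; have := cc_p M g; rewrite c0 mod0n modn_small //.
  exact: prime_gt1.
have := @LTE p p_pr p_odd (cc M g) k n.+1 (cc_p M g) c0 k0; rewrite addSn => /(_ e) h.
by apply/UnP; rewrite -(cc_le g (leq_addr (logn p k) n)) h.
Qed.

Lemma torsion_H : torsion `<=` H.
Proof. by move=> g tg x; apply. Qed.

Lemma H_Un n : H `<=` Un n.
Proof.
apply: (Krull_open (s := [:: zeta n.+1])).
- exact: Un1.
- exact: UnM.
- exact: Un_open.
exact: torsion_Un.
Qed.

(** If [cc] is trivial at all levels, g^(p-1) fixes all p-power roots of unity, so [g] is torsion on
    them and fixes Q_oo by definition. *)
Lemma Un_cap g : (forall n, Un n g) -> H g.
Proof.
move=> gU; apply: torsion_H; exists p.-1; first by rewrite -ltnS prednK // prime_gt1.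
case=> [|m] z zm.
  by rewrite expn0 expr1 in zm; rewrite zm autom1.
rewrite (chiP _ zm); have e : chi m.+1 (g ^+ p.-1)%g = 1%N %[mod p ^ m.+1].
  have := gU m; rewrite /Un /= /cc modn_mod => <-.
  elim: (p.-1) => [|k IHk]; first by rewrite expg0 expn0 chi1.
  by rewrite expgS chiM -modnMmr IHk modnMmr -expnS.
have [i ->] := prim_rootP (zetaP m.+1) zm.
rewrite -exprM; apply/eqP; rewrite (eq_prim_root_expr (zetaP m.+1)).
by rewrite -modnMmr e modnMmr muln1.
Qed.

Lemma H1 : H 1%g. Proof. by move=> x _. Qed.
Lemma HM g h : H g -> H h -> H (g * h)%g.
Proof. by move=> gH hH x xQ; rewrite automM hH // gH. Qed.
Lemma HV g : H g -> H g^-1%g.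
Proof. by move=> gH x xQ; rewrite -{1}(gH x xQ) automKV. Qed.
Lemma H_normal g h : H h -> H (g * h * g^-1)%g.
Proof. by move=> hH; apply: Un_cap => n; apply: Un_normal; apply: H_Un. Qed.

Definition UnO n : open_subgroup H :=
  @OpenSubgroup H (Un n) (Un1 n) (@UnM n) (@UnV n) (@H_Un n)
    (ex_intro _ [:: zeta n.+1] (@Un_open n)).

(** [Qn_aut_exists] realises each finite level; a limit of the automorphisms found serves all
    levels. *)
Lemma gamma_exists : exists g : galQ, forall n, chi n g = (1 + p)%N %[mod p ^ n].
Proof.
have ex m : exists g : galQ, chi m g = (1 + p)%N %[mod p ^ m].
  have co : coprime (1 + p) (p ^ m).
    by rewrite coprimeXr // coprime_sym -{2}[p]muln1 coprime_1p.
  have [u uP] := Qn_aut_exists co.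
  exists (@Autom algC u (algC_invaut u) (@algC_autK u) (@algC_invautK u)
           (rmorphD u) (rmorphM u)).
  by apply: chi_mod; apply: uP; apply: prim_expr_order (zetaP m).
have /choice[g gP] := ex; have [U [UU Ule]] := ultra_nat.
have [h hP] := galQ_ultralim g UU; exists h => n.
have [m [/= e nm]] := filter_ex (filterI (hP (zeta n)) (Ule n)).
have : chi n h = chi n (g m) %[mod p ^ n] by apply: chi_mod; rewrite -e chiE.
move=> ->; rewrite -(chi_le (g m) nm).
by rewrite -(modn_dvdm _ (dvdn_exp2l p nm)) gP modn_dvdm // dvdn_exp2l.
Qed.

Definition gam : galQ := sval (cid gamma_exists).
Lemma gamP n : chi n gam = (1 + p)%N %[mod p ^ n].
Proof. by rewrite /gam; case: cid. Qed.

Lemma cc_gam n i : cc n (gam ^+ i)%g = ((1 + p) ^ (p.-1 * i) %% p ^ n.+1)%N.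
Proof. by rewrite ccX /cc modnXm -expnM -modnXm gamP modnXm. Qed.

Let copp n : coprime p.-1 (p ^ n).
Proof.
by rewrite coprimeXr // coprime_sym; case: (p) p0 => // k _; rewrite coprime_sym coprimenS.
Qed.

Lemma Un_gam n i : Un n (gam ^+ i)%g <-> (p ^ n %| i)%N.
Proof.
rewrite /Un /= cc_gam modn_mod order_1p // mulnC Gauss_dvdl // coprime_sym.
exact: copp.
Qed.

(** Through [cc] the element gam becomes (1 + p)^(p-1), which still generates because p - 1 is
    invertible modulo p^n. *)
Lemma Un_gen n g : exists2 i, (i < p ^ n)%N & cc n g = cc n (gam ^+ i)%g.
Proof.
have [j _ jE] := log_1p p_pr p_odd n (cc_p n g).
have [u uP] := modn_inverse (pX0 n) (copp n).
exists (j * u %% p ^ n)%N; first by rewrite ltn_mod.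
rewrite -cc_mod jE cc_gam; apply: expn1p_mod => //.
by rewrite modnMmr mulnCA [(p.-1 * u)%N]mulnC -modnMmr uP modnMmr muln1.
Qed.

Lemma osub_eq (K : set galQ) (U V : open_subgroup K) :
  osub_set U = osub_set V -> U = V.
Proof.
case: U V => [U a b c d e] [V a' b' c' d' e'] /= UV; subst V.
by congr OpenSubgroup; apply: Prop_irrelevance.
Qed.

(** An open subgroup above H contains some [Un N]; otherwise elements of the [Un N] outside it would
    have a limit in H. The quotient by [Un N] is cyclic of order p^N, so the subgroup is determined
    by the least n with gam^(p^n) in it. *)
Lemma UnO_all (V : open_subgroup H) : exists n, V = UnO n.
Proof.
have [s sV] := osub_open V.
have VX (g : galQ) k : osub_set V g -> osub_set V (g ^+ k)%g.
  move=> Vg; elim: k => [|k IHk]; first by rewrite expg0; apply: osub1.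
  by rewrite expgS; apply: osubM.
have [N NV] : exists N, Un N `<=` V.
  apply: contrapT => nex.
  have /choice[g gP] : forall N, exists g, Un N g /\ ~ osub_set V g.
    move=> N; apply: contrapT => nN; apply: nex; exists N => g gU.
    by apply: contrapT => nV; apply: nN; exists g.
  have [U [UU Ule]] := ultra_nat; have [h hP] := galQ_ultralim g UU.
  have hH : H h.
    apply: Un_cap => n.
    have [m [/= e nm]] := filter_ex (filterI (hP (zeta n.+1)) (Ule n)).
    apply/UnP; rewrite -(cc_agree e); apply/UnP.
    by apply: (Un_le nm); case: (gP m).
  have Us : U [set m | agree s (g m) h].
    elim: (s) => [|x t IHt]; first by apply: filterS filterT.
    apply: filterS (filterI (hP x) IHt) => m [/= e1 e2] y.
    by rewrite inE => /orP[/eqP->//|/e2].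
  have [m /= gh] := filter_ex Us; case: (gP m) => _; apply.
  rewrite -[g m](mulVKg h); apply: osubM; first exact: (osub_ge V).
  exact/sV/agree_mulV.
have exn : exists n, `[< osub_set V (gam ^+ (p ^ n))%g >].
  by exists N; apply/asboolP; apply: NV; apply/Un_gam.
case: (ex_minnP exn) => n /asboolP Vn nmin; exists n; apply: osub_eq.
have split g : exists2 i, cc N g = cc N (gam ^+ i)%g & forall W : set galQ,
    (forall g h, W g -> W h -> W (g * h)%g) -> (forall g, W g -> W g^-1%g) ->
    Un N `<=` W -> (W g <-> W (gam ^+ i)%g).
  have [i _ ci] := Un_gen N g; exists i => // W WM WV NW.
  have Wi : W ((gam ^+ i)^-1 * g)%g by apply/NW/Un_eq.
  split=> h; last by rewrite -[g](mulVKg (gam ^+ i)%g); apply: WM.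
  have -> : (gam ^+ i = g * (gam ^- i * g)^-1)%g by rewrite invgM invgK mulVKg.
  by apply: WM => //; apply: WV.
have nN : (n <= N)%N by apply: nmin; apply/asboolP; apply: NV; apply/Un_gam.
apply/seteqP; split=> g /=; have [i _ iP] := split g.
  rewrite (iP V) //; [|exact: osubM|exact: osubV]; move=> Vi.
  rewrite (iP (Un n)); [|exact: UnM|exact: UnV|exact: Un_le].
  apply/Un_gam.
  have [c _ /dvdnP[k kE]] := Bezoutl i (pX0 N).
  have /dvdn_pfactor[//|a aN aE] : (gcdn (p ^ N) i %| p ^ N)%N by apply: dvdn_gcdl.
  have : osub_set V (gam ^+ (p ^ a))%g.
    have e : (gam ^+ (p ^ a) = gam ^+ (k * p ^ N) * (gam ^+ (c * i))^-1)%g.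
      by rewrite -kE aE expgnDr mulgK.
    rewrite e; apply: osubM; first by apply: NV; apply/Un_gam; apply: dvdn_mull.
    by apply: osubV; rewrite mulnC expgnA; apply: VX.
  move=> /asboolP/nmin na; apply: dvdn_trans (dvdn_exp2l p na) _.
  by rewrite -aE dvdn_gcdr.
rewrite (iP (Un n)); [|exact: UnM|exact: UnV|exact: Un_le].
move=> /Un_gam/dvdnP[k ik].
rewrite (iP V) //; [|exact: osubM|exact: osubV].
by rewrite ik mulnC expgnA; apply: VX.
Qed.

(** * Decomposition in Q_oo of a prime l different from p *)

Section Decomposition.
Variables (l : nat) (P : set algC).
Hypotheses (l_pr : prime l) (lp : l != p) (PP : Defs.prime_above l P).
Let PI := prime_above_ideal PP.

(** A root of unity w of order dividing p^m, not 1 but congruent to 1 modulo [P], would put p^m into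
    [P], since its powers sum to 0. So the Frobenius congruence is an equality on p-power roots of
    unity. *)
Lemma frobenius_chi (s : galQ) : (forall x, x \in Aint -> P (x ^+ l - s x)) ->
  forall m, chi m s = l %[mod p ^ m].
Proof.
move=> sF m; apply: chi_mod; apply/eqP.
have zA : zeta m \in Aint := Aint_prim_root (zetaP m).
have := sF _ zA; rewrite chiE => Pz.
apply: contrapT => /eqP ne.
pose n := (p ^ m)%N; have zn := zetaP m.
have npP : ~ P (n%:R).
  move=> Pn; have := above_int l_pr PP (c := n%:Z) Pn.
  rewrite /= /n Euclid_dvdX // => /andP[]; rewrite dvdn_prime2 // => /eqP e _.
  by move: lp; rewrite e eqxx.
apply: npP.
pose w := zeta m ^+ l / zeta m ^+ chi m s.
have z0 k : zeta m ^+ k != 0.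
  apply: expf_neq0; apply/eqP=> e; have := prim_expr_order zn.
  by rewrite e expr0n gtn_eqF // => /eqP; rewrite eq_sym oner_eq0.
have wn : w ^+ n = 1.
  by rewrite /w expr_div_n -!exprM ![(_ * n)%N]mulnC !exprM (prim_expr_order zn) !expr1n divr1.
have w1 : w != 1.
  apply/eqP=> w1; move/eqP: ne; apply; apply/eqP.
  by rewrite -[RHS](divfK (z0 (chi m s))) -/w w1 mul1r.
have wA : w \in Aint by apply: (Aint_unity_root (pX0 m)); apply/unity_rootP.
have : 'X^n - 1 = ('X - 1) * \sum_(i < n) 'X^i :> {poly algC} by rewrite subrX1.
have [i wi] := prim_rootP zn wn.
have Pw : P (w - 1).
  have -> : w - 1 = (zeta m ^+ chi m s)^-1 * (zeta m ^+ l - zeta m ^+ chi m s).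
    by rewrite mulrBr mulVf // mulrC.
  apply: (pi_M PI) => //=.
  apply: (Aint_unity_root (pX0 m)); apply/unity_rootP.
  by rewrite exprVn -exprM mulnC exprM (prim_expr_order zn) expr1n invr1.
move=> _.
have sum0 : \sum_(j < n) w ^+ j = 0.
  apply: (mulfI (_ : w - 1 != 0)); first by rewrite subr_eq0.
  by rewrite -subrX1 wn subrr mulr0.
have -> : n%:R = - \sum_(j < n) (w ^+ j - 1) :> algC.
  by rewrite sumrB sum0 sub0r opprK sumr_const card_ord.
apply: (pi_N PI); apply: (pi_sum PI) => j _; rewrite subrX1.
apply: (pi_Mr PI) => //; apply: (pi_Osum PI) => k _; exact: (pi_OX PI).
Qed.

Lemma decompositionX (s : galQ) k : decomposition P s -> decomposition P (s ^+ k)%g.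
Proof.
move=> sP; elim: k => [|k IHk] x; first by rewrite expg0.
by rewrite expgS automM sP IHk.
Qed.

(** Frobenius at l has infinite order in Gal(Q_oo/Q). If m is the last level with [s] in [Un m], the
    powers of [s] approximate every element of [Un m] at all levels, and a limit of powers of [s]
    stays in the decomposition group. *)
Lemma decomposition_index : exists m, forall g, Un m g ->
  exists2 d, decomposition P d & H (d^-1 * g)%g.
Proof.
have [s [sD sF]] := frobenius_exists l_pr PP.
have sl n : cc n s = (l ^ p.-1 %% p ^ n.+1)%N.
  by rewrite /cc -modnXm (frobenius_chi sF) modnXm.
have exn : exists n, `[< ~ Un n s >].
  (* At this level the modulus exceeds l^(p-1) > 1, so the residue of l^(p-1) is not 1. *)
  exists (l ^ p.-1)%N; apply/asboolP; rewrite UnP sl.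
  have lt : (l ^ p.-1 < p ^ (l ^ p.-1).+1)%N.
    by apply: leq_trans (ltn_expl _ (prime_gt1 p_pr)) _; rewrite leq_exp2l ?prime_gt1.
  rewrite !modn_small // ?(leq_ltn_trans _ lt) ?expn_gt0 ?prime_gt0 //.
  have : (1 < l ^ p.-1)%N by rewrite -(exp1n p.-1) ltn_exp2r ?prime_gt1 // -ltnS prednK // prime_gt1.
  by move=> /[swap] ->.
case: (ex_minnP exn) => [[|m]] /asboolP sm smin.
  by case: sm; apply/UnP; have := cc_p 0 s; rewrite -[RHS]/(1 %% p ^ 0.+1)%N !expn1 => <-; rewrite -{1}cc_mod expn1.
have sUm : Un m s.
  by apply: contrapT => /asboolP/smin; rewrite ltnn.
exists m => g gU.
have /choice[i iP] : forall N, exists i, (m < N)%N -> cc N (s ^+ i)%g = cc N g.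
  move=> N; have [mN|] := ltnP m N; last by exists 0.
  have [a _ ca] := Un_gen N s; have [b _ cb] := Un_gen N g.
  have gen k h c : (k <= N)%N -> cc N h = cc N (gam ^+ c)%g -> Un k h <-> (p ^ k %| c)%N.
    move=> kN e; rewrite -Un_gam !UnP -!(cc_le _ kN) e //.
  (* In the cyclic quotient s = gam^a and g = gam^b, where a = p^m a' with a' prime to p and b = p^m
     b'; with u inverse to a', the exponent u b' turns s into g. *)
  have /dvdnP[a' aE] : (p ^ m %| a)%N by apply/(gen m s a (ltnW mN) ca).
  have /dvdnP[b' bE] : (p ^ m %| b)%N by apply/(gen m g b (ltnW mN) cb).
  have coa : coprime a' p.
    rewrite coprime_sym prime_coprime //; apply/negP=> /dvdnP[c cE].
    apply: sm; apply/(gen m.+1 s a mN ca).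
    by rewrite aE cE expnS -mulnA dvdn_mull.
  have [u uP] := modn_inverse (pX0 N) (coprimeXr N coa).
  exists (u * b')%N => _.
  rewrite ccX ca cb -ccX -expgnA !cc_gam; apply: expn1p_mod => //.
  have E : (a * (u * b') = b %[mod p ^ N])%N.
    have -> : (a * (u * b') = u * a' * b)%N by rewrite aE bE; ring.
    by rewrite -modnMml uP modnMml mul1n.
  by rewrite -modnMmr E modnMmr.
have [U [UU Ule]] := ultra_nat.
have [d dP] := galQ_ultralim (fun N => s ^+ i N)%g UU.
exists d.
  move=> x; have [N /= <-] := filter_ex (dP x); exact: decompositionX.
apply: Un_cap => n; apply/Un_eq.
have [N [/= e]] := filter_ex (filterI (dP (zeta n.+1)) (Ule (maxn n m.+1))).
rewrite geq_max => /andP[nN mN].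
by rewrite -(cc_agree e) -(cc_le _ nN) iP // cc_le.
Qed.

(** The primes above l form one Galois orbit, and the decomposition group times H contains [Un m];
    so the H-orbits are represented by the gam^i with i < p^m. *)
Lemma finite_decomposition : exists rs : seq galQ, forall Q, Defs.prime_above l Q ->
  exists h r, [/\ H h, r \in rs & forall x, Q x <-> P ((h * r)^-1%g x)].
Proof.
have [m mP] := decomposition_index.
exists [seq (gam ^+ i)%g | i <- iota 0 (p ^ m)] => Q PQ.
have [g gP] := prime_above_transitive l_pr PP PQ.
(* g^-1 = gam^i u, u in Un m = D H *)
have [i ilt ci] := Un_gen m g^-1%g.
have [d dD dH] := mP ((gam ^+ i)^-1 * g^-1)%g (iffRL (Un_eq _ _ _) (esym ci)).
pose t := (gam ^+ i)%g.
pose h := (d^-1 * (t^-1 * g^-1))%g.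
exists (t * (d * h * d^-1) * t^-1)%g, t; split.
- by do 2!apply: H_normal.
- by apply: map_f; rewrite mem_iota.
have -> : (t * (d * h * d^-1) * t^-1 * t = g^-1 * d^-1)%g.
  by rewrite /h mulVKg -!mulgA mulVg mulg1 !mulgA mulgV mul1g.
by move=> x; rewrite gP invgM !invgK automM dD.
Qed.

End Decomposition.
End Cyclotomic.

(** * The Galois group at p *)

Lemma uniq_sub_perm (T : eqType) (s rs : seq T) : uniq s -> {subset s <= rs} ->
  exists t, perm_eq rs (s ++ t).
Proof.
elim: s rs => [|x s IHs] rs; first by exists rs.
move=> /= /andP[xs us] sub; have xr : x \in rs by apply: sub; rewrite mem_head.
have pr := perm_to_rem xr.
have [//|y ys|t tP] := IHs (rem x rs).
  have : y \in rs by apply: sub; rewrite inE ys orbT.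
  rewrite (perm_mem pr) inE => /orP[/eqP e|//].
  by rewrite -e ys in xs.
by exists t; apply: perm_trans pr _; rewrite /= perm_cons.
Qed.

Lemma geom_poly_monic (F : fieldType) (n q : nat) : (0 < n)%N -> (0 < q)%N ->
  (\sum_(i < n) 'X^(q * i) : {poly F}) != 0 /\
  lead_coef (\sum_(i < n) 'X^(q * i) : {poly F}) = 1.
Proof.
case: n => // n _ q0.
have sz : size (\sum_(i < n.+1) 'X^(q * i) : {poly F}) = (q * n).+1.
  rewrite big_ord_recr /= addrC size_polyDl ?size_polyXn //.
  rewrite ltnS; apply: leq_trans (size_sum _ _ _) _; apply/bigmax_leqP => i _.
  by rewrite size_polyXn ltn_pmul2l.
split; first by rewrite -size_poly_eq0 sz.
rewrite lead_coefE sz /= big_ord_recr /= coefD coefXn eqxx.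
rewrite coef_sum big1 ?add0r // => i _; rewrite coefXn gtn_eqF //.
by rewrite ltn_pmul2l.
Qed.

(** Lifted from the field with p elements. It makes an integral element whose p-th power is
    congruent to itself congruent to one of 0, ..., p - 1. *)
Lemma fermat_product (p : nat) : prime p -> exists G : {poly int},
  'X^p - 'X = \prod_(a < p) ('X - (a%:R)%:P) + (p%:R)%:P * G.
Proof.
move=> p_pr; pose D : {poly int} := 'X^p - 'X - \prod_(a < p) ('X - (a%:R)%:P).
have pc := pchar_Fp p_pr.
have D0 : map_poly (intr : int -> 'F_p) D = 0.
  rewrite /D rmorphB rmorphB /= rmorphXn /= map_polyX rmorph_prod /=.
  under eq_bigr => a _ do rewrite rmorphB /= map_polyX map_polyC /= rmorph_nat.
  apply/eqP; rewrite subr_eq0 eq_sym.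
  have mp : \prod_(a < p) ('X - (a%:R : 'F_p)%:P) \is monic.
    by apply: rpred_prod => a _; apply: monicXsubC.
  have sz : size ('X^p - 'X : {poly 'F_p}) = p.+1.
    by rewrite size_polyDl ?size_polyXn // size_polyN size_polyX ltnS prime_gt1.
  have mX : ('X^p - 'X : {poly 'F_p}) \is monic.
    rewrite monicE lead_coefE sz coefB coefXn eqxx coefX.
    by rewrite gtn_eqF ?prime_gt1 // subr0.
  have Epr : \prod_(a < p) ('X - (a%:R : 'F_p)%:P) =
      \prod_(y <- [seq (nat_of_ord a)%:R | a <- enum 'I_p]) ('X - y%:P).
    by rewrite big_map big_enum.
  rewrite -eqp_monic // -dvdp_size_eqp Epr.
    by rewrite sz size_prod_XsubC size_map -cardE card_ord.
  apply: uniq_roots_dvdp.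
    apply/allP=> _ /mapP[a _ ->]; rewrite rootE !hornerE subr_eq0 -natrX.
    by rewrite -(Fp_nat_mod p_pr) (fermat_little a p_pr) Fp_nat_mod.
  rewrite uniq_rootsE map_inj_in_uniq ?enum_uniq // => a b _ _.
  move=> /(congr1 (fun y : 'F_p => nat_of_ord y)) /=.
  by rewrite !val_Fp_nat // !modn_small // => /val_inj.
have dv i : exists c, D`_i = p%:R * c.
  have /dvdzP[c ->] : (p%:Z %| D`_i)%Z.
    rewrite (dvdz_pcharf pc) -[_%:~R](coef_map (intr : {rmorphism int -> 'F_p})).
    by rewrite D0 coef0.
  by exists c; rewrite mulrC natz.
have /choice[c cP] := dv.
exists (\poly_(i < size D) c i).
have <- : D = (p%:R)%:P * \poly_(i < size D) c i.
  apply/polyP=> i; rewrite coefCM coef_poly.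
  by case: ltnP => [_|/(nth_default 0)->]; rewrite ?mulr0.
by rewrite [RHS]addrC /D subrK.
Qed.

Section Local.
Variables (p : nat) (Qp : padicField p) (Qpb : padicClosure Qp).
Variable iota : {rmorphism algC -> Qpb}.
Hypotheses (p_pr : prime p) (p_odd : odd p).
Local Notation ZZ := (padic_int Qp).
Local Notation emb := (pclosure_emb Qpb).
Local Notation algB := (@pclosure_alg p Qp Qpb).
Local Notation H := (GQinf p).
Let p0 := prime_gt0 p_pr.

Definition phiB : {rmorphism ZZ -> Qpb} := (emb \o val).
Arguments phiB : simpl never.
Local Notation intB := (integralOver phiB).
Local Notation maxB := (imax phiB).

Lemma phiBE (x : ZZ) : phiB x = emb (val x). Proof. by []. Qed.

Lemma maxB_ideal : prime_ideal [set x | intB x] [set x | maxB x].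
Proof.
split; rewrite /mkset.
- exact: integral1.
- exact: integral_sub.
- exact: integral_mul.
- by move=> x [].
- split; first exact: integral0.
  by case; rewrite eqxx.
- by move=> x y; apply: imax_add.
- by move=> x y; apply: imax_mul.
- exact: imax1.
by move=> x y; apply: imax_prime.
Qed.
Let PI := maxB_ideal.

Lemma maxB_p : maxB p%:R. Proof. exact: (imax_p p_pr phiBE). Qed.

Lemma over_int (s : autom Qpb) x : local_gal s -> intB x -> intB (s x).
Proof.
move=> /overP sF [f mf fx]; exists f => //.
have -> : map_poly phiB f = map_poly (autom_morph s) (map_poly phiB f).
  by apply/polyP=> i; rewrite !coef_map /= -[RHS]/(s (emb (val f`_i))) sF.
by rewrite autom_morphE rmorph_root.
Qed.

Lemma local1 : local_gal (1%g : autom Qpb). Proof. by move=> x _. Qed.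
Lemma localM (s t : autom Qpb) : local_gal s -> local_gal t -> local_gal (s * t)%g.
Proof. by move=> sF tF x xr; rewrite automM tF // sF. Qed.
Lemma localV (s : autom Qpb) : local_gal s -> local_gal s^-1%g.
Proof. by move=> sF x xr; rewrite -{1}(sF x xr) automKV. Qed.

Lemma over_max (s : autom Qpb) x : local_gal s -> maxB x -> maxB (s x).
Proof.
move=> sF [ix nx]; split; first exact: over_int.
move=> [sx0 isx]; apply: nx; split.
  by apply: contra_neq sx0 => ->; rewrite autom0.
have -> : x^-1 = s^-1%g (s x)^-1.
  by apply: (autom_inj (s := s)); rewrite automVK autom_morphE fmorphV.
exact/over_int/isx/localV.
Qed.

Lemma inertia_normal (s t : autom Qpb) : local_gal s -> local_inertia t ->
  local_inertia (s * t * s^-1)%g.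
Proof.
move=> sF [tF tI]; have sVF := localV sF; split; first by do !apply: localM.
move=> x ix; rewrite !automM -{2}(automVK s x) -automB; apply: over_max => //.
exact/tI/over_int.
Qed.

(** The minimal polynomial of x already splits in [algC], so every conjugate of [iota x] is in the
    image of [iota]. *)
Lemma restr_exists (s : autom Qpb) : exists g : galQ, forall x, iota (g x) = s (iota x).
Proof.
have /choice[f fP] : forall x, exists y, iota y = s (iota x).
  move=> x; have [rs Drs] := closed_field_poly_normal (minCpoly x).
  rewrite (monicP (minCpoly_monic x)) scale1r in Drs.
  have [q [Dq mq] _] := minCpolyP x.
  have : root (map_poly iota (minCpoly x)) (s (iota x)).
    have -> : map_poly iota (minCpoly x) = map_poly (autom_morph s) (map_poly iota (minCpoly x)).
      by rewrite Dq -!map_poly_comp; apply: eq_map_poly => c /=; rewrite !fmorph_rat.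
    by rewrite autom_morphE !rmorph_root // root_minCpoly.
  rewrite Drs rmorph_prod /=.
  under eq_bigr => r _ do rewrite rmorphB /= map_polyX map_polyC.
  rewrite -(big_map iota xpredT (fun y => 'X - y%:P)) root_prod_XsubC.
  by case/mapP=> y _ ->; exists y.
have [x y|x y|c|g gf] := autom_of_endo algC_algebraic (f := f).
- by apply: (fmorph_inj iota); rewrite rmorphD !fP rmorphD aut_add.
- by apply: (fmorph_inj iota); rewrite rmorphM !fP rmorphM aut_mul.
- by apply: (fmorph_inj iota); rewrite fP /= autom_morphE !fmorph_rat.
by exists g => x; rewrite gf fP.
Qed.

Lemma unity_int n y : (0 < n)%N -> y ^+ n = 1 -> intB y.
Proof.
move=> n0 yn; apply: (@integral_root_monic _ _ phiB y ('X^n - 1)).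
- by rewrite monic_Xn_sub_1.
- by rewrite rootE !hornerE yn subrr.
apply/integral_poly => i; rewrite coefB coefXn coef1.
by apply: integral_sub; apply: integral_nat.
Qed.

(** Frobenius is injective on the residue field: y^p - 1 in the maximal ideal forces y - 1 into
    it. *)
Lemma root_unity_max m y : y ^+ (p ^ m) = 1 -> maxB (y - 1).
Proof.
elim: m y => [|m IHm] y ym.
  by move: ym; rewrite expn0 expr1 => ->; rewrite subrr; apply: (pi_0 PI).
have iy : intB y by apply: unity_int ym; rewrite expn_gt0 p0.
have := IHm (y ^+ p); rewrite -exprM -expnS => /(_ ym) h.
have i1 : intB (y - 1) by apply: integral_sub => //; apply: integral1.
have f := frobD PI p_pr maxB_p (x := y - 1) (y := 1) i1 (pi_O1 PI).
rewrite subrK expr1n in f.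
apply: (pi_X PI (k := p)) => //.
have -> : (y - 1) ^+ p = (y ^+ p - 1) - (y ^+ p - ((y - 1) ^+ p + 1)) by ring.
exact: (pi_B PI).
Qed.

Lemma nat_max n : coprime n p -> ~ maxB n%:R.
Proof.
move=> co mn; apply: (pi_1 PI).
have [u [v e]] := Bezoutz n%:Z p%:Z.
have {e} e : u * n%:Z + v * p%:Z = 1 by rewrite e /gcdz /=; move: co; rewrite /coprime => /eqP->.
have intZ (c : int) : intB c%:~R.
  case: c => k; first exact: integral_nat.
  by rewrite NegzE rmorphN; apply: integral_opp; apply: integral_nat.
rewrite -[1]/(1%:~R) -e rmorphD !rmorphM /=.
by apply: (pi_D PI); apply: (pi_M PI) => //; [exact: intZ | exact: intZ | exact: maxB_p].
Qed.

(** If y were not 1, its powers would sum to 0, and n, being the sum of the 1 - y^j, would lie in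
    the maximal ideal. *)
Lemma unity_max_eq n y : coprime n p -> y ^+ n = 1 -> maxB (y - 1) -> y = 1.
Proof.
move=> co yn my; apply/eqP; apply: contrapT => /negP y1.
have n0 : (0 < n)%N.
  by case: (n) co => //; rewrite /coprime gcd0n => /eqP e; move: p_pr; rewrite e.
have iy := unity_int n0 yn.
apply: (nat_max co).
have sum0 : \sum_(j < n) y ^+ j = 0.
  apply: (mulfI (_ : y - 1 != 0)); first by rewrite subr_eq0.
  by rewrite -subrX1 yn subrr mulr0.
have -> : n%:R = - \sum_(j < n) (y ^+ j - 1) :> Qpb.
  by rewrite sumrB sum0 sub0r opprK sumr_const card_ord.
apply: (pi_N PI); apply: (pi_sum PI) => j _; rewrite subrX1.
apply: (pi_Mr PI) => //; apply: (pi_Osum PI) => k _; exact: (pi_OX PI).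
Qed.

Lemma max_Qp (c : Qp) : maxB (emb c) -> pabs c <= p%:R^-1.
Proof.
move=> [ic nc]; apply: pabs_lt1 => //.
rewrite lt_neqAle (padic_int_closed phiBE ic) // andbT; apply/eqP=> c1; apply: nc.
have c0 : c != 0 by rewrite -pabs_eq0 c1 oner_eq0.
split; first by rewrite fmorph_eq0.
have ci : c^-1 \in @padic_int_pred p Qp by rewrite inE pabsV // c1 invr1.
by rewrite -fmorphV -[emb _]/(phiB (PadicInt ci)); apply: integral_id.
Qed.

(* Total ramification: if the orbit of a primitive p^m-th root of unity were
   not everything, then p would be a product of two elements of pZ_p. *)
Lemma local_cyclotomic m a : coprime a p ->
  exists2 s : autom Qpb, local_gal s & s (iota (zeta p_pr m)) = iota (zeta p_pr m) ^+ a.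
Proof.
move=> co; set th := iota _.
have thP : (p ^ m).-primitive_root th by rewrite fmorph_primitive_root zetaP.
case: m @th thP => [|m] th thP.
  exists 1%g; first exact: local1.
  have := prim_expr_order thP; rewrite expn0 expr1 => e.
  by rewrite automI -/th e expr1n.
have [|||O [uO OP Oh]] := @orbit_list Qpb (@local_gal p Qp Qpb) Qpb (fun h => h) _ _ localM th (conjs algB th).
- by [].
- by [].
- by move=> h hF; apply: conjsP.
suff /OP[s sF ->] : th ^+ a \in O by exists s.
apply/negPn/negP=> nO.
pose q := (p ^ m)%N.
(* The cyclotomic polynomial of order p^(m+1). Its value p at 1 is the product of the 1 - y over its
   roots y, all of which lie in the maximal ideal. *)
pose Psi : {poly Qpb} := \sum_(i < p) 'X^(q * i).
have [Psi0 mPsi] : Psi != 0 /\ lead_coef Psi = 1.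
  by apply: geom_poly_monic => //; rewrite expn_gt0 p0.
have Psi1 : Psi.[1] = p%:R.
  rewrite /Psi horner_sum; under eq_bigr => i _ do rewrite hornerXn expr1n.
  by rewrite sumr_const card_ord.
have fac y : (y ^+ q - 1) * Psi.[y] = y ^+ (p ^ m.+1) - 1.
  rewrite /Psi horner_sum; under eq_bigr => i _ do rewrite hornerXn exprM.
  by rewrite -subrX1 -exprM mulnC -expnS.
have prim_root_Psi y : y ^+ (p ^ m.+1) = 1 -> y ^+ q != 1 -> root Psi y.
  move=> y1 yq; have /eqP := fac y; rewrite y1 subrr mulf_eq0 subr_eq0 (negPf yq).
  by [].
have root_Psi_unity y : root Psi y -> y ^+ (p ^ m.+1) = 1.
  by move=> /rootP py; apply/eqP; rewrite -subr_eq0 -fac py mulr0.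
have thaP : (p ^ m.+1).-primitive_root (th ^+ a).
  by rewrite prim_root_exp_coprime // coprimeXr.
have primq y : (p ^ m.+1).-primitive_root y -> root Psi y.
  move=> yP; apply: prim_root_Psi; first exact: prim_expr_order.
  rewrite -(prim_order_dvd yP) /q; apply/negP=> /dvdn_leq.
  have pm0 : (0 < p ^ m)%N by rewrite expn_gt0 p0.
  by move=> /(_ pm0); rewrite leqNgt ltn_exp2l ?prime_gt1 // ltnSn.
have [rs Drs] := closed_field_poly_normal Psi; rewrite mPsi scale1r in Drs.
have rsP y : (y \in rs) = root Psi y by rewrite Drs root_prod_XsubC.
have [||t tP] := @uniq_sub_perm _ (th ^+ a :: O) rs.
- by rewrite /= nO.
- move=> y; rewrite inE => /orP[/eqP->|/OP[s sF ->]]; rewrite rsP; apply: primq => //.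
  by rewrite autom_morphE fmorph_primitive_root.
have pE : p%:R = (\prod_(y <- O) (1 - y)) * ((1 - th ^+ a) * \prod_(y <- t) (1 - y)).
  rewrite -Psi1 Drs horner_prod (perm_big _ tP) /= big_cons big_cat /=.
  by rewrite [RHS]mulrCA; congr (_ * (_ * _)); rewrite ?hornerXsubC //; apply: eq_bigr => y _; rewrite hornerXsubC.
set A := \prod_(y <- O) _ in pE; set B := (1 - th ^+ a) * _ in pE.
have fixA (s : autom Qpb) : over emb s -> s A = A.
  move=> sF; rewrite /A autom_morphE rmorph_prod; apply: etrans (perm_big _ (Oh s sF)).
  by rewrite big_map; apply: eq_bigr => y _; rewrite rmorphB rmorph1.
have [c Ac] := fixed_over algB (padic_char0 Qp p_pr) fixA.
have m1 y : y \in rs -> maxB (1 - y).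
  rewrite rsP => /root_Psi_unity/root_unity_max h; rewrite -opprB.
  exact: (pi_N PI).
have thO : th \in O by apply/OP; exists 1%g => //; apply: local1.
have sub y : y \in O ++ t -> y \in rs by rewrite (perm_mem tP) /= inE => ->; rewrite orbT.
have iprod (r : seq Qpb) : {subset r <= rs} -> intB (\prod_(y <- r) (1 - y)).
  move=> rr; rewrite big_seq; apply: big_ind; [exact: integral1 | exact: integral_mul |].
  by move=> y /rr/m1[].
have mA : maxB A.
  rewrite /A (big_rem th) //= mulrC; apply: (pi_M PI).
    by apply: iprod => y /mem_rem yO; apply: sub; rewrite mem_cat yO.
  by apply: m1; apply: sub; rewrite mem_cat thO.
have mB : maxB B.
  rewrite /B mulrC; apply: (pi_M PI).
    by apply: iprod => y yt; apply: sub; rewrite mem_cat yt orbT.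
  by apply: m1; rewrite rsP; apply: primq.
have c0 : c != 0.
  apply/eqP=> c0; move/eqP: pE; rewrite Ac c0 rmorph0 mul0r.
  by rewrite -(rmorph_nat emb) fmorph_eq0 (negPf (p_neq0 Qp p_pr)).
have BE : B = emb (p%:R / c).
  rewrite fmorph_div rmorph_nat -Ac pE mulrAC mulfV ?mul1r //.
  by rewrite Ac fmorph_eq0.
rewrite Ac in mA; rewrite BE in mB.
have := ler_pM (pabs_ge0 _) (pabs_ge0 _) (max_Qp mA) (max_Qp mB).
rewrite -pabsM mulrC divfK // pabs_p.
rewrite leNgt => /negP; apply.
have ip0 : 0 < (p%:R^-1 : rat) by rewrite invr_gt0 ltr0n.
by rewrite -[X in _ < X]mul1r ltr_pM2r // invf_lt1 ?ltr0n // ltr1n prime_gt1.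
Qed.

Lemma GpM g h : Gp iota g -> Gp iota h -> Gp iota (g * h)%g.
Proof.
move=> [s sF sP] [t tF tP]; exists (s * t)%g; first exact: localM.
by move=> x; rewrite !automM sP tP.
Qed.
Lemma GpV g : Gp iota g -> Gp iota g^-1%g.
Proof.
move=> [s sF sP]; exists s^-1%g; first exact: localV.
by move=> x; apply: (autom_inj (s := s)); rewrite -sP !automVK.
Qed.
Lemma Ip_Gp : Ip iota `<=` Gp iota.
Proof. by move=> g [s [sF _] sP]; exists s. Qed.
Lemma Ip_normal g h : Gp iota g -> Ip iota h -> Ip iota (g * h * g^-1)%g.
Proof.
move=> [s sF sP] [t tI tP]; exists (s * t * s^-1)%g; first exact: inertia_normal.
move=> x; rewrite !automM sP tP; congr (s (t _)).
by apply: (autom_inj (s := s)); rewrite -sP !automVK.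
Qed.

Lemma Ip_div g h : Ip iota g -> Ip iota h -> Ip iota (g^-1 * h)%g.
Proof.
move=> [s [sF sI] sP] [t [tF tI] tP]; exists (s^-1 * t)%g; last first.
  move=> x; rewrite !automM -tP; apply: (autom_inj (s := s)).
  by rewrite -sP !automVK.
have sV := localV sF; split; first exact: localM.
move=> x ix; have -> : (s^-1 * t)%g x - x = s^-1%g (t x - x) - s^-1%g (s x - x).
  by rewrite automM !automB automKV opprB addrA subrK.
by apply: (pi_B PI); apply: over_max => //; [apply: tI | apply: sI].
Qed.

(** The prime p is totally ramified in Q_oo: every residue prime to p is the action of a local
    automorphism on p-power roots of unity, and a limit treats all levels at once. *)
Lemma Gp_H g : exists2 d, Gp iota d & H (d^-1 * g)%g.
Proof.
have /choice[s sP] : forall m, exists s : autom Qpb, local_gal s /\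
    s (iota (zeta p_pr m)) = iota (zeta p_pr m) ^+ chi p_pr m g.
  case=> [|m].
    exists 1%g; split; first exact: local1.
    have := prim_expr_order (zetaP p_pr 0); rewrite expn0 expr1 => e.
    by rewrite automI e rmorph1 expr1n.
  have [s sF sE] := local_cyclotomic m.+1 (chi_coprime p_pr m g).
  by exists s.
have [U [UU Ule]] := ultra_nat.
have [h hF hP] := autom_ultralim algB UU (fun m => proj1 (sP m)).
have [d dP] := restr_exists h; exists d; first by exists h.
apply: (Un_cap (p_pr := p_pr)) => n; apply/(Un_eq p_pr); apply: cc_agree.
have [m [/= e nm]] := filter_ex (filterI (hP (iota (zeta p_pr n.+1))) (Ule n.+1)).
apply: (fmorph_inj iota); rewrite dP -e.
have zm : (zeta p_pr n.+1) ^+ (p ^ m) = 1.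
  by rewrite -(subnKC nm) expnD exprM (prim_expr_order (zetaP _ _)) expr1n.
rewrite (chiP p_pr g zm); have [i ->] := prim_rootP (zetaP p_pr m) zm.
by rewrite !rmorphXn automX (proj2 (sP m)) -!exprM mulnC.
Qed.


(** Modulo the maximal ideal [c] is one of 0, ..., p - 1, and these are fixed by [s]. *)
Lemma maxB_frob_fixed (s : autom Qpb) c : local_gal s -> intB c ->
  maxB (c ^+ p - c) -> maxB (s c - c).
Proof.
move=> sF ic mc; have [G GE] := fermat_product p_pr.
have GE' : c ^+ p - c = \prod_(a < p) (c - a%:R) + p%:R * (map_poly intr G).[c].
  have := congr1 (fun q : {poly int} => (map_poly intr q).[c]) GE.
  rewrite !rmorphB rmorphD rmorphM rmorph_prod /= rmorphXn /= map_polyX map_polyC.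
  rewrite hornerD hornerN hornerXn hornerX hornerD hornerM hornerC horner_prod => ->.
  rewrite /= rmorph_nat; congr (_ + _); apply: eq_bigr => a _.
  by rewrite rmorphB /= map_polyX map_polyC hornerXsubC /= rmorph_nat.
have iG : intB (map_poly intr G).[c].
  elim/poly_ind: (G) => [|q d IHq]; first by rewrite rmorph0 horner0; apply: integral0.
  have -> : (map_poly intr (q * 'X + d%:P)).[c] = (map_poly intr q).[c] * c + d%:~R.
    by rewrite rmorphD rmorphM /= map_polyX map_polyC !hornerE.
  apply: integral_add; first exact: integral_mul.
  case: d => k; first exact: integral_nat.
  by rewrite NegzE rmorphN; apply: integral_opp; apply: integral_nat.
have : maxB (\prod_(a <- index_enum 'I_p) (c - (a : nat)%:R)).
  have -> : \prod_(a < p) (c - a%:R) = (c ^+ p - c) - p%:R * (map_poly intr G).[c].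
    by rewrite GE' addrK.
  by apply: (pi_B PI) => //; apply: (pi_Mr PI) => //; apply: maxB_p.
case/(pi_prod PI) => [a _|a _ ma]; first by apply: integral_sub => //; apply: integral_nat.
have -> : s c - c = s (c - a%:R) - (c - a%:R).
  by rewrite automB [s a%:R]autom_morphE rmorph_nat; ring.
by apply: (pi_B PI) => //; apply: over_max.
Qed.

(** The polynomial whose roots are the Frobenius orbit x^(p^k) is fixed by Frobenius modulo the
    maximal ideal, so [s] fixes its coefficients there; hence s x is congruent to one of the
    roots. *)
Lemma local_frobenius_power (s : autom Qpb) x N : local_gal s -> (0 < N)%N ->
  x ^+ (p ^ N) = x -> intB x -> exists k, maxB (s x - x ^+ (p ^ k)).
Proof.
move=> sF N0 xN ix.
pose F : {poly Qpb} := \prod_(k < N) ('X - (x ^+ (p ^ k))%:P).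
have OX y : intB y -> polyO [set x | intB x] ('X - y%:P).
  move=> iy i; rewrite coefB coefX coefC /mkset; apply: integral_sub.
    exact: integral_nat.
  by case: (i == 0)%N => //; apply: integral0.
have Oprod (I : Type) (r : seq I) (f : I -> {poly Qpb}) :
   (forall i, polyO [set x | intB x] (f i)) -> polyO [set x | intB x] (\prod_(i <- r) f i).
  move=> Of; apply: big_ind => //; last exact: (polyOM PI).
  by move=> i; rewrite coef1; apply: integral_nat.
have ixk k : intB (x ^+ k) by exact: intX.
have frX y : intB y -> polyI [set x | maxB x] (fr p ('X - y%:P) - ('X - (y ^+ p)%:P)).
  move=> iy i; rewrite coefB coef_fr // !coefB !coefX !coefC.
  case: i => [|[|i]] /=.
  - by rewrite !sub0r opprK; apply: (frobN PI p_pr maxB_p).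
  - by rewrite !subr0 expr1n subrr; apply: (pi_0 PI).
  by rewrite !subr0 expr0n gtn_eqF // ?subr0; apply: (pi_0 PI).
have frprod (r : seq nat) : polyI [set x | maxB x]
   (fr p (\prod_(k <- r) ('X - (x ^+ (p ^ k))%:P)) - \prod_(k <- r) ('X - (x ^+ (p ^ k.+1))%:P)).
  elim: r => [|k r IHr].
    rewrite !big_nil => i; rewrite coefB coef_fr // coef1.
    by case: (i == 0)%N; rewrite ?expr1n ?expr0n ?(gtn_eqF p0) subrr; apply: (pi_0 PI).
  rewrite !big_cons.
  set A := 'X - _; set B := \prod_(j <- r) _; set A' := 'X - _; set B' := \prod_(j <- r) _.
  have OA : polyO [set x | intB x] A by apply: OX.
  have OB : polyO [set x | intB x] B by apply: Oprod => j; apply: OX.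
  have OA' : polyO [set x | intB x] A' by apply: OX.
  have h1 := frM PI p_pr maxB_p OA OB.
  have h2 : polyI [set x | maxB x] (fr p A - A').
    by rewrite /A /A' expnSr exprM; apply: frX.
  have h3 := polyIM PI (polyO_fr PI p_pr OB) h2.
  have h4 := polyIM PI OA' IHr.
  have := polyID PI h1 (polyID PI h3 h4).
  by congr polyI; rewrite -/B -/B'; ring.
have FE : F = \prod_(k <- seq.iota 0 N) ('X - (x ^+ (p ^ k))%:P).
  by rewrite /F -(big_mkord xpredT (fun k => 'X - (x ^+ (p ^ k))%:P)) /index_iota subn0.
(* Raising the exponent k by one permutes the factors cyclically because x^(p^N) = x. *)
have FE' : \prod_(k <- seq.iota 0 N) ('X - (x ^+ (p ^ k.+1))%:P) = F.
  pose f k : {poly Qpb} := 'X - (x ^+ (p ^ k))%:P.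
  have gen M : \prod_(k <- seq.iota 0 M) f k.+1 * f 0%N = \prod_(k <- seq.iota 0 M) f k * f M.
    elim: M => [|M IHM]; first by rewrite !big_nil.
    by rewrite -addn1 iotaD !big_cat /= !big_seq1 add0n addn1 mulrAC IHM.
  apply: (mulIf (_ : f 0%N != 0)); first by rewrite polyXsubC_eq0.
  by rewrite gen FE; congr (_ * _); rewrite /f xN expn0 expr1.
have frF : polyI [set x | maxB x] (fr p F - F).
  by have := frprod (seq.iota 0 N); rewrite -FE FE'.
have OF : polyO [set x | intB x] F by apply: Oprod => k; apply: OX.
have Fs : polyI [set x | maxB x] (map_poly (autom_morph s) F - F).
  move=> i; rewrite coefB coef_map; apply: maxB_frob_fixed => //; first exact: OF.
  by have := frF i; rewrite coefB coef_fr.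
have : maxB F.[s x].
  have Fx : F.[x] = 0.
    apply/eqP; rewrite /F horner_prod; apply/prodf_eq0; exists (Ordinal N0) => //.
    by rewrite /= expn0 expr1 hornerXsubC subrr.
  have : (map_poly (autom_morph s) F).[s x] = 0.
    by rewrite autom_morphE horner_map Fx rmorph0.
  have {2}-> : F = map_poly (autom_morph s) F - (map_poly (autom_morph s) F - F) by ring.
  rewrite hornerD => ->; rewrite add0r hornerN; apply: (pi_N PI).
  move: Fs; set E := _ - F => IE; rewrite horner_coef; apply: (pi_sum PI) => i _.
  by apply: (pi_Mr PI); [exact: IE | apply: intX; exact: over_int].
rewrite /F horner_prod => /(pi_prod PI)[k _|k _]; rewrite hornerXsubC.
  by apply: integral_sub => //; apply: over_int.
by exists k.
Qed.

(** A root of unity of order p^N - 1, generating the unramified extension of degree N of [Qp]; at N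
    = 0 the value is a default. *)
Definition omega N : Qpb :=
  if (0 < p ^ N - 1)%N =P true is ReflectT h then iota (sval (C_prim_root_exists h)) else 1.

Lemma omegaP N : (0 < N)%N -> (p ^ N - 1).-primitive_root (omega N).
Proof.
move=> N0; have h : (0 < p ^ N - 1)%N.
  by rewrite subn_gt0 -{1}(exp1n N) ltn_exp2r // prime_gt1.
rewrite /omega; case: eqP => // h'.
by rewrite fmorph_primitive_root; case: C_prim_root_exists.
Qed.

Lemma omega_frob N : (0 < N)%N -> omega N ^+ (p ^ N) = omega N.
Proof.
move=> N0; have := prim_expr_order (omegaP N0) => e.
have -> : (p ^ N = (p ^ N - 1).+1)%N by rewrite subn1 prednK // expn_gt0 p0.
by rewrite exprS e mulr1.
Qed.

Lemma omega_coprime N : (0 < N)%N -> coprime (p ^ N - 1) p.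
Proof.
move=> N0; rewrite coprime_sym prime_coprime //; apply/negP=> d.
have : (p %| p ^ N)%N by rewrite -(prednK N0) expnS dvdn_mulr.
have -> : (p ^ N = (p ^ N - 1) + 1)%N by rewrite subnK // expn_gt0 p0.
by rewrite dvdn_addr // dvdn1 => /eqP p1; move: p_pr; rewrite p1.
Qed.

Lemma omega_int N : (0 < N)%N -> intB (omega N).
Proof.
move=> N0; apply: unity_int (prim_expr_order (omegaP N0)).
exact: prim_order_gt0 (omegaP N0).
Qed.

(** A congruence between roots of unity of order prime to p is an equality, so the residual action
    of [s] lifts. *)
Lemma local_omega (s : autom Qpb) N : local_gal s -> (0 < N)%N ->
  exists k, s (omega N) = omega N ^+ (p ^ k).
Proof.
move=> sF N0; have iw := omega_int N0; have wP := omegaP N0.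
have [k mk] := local_frobenius_power sF N0 (omega_frob N0) iw; exists k.
set w := omega N in mk *; set n := (p ^ N - 1)%N in wP.
have w0 : w ^+ (p ^ k) != 0.
  apply: expf_neq0; apply/eqP=> e; have := prim_expr_order wP.
  by rewrite -/w e expr0n gtn_eqF ?(prim_order_gt0 wP) // => /eqP; rewrite eq_sym oner_eq0.
have iv : intB (w ^+ (p ^ k))^-1.
  apply: unity_int (prim_order_gt0 wP) _.
  by rewrite exprVn -exprM mulnC exprM (prim_expr_order wP) expr1n invr1.
rewrite -[LHS](divfK w0) (_ : s w / w ^+ (p ^ k) = 1) ?mul1r //.
apply: (unity_max_eq (omega_coprime N0)).
  rewrite expr_div_n -automX (prim_expr_order wP) autom1 -exprM mulnC exprM.
  by rewrite (prim_expr_order wP) expr1n divr1.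
have -> : s w / w ^+ (p ^ k) - 1 = (w ^+ (p ^ k))^-1 * (s w - w ^+ (p ^ k)).
  by rewrite mulrBr mulVf // mulrC.
exact: (pi_M PI).
Qed.

Definition Dloc : set (autom Qpb) :=
  [set s | local_gal s /\ forall x, cyclotomic_Zp_ext p x -> s (iota x) = iota x].

Lemma Dloc1 : Dloc 1%g. Proof. by split=> //; apply: local1. Qed.
Lemma DlocM s t : Dloc s -> Dloc t -> Dloc (s * t)%g.
Proof.
move=> [sF sQ] [tF tQ]; split; first exact: localM.
by move=> x xQ; rewrite automM tQ // sQ.
Qed.
Lemma DlocV s : Dloc s -> Dloc s^-1%g.
Proof.
move=> [sF sQ]; split; first exact: localV.
by move=> x xQ; rewrite -{1}(sQ x xQ) automKV.
Qed.
Lemma DlocX s k : Dloc s -> Dloc (s ^+ k)%g.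
Proof.
move=> sD; elim: k => [|k IHk]; first by rewrite expg0; apply: Dloc1.
by rewrite expgS; apply: DlocM.
Qed.
Lemma Dloc_lim (U : set_system nat) (g : nat -> autom Qpb) : UltraFilter U ->
  (forall i, Dloc (g i)) -> exists2 h, Dloc h & forall x, U [set i | g i x = h x].
Proof.
move=> UU gD; have [h hF hP] := autom_ultralim algB UU (fun m => proj1 (gD m)).
exists h => //; split=> // x xQ; have [i /= <-] := filter_ex (hP (iota x)).
by case: (gD i) => _; apply.
Qed.

Lemma powX (s : autom Qpb) w b q : s w = w ^+ b -> (s ^+ q)%g w = w ^+ (b ^ q).
Proof.
move=> sw; elim: q => [|q IHq]; first by rewrite expg0 expn0 expr1.
by rewrite expgS automM IHq automX sw -exprM expnS.
Qed.

(** Take the least k > 0 such that some element acts as the power p^k; the identity realises k = N.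
    By division with remainder every element acts as a power of that one. *)
Lemma Dloc_cyclic N : (0 < N)%N -> exists2 f, Dloc f &
  forall g, Dloc g -> exists q, g (omega N) = (f ^+ q)%g (omega N).
Proof.
move=> N0; set w := omega N.
have exk : exists k, `[< (0 < k)%N /\ exists2 g, Dloc g & g w = w ^+ (p ^ k) >].
  exists N; apply/asboolP; split=> //; exists 1%g; first exact: Dloc1.
  by rewrite automI omega_frob.
case: (ex_minnP exk) => k /asboolP[k0 [f fD fw]] kmin; exists f => // g gD.
have [j gw] := local_omega (proj1 gD) N0.
have fq q : (f ^+ q)%g w = w ^+ (p ^ (k * q)) by rewrite (powX _ fw) -expnM.
exists (j %/ k)%N.
pose h := ((f ^+ (j %/ k))^-1 * g)%g.
have hw : h w = w ^+ (p ^ (j %% k)).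
  apply: (autom_inj (s := (f ^+ (j %/ k))%g)); rewrite /h automM automVK gw automX fq.
  by rewrite -exprM -expnD mulnC -divn_eq.
have [r0|r0] := posnP (j %% k)%N.
  move: hw; rewrite r0 expn0 expr1 => /(congr1 (f ^+ (j %/ k))%g).
  by rewrite /h automM automVK.
have : (k <= j %% k)%N.
  apply: kmin; apply/asboolP; split=> //; exists h => //.
  by apply: DlocM => //; apply: DlocV; apply: DlocX.
by rewrite leqNgt ltn_mod k0.
Qed.

Lemma omega_dvd M N : (0 < M)%N -> (0 < N)%N -> (M %| N)%N -> exists i, omega M = omega N ^+ i.
Proof.
move=> M0 N0 /dvdnP[k kE].
have wN : omega M ^+ (p ^ N - 1) = 1.
  have /dvdnP[c ->] : (p ^ M - 1 %| p ^ N - 1)%N.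
    by rewrite kE mulnC expnM !subn1 [((p ^ M) ^ k).-1]predn_exp dvdn_mulr.
  by rewrite mulnC exprM (prim_expr_order (omegaP M0)) expr1n.
by have [i ->] := prim_rootP (omegaP N0) wN; exists i.
Qed.

(** A unit x is congruent to a root of unity of order p^M - 1: some x^n with n prime to p is
    congruent to 1, and n divides p^M - 1 for a suitable M. So an element fixing these roots of
    unity acts trivially on the residue field. *)
Lemma omega_inertia (u : autom Qpb) : local_gal u ->
  (forall j, u (omega j.+1`!) = omega j.+1`!) -> local_inertia u.
Proof.
move=> uF uw; split=> // x ix; change (maxB (u x - x)); change (intB x) in ix.
have [N [e [b [N0 ib [e01 xN]]]]] := int_pow_01 p_pr ix.
have mpb : maxB (p%:R * b) by apply: (pi_Mr PI) => //; apply: maxB_p.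
case: e01 xN => -> xN.
  have mx : maxB x by apply: (pi_X PI (k := N)) => //; rewrite xN add0r.
  by apply: (pi_B PI) => //; apply: over_max.
have [n co NE] := pfactor_coprime p_pr N0.
have n0 : (0 < n)%N.
  by case: (n) co => //; rewrite /coprime gcdn0 => /eqP p1; move: p_pr; rewrite p1.
have xn : maxB (x ^+ n - 1).
  move: xN; rewrite NE exprM => xN.
  have : maxB ((x ^+ n) ^+ (p ^ logn p N) - 1) by rewrite xN addrC addKr.
  have : intB (x ^+ n) by exact: intX.
  move: (x ^+ n) => y iy; elim: (logn p N) => [|t IHt]; first by rewrite expn0 expr1.
  rewrite expnSr exprM => h; apply: IHt.
  set z := y ^+ (p ^ t) in h *.
  have iz : intB z by exact: intX.
  have i1 : intB (z - 1) by apply: integral_sub => //; apply: integral1.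
  have f := frobD PI p_pr maxB_p (x := z - 1) (y := 1) i1 (pi_O1 PI).
  rewrite subrK expr1n in f; apply: (pi_X PI (k := p)) => //.
  have -> : (z - 1) ^+ p = (z ^+ p - 1) - (z ^+ p - ((z - 1) ^+ p + 1)) by ring.
  exact: (pi_B PI).
pose k := (totient n); have k0 : (0 < k)%N by rewrite totient_gt0.
(* M is a factorial because only those levels are assumed fixed; being a multiple of the totient of
   n, it makes n divide p^M - 1. *)
pose M := k`!; have M0 : (0 < M)%N by apply: fact_gt0.
have /dvdnP[c cE] : (n %| p ^ M - 1)%N.
  have /dvdnP[d ->] : (k %| M)%N by rewrite dvdn_fact // k0 leqnn.
  rewrite -eqn_mod_dvd ?expn_gt0 ?p0 // mulnC expnM -modnXm.
  by rewrite Euler_exp_totient ?modnXm ?exp1n.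
have : maxB (\prod_(i <- index_iota 0 (p ^ M - 1)) (x - omega M ^+ i)).
  have -> : \prod_(i <- index_iota 0 (p ^ M - 1)) (x - omega M ^+ i) = x ^+ (p ^ M - 1) - 1.
    have := congr1 (horner^~ x) (factor_Xn_sub_1 (omegaP M0)).
    rewrite horner_prod !hornerE => <-.
    by apply: eq_bigr => i _; rewrite hornerXsubC.
  rewrite cE mulnC exprM subrX1; apply: (pi_Mr PI) => //.
  by apply: (pi_Osum PI) => i _; do 2!apply: intX.
case/(pi_prod PI) => [i _|i _ mi].
  by apply: integral_sub => //; apply: intX; apply: omega_int.
have -> : u x - x = u (x - omega M ^+ i) - (x - omega M ^+ i).
  have := uw k.-1; rewrite prednK // => ew.
  by rewrite automB automX ew; ring.
by apply: (pi_B PI) => //; apply: over_max.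
Qed.

(** The levels j! are totally ordered and cofinal for divisibility. [f] is a limit of generators of
    the cyclic actions at these levels; for a given g, psi is a limit of powers of [f] acting like g
    on all these roots of unity, so that psi^-1 g is in inertia. *)
Lemma frobenius_generator : exists f : galQ, [/\ Gp iota f, H f &
  forall g, Gp iota g -> H g -> exists psi u, [/\ g = (psi * u)%g,
    Gp iota psi /\ H psi, Ip iota u /\ H u &
    forall s, exists k, agree s (f ^+ k)%g psi]].
Proof.
have f0 j : (0 < j`!)%N by apply: fact_gt0.
have /choice[fj fjP] : forall j : nat, exists f, Dloc f /\
   forall g, Dloc g -> exists q, g (omega j`!) = (f ^+ q)%g (omega j`!).
  by move=> j; have [f fD fP] := Dloc_cyclic (f0 j); exists f.
have [U [UU Ule]] := ultra_nat.
have [f fD fU] := Dloc_lim UU (fun j => proj1 (fjP j)).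
have down (j i : nat) (s t : autom Qpb) : (j <= i)%N ->
   s (omega i`!) = t (omega i`!) -> s (omega j`!) = t (omega j`!).
  move=> ji st.
  have d : (j`! %| i`!)%N by rewrite -(bin_fact ji) mulnCA dvdn_mulr.
  have [c ->] := omega_dvd (f0 j) (f0 i) d.
  by rewrite !automX st.
have pw (s t : autom Qpb) j q : local_gal s ->
   s (omega j`!) = t (omega j`!) -> (s ^+ q)%g (omega j`!) = (t ^+ q)%g (omega j`!).
  move=> sF st; have [k sk] := local_omega sF (f0 j).
  by rewrite (powX _ sk) (@powX t _ (p ^ k)) // -st.
have fgen g : Dloc g -> forall j, exists q, g (omega j`!) = (f ^+ q)%g (omega j`!).
  move=> gD j; have [i [/= e ji]] := filter_ex (filterI (fU (omega j`!)) (Ule j)).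
  have [q gq] := proj2 (fjP i) g gD; exists q.
  rewrite (down _ _ _ _ ji gq); apply: pw => //.
  by case: (fjP i) => -[].
have restr s : Dloc s -> exists2 g : galQ, Gp iota g /\ H g & forall x, iota (g x) = s (iota x).
  move=> [sF sQ]; have [g gP] := restr_exists s; exists g => //; split; first by exists s.
  by move=> x xQ; apply: (fmorph_inj iota); rewrite gP sQ.
have [f' [f'G f'H] f'P] := restr f fD.
exists f'; split=> // g [s sF sP] gH.
have sD : Dloc s by split=> // x xQ; rewrite -sP gH.
have /choice[q qP] := fgen s sD.
have [psi psiD psiU] := Dloc_lim UU (fun j => DlocX (q j) fD).
have uD : Dloc (psi^-1 * s)%g by apply: DlocM => //; apply: DlocV.
have [psi' psi'G psi'P] := restr psi psiD.
have [u' u'G u'P] := restr _ uD.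
exists psi', u'; split=> //.
- apply: autom_eq => x; apply: (fmorph_inj iota).
  by rewrite automM psi'P u'P sP automM automVK.
- split; last by case: u'G.
  exists (psi^-1 * s)%g => //; apply: omega_inertia; first by case: uD.
  move=> j; apply: (autom_inj (s := psi)); rewrite automM automVK.
  have [i [/= e ji]] := filter_ex (filterI (psiU (omega j.+1`!)) (Ule j.+1)).
  by rewrite -e; apply: down ji _; apply: qP.
move=> t.
have Ut : U [set j | agree t (f' ^+ q j)%g psi'].
  elim: t => [|x t IHt]; first by apply: filterS filterT.
  apply: filterS (filterI (psiU (iota x)) IHt) => j [/= e1 e2] y.
  rewrite inE => /orP[/eqP->|/e2//]; apply: (fmorph_inj iota).
  rewrite psi'P -e1; elim: (q j) => [|k IHk]; first by rewrite !expg0.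
  by rewrite !expgS !automM f'P IHk.
by have [j /= jt] := filter_ex Ut; exists (q j).
Qed.

End Local.

(** * The Iwasawa algebra *)

Section IwasawaPolynomials.
Import Pdiv.RingMonic.
Local Notation rmodp := Pdiv.CommonRing.rmodp.
Local Notation rdivp := Pdiv.CommonRing.rdivp.

Section Index.
Variable p : nat.
Hypotheses (p_pr : prime p) (p_odd : odd p).
Local Notation H := (GQinf p).
Local Notation gam := (gam p_pr).
Local Notation U := (UnO p_pr p_odd).
Local Notation cc := (cc p_pr).
Local Notation Un := (Un p_pr).
Let p0 := prime_gt0 p_pr.
Let pX0 m : (0 < p ^ m)%N. Proof. by rewrite expn_gt0 p0. Qed.

Lemma cc_gam_eq n i j : cc n (gam ^+ i)%g = cc n (gam ^+ j)%g <-> i = j %[mod p ^ n].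
Proof.
wlog ij : i j / (i <= j)%N.
  move=> h; case: (leqP i j) => [/h//|/ltnW/h[h1 h2]].
  by split=> [/esym/h1/esym|/esym/h2/esym].
rewrite -Un_eq -(subnKC ij) expgnDr mulKg Un_gam // subnKC //.
rewrite -eqn_mod_dvd //; split=> [/eqP/esym//|/esym/eqP//].
Qed.

Lemma ix_exists n g : exists i, (i < p ^ n)%N /\ cc n g = cc n (gam ^+ i)%g.
Proof. by have [i] := Un_gen p_pr p_odd n g; exists i. Qed.

(** The exponent of gam in the class of g: the quotient by [Un n] is identified with Z/p^n. *)
Definition ix n (g : galQ) := sval (cid (ix_exists n g)).
Lemma ix_lt n g : (ix n g < p ^ n)%N.
Proof. by rewrite /ix; case: cid => i []. Qed.
Lemma ix_cc n g : cc n g = cc n (gam ^+ ix n g)%g.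
Proof. by rewrite /ix; case: cid => i []. Qed.
Lemma ix_uniq n g i : cc n g = cc n (gam ^+ i)%g -> ix n g = (i %% p ^ n)%N.
Proof. by rewrite ix_cc => /cc_gam_eq; rewrite modn_small // ix_lt. Qed.
Lemma ix_gam n i : ix n (gam ^+ i)%g = (i %% p ^ n)%N.
Proof. exact: ix_uniq. Qed.
Lemma ix_mul n g h : ix n (g * h)%g = ((ix n g + ix n h) %% p ^ n)%N.
Proof. by apply: ix_uniq; rewrite expgnDr !ccM -!ix_cc. Qed.
Lemma ix_eq n g h : Un n (g^-1 * h)%g <-> ix n g = ix n h.
Proof.
rewrite Un_eq; split=> [e|e]; last by rewrite ix_cc e -ix_cc.
by rewrite (ix_uniq (i := ix n h)) ?modn_small ?ix_lt // e ix_cc.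
Qed.
Lemma ix_Un n u : Un n u -> ix n u = 0%N.
Proof.
move=> uU; have /ix_eq <- : Un n (1^-1 * u)%g by rewrite invg1 mul1g.
by rewrite -[1%g](expg0 gam) ix_gam mod0n.
Qed.
Lemma ix_mulU n g u : Un n u -> ix n (g * u)%g = ix n g.
Proof. by move=> /ix_Un uU; rewrite ix_mul uU addn0 modn_small // ix_lt. Qed.
Lemma ix_le m n g : (n <= m)%N -> (ix m g %% p ^ n)%N = ix n g.
Proof.
move=> nm; apply/esym/ix_uniq.
by rewrite -!(cc_le p_pr _ nm) ix_cc.
Qed.

Lemma ix_div n g h : ((ix n h + ix n (h^-1 * g)%g) %% p ^ n = ix n g)%N.
Proof. by rewrite -ix_mul mulVKg. Qed.
Lemma ix_div_uniq n g h j : (j < p ^ n)%N ->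
  ((ix n h + j) %% p ^ n = ix n g)%N -> j = ix n (h^-1 * g)%g.
Proof.
move=> jp; rewrite -(ix_div n g h) => /eqP; rewrite eqn_modDl.
by rewrite !modn_small ?ix_lt // => /eqP.
Qed.

Lemma level_inj m n : U m = U n -> m = n.
Proof.
move=> e; have eU g : Un m g <-> Un n g.
  by rewrite -[Un m]/(osub_set (U m)) e.
have le a b : (forall g, Un a g -> Un b g) -> (b <= a)%N.
  move=> h; have /h/(Un_gam p_pr p_odd) : Un a (gam ^+ (p ^ a))%g by apply/Un_gam.
  by rewrite dvdn_Pexp2l ?prime_gt1.
by apply/eqP; rewrite eqn_leq !le // => g; rewrite eU.
Qed.

Definition level (V : open_subgroup H) := sval (cid (UnO_all p_pr p_odd V)).
Lemma levelP V : V = U (level V). Proof. by rewrite /level; case: cid. Qed.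
Lemma levelU n : level (U n) = n.
Proof. by apply: level_inj; rewrite -levelP. Qed.

Lemma lcoset_eq n g h : lcoset (Un n) g = lcoset (Un n) h <-> ix n g = ix n h.
Proof.
split=> [e|e].
  have : lcoset (Un n) h g by rewrite -e; exists 1%g; [exact: Un1 | rewrite mulg1].
  by case=> u uU <-; rewrite ix_mulU.
have sub a b : ix n a = ix n b -> lcoset (Un n) a `<=` lcoset (Un n) b.
  move=> /ix_eq ab _ [u uU <-]; exists (b^-1 * (a * u))%g; last by rewrite mulVKg.
  apply/ix_eq; rewrite ix_mulU //; apply/esym/ix_eq.
  by have /UnV := ab; rewrite invgM invgK => h'; apply/ix_eq/esym/ix_eq.
by apply/seteqP; split; apply: sub.
Qed.

Lemma coset_repP n g : ix n (coset_rep (lcoset (Un n) g)) = ix n g.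
Proof.
have : lcoset (Un n) g (coset_rep (lcoset (Un n) g)).
  apply: (xgetPex 1%g); exists g; exists 1%g; [exact: Un1 | by rewrite mulg1].
by case=> u uU <-; rewrite ix_mulU.
Qed.

Lemma sum_cosets (V : nmodType) n (F : galQ -> V) :
  (forall g h, ix n g = ix n h -> F g = F h) ->
  \sum_(C \in cosets (Un n)) F (coset_rep C) = \sum_(i < p ^ n) F (gam ^+ i)%g.
Proof.
move=> FU; rewrite (@reindex_fsbig _ _ _ _ _ (fun i => lcoset (Un n) (gam ^+ i)%g) `I_(p ^ n)).
  rewrite -fsbig_ord; apply: eq_bigr => i _; apply: FU; exact: coset_repP.
split.
- by move=> i _; exists (gam ^+ i)%g.
- move=> i j; rewrite !inE /= => iI jI /lcoset_eq.
  by rewrite !ix_gam !modn_small.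
move=> _ [g _ <-]; exists (ix n g); first exact: ix_lt.
by apply/lcoset_eq; rewrite ix_gam modn_small ?ix_lt.
Qed.

Lemma sum_subcosets (V : nmodType) m n (F : galQ -> V) g : (n <= m)%N ->
  (forall g h, ix m g = ix m h -> F g = F h) ->
  \sum_(C \in [set C | cosets (Un m) C /\ C `<=` lcoset (Un n) g]) F (coset_rep C) =
  \sum_(i < p ^ m | (i %% p ^ n)%N == ix n g) F (gam ^+ i)%g.
Proof.
move=> nm FU.
have subP h : lcoset (Un m) h `<=` lcoset (Un n) g <-> ix n h = ix n g.
  split=> [/(_ h)|e _ [u uU <-]].
    case; first by exists 1%g; [exact: Un1 | rewrite mulg1].
    by move=> u uU <-; rewrite ix_mulU.
  exists (g^-1 * (h * u))%g; last by rewrite mulVKg.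
  by apply/ix_eq; rewrite ix_mulU ?e //; apply: (Un_le nm).
rewrite (@reindex_fsbig _ _ _ _ _ (fun i => lcoset (Un m) (gam ^+ i)%g)
   (`I_(p ^ m) `&` [set i | (i %% p ^ n)%N = ix n g])).
  rewrite fsbig_mkcondr -fsbig_ord [RHS]big_mkcond; apply: eq_bigr => i _.
  rewrite (_ : (nat_of_ord i \in [set i | (i %% p ^ n)%N = ix n g]) = ((i %% p ^ n)%N == ix n g)).
    by case: ifP => // _; apply: FU; exact: coset_repP.
  by apply/idP/eqP; rewrite inE.
split.
- move=> i [iI e]; split; first by exists (gam ^+ i)%g.
  by apply/subP; rewrite ix_gam.
- move=> i j; rewrite !inE /= => -[iI _] [jI _] /lcoset_eq.
  by rewrite !ix_gam !modn_small.
move=> _ [[h _ <-] /subP hg]; exists (ix m h).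
  by split; [exact: ix_lt | rewrite /= ix_le].
by apply/lcoset_eq; rewrite ix_gam modn_small ?ix_lt.
Qed.

(** * Polynomial model of the Iwasawa algebra *)

Section Algebra.
Variable R : comNzRingType.
Implicit Types (P Q : nat -> {poly R}) (A B : {poly R}).
Local Notation iwfun := (iwfun R H).

Definition omg n : {poly R} := 'X^(p ^ n) - 1.
Lemma omg_monic n : omg n \is monic. Proof. by rewrite monic_Xn_sub_1. Qed.
Lemma omg_size n : size (omg n) = (p ^ n).+1. Proof. by rewrite size_Xn_sub_1. Qed.
Definition red n A := rmodp A (omg n).

Lemma red_size n A : (size (red n A) <= p ^ n)%N.
Proof.
by rewrite -ltnS -omg_size; apply: Pdiv.CommonRing.ltn_rmodpN0; rewrite monic_neq0 ?omg_monic.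
Qed.
Lemma red_small n A : (size A <= p ^ n)%N -> red n A = A.
Proof. by move=> sA; rewrite /red Pdiv.CommonRing.rmodp_small // omg_size. Qed.
Lemma redD n A B : red n (A + B) = red n A + red n B.
Proof. exact/rmodpD/omg_monic. Qed.
Lemma redB n A B : red n (A - B) = red n A - red n B.
Proof. exact/rmodpB/omg_monic. Qed.
Lemma redZ n a A : red n (a *: A) = a *: red n A.
Proof. exact/rmodpZ/omg_monic. Qed.
Lemma red_sum n (I : Type) (r : seq I) (T : pred I) (F : I -> {poly R}) :
  red n (\sum_(i <- r | T i) F i) = \sum_(i <- r | T i) red n (F i).
Proof. exact/rmodp_sum/omg_monic. Qed.
Lemma red_red n A : red n (red n A) = red n A.
Proof. by rewrite red_small // red_size. Qed.
Lemma redMr n A B : red n (A * red n B) = red n (A * B).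
Proof. exact/rmodp_mulmr/omg_monic. Qed.
Lemma redMl n A B : red n (red n A * B) = red n (A * B).
Proof. by rewrite mulrC redMr mulrC. Qed.
Lemma red_omg n A : red n (A * omg n) = 0.
Proof. exact/rmodp_mull/omg_monic. Qed.
Lemma red_eq n A B : red n A = red n B <-> exists C, A = B + C * omg n.
Proof.
split=> [e|[C ->]]; last by rewrite redD red_omg addr0.
have a := rdivp_eq (omg_monic n) A; have b := rdivp_eq (omg_monic n) B.
rewrite -/(red _ _) e in a; rewrite -/(red _ _) in b; exists (rdivp A (omg n) - rdivp B (omg n)).
move: (rdivp A _) (rdivp B _) (red n B) b a {e} => qa qb r -> ->.
by ring.
Qed.
Lemma omg_dvd n m : (n <= m)%N -> exists C, omg m = C * omg n.
Proof.
move=> nm; exists (\sum_(i < p ^ (m - n)) 'X^(p ^ n) ^+ i).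
by rewrite mulrC -subrX1 -exprM -expnD subnKC.
Qed.
Lemma red_le n m A : (n <= m)%N -> red n (red m A) = red n A.
Proof.
move=> nm; apply/red_eq; have [C e] := omg_dvd nm.
exists (- rdivp A (omg m) * C); rewrite -mulrA -e {2}(rdivp_eq (omg_monic m) A).
by rewrite -/(red m A); ring.
Qed.

Lemma red_Xn n j : red n 'X^j = 'X^(j %% p ^ n).
Proof.
have sz : (size ('X^(j %% p ^ n) : {poly R}) <= p ^ n)%N by rewrite size_polyXn ltn_mod.
rewrite -[RHS](red_small sz); apply/red_eq.
exists ('X^(j %% p ^ n) * \sum_(i < j %/ p ^ n) 'X^(p ^ n) ^+ i).
rewrite -mulrA [_ * omg n]mulrC -subrX1 -exprM mulrBr mulr1 -exprD.
by rewrite addrC subrK mulnC addnC -divn_eq.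
Qed.

Lemma poly_wide N A : (size A <= N)%N -> A = \sum_(j < N) A`_j *: 'X^j.
Proof.
move=> sA; apply/polyP=> k; rewrite coef_sum.
under eq_bigr => j _ do rewrite coefZ coefXn.
have [kN|Nk] := ltnP k N; last first.
  rewrite nth_default ?(leq_trans sA) // big1 // => j _.
  by rewrite gtn_eqF ?mulr0 // (leq_trans (ltn_ord j)).
rewrite (bigD1 (Ordinal kN)) //= eqxx mulr1 big1 ?addr0 // => j jk.
rewrite eq_sym -(inj_eq val_inj) in jk; by rewrite (negPf jk) mulr0.
Qed.

Lemma red_coef n N A i : (size A <= N)%N -> (i < p ^ n)%N ->
  (red n A)`_i = \sum_(j < N | (j %% p ^ n)%N == i) A`_j.
Proof.
move=> sA ip; rewrite {1}(poly_wide sA).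
rewrite red_sum coef_sum.
under eq_bigr => j _ do rewrite redZ red_Xn coefZ coefXn.
rewrite [RHS]big_mkcond; apply: eq_bigr => j _; rewrite eq_sym.
by case: ifP => _; rewrite ?mulr0 // mulr1.
Qed.

(** The group ring of the quotient by [Un n] is R[X]/(X^(p^n) - 1), with X the class of gam. An
    element of the Iwasawa algebra is thus a family of polynomials, of which only the remainders
    count. *)
Definition mk P : iwfun := fun V g => (red (level V) (P (level V)))`_(ix (level V) g).
Definition coherent P := forall n m, (n <= m)%N -> red n (P m) = red n (P n).

Lemma mkU P n g : mk P (U n) g = (red n (P n))`_(ix n g).
Proof. by rewrite /mk levelU. Qed.

Lemma mk_eq P Q : (forall n, red n (P n) = red n (Q n)) -> mk P = mk Q.
Proof. by move=> e; apply/funext=> V; apply/funext=> g; rewrite /mk e. Qed.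

Lemma mk_inj P Q n : mk P = mk Q -> red n (P n) = red n (Q n).
Proof.
move=> e; apply/polyP=> i; have [ip|pi] := ltnP i (p ^ n).
  by have := mkU P n (gam ^+ i)%g; rewrite e mkU ix_gam modn_small.
by rewrite !nth_default // (leq_trans (red_size _ _)).
Qed.

Lemma mk_iwasawa P : coherent P -> iwasawa (mk P).
Proof.
move=> cP; split=> [V g u|V V']; rewrite (levelP V).
  by move=> uU; rewrite !mkU ix_mulU.
rewrite (levelP V'); set m := level V; set n := level V' => sub g.
have nm : (n <= m)%N.
  have /sub/(Un_gam p_pr p_odd) : Un m (gam ^+ (p ^ m))%g by apply/Un_gam.
  by rewrite dvdn_Pexp2l ?prime_gt1.
rewrite (@sum_subcosets _ m n (mk P (U m))) // => [|h k e]; last by rewrite !mkU e.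
rewrite mkU -(cP _ _ nm) -(red_le _ nm) (@red_coef n (p ^ m)) ?red_size ?ix_lt //.
by apply: eq_bigr => j _; rewrite mkU ix_gam modn_small.
Qed.

Definition lev n (lam : iwfun) : {poly R} := \poly_(i < p ^ n) lam (U n) (gam ^+ i)%g.

Lemma iw_ix (lam : iwfun) n g h : iwasawa lam -> ix n g = ix n h -> lam (U n) g = lam (U n) h.
Proof.
by move=> lamI /ix_eq gh; rewrite -[h](mulVKg g) (iwasawa_inv lamI) //.
Qed.

Lemma lev_coherent lam : iwasawa lam -> coherent (lev^~ lam).
Proof.
move=> lamI n m nm; rewrite [RHS]red_small ?size_poly //.
apply/polyP=> i; have [ip|pi] := ltnP i (p ^ n); last first.
  by rewrite !nth_default ?(leq_trans (red_size _ _)) ?(leq_trans (size_poly _ _)).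
rewrite (@red_coef n (p ^ m)) ?size_poly // coef_poly ip.
have sub : osub_set (U m) `<=` osub_set (U n) by apply: Un_le.
rewrite (iwasawa_compat lamI sub) (@sum_subcosets _ m n (lam (U m))) //; last first.
  by move=> g h; apply: iw_ix.
rewrite ix_gam (modn_small ip); apply: eq_bigr => j _.
by rewrite coef_poly ltn_ord.
Qed.

Lemma lev_mk lam : iwasawa lam -> lam = mk (lev^~ lam).
Proof.
move=> lamI; apply/funext=> V; apply/funext=> g; rewrite (levelP V) mkU.
rewrite red_small ?size_poly // coef_poly ix_lt; apply: iw_ix => //.
by rewrite ix_gam modn_small ?ix_lt.
Qed.

Lemma iw_mk lam : iwasawa lam -> exists2 P, coherent P & lam = mk P.
Proof. by move=> lamI; exists (lev^~ lam); [exact: lev_coherent | exact: lev_mk]. Qed.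

Lemma coherentC A : coherent (fun=> A). Proof. by []. Qed.
Lemma coherentB P Q : coherent P -> coherent Q -> coherent (fun n => P n - Q n).
Proof. by move=> cP cQ n m nm; rewrite !redB cP // cQ. Qed.
Lemma coherentD P Q : coherent P -> coherent Q -> coherent (fun n => P n + Q n).
Proof. by move=> cP cQ n m nm; rewrite !redD cP // cQ. Qed.
Lemma coherentM P Q : coherent P -> coherent Q -> coherent (fun n => P n * Q n).
Proof.
move=> cP cQ n m nm.
by rewrite -redMr cQ // redMr -redMl cP // redMl.
Qed.

Lemma mkB P Q : mk P - mk Q = mk (fun n => P n - Q n).
Proof.
apply/funext=> V; apply/funext=> g.
by rewrite -[LHS]/(mk P V g - mk Q V g) /mk redB coefB.
Qed.
Lemma mkD P Q : mk P + mk Q = mk (fun n => P n + Q n).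
Proof.
apply/funext=> V; apply/funext=> g.
by rewrite -[LHS]/(mk P V g + mk Q V g) /mk redD coefD.
Qed.
Lemma mk0 : mk (fun=> 0) = 0.
Proof.
apply/funext=> V; apply/funext=> g; rewrite /mk red_small ?size_poly0 //.
by rewrite coef0.
Qed.

Lemma mkC a : iwconst a = mk (fun=> a%:P).
Proof.
apply/funext=> V; apply/funext=> g; rewrite (levelP V) mkU; set n := level V.
rewrite red_small; last by rewrite (leq_trans (size_polyC_leq1 _)).
rewrite coefC /iwconst; case: asboolP => [gU|ngU].
  by rewrite (ix_Un gU).
case: eqP => // e; case: ngU; rewrite -[g]mul1g -invg1; apply/ix_eq.
by rewrite e -[1%g](expg0 gam) ix_gam mod0n.
Qed.

Lemma mkM P Q : iwmul (mk P) (mk Q) = mk (fun n => P n * Q n).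
Proof.
apply/funext=> V; apply/funext=> g; rewrite (levelP V) mkU; set n := level V.
rewrite /iwmul (@sum_cosets _ n (fun h => mk P (U n) h * mk Q (U n) (h^-1 * g)%g)); last first.
  move=> h k hk; rewrite !mkU hk; congr (_ * (red n _)`_ _).
  by apply: ix_div_uniq (ix_lt _ _) _; rewrite -hk ix_div.
rewrite -redMl -redMr; set A := red n (P n); set B := red n (Q n).
have EA : A = \sum_(i < p ^ n) A`_i *: 'X^i := poly_wide (red_size n (P n)).
have EB : B = \sum_(i < p ^ n) B`_i *: 'X^i := poly_wide (red_size n (Q n)).
rewrite [in RHS]EA mulr_suml red_sum coef_sum.
apply: eq_bigr => i _; rewrite !mkU ix_gam modn_small // -/A -/B.
rewrite -scalerAl redZ coefZ; congr (_ * _).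
rewrite [in RHS]EB mulr_sumr red_sum coef_sum.
have j0P := ix_lt n ((gam ^+ i)^-1 * g)%g.
rewrite (bigD1 (Ordinal j0P)) //= -scalerAr -exprD redZ red_Xn coefZ coefXn.
have := ix_div n g (gam ^+ i)%g; rewrite ix_gam (modn_small (ltn_ord i)) => e.
rewrite e eqxx mulr1 big1 ?addr0 // => j jj0.
rewrite -scalerAr -exprD redZ red_Xn coefZ coefXn.
case: eqP => [e'|_]; last by rewrite mulr0.
case/eqP: jj0; apply: val_inj => /=; apply: ix_div_uniq => //.
by rewrite ix_gam (modn_small (ltn_ord i)).
Qed.

Lemma iwasawaM (lam mu : iwfun) : iwasawa lam -> iwasawa mu -> iwasawa (iwmul lam mu).
Proof.
move=> /iw_mk[P cP ->] /iw_mk[Q cQ ->]; rewrite mkM.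
exact/mk_iwasawa/coherentM.
Qed.

Lemma mkX P k : iwexp (mk P) k = mk (fun n => P n ^+ k).
Proof.
elim: k => [|k IHk]; first by rewrite /iwexp /= mkC.
by rewrite /iwexp iterS -/(iwexp _ k) IHk mkM; apply: mk_eq => n; rewrite exprS.
Qed.

Lemma iwasawaX (lam : iwfun) k : iwasawa lam -> iwasawa (iwexp lam k).
Proof.
move=> lamI; elim: k => [|k IHk].
  by rewrite /iwexp /= mkC; apply: mk_iwasawa.
by rewrite /iwexp iterS; apply: iwasawaM.
Qed.

Lemma iwdvd_mk (A : {poly R}) P : coherent P -> iwdvd (mk (fun=> A)) (mk P) <->
  exists2 Q, coherent Q & forall n, red n (P n) = red n (A * Q n).
Proof.
move=> cP; split=> [[nu /iw_mk[Q cQ ->]]|[Q cQ e]].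
  by rewrite mkM => e; exists Q => // n; apply: (mk_inj n e).
exists (mk Q); first exact: mk_iwasawa.
by rewrite mkM; apply: mk_eq.
Qed.

Section Complete.
Variable pi : R.
Hypotheses (cR : adic_compact pi) (sR : adic_separated pi).
Hypothesis (pi_p : exists c : R, p%:R = pi * c).
Hypothesis (pi_unit : forall x : R, ~ (exists y, x = pi * y) -> exists u, x * u = 1).
Hypothesis (pi_I : forall x y : R, pi * x = pi * y -> x = y).

Lemma poly_separated A : (forall j, exists z, A = pi ^+ j *: z) -> A = 0.
Proof.
move=> h; apply/polyP=> i; rewrite coef0; apply: sR => j.
by have [z ->] := h j; exists z`_i; rewrite coefZ.
Qed.

Variable UF : set_system nat.
Hypotheses (UU : UltraFilter UF) (Ule : forall n, UF [set m | (n <= m)%N]).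

(** pi-adic convergence along [UF], uniform in the coefficients. *)
Definition plim (T : nat -> {poly R}) A :=
  forall j, UF [set m | exists z, T m - A = pi ^+ j *: z].

Lemma plim_ext T T' A : plim T A -> UF [set m | T m = T' m] -> plim T' A.
Proof. by move=> TA e j; apply: filterS (filterI (TA j) e) => m [/= [z ez] <-]; exists z. Qed.
Lemma plimD T T' A A' : plim T A -> plim T' A' -> plim (fun m => T m + T' m) (A + A').
Proof.
move=> TA TA' j; apply: filterS (filterI (TA j) (TA' j)) => m [/= [z ez] [z' ez']].
by exists (z + z'); rewrite scalerDr -ez -ez'; ring.
Qed.
Lemma plimM T T' A A' : plim T A -> plim T' A' -> plim (fun m => T m * T' m) (A * A').
Proof.
move=> TA TA' j; apply: filterS (filterI (TA j) (TA' j)) => m [/= [z ez] [z' ez']].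
exists (z * T' m + A * z'); rewrite scalerDr scalerAl scalerAr -ez -ez'; ring.
Qed.
Lemma plimC A : plim (fun=> A) A.
Proof. by move=> j; apply: filterS filterT => m _ /=; exists 0; rewrite subrr scaler0. Qed.
Lemma plim_red T A n : plim T A -> plim (fun m => red n (T m)) (red n A).
Proof.
move=> TA j; apply: filterS (TA j) => m [/= z ez]; exists (red n z).
by rewrite -redB ez redZ.
Qed.
Lemma plim_uniq T A B : plim T A -> plim T B -> A = B.
Proof.
move=> TA TB; apply/eqP; rewrite -subr_eq0; apply/eqP/poly_separated => j.
have [m [/= [z ez] [z' ez']]] := filter_ex (filterI (TA j) (TB j)).
by exists (z' - z); rewrite scalerBr -ez -ez'; ring.
Qed.
Lemma plim_exists (T : nat -> {poly R}) d : (forall m, (size (T m) <= d)%N) ->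
  exists2 A : {poly R}, (size A <= d)%N & plim T A.
Proof. by move=> sT; have [A sA AP] := poly_ultralim cR UU sT; exists A. Qed.

Lemma iw_lim (T : nat -> {poly R}) : exists2 Z, coherent Z & forall n, plim (fun m => red n (T m)) (red n (Z n)).
Proof.
have /choice[Z ZP] : forall n, exists Z, plim (fun m => red n (T m)) (red n Z).
  move=> n; have [A sA AP] := plim_exists (fun m => red_size n (T m)).
  by exists A; rewrite red_small.
exists Z => // n m nm; apply: plim_uniq (ZP n).
have := plim_red n (ZP m); rewrite red_le // => /plim_ext; apply.
by apply: filterS filterT => k _ /=; rewrite red_le.
Qed.

Lemma coherent_lim P n : coherent P -> plim (fun m => red n (P m)) (red n (P n)).
Proof.
move=> cP; apply: plim_ext (plimC _) _.
by apply: filterS (Ule n) => m /= nm; rewrite cP.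
Qed.

(** Each level is divided by [F] among polynomials. As [F] is monic, the remainders have bounded
    size and a common limit; the quotients are controlled modulo each X^(p^n) - 1, where they have a
    coherent limit. *)
Lemma iw_division F P : F \is monic -> coherent P -> exists r : {poly R},
  [/\ (size r < size F)%N, plim (fun m => rmodp (P m) F) r &
  iwdvd (mk (fun=> F)) (mk P - mk (fun=> r))].
Proof.
move=> mF cP; have F0 : (0 < size F)%N by rewrite size_poly_gt0 monic_neq0.
have sr m : (size (rmodp (P m) F) <= (size F).-1)%N.
  by rewrite -ltnS prednK //; apply: Pdiv.CommonRing.ltn_rmodpN0; rewrite monic_neq0.
have [r szr rP] := plim_exists sr; exists r; split=> //.
  by rewrite -(prednK F0) ltnS.
have [Z cZ ZP] := iw_lim (fun m => rdivp (P m) F).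
rewrite mkB; apply/iwdvd_mk; first exact: coherentB.
exists Z => // n; apply: (@plim_uniq (fun m => red n (P m - rmodp (P m) F))).
  apply: plim_ext (_ : plim (fun m => red n (red n (P m) - rmodp (P m) F)) _) _.
    have h : plim (fun m => red n (P m) + (-1) * rmodp (P m) F) (red n (P n) + (-1) * r).
      by apply: plimD; [apply: coherent_lim | apply: plimM => //; apply: plimC].
    have := plim_red n h; rewrite mulN1r !redB red_red => /plim_ext; apply.
    by apply: filterS filterT => m _ /=; rewrite mulN1r.
  by apply: filterS filterT => m _ /=; rewrite !redB red_red.
rewrite -redMr; apply: plim_ext (plim_red n (plimM (plimC F) (ZP n))) _.
apply: filterS filterT => m _ /=; rewrite redMr.
by rewrite {2}(rdivp_eq mF (P m)) addrK mulrC.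
Qed.

Lemma frobD_ring (S : comNzRingType) (x y : S) : exists z, (x + y) ^+ p = x ^+ p + y ^+ p + p%:R * z.
Proof.
rewrite exprDn -(prednK p0) big_ord_recr big_ord_recl /= !subn0 !subnn !bin0 binn.
rewrite !expr0 !mulr1 !mulr1n mul1r (prednK p0).
have /choice[c cP] : forall i : 'I_p.-1, exists c, 'C(p, i.+1) = (p * c)%N.
  move=> i; have /dvdnP[c ->] : (p %| 'C(p, i.+1))%N.
    by apply: prime_dvd_bin => //; have := ltn_ord i; have := prime_gt1 p_pr; lia.
  by exists c; rewrite mulnC.
exists (\sum_(i < p.-1) (x ^+ (p - i.+1) * y ^+ i.+1) *+ c i).
rewrite mulr_sumr addrAC; congr (_ + _); apply: eq_bigr => i _.
by rewrite /bump /= add1n cP mulrnA mulr_natl mulrnAC.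
Qed.

(** Frobenius modulo pi, where oddness of p gives (-1)^p = -1. *)
Lemma omg_frob n : exists C, ('X - 1) ^+ (p ^ n) = omg n + pi *: C.
Proof.
elim: n => [|n [C e]]; first by exists 0; rewrite expn0 expr1 scaler0 addr0.
have [c pc] := pi_p.
rewrite expnSr exprM e /omg.
have [z1 e1] := frobD_ring (omg n) (pi *: C); rewrite e1 /omg.
have [z2 e2] := frobD_ring 'X^(p ^ n) (-1 : {poly R}); rewrite e2.
have -> : (-1 : {poly R}) ^+ p = -1 by rewrite -signr_odd p_odd expr1.
exists (c *: z2 + c *: z1 + pi ^+ p.-1 *: C ^+ p).
rewrite -exprM -expnSr exprZn -{3}(prednK p0) exprS.
have pP : p%:R = pi%:P * c%:P :> {poly R} by rewrite -polyCM -pc rmorph_nat.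
by rewrite pP -!mul_polyC !polyCM; ring.
Qed.


Definition inI (F : {poly R}) j A := exists U V, A = F * U + pi ^+ j *: V.

Lemma inID F j A B : inI F j A -> inI F j B -> inI F j (A + B).
Proof.
move=> [a [b ->]] [c [d ->]]; exists (a + c), (b + d).
by rewrite mulrDr scalerDr; ring.
Qed.
Lemma inIM F j A B : inI F j A -> inI F j (A * B).
Proof.
move=> [a [b ->]]; exists (a * B), (b * B).
by rewrite -!mul_polyC; ring.
Qed.
Lemma inIMM F i j A B : inI F i A -> inI F j B -> inI F (i + j) (A * B).
Proof.
move=> [a [b ->]] [c [d ->]]; exists (F * a * c + a * (pi ^+ j *: d) + (pi ^+ i *: b) * c), (b * d).
by rewrite -!mul_polyC exprD polyCM; ring.
Qed.
Lemma inI_le F i j A : (i <= j)%N -> inI F j A -> inI F i A.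
Proof.
move=> ij [a [b ->]]; exists a, (pi ^+ (j - i) *: b).
by rewrite scalerA -exprD subnKC.
Qed.
Lemma inI_gen F j A : inI F j (F * A).
Proof. by exists A, 0; rewrite scaler0 addr0. Qed.
Lemma inI_pi F j A : inI F j (pi ^+ j *: A).
Proof. by exists 0, A; rewrite mulr0 add0r. Qed.

Section Distinguished.
Variables (F : {poly R}) (E : nat) (G : {poly R}).
Hypotheses (mF : F \is monic) (FE : F = ('X - 1) ^+ E + pi *: G).

(** Modulo pi, [F] is a power of X - 1 and divides (X - 1)^(p^n), hence X^(p^n) - 1, for large n.
    One more level multiplies by a sum of p terms congruent to 1 modulo (F, pi), which is in that
    ideal since pi divides p; this gains a power of pi. *)
Lemma omg_small j : exists n0, forall n, (n0 <= n)%N -> inI F j (omg n).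
Proof.
suff [n hn] : exists n, inI F j (omg n).
  by exists n => m nm; have [C ->] := omg_dvd nm; rewrite mulrC; apply: inIM.
have p1 : exists n, inI F 1 (omg n).
  (* Level [E] is sufficient because p^E is at least [E]. *)
  exists E; have Ep : (E <= p ^ E)%N by apply/ltnW/ltn_expl/prime_gt1.
  have [C e] := omg_frob E.
  exists (('X - 1) ^+ (p ^ E - E)), (- G * ('X - 1) ^+ (p ^ E - E) - C).
  have -> : omg E = ('X - 1) ^+ (p ^ E) - pi *: C by rewrite e addrK.
  rewrite FE expr1 -{1}(subnKC Ep) exprD -!mul_polyC; ring.
elim: j => [|[|j] IHj]; last 1 first.
- have [n hn] := IHj; exists n.+1.
  have hn1 := inI_le (isT : (1 <= j.+1)%N) hn.
  have -> : omg n.+1 = omg n * \sum_(i < p) 'X^(p ^ n) ^+ i.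
    by rewrite -subrX1 -exprM -expnSr.
  rewrite -addn1; apply: inIMM => //.
  have hX i : inI F 1 ('X^(p ^ n) ^+ i - 1).
    by rewrite subrX1; apply: inIM.
  have -> : \sum_(i < p) 'X^(p ^ n) ^+ i = \sum_(i < p) ('X^(p ^ n) ^+ i - 1) + p%:R :> {poly R}.
    by rewrite sumrB sumr_const card_ord subrK.
  apply: inID; last first.
    have [c pc] := pi_p; have -> : p%:R = pi ^+ 1 *: c%:P :> {poly R}.
      by rewrite expr1 -mul_polyC -polyCM -pc rmorph_nat.
    exact: inI_pi.
  elim/big_ind: _ => // [|A B]; first by rewrite -(mulr0 F); apply: inI_gen.
  exact: inID.
- by exists 0%N, 0, (omg 0); rewrite mulr0 expr0 scale1r add0r.
- exact: p1.
Qed.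

Lemma small_inI (r : {poly R}) j : (size r < size F)%N -> inI F j r -> exists z, r = pi ^+ j *: z.
Proof.
move=> sr [A [B e]]; exists (rmodp B F).
rewrite -[LHS](@Pdiv.CommonRing.rmodp_small _ r F) // e rmodpD // rmodpZ // mulrC.
by rewrite rmodp_mull // add0r.
Qed.

Lemma iw_small (r : {poly R}) j (x y : iwfun) : iwasawa x -> iwasawa y -> (size r < size F)%N ->
  mk (fun=> r) = iwmul (mk (fun=> F)) x + iwmul (iwconst (pi ^+ j)) y ->
  exists z, r = pi ^+ j *: z.
Proof.
move=> /iw_mk[P cP ->] /iw_mk[Q cQ ->] sr; rewrite mkC !mkM mkD => e.
have [n0 hn] := omg_small j; apply: small_inI => //.
have /red_eq[C ->] := mk_inj n0 e.
apply: inID; last by rewrite mulrC; apply/inIM/hn.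
by apply: inID; [apply: inI_gen | rewrite mul_polyC; apply: inI_pi].
Qed.

(** Uniqueness of the remainder: at a high level X^(p^n) - 1 lies in (F, pi^j), so [r] does too;
    being smaller than the monic [F], it is divisible by pi^j, for every j. *)
Lemma iw_small0 (r : {poly R}) : (size r < size F)%N -> iwdvd (mk (fun=> F)) (mk (fun=> r)) -> r = 0.
Proof.
move=> sr [x xI e]; apply: poly_separated => j.
apply: (@iw_small r j x 0) => //; first by rewrite -mk0; apply: mk_iwasawa.
by rewrite e -mk0 mkC mkM -[X in X = _]addr0 -mk0; congr (_ + _); apply: mk_eq => n; rewrite mulr0.
Qed.

End Distinguished.

(** M is the order of vanishing at 1 modulo pi, found by splitting off factors X - 1 as long as pi
    divides the value at 1. *)
Lemma taylor_nondiv A : ~ (exists B, A = pi *: B) -> exists (M : nat) (Q B : {poly R}),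
  [/\ (M < size A)%N, A = ('X - 1) ^+ M * Q + pi *: B & ~ exists c, Q.[1] = pi * c].
Proof.
have [k] := ubnP (size A); elim: k A => // k IHk A sA nA.
have A0 : A != 0 by apply/eqP => A0; apply: nA; exists 0; rewrite A0 scaler0.
have [[c ec]|nc] := pselect (exists c, A.[1] = pi * c); last first.
  by exists 0%N, A, 0; rewrite size_poly_gt0 expr0 mul1r scaler0 addr0.
have [A' eA] : exists A', A - A.[1]%:P = A' * ('X - 1%:P).
  by apply/factor_theorem; rewrite /root !hornerE subrr.
have eA' : A = A' * ('X - 1) + pi *: c%:P.
  by rewrite -[A](subrK A.[1]%:P) eA ec polyCM mul_polyC.
have sA' : (size A' < size A)%N.
  have [->|A'0] := eqVneq A' 0; first by rewrite size_poly0 size_poly_gt0.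
  have := size_Mmonic A'0 (monicXsubC (1 : R)); rewrite -eA size_XsubC addn2 /= => e.
  have : (size (A - A.[1]%:P)%R <= size A)%N.
    by rewrite (leq_trans (size_polyD _ _)) // geq_max leqnn size_polyN (leq_trans (size_polyC_leq1 _)) // size_poly_gt0.
  by rewrite e.
have [||M [Q [B [sM e nQ]]]] := IHk A'.
- by apply: leq_trans sA' _; rewrite -ltnS.
- by move=> [B e]; apply: nA; exists (B * ('X - 1) + c%:P); rewrite eA' e scalerDr -scalerAl.
exists M.+1, Q, (B * ('X - 1) + c%:P); split=> //; first exact: leq_trans sA'.
by rewrite eA' e exprS scalerDr -!mul_polyC; ring.
Qed.

Lemma iw_nondiv (lam : iwfun) : iwasawa lam -> ~ iwdvd (iwconst pi) lam ->
  exists n, ~ exists B, lev n lam = pi *: B.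
Proof.
move=> lamI nd; apply: contrapT => /forallNP h; apply: nd.
have /choice[B BP] : forall n, exists B, lev n lam = pi *: B.
  by move=> n; apply: contrapT => hn; apply: (h n).
have pI A C : pi *: A = pi *: C -> A = C.
  move=> e; apply/polyP=> i; apply: pi_I; have := congr1 (fun q : {poly R} => q`_i) e.
  by rewrite !coefZ.
have cB : coherent B.
  move=> n m nm; apply: pI; rewrite -!redZ -!BP; exact: lev_coherent.
rewrite mkC {1}(lev_mk lamI); apply/iwdvd_mk; first exact: lev_coherent.
by exists B => // n; rewrite BP mul_polyC.
Qed.

(** A weak form of Weierstrass preparation: modulo pi, [lam] is (X - 1)^M times a unit. The unit is
    inverted at every level by a geometric series, and a limit of the inverses is taken. *)
Lemma iw_pow_aug (lam : iwfun) : iwasawa lam -> ~ iwdvd (iwconst pi) lam -> exists M x y,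
  [/\ iwasawa x, iwasawa y & mk (fun=> ('X - 1) ^+ M) = iwmul lam x + iwmul (iwconst pi) y].
Proof.
move=> lamI nd; have [n nn] := iw_nondiv lamI nd.
have [M [Q [B [sM e nQ]]]] := taylor_nondiv nn.
have [u Qu] := pi_unit nQ.
have Mn : (M < p ^ n)%N by apply: leq_trans sM (size_poly _ _).
have key m : exists vy : {poly R} * {poly R}, (n <= m)%N ->
    exists z, ('X - 1) ^+ M = lev m lam * vy.1 + pi *: vy.2 + z * omg m.
  have [nm|_] := leqP n m; last by exists (0, 0).
  have [C0 eC0] := omg_frob n.
  have /red_eq[C eC] := lev_coherent lamI nm.
  (* At level m, [lam] is its level n plus a multiple of X^(p^n) - 1, that is of (X - 1)^(p^n)
     modulo pi. As M < p^n the factor (X - 1)^M comes out, and [U] has the same value at 1 as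
     [Q]. *)
  pose U := Q + ('X - 1) ^+ (p ^ n - M) * C.
  have U1 : (1 - u *: U).[1] = 0.
    rewrite /U !hornerE subrr expr0n; have -> : (p ^ n - M == 0)%N = false by lia.
    by rewrite mul0r addr0 [u * _]mulrC Qu subrr.
  have /factor_theorem[h eh] : root (1 - u *: U) 1 by apply/rootP.
  (* [t] vanishes at 1, so t^(p^m) is a multiple of (X - 1)^(p^m), which is X^(p^m) - 1 modulo pi.
     The geometric series in [t] therefore inverts u U modulo pi at level m. *)
  pose t := 1 - u *: U.
  have [C1 eC1] := omg_frob m.
  have et : t ^+ (p ^ m) = h ^+ (p ^ m) * (omg m + pi *: C1).
    by rewrite /t eh exprMn eC1.
  have eP : ('X - 1) ^+ M * U = lev m lam - pi *: (B - C0 * C).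
    have e2 : ('X - 1) ^+ M * (('X - 1) ^+ (p ^ n - M) * C) = (omg n + pi *: C0) * C.
      by rewrite mulrA -exprD subnKC ?(ltnW Mn) // eC0.
    by rewrite /U mulrDr e2 eC e -!mul_polyC; ring.
  pose s := \sum_(i < p ^ m) t ^+ i.
  have es : s * (u *: U) = 1 - t ^+ (p ^ m).
    have := subrX1 t (p ^ m); rewrite -/s => e3.
    have -> : u *: U = 1 - t by rewrite /t opprB addrC subrK.
    by rewrite -[RHS]opprB e3; ring.
  exists (u *: s, - (B - C0 * C) * (u *: s) + ('X - 1) ^+ M * h ^+ (p ^ m) * C1) => _ /=.
  exists (('X - 1) ^+ M * h ^+ (p ^ m)).
  have -> : lev m lam = ('X - 1) ^+ M * U + pi *: (B - C0 * C) by rewrite eP subrK.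
  transitivity (('X - 1) ^+ M * (s * (u *: U) + t ^+ (p ^ m))); first by rewrite es subrK mulr1.
  by rewrite et -!mul_polyC; ring.
have {key}/choice[vy vyP] := key.
have [V cV VP] := iw_lim (fun m => (vy m).1); have [Y cY YP] := iw_lim (fun m => (vy m).2).
exists M, (mk V), (mk Y); split; [exact: mk_iwasawa | exact: mk_iwasawa |].
rewrite {1}(lev_mk lamI) mkC !mkM mkD; apply: mk_eq => k.
apply: (@plim_uniq (fun m => red k (('X - 1) ^+ M))); first exact: plimC.
have h := plim_red k (plimD (plimM (plimC (lev k lam)) (VP k)) (plimM (plimC pi%:P) (YP k))).
rewrite redD !redMr -redD in h; apply: plim_ext h _.
apply: filterS (filterI (Ule n) (Ule k)) => m [/= nm km].
have [z ->] := vyP m nm; rewrite !redD -(red_le (z * _) km) red_omg.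
rewrite [red k 0]red_small ?size_poly0 // addr0.
rewrite !redMr -[in RHS]redMl (lev_coherent lamI km) redMl.
by rewrite -mul_polyC.
Qed.

End Complete.
End Algebra.
End Index.
End IwasawaPolynomials.

Section IwasawaValuation.
Import Pdiv.RingMonic.
Local Notation rmodp := Pdiv.CommonRing.rmodp.
Local Notation rdivp := Pdiv.CommonRing.rdivp.

Lemma monic_mulI (R : nzRingType) (F A B : {poly R}) : F \is monic -> A * F = B * F -> A = B.
Proof.
move=> mF e; apply/eqP; rewrite -subr_eq0; apply/eqP; apply/eqP/negPn/negP => D0.
have := size_Mmonic D0 mF; rewrite mulrBl e subrr size_poly0 => /esym/eqP.
have : (0 < size F)%N by rewrite size_poly_gt0 monic_neq0.
have : (0 < size (A - B)%R)%N by rewrite size_poly_gt0.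
by case: (size (A - B)) (size F) => // a [] // b; rewrite addnS.
Qed.

(** * Distinguished polynomials over the valuation ring *)

Section Valuation.
Variables (p : nat) (Qp : padicField p) (K : fieldExtType Qp) (varpi : valring K).
Hypotheses (p_pr : prime p) (p_odd : odd p) (varpi_unif : uniformizer varpi).
Local Notation R := (valring K).
Local Notation H := (GQinf p).
Local Notation mk := (mk p_pr p_odd).
Local Notation iwfun := (iwfun R H).
Implicit Types (f q F G A B C : {poly R}).

Lemma pi_inj (x y : R) : varpi * x = varpi * y -> x = y.
Proof. by apply: valring_mulI; apply: varpi_neq0R. Qed.
Lemma piX_inj k (x y : R) : varpi ^+ k * x = varpi ^+ k * y -> x = y.
Proof. by apply: valring_mulI; apply: varpiX_neq0. Qed.
Lemma pi_polyI A B : varpi *: A = varpi *: B -> A = B.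
Proof.
move=> e; apply/polyP => i; apply: pi_inj.
by have := congr1 (fun q : {poly R} => q`_i) e; rewrite !coefZ.
Qed.
Lemma pi_unit (x : R) : ~ (exists y, x = varpi * y) -> exists u, x * u = 1.
Proof. by move=> nx; apply/varpi_unif. Qed.

Lemma monic_pi F A C : F \is monic -> A * F = varpi *: C -> exists z, A = varpi *: z.
Proof.
move=> mF e; exists (rdivp C F); apply: (monic_mulI mF).
have r0 : rmodp C F = 0.
  apply: pi_polyI; rewrite -rmodpZ // -e scaler0; exact: rmodp_mull.
by rewrite e {1}(rdivp_eq mF C) r0 addr0 scalerAl.
Qed.

Lemma strip1 f c : f \is monic -> f.[1] = varpi * c ->
  exists2 f', f' \is monic & f = f' * ('X - 1) + varpi *: c%:P.
Proof.
move=> mf fc.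
have [f' ef] : exists f', f - f.[1]%:P = f' * ('X - 1%:P).
  by apply/factor_theorem; rewrite /root !hornerE subrr.
have ef' : f = f' * ('X - 1) + varpi *: c%:P.
  by rewrite -[f in LHS](subrK f.[1]%:P) ef fc polyCM mul_polyC.
exists f' => //; rewrite -(monicMr _ (monicXsubC (1 : R))) -ef monicE lead_coefDl.
  by rewrite -monicE.
rewrite size_polyN; apply: leq_ltn_trans (size_polyC_leq1 _) _.
rewrite ltnNge; apply/negP => s1; have f1 := size1_polyC s1.
move: mf fc; rewrite f1 monicE lead_coefC hornerC => /eqP -> e.
by case: (varpi_nunit varpi_unif); exists c.
Qed.

(** Induction on [D]: varpi divides the value at 1 of one of the factors, and X - 1 is split off
    from it. For D = 0, a factor of positive degree would make the leading coefficient 1 of the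
    product divisible by varpi. *)
Lemma distinguished_factor f q D G : f \is monic -> q \is monic ->
  f * q = ('X - 1) ^+ D + varpi *: G -> exists e G', f = ('X - 1) ^+ e + varpi *: G'.
Proof.
elim: D f q G => [|D IHD] f q G mf mq e.
  exists 0%N, 0; rewrite expr0 scaler0 addr0.
  have f0 : (0 < size f)%N by rewrite size_poly_gt0 monic_neq0.
  have q0 : (0 < size q)%N by rewrite size_poly_gt0 monic_neq0.
  have [f1|f1] := leqP (size f) 1.
    by move: mf; rewrite (size1_polyC f1) monicE lead_coefC => /eqP ->.
  have mfq : f * q \is monic by rewrite monicMl.
  have sfq : size (f * q) = (size f + size q).-1 by rewrite size_Mmonic // monic_neq0.
  case: (varpi_nunit varpi_unif); exists G`_(size (f * q)).-1.
  move: mfq; rewrite monicE /lead_coef => /eqP; rewrite {1}e expr0 coefD coefZ coef1 sfq.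
  have -> : ((size f + size q).-1.-1 == 0)%N = false by lia.
  by rewrite add0r.
have : exists z, f.[1] * q.[1] = varpi * z.
  exists G.[1]; have := congr1 (fun s : {poly R} => s.[1]) e.
  have X1 : ('X - 1 : {poly R}).[1] = 0 by rewrite !hornerE subrr.
  by rewrite /= hornerM => ->; rewrite hornerD horner_exp X1 hornerZ expr0n add0r.
case/(varpi_prime varpi_unif) => -[c ec].
  have [f' mf' ef] := strip1 mf ec.
  have [z ez] : exists z, f' * q - ('X - 1) ^+ D = varpi *: z.
    apply: (monic_pi (C := G - c *: q) (monicXsubC (1 : R))).
    have e2 : f' * ('X - 1) = f - varpi *: c%:P by rewrite ef addrK.
    rewrite mulrBl mulrAC e2 mulrBl e -exprSr -!mul_polyC; ring.
  have [|e' [G' eG]] := IHD f' q z mf' mq; first by rewrite -ez addrC subrK.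
  exists e'.+1, (G' * ('X - 1) + c%:P); rewrite ef eG exprSr scalerDr mulrDl -scalerAl addrA //.
have [q' mq' eq] := strip1 mq ec.
have [z ez] : exists z, f * q' - ('X - 1) ^+ D = varpi *: z.
  apply: (monic_pi (C := G - c *: f) (monicXsubC (1 : R))).
  have e2 : q' * ('X - 1) = q - varpi *: c%:P by rewrite eq addrK.
  rewrite mulrBl -mulrA e2 mulrBr e -exprSr -!mul_polyC; ring.
by apply: (IHD f q' z) => //; rewrite -ez addrC subrK.
Qed.

(** Gauss's lemma on Taylor expansions at 1: the product of the first coefficients not divisible by
    varpi is not divisible by it either. *)
Lemma pi_poly_prime A B C : A * B = varpi *: C ->
  (exists z, A = varpi *: z) \/ (exists z, B = varpi *: z).
Proof.
move=> e; apply: contrapT => /not_orP[nA nB].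
have [M [Q [S [_ eA nQ]]]] := taylor_nondiv nA.
have [M' [Q' [S' [_ eB nQ']]]] := taylor_nondiv nB.
have [z ez] : exists z, Q * Q' = varpi *: z.
  have m := monic_exp (M + M') (monicXsubC (1 : R)).
  apply: (monic_pi (C := C - S * (('X - 1) ^+ M' * Q') - (('X - 1) ^+ M * Q) * S' - varpi *: (S * S')) m).
  rewrite !scalerBr -e eA eB exprD -!mul_polyC; ring.
have : exists z, Q.[1] * Q'.[1] = varpi * z.
  by exists z.[1]; rewrite -hornerM ez hornerZ.
by case/(varpi_prime varpi_unif).
Qed.

Local Notation mp := (map_poly (val : R -> K)).
Lemma mp_inj : injective mp.
Proof. by apply: map_inj_poly; [exact: val_inj | exact: raddf0]. Qed.
Lemma mp_size A : size (mp A) = size A.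
Proof. by apply: size_map_inj_poly; [exact: val_inj | exact: raddf0]. Qed.
Lemma mp_monic A : (mp A \is monic) = (A \is monic).
Proof.
rewrite !monicE /lead_coef mp_size coef_map /=.
exact: (inj_eq val_inj _ 1).
Qed.

Lemma poly_denominator (f : {poly K}) : exists a A, val varpi ^+ a *: f = mp A.
Proof.
have /choice[a aP] : forall i, exists n, exists x : R, val varpi ^+ n * f`_i = val x.
  by move=> i; have [n [x e]] := K_denominator_varpi p_pr varpi_unif f`_i; exists n, x.
pose N := \max_(i < size f) a i; exists N.
have /choice[x xP] : forall i, exists x : R, val varpi ^+ N * f`_i = val x.
  move=> i; have [sf|fs] := leqP (size f) i.
    by exists 0; rewrite nth_default // mulr0 raddf0.
  have [x e] := aP i; exists (varpi ^+ (N - a i) * x).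
  have aN : (a i <= N)%N by have := leq_bigmax (F := fun i : 'I__ => a i) (Ordinal fs).
  by rewrite rmorphM rmorphXn /= -e mulrA -exprD subnK.
exists (\poly_(i < size f) x i); apply/polyP => i.
rewrite coefZ coef_map /= coef_poly; case: ltnP => // h.
by rewrite nth_default // mulr0.
Qed.

Lemma primitive_part (f : {poly K}) : f \is monic -> exists a A,
  val varpi ^+ a *: f = mp A /\ ~ exists z, A = varpi *: z.
Proof.
move=> mf; pose P a := `[< exists A, val varpi ^+ a *: f = mp A >].
have exP : exists a, P a by have [a hA] := poly_denominator f; exists a; apply/asboolP.
case: (ex_minnP exP) => -[|a] /asboolP[A e] mina.
  exists 0%N, A; split=> // -[z ez]; case: (varpi_nunit varpi_unif); exists z`_(size f).-1.
  apply: val_inj; rewrite rmorphM rmorph1 /=.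
  have := congr1 (fun q : {poly K} => q`_(size f).-1) e.
  rewrite expr0 scale1r ez coef_map /= coefZ -/(lead_coef f) (monicP mf) => ->; exact: erefl.
exists a.+1, A; split=> // -[z ez]; suff : P a by move/mina; rewrite ltnn.
apply/asboolP; exists z; apply: (scalerI (varpi_neq0 p_pr varpi_unif)).
by rewrite scalerA -exprS e ez map_polyZ.
Qed.

(** With minimal powers of varpi clearing the denominators, the product of the two factors becomes
    varpi^(a+b) F; primality of varpi among polynomials forces a + b = 0. *)
Lemma gauss_factor (f q : {poly K}) F D G : f \is monic -> F \is monic ->
  F = ('X - 1) ^+ D + varpi *: G -> f * q = mp F ->
  exists f', [/\ f' \is monic, f = mp f' & exists e G', f' = ('X - 1) ^+ e + varpi *: G'].
Proof.
move=> mf mF eF e.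
have mq : q \is monic by rewrite -(monicMl _ mf) e mp_monic.
have [a [A [eA nA]]] := primitive_part mf; have [b [B [eB nB]]] := primitive_part mq.
have eAB : A * B = varpi ^+ (a + b) *: F.
  have E1 : mp (A * B) = mp A * mp B := rmorphM _ _ _.
  have E2 : mp (varpi ^+ (a + b) *: F) = val (varpi ^+ (a + b)) *: mp F by exact: map_polyZ.
  have E3 : val (varpi ^+ (a + b)) = val varpi ^+ (a + b) by exact: rmorphXn.
  apply: mp_inj; rewrite E1 E2 E3 -eA -eB -e.
  by rewrite -scalerAl -scalerAr scalerA exprD.
have ab0 : (a + b = 0)%N.
  move: eAB; case: (a + b)%N => // k; rewrite exprS -scalerA.
  by case/pi_poly_prime => -[z ez]; [case: nA | case: nB]; exists z.
have [a0 b0] : a = 0%N /\ b = 0%N by lia.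
move: eA eB eAB; rewrite a0 b0 !expr0 !scale1r => eA eB eAB.
exists A; rewrite -mp_monic -eA; split=> //.
by apply: (distinguished_factor (q := B) (D := D) (G := G)); rewrite -?mp_monic -?eA -?eB // eAB.
Qed.

Let sR := valring_separated p_pr varpi_unif.
Let cR := valring_compact p_pr varpi_unif.
Let pip := varpi_p p_pr varpi_unif.

Lemma iw_div F (lam : iwfun) : F \is monic -> iwasawa lam -> exists2 r : {poly R},
  (size r < size F)%N & iwdvd (mk (fun=> F)) (lam - mk (fun=> r)).
Proof.
move=> mF lamI; have [UF [UU Ule]] := ultra_nat.
have [P cP ->] := iw_mk p_pr p_odd lamI.
by have [r [sr _ dr]] := iw_division p_pr p_odd cR sR UU Ule mF cP; exists r.
Qed.

Lemma iwdvdD (lam x y : iwfun) : iwasawa lam -> iwdvd lam x -> iwdvd lam y -> iwdvd lam (x + y).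
Proof.
move=> /(iw_mk p_pr p_odd)[L cL ->] [a /(iw_mk p_pr p_odd)[A cA ->] ->] [b /(iw_mk p_pr p_odd)[B cB ->] ->].
exists (mk (fun n => A n + B n)); first exact/mk_iwasawa/coherentD.
by rewrite !mkM mkD; apply: mk_eq => n; rewrite mulrDr.
Qed.
Lemma iwdvdM (lam x y : iwfun) : iwasawa lam -> iwasawa y -> iwdvd lam x -> iwdvd lam (iwmul x y).
Proof.
move=> /(iw_mk p_pr p_odd)[L cL ->] /(iw_mk p_pr p_odd)[Y cY ->] [a /(iw_mk p_pr p_odd)[A cA ->] ->].
exists (mk (fun n => A n * Y n)); first exact/mk_iwasawa/coherentM.
by rewrite !mkM; apply: mk_eq => n; rewrite mulrA.
Qed.
Lemma iwmulC (x y : iwfun) : iwasawa x -> iwasawa y -> iwmul x y = iwmul y x.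
Proof.
move=> /(iw_mk p_pr p_odd)[A cA ->] /(iw_mk p_pr p_odd)[B cB ->].
by rewrite !mkM; apply: mk_eq => n; rewrite mulrC.
Qed.
Lemma iwdvd_gen F A : iwdvd (mk (fun=> F)) (mk (fun=> F * A)).
Proof. by exists (mk (fun=> A)); [exact: mk_iwasawa | rewrite mkM]. Qed.
Lemma iwdvdN (lam x : iwfun) : iwasawa lam -> iwdvd lam x -> iwdvd lam (- x).
Proof.
move=> lamI h; have -> : - x = iwmul x (mk (fun=> -1)).
  case: h => a /(iw_mk p_pr p_odd)[A cA ->] ->.
  move: lamI => /(iw_mk p_pr p_odd)[L cL ->].
  rewrite !mkM -[LHS]add0r -(mk0 p_pr p_odd) mkB; apply: mk_eq => n.
  by rewrite mulrN1 sub0r.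
by apply: iwdvdM => //; apply: mk_iwasawa.
Qed.
Lemma iwasawaB (x y : iwfun) : iwasawa x -> iwasawa y -> iwasawa (x - y).
Proof.
move=> /(iw_mk p_pr p_odd)[A cA ->] /(iw_mk p_pr p_odd)[B cB ->].
by rewrite mkB; apply/mk_iwasawa/coherentB.
Qed.
Lemma iwasawaD (x y : iwfun) : iwasawa x -> iwasawa y -> iwasawa (x + y).
Proof.
move=> /(iw_mk p_pr p_odd)[A cA ->] /(iw_mk p_pr p_odd)[B cB ->].
by rewrite mkD; apply/mk_iwasawa/coherentD.
Qed.
Lemma iwasawaC (a : R) : iwasawa (iwconst a : iwfun).
Proof. by rewrite mkC; apply: mk_iwasawa. Qed.

Section Prime.
Variables (f : {poly R}) (E : nat) (G : {poly R}).
Hypotheses (mf : f \is monic) (fE : f = ('X - 1) ^+ E + varpi *: G).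

Lemma distinguished_exp k : exists G', f ^+ k = ('X - 1) ^+ (E * k) + varpi *: G'.
Proof.
elim: k => [|k [G' e]]; first by exists 0; rewrite !muln0 !expr0 scaler0 addr0.
exists (G * ('X - 1) ^+ (E * k) + f * G').
by rewrite exprS e mulnS exprD !fE -!mul_polyC; ring.
Qed.

Lemma iwsmall (r : {poly R}) : (size r < size f)%N -> iwdvd (mk (fun=> f)) (mk (fun=> r)) -> r = 0.
Proof. by apply: (iw_small0 sR pip mf fE). Qed.

(** Division by [f] replaces both elements by polynomials of smaller size. By uniqueness of
    remainders, divisibility of their product in the Iwasawa algebra is divisibility among
    polynomials, where irreducibility over [K] applies. *)
Lemma iwprime_mk : irreducible_poly (mp f) -> iwprime (mk (fun=> f)).
Proof.
move=> irf; have f1 : (1 < size f)%N by rewrite -mp_size irf.1.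
split.
- exact: mk_iwasawa.
- rewrite -(mk0 p_pr p_odd) => e; have := mk_inj (size f) e; rewrite !red_small ?size_poly0 //.
    by move=> f0; move: f1; rewrite f0 size_poly0.
  by apply/ltnW/ltn_expl/prime_gt1.
- rewrite mkC => /iwsmall; rewrite (leq_ltn_trans (size_polyC_leq1 _)) // => /(_ isT)/eqP.
  by rewrite polyC_eq0 oner_eq0.
move=> mu nu muI nuI d.
have [r sr dr] := iw_div mf muI; have [s ss ds] := iw_div mf nuI.
have fI : iwasawa (mk (fun=> f)) by apply: mk_iwasawa.
have rI (A : {poly R}) : iwasawa (mk (fun=> A)) by apply: mk_iwasawa.
have drs : iwdvd (mk (fun=> f)) (mk (fun=> r * s)).
  have -> : mk (fun=> r * s) = iwmul mu nu - iwmul (mu - mk (fun=> r)) nu - iwmul (nu - mk (fun=> s)) (mk (fun=> r)).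
    move: muI nuI => /(iw_mk p_pr p_odd)[A cA ->] /(iw_mk p_pr p_odd)[B cB ->].
    by rewrite !mkB !mkM !mkB; apply: mk_eq => n; congr red; ring.
  apply: iwdvdD => //; last by apply: iwdvdN => //; apply: iwdvdM.
  by apply: iwdvdD => //; apply: iwdvdN => //; apply: iwdvdM.
have r0 : rmodp (r * s) f = 0.
  apply: iwsmall; first by apply: Pdiv.CommonRing.ltn_rmodpN0; rewrite monic_neq0.
  have -> : mk (fun=> rmodp (r * s) f) = mk (fun=> r * s) - mk (fun=> f * rdivp (r * s) f).
    by rewrite mkB; apply: mk_eq => n; rewrite {2}(rdivp_eq mf (r * s)); congr red; ring.
  by apply: iwdvdD => //; apply: iwdvdN => //; apply: iwdvd_gen.
have ers := rdivp_eq mf (r * s); rewrite r0 addr0 in ers.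
have fdv : mp f %| mp r * mp s.
  have -> : mp r * mp s = mp (rdivp (r * s) f) * mp f.
    transitivity (mp (r * s)); first exact/esym/rmorphM.
    by rewrite {1}ers; exact: rmorphM.
  exact: dvdp_mulIr.
have small (t : {poly R}) : (size t < size f)%N -> mp f %| mp t -> t = 0.
  move=> st ft; apply: mp_inj; rewrite raddf0; apply/eqP/negPn/negP => t0.
  by have := dvdp_leq t0 ft; rewrite !mp_size leqNgt st.
have [fr|nfr] := boolP (mp f %| mp r); [left|right].
  by move: dr; rewrite (small r sr fr) mk0 subr0.
move: fdv; rewrite Gauss_dvdpr ?irreducible_poly_coprime // => fs.
by move: ds; rewrite (small s ss fs) mk0 subr0.
Qed.

Lemma pi_ndvd_mk : ~ iwdvd (iwconst varpi) (mk (fun=> f)).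
Proof.
rewrite mkC iwdvd_mk // => -[Q cQ e]; have := e (size f).
have sz : (size f <= p ^ size f)%N by apply/ltnW/ltn_expl/prime_gt1.
rewrite (red_small p_pr sz) mul_polyC (redZ p_pr).
move/(congr1 (fun q : {poly R} => q`_(size f).-1)); rewrite -lead_coefE (monicP mf) coefZ => e1.
by case: (varpi_nunit varpi_unif); exists (red p (size f) (Q (size f)))`_(size f).-1.
Qed.
End Prime.

Lemma poly_fin D N : exists ls : seq {poly R}, forall r : {poly R}, (size r <= D)%N ->
  exists2 c : {poly R}, c \in ls & (size c <= D)%N /\ exists z, r - c = varpi ^+ N *: z.
Proof.
have [ks kP] := residue_pow_finite p_pr varpi_unif N.
elim: D => [|D [ls lP]].
  exists [:: 0] => r; rewrite leqn0 size_poly_eq0 => /eqP ->.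
  by exists 0; [rewrite inE | split; [rewrite size_poly0 | exists 0; rewrite subrr scaler0]].
exists [seq c * 'X + a%:P | c <- ls, a <- ks] => r sr.
have er : r = (\poly_(i < D) r`_i.+1) * 'X + (r`_0)%:P.
  apply/polyP => i; rewrite coefD coefMX coefC; case: i => [|i] /=; first by rewrite add0r.
  rewrite addr0 coef_poly; case: ltnP => // Di; by rewrite nth_default // (leq_trans sr).
have [c cl [sc [z ez]]] := lP _ (size_poly D (fun i => r`_i.+1)).
have [a ak [y ey]] := kP r`_0.
exists (c * 'X + a%:P); first by apply/allpairsP; exists (c, a).
split.
  apply: leq_trans (size_polyD _ _) _; rewrite geq_max (leq_trans (size_polyC_leq1 _)) // andbT.
  have [->|c0] := eqVneq c 0; first by rewrite mul0r size_poly0.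
  by rewrite size_mulX.
exists (z * 'X + y%:P); rewrite scalerDr scalerAl -ez -mul_polyC -polyCM -ey polyCB.
by rewrite mulrBl {1}er; ring.
Qed.

(** Modulo varpi the ideal of lam^l contains a power of X - 1, which is monic; remainders modulo it
    have bounded size, and modulo varpi there are finitely many of them. *)
Lemma iw_fin (lam : iwfun) l : iwasawa lam -> ~ iwdvd (iwconst varpi) lam ->
  exists ls : seq iwfun, forall x, iwasawa x -> exists c y z,
   [/\ c \in ls, iwasawa y, iwasawa z & x - c = iwmul (iwconst varpi) y + iwmul (iwexp lam l) z].
Proof.
move=> lamI nd; have [UF [UU Ule]] := ultra_nat.
have [M [x0 [y0 [x0I y0I e0]]]] :=
  iw_pow_aug p_pr p_odd cR sR pip pi_unit pi_inj UU Ule lamI nd.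
have [x1 [y1 [x1I y1I e1]]] : exists x y, [/\ iwasawa x, iwasawa y &
    mk (fun=> ('X - 1) ^+ (M * l)) = iwmul (iwexp lam l) x + iwmul (iwconst varpi) y].
  move: lamI x0I y0I e0 => /(iw_mk p_pr p_odd)[L cL eL] /(iw_mk p_pr p_odd)[X cX ->] /(iw_mk p_pr p_odd)[Y cY ->].
  rewrite eL !mkC !mkX !mkM mkD => e0.
  elim: l => [|l [x1 [y1 [/(iw_mk p_pr p_odd)[X1 cX1 ->] /(iw_mk p_pr p_odd)[Y1 cY1 ->] e1]]]].
    exists (mk (fun=> 1)), (mk (fun=> 0)); split; [exact: mk_iwasawa|exact: mk_iwasawa|].
    by rewrite !mkM mkD; apply: mk_eq => n; rewrite muln0 !expr0 mulr1 mulr0 addr0.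
  have cE : coherent p (fun n => L n ^+ l).
    elim: (l) => [|k IHk]; first by move=> n m nm; rewrite !expr0.
    by have := coherentM p_pr cL IHk; move=> h n m /h; rewrite -!exprS.
  exists (mk (fun n => X n * X1 n)).
  exists (mk (fun n => L n * X n * Y1 n + Y n * (L n ^+ l * X1 n) + (varpi%:P * (Y n * Y1 n)))).
  split; first exact/mk_iwasawa/coherentM.
    apply/mk_iwasawa; apply: (coherentD p_pr); last first.
      by apply: (coherentM p_pr (P := fun=> varpi%:P)); [exact: coherentC | exact: coherentM].
    by apply: (coherentD p_pr); apply: (coherentM p_pr) => //; apply: (coherentM p_pr).
  rewrite !mkM mkD in e1; rewrite !mkM mkD; apply: mk_eq => n.
  have /(red_eq p_pr)[S eS] := mk_inj n e0; have /(red_eq p_pr)[S1 eS1] := mk_inj n e1.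
  apply/(red_eq p_pr); rewrite mulnS exprD eS eS1 exprS.
  exists (S * (L n ^+ l * X1 n + varpi%:P * Y1 n) + (L n * X n + varpi%:P * Y n) * S1 + S * S1 * omg p R n).
  by ring.
pose F : {poly R} := ('X - 1) ^+ (M * l).
have mF : F \is monic by apply: monic_exp; apply: monicXsubC.
have [ps pP] := poly_fin (size F).-1 1.
exists [seq mk (fun=> c) | c <- ps] => x xI.
have [r sr [nu nuI enu]] := iw_div mF xI.
have [|c cps [_ [z ez]]] := pP r.
  by rewrite -ltnS prednK // size_poly_gt0 monic_neq0.
exists (mk (fun=> c)), (mk (fun=> z) + iwmul y1 nu), (iwmul x1 nu); split.
- exact: map_f.
- by apply: iwasawaD; [exact: mk_iwasawa | exact: iwasawaM].
- exact: iwasawaM.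
have -> : x - mk (fun=> c) = mk (fun=> varpi *: z) + iwmul (iwmul (iwexp lam l) x1 + iwmul (iwconst varpi) y1) nu.
  have ez' : varpi *: z = r - c by rewrite ez expr1.
  rewrite ez' -e1 -/F -enu -mkB.
  by rewrite [RHS]addrC addrA subrK.
move: lamI x1I y1I nuI {e1 enu} => /(iw_mk p_pr p_odd)[L cL ->] /(iw_mk p_pr p_odd)[X1 cX ->] /(iw_mk p_pr p_odd)[Y1 cY ->] /(iw_mk p_pr p_odd)[N cN ->].
rewrite mkC mkX !mkM !mkD !mkM !mkD; apply: mk_eq => n; rewrite -mul_polyC; congr red; ring.
Qed.

End Valuation.
End IwasawaValuation.

(** * Primary decomposition of an endomorphism *)

Section Primary.
Variables (K : fieldType) (n' : nat) (g : 'M[K]_n'.+1).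
Implicit Types (f q N : {poly K}) (w : 'rV[K]_n'.+1).
Local Notation h := (horner_mx g).

Lemma irr_factor N : (1 < size N)%N ->
  exists f, [/\ f \is monic, irreducible_poly f & f %| N].
Proof.
have [k] := ubnP (size N); elim: k N => // k IHk N sN N1.
have N0 : N != 0 by rewrite -size_poly_gt0 (ltn_trans _ N1).
have lN : (lead_coef N)^-1 != 0 by rewrite invr_eq0 lead_coef_eq0.
have [iN|nN] := pselect (irreducible_poly N).
  exists ((lead_coef N)^-1 *: N); split.
  - by rewrite monicE lead_coefZ mulVf // lead_coef_eq0.
  - split; first by rewrite size_scale.
    move=> q q1 qN; rewrite (eqp_trans (apply_irredp iN q1 _)) //.
      by rewrite -(eqp_dvdr _ (eqp_scale _ lN)).
    by rewrite eqp_sym eqp_scale.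
  - by rewrite (eqp_dvdl _ (eqp_scale _ lN)).
have [q [q1 qN neq]] : exists q, [/\ size q != 1%N, q %| N & ~~ (q %= N)].
  apply: contrapT => hn; apply: nN; split=> // q q1 qN.
  by apply/negP => /negP nq; apply: hn; exists q.
have q0 : q != 0 by apply: contraNneq N0 => q0; move: qN; rewrite q0 dvd0p.
have sqN : (size q < size N)%N.
  rewrite ltn_neqAle dvdp_leq // andbT; apply: contra neq => /eqP e.
  by rewrite -dvdp_size_eqp // e.
have [||f [mf irf fq]] := IHk q; first by apply: leq_trans sqN _.
- by rewrite ltn_neqAle eq_sym q1 size_poly_gt0.
- by exists f; split=> //; apply: dvdp_trans fq qN.
Qed.

Lemma max_power f N : f \is monic -> (1 < size f)%N -> N != 0 ->
  exists l Q, N = f ^+ l * Q /\ ~~ (f %| Q).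
Proof.
move=> mf f1; have [k] := ubnP (size N); elim: k N => // k IHk N sN N0.
have [/dvdpP[Q e]|nd] := boolP (f %| N); last by exists 0%N, N; rewrite expr0 mul1r.
have Q0 : Q != 0 by apply: contraNneq N0; rewrite e => ->; rewrite mul0r.
have sQ : (size Q < k)%N.
  apply: leq_trans (_ : (size N <= k)%N); last by [].
  rewrite e size_Mmonic //; move: f1; case: (size f) => // m m0.
  by rewrite addnS /= -addn1 leq_add2l.
have [l [Q' [e' nd]]] := IHk Q sQ Q0; exists l.+1, Q'; split=> //.
by rewrite e e' exprS mulrC mulrA.
Qed.

Lemma hM p q : h (p * q) = h p *m h q. Proof. exact: rmorphM. Qed.
Lemma hD p q : h (p + q) = h p + h q. Proof. exact: raddfD. Qed.
Lemma h1 : h 1 = 1%:M. Proof. exact: rmorph1. Qed.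
Lemma hMC p q : h (p * q) = h q *m h p. Proof. by rewrite mulrC hM. Qed.
Lemma h_rV E (c : 'rV[K]_E) : h (rVpoly c) = \sum_(i < E) c 0 i *: g ^+ i.
Proof.
rewrite /rVpoly poly_def raddf_sum; apply: eq_bigr => i _ /=.
by rewrite valK horner_mxZ rmorphXn /= horner_mx_X.
Qed.

(** The annihilator of [w] is generated by f^(l+1): a smaller non-zero annihilator would, through
    Bezout, leave [w] killed by a lower power of [f]. *)
Lemma prim_indep f l w q : f \is monic -> irreducible_poly f ->
  w *m h (f ^+ l.+1) = 0 -> w *m h (f ^+ l) != 0 -> w *m h q = 0 ->
  (size q < size (f ^+ l.+1))%N -> q = 0.
Proof.
move=> mf irf w0 w1 wq sq; apply/eqP/negPn/negP => q0.
have [k [Q [e nd]]] := max_power mf irf.1 q0.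
have kl : (k <= l)%N.
  rewrite leqNgt; apply/negP => lk.
  have : (size (f ^+ l.+1) <= size q)%N.
    by apply: dvdp_leq => //; rewrite e dvdp_mulr // dvdp_exp2l.
  by rewrite leqNgt sq.
have /Bezout_eq1_coprimepP[[a b] /= ab] : coprimep Q (f ^+ l.+1).
  by rewrite coprimep_expr // coprimep_sym irreducible_poly_coprime.
have : w *m h (f ^+ k) = 0.
  have -> : f ^+ k = q * a + f ^+ l.+1 * (b * f ^+ k).
    by rewrite e -[f ^+ k in LHS]mulr1 -ab; ring.
  by rewrite hD mulmxDr !hM !mulmxA wq w0 !mul0mx addr0.
move=> wk; case/eqP: w1; rewrite -(subnKC kl) exprD hM mulmxA wk mul0mx //.
Qed.

(** A cyclic summand (f, l, w): the generator [w], annihilated by f^l. *)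
Definition cyc := ({poly K} * nat * 'rV[K]_n'.+1)%type.
Definition cyc_poly (t : cyc) := t.1.1 ^+ t.1.2.
Definition cyc_ok (U : 'M[K]_n'.+1) (t : cyc) := [/\ t.1.1 \is monic,
  irreducible_poly t.1.1, t.2 != 0, (t.2 <= U)%MS & t.2 *m h (cyc_poly t) = 0].

(** Induction on the rank. The conclusion has the form needed for duality: the rank bound takes the
    place of independence of the summands, and spanning is tested by functionals [phi] that vanish
    on all translates of the generators. *)
Lemma primary_decomp (U : 'M[K]_n'.+1) : stablemx U g -> exists s : seq cyc,
  [/\ forall t, t \in s -> cyc_ok U t,
    (\sum_(t <- s) (size (cyc_poly t)).-1 <= \rank U)%N &
    forall (u : 'rV_n'.+1) (phi : 'cV_n'.+1), (u <= U)%MS ->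
      (forall t i, t \in s -> t.2 *m g ^+ i *m phi = 0) -> u *m phi = 0].
Proof.
have [k] := ubnP (\rank U); elim: k U => // k IHk U rU sU.
have [U0|U0] := eqVneq U 0.
  exists [::]; split=> //; first by rewrite big_nil.
  by move=> u phi; rewrite U0 submx0 => /eqP-> _; rewrite mul0mx.
(* The least size of a non-zero annihilator of [U]; the polynomial [N] attaining it is a minimal
   polynomial of [g] on [U]. *)
pose P k := `[< exists N, [/\ N != 0, size N = k & U *m h N = 0] >].
have exP : exists k, P k.
  exists (size (char_poly g)); apply/asboolP; exists (char_poly g).
  by rewrite monic_neq0 ?char_poly_monic // Cayley_Hamilton mulmx0.
case: (ex_minnP exP) => m /asboolP[N [N0 sN UN]] minN.
have minN' q : q != 0 -> (size q < size N)%N -> U *m h q != 0.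
  move=> q0 sq; apply/eqP => Uq; have := minN (size q).
  by rewrite leqNgt -sN sq => /implyP; rewrite implybF => /negP; apply; apply/asboolP; exists q.
have N1 : (1 < size N)%N.
  rewrite ltn_neqAle size_poly_gt0 N0 andbT eq_sym; apply/negP => /size_poly1P[c c0 e].
  move: UN; rewrite e horner_mx_C mul_mx_scalar => /eqP.
  by rewrite scaler_eq0 (negPf c0) (negPf U0).
have [f [mf irf fN]] := irr_factor N1.
have [l [Q [eN nfQ]]] := max_power mf irf.1 N0.
have Q0 : Q != 0 by apply: contraNneq N0; rewrite eN => ->; rewrite mulr0.
have fX0 i : f ^+ i != 0 by rewrite expf_neq0 // monic_neq0.
case: l eN => [|l] eN; first by case/negP: nfQ; move: fN; rewrite eN mul1r.
have fX1 : (1 < size (f ^+ l.+1))%N.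
  by rewrite -[size _](prednK (_ : 0 < _)%N) ?size_poly_gt0 // ltnS size_exp muln_gt0 andbT -subn1 subn_gt0 irf.1.
have rowU (B : 'M_n'.+1) u : (u <= U)%MS -> U *m B = 0 -> u *m B = 0 :> 'rV_n'.+1.
  by move=> /submxP[D ->] UB; rewrite -mulmxA UB mulmx0.
have stU q (u : 'rV_n'.+1) : (u <= U)%MS -> (u *m h q <= U)%MS.
  by move=> uU; apply: submx_trans (submxMr _ uU) (horner_mx_stable q sU).
have [Q1|Q1] := ltnP 1 (size Q).
  have /Bezout_eq1_coprimepP[[a b] /= ab] : coprimep Q (f ^+ l.+1).
    by rewrite coprimep_expr // coprimep_sym irreducible_poly_coprime.
  (* [N] has two coprime factors, and [U] is the direct sum of their kernels. *)
  pose V q := (U :&: kermx (h q))%MS.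
  have VP q (u : 'rV_n'.+1) : (u <= V q)%MS = (u <= U)%MS && (u *m h q == 0).
    by rewrite sub_capmx; congr (_ && _); apply/sub_kermxP/eqP.
  have stV q : stablemx (V q) g.
    apply/row_subP=> i; rewrite row_mul; have : (row i (V q) <= V q)%MS := row_sub _ _.
    rewrite !VP => /andP[uU /eqP u0]; apply/andP; split.
      by have := stU 'X _ uU; rewrite horner_mx_X.
    by rewrite -mulmxA -{1}(horner_mx_X g) -hMC hM mulmxA u0 mul0mx.
  have ltV q : q != 0 -> (size q < size N)%N -> (\rank (V q) < k)%N.
    move=> q0 sq; apply: leq_trans (_ : (\rank U <= k)%N) => //.
    rewrite ltn_neqAle mxrankS ?capmxSl // andbT.
    rewrite (mxrank_leqif_sup (capmxSl U (kermx (h q)))).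
    apply/negP; rewrite sub_capmx => /andP[_ /sub_kermxP e].
    by have := minN' _ q0 sq; rewrite e eqxx.
  have sN' : size N = (size (f ^+ l.+1) + size Q).-1 by rewrite eN size_mul.
  have s1 : (size (f ^+ l.+1) < size N)%N by rewrite sN'; lia.
  have s2 : (size Q < size N)%N by rewrite sN'; lia.
  have [s [s1P s1r s1s]] := IHk _ (ltV _ (fX0 _) s1) (stV _).
  have [t [t1P t1r t1s]] := IHk _ (ltV _ Q0 s2) (stV _).
  exists (s ++ t); split.
  - move=> c; rewrite mem_cat => /orP[/s1P|/t1P] [? ? ? cV ?]; split=> //;
      by apply: submx_trans cV (capmxSl _ _).
  - rewrite big_cat /=; apply: leq_trans (leq_add s1r t1r) _.
    rewrite -mxrank_sum_cap; set W := (V _ :&: V _)%MS.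
    have -> : W = 0.
      apply/eqP; rewrite -submx0; apply/row_subP => i; rewrite submx0.
      have : (row i W <= W)%MS := row_sub _ _.
      rewrite sub_capmx !VP => /andP[/andP[_ /eqP u1] /andP[_ /eqP u2]].
      rewrite -[row i W]mulmx1 -h1 -ab hD mulmxDr !hMC !mulmxA u1 u2.
      by rewrite !mul0mx addr0.
    by rewrite mxrank0 addn0 mxrankS // addsmx_sub !capmxSl.
  - move=> u phi uU hphi.
    have e : u = u *m h (a * Q) + u *m h (b * f ^+ l.+1).
      by rewrite -mulmxDr -hD ab h1 mulmx1.
    rewrite e mulmxDl (s1s (u *m h (a * Q))) ?(t1s (u *m h (b * f ^+ l.+1))) ?addr0 //.
    + rewrite VP stU //= -mulmxA -hM (_ : _ * Q = N * b); last by rewrite eN; ring.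
      by rewrite hM mulmxA (rowU (h N)) // mul0mx.
    + by move=> c i cs; apply: hphi; rewrite mem_cat cs orbT.
    + rewrite VP stU //= -mulmxA -hM (_ : _ * f ^+ l.+1 = N * a); last by rewrite eN; ring.
      by rewrite hM mulmxA (rowU (h N)) // mul0mx.
    + by move=> c i cs; apply: hphi; rewrite mem_cat cs.
have {Q1} /eqP/size_poly1P[c c0 eQ] : size Q = 1%N.
  by apply/eqP; rewrite eqn_leq Q1 size_poly_gt0.
set F := f ^+ l.+1 in fX1 eN.
have UF : U *m h F = 0.
  have := UN; rewrite eN eQ mulrC mul_polyC horner_mxZ -scalemxAr => /eqP.
  by rewrite scaler_eq0 (negPf c0) => /eqP.
have UF1 : U *m h (f ^+ l) != 0.
  apply: minN'; first by [].
  rewrite eN eQ mulrC mul_polyC size_scale // /F exprS (size_mul (monic_neq0 mf) (fX0 l)).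
  have f2 : (1 < size f)%N := irf.1.
  by case: (size f) f2 => [|[|b]] // _; rewrite !addSn /= ltnS leq_addl.
have [i0 w1] : exists i, row i U *m h (f ^+ l) != 0.
  apply: contrapT => /forallNP hn; case/eqP: UF1; apply/row_matrixP => i.
  by rewrite row_mul row0; apply/eqP/negPn/negP/hn.
set w := row i0 U in w1.
have wU : (w <= U)%MS := row_sub _ _.
have wF : w *m h F = 0 := rowU _ _ wU UF.
pose E' := (size F).-2; have sF : size F = E'.+2 by rewrite /E'; move: fX1; case: size => // -[].
pose W := \matrix_(i < E'.+1) (w *m g ^+ i).
have cW (c1 : 'rV_E'.+1) : c1 *m W = w *m h (rVpoly c1).
  rewrite mulmx_sum_row h_rV mulmx_sumr; apply: eq_bigr => i _.
  by rewrite rowK scalemxAr.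
have srV (c1 : 'rV[K]_E'.+1) : (size (rVpoly c1) < size F)%N by rewrite sF ltnS size_poly.
have [B WB] : exists B, W *m B = 1%:M.
  apply/row_freeP; rewrite -kermx_eq0; apply/eqP/row_matrixP => i; rewrite row0.
  set c1 := row i _; have : c1 *m W = 0 by apply/sub_kermxP/row_sub.
  rewrite cW => /(prim_indep mf irf wF w1)/(_ (srV _)) e.
  by rewrite -[c1]rVpolyK e linear0.
(* Here [N] is a power of [f] up to a constant, and [w] has it as annihilator. [phi] reads the
   coefficient of the highest power of [g] in the cyclic space of [w]; its translates by powers of
   [g] will cut out a stable complement of that space. *)
pose phi := col ord_max B.
have cWphi (c1 : 'rV_E'.+1) : (c1 *m W *m phi) 0 0 = c1 0 ord_max.
  by rewrite /phi colE -mulmxA (mulmxA W) WB mul1mx -colE mxE.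
pose Phi := \matrix_(i < n'.+1, j < E'.+1) (g ^+ j *m phi) i 0.
have uPhi m1 (u : 'M_(m1, n'.+1)) i j : (u *m Phi) i j = (u *m g ^+ j *m phi) i 0.
  by rewrite -mulmxA !mxE; apply: eq_bigr => z _; rewrite mxE.
pose T := W *m Phi.
have Tunit : T \in unitmx.
  rewrite -row_free_unit -kermx_eq0; apply/eqP/row_matrixP => i; rewrite row0.
  set c1 := row i _; have c1T : c1 *m T = 0 by apply/sub_kermxP/row_sub.
  apply/eqP/negPn/negP => c10; pose q := rVpoly c1.
  have q0 : q != 0 by apply: contraNneq c10 => q0; rewrite -[c1]rVpolyK -/q q0 linear0.
  have sq : (size q <= E'.+1)%N by rewrite size_poly.
  (* Multiplication of [q] by this power of X moves its leading coefficient to the coordinate read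
     by [phi]. *)
  have jP : (E'.+1 - size q < E'.+1)%N by rewrite ltn_subrL size_poly_gt0 q0.
  have sqX : size (q * 'X^(E'.+1 - size q)) = E'.+1.
    by rewrite size_mulXn // subnK.
  have : (c1 *m T) 0 (Ordinal jP) = 0 by rewrite c1T mxE.
  rewrite mulmxA uPhi cW -/q /=.
  have -> : g ^+ (E'.+1 - size q) = h 'X^(E'.+1 - size q) by rewrite rmorphXn /= horner_mx_X.
  rewrite -(mulmxA w) -hM -[_ * 'X^_](@poly_rV_K _ E'.+1) ?sqX // -cW cWphi mxE /=.
  have := lead_coef_Mmonic q (monicXn K (E'.+1 - size q)); rewrite /lead_coef sqX /= => -> /eqP.
  by rewrite -/(lead_coef q) lead_coef_eq0 (negPf q0).
pose U' := (U :&: kermx Phi)%MS.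
have U'P (u : 'rV_n'.+1) : (u <= U')%MS = (u <= U)%MS && (u *m Phi == 0).
  by rewrite sub_capmx; congr (_ && _); apply/sub_kermxP/eqP.
have U'h (u : 'rV_n'.+1) q : (u <= U')%MS -> u *m h q *m phi = 0.
  rewrite U'P => /andP[uU /eqP u0].
  rewrite (divp_eq q F) hD mulmxDr hMC mulmxA (rowU (h F)) // mul0mx add0r.
  rewrite -[q %% F](@poly_rV_K _ E'.+1); last by rewrite -ltnS -sF ltn_modp monic_neq0 // monic_exp.
  rewrite h_rV mulmx_sumr mulmx_suml big1 // => i _.
  rewrite -scalemxAr -scalemxAl; apply/eqP; rewrite scaler_eq0; apply/orP; right.
  have e : (u *m Phi) 0 i = 0 by rewrite u0 mxE.
  rewrite uPhi in e.
  by apply/eqP/matrixP => a b; rewrite !ord1 e mxE.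
have stU' : stablemx U' g.
  apply/row_subP=> i; rewrite row_mul; have uU' : (row i U' <= U')%MS := row_sub _ _.
  have := uU'; rewrite !U'P => /andP[uU _]; apply/andP; split.
    by have := stU 'X _ uU; rewrite horner_mx_X.
  apply/eqP/matrixP => a j; rewrite uPhi -(mulmxA (row i U')).
  have -> : g *m g ^+ j = h ('X * 'X^j) by rewrite hM rmorphXn /= horner_mx_X.
  by rewrite U'h // !mxE.
have WU : (W <= U)%MS.
  apply/row_subP => i; rewrite rowK.
  have -> : g ^+ i = h 'X^i by rewrite rmorphXn /= horner_mx_X.
  exact: stU.
have rUP : \rank (U *m Phi) = E'.+1.
  apply/eqP; rewrite eqn_leq rank_leq_col /=.
  have : (\rank T <= \rank (U *m Phi))%N by rewrite mxrankS // submxMr.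
  by rewrite mxrank_unit.
have rU' : (E'.+1 + \rank U')%N = \rank U by rewrite -rUP mxrank_mul_ker.
have [|s [sP sr ss]] := IHk U' _ stU'.
  by move: rU; rewrite -rU' addSn ltnS; apply: leq_trans; rewrite ltnS leq_addl.
exists ((f, l.+1, w) :: s); split.
- move=> t; rewrite inE => /orP[/eqP->|/sP[? ? ? tU' ?]].
    split=> //=; by apply: contraNneq w1 => ->; rewrite mul0mx.
  by split=> //; apply: submx_trans tU' (capmxSl _ _).
- by rewrite big_cons -rU' leq_add // /cyc_poly /= -/F sF.
- move=> u phi1 uU hp.
  pose c1 := u *m Phi *m invmx T.
  have u'U : (u - c1 *m W <= U')%MS.
    have e : c1 *m W *m Phi = u *m Phi by rewrite -mulmxA -/T /c1 mulmxKV.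
    rewrite U'P mulmxBl e subrr eqxx andbT.
    by rewrite addmx_sub // eqmx_opp (submx_trans (submxMl _ _) WU).
  rewrite -[u](subrK (c1 *m W)) mulmxDl (ss _ _ u'U) ?add0r.
    rewrite cW h_rV mulmx_sumr mulmx_suml big1 // => i _.
    rewrite -scalemxAr -scalemxAl (hp (f, l.+1, w)) ?scaler0 //.
    by rewrite inE eqxx.
  by move=> t i ts; apply: hp; rewrite inE ts orbT.
Qed.

End Primary.

(** * Duals of discrete modules and vanishing of mu *)

Section Quotients.
Local Open Scope quotient_scope.

(** * Extension of homomorphisms into a divisible group *)

Section Baer.
Variables (V T : zmodType).
Hypothesis T_div : forall n (t : T), (0 < n)%N -> exists s, s *+ n = t.

(** Partial homomorphisms are represented by their graphs, so that inclusion is the order for Zorn's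
    lemma. *)
Definition graph (G : set (V * T)) := [/\ G 0, forall a b, G a -> G b -> G (a - b) &
  forall t, G (0, t) -> t = 0].

Lemma graphN G a : graph G -> G a -> G (- a).
Proof. by move=> [G0 GB _] Ga; rewrite -sub0r; apply: GB. Qed.
Lemma graphD G a b : graph G -> G a -> G b -> G (a + b).
Proof. by move=> gG Ga Gb; rewrite -[b]opprK; case: (gG) => _ GB _; apply: GB => //; apply: graphN. Qed.
Lemma graphMn G a n : graph G -> G a -> G (a *+ n).
Proof.
move=> gG Ga; elim: n => [|n IHn]; first by rewrite mulr0n; case: gG.
by rewrite mulrSr; apply: graphD.
Qed.

Lemma graph_fun G v t t' : graph G -> G (v, t) -> G (v, t') -> t = t'.
Proof.
move=> [_ GB G1] Gt Gt'; apply/eqP; rewrite -subr_eq0; apply/eqP/G1.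
by have := GB _ _ Gt Gt'; rewrite -[(v, t) - _]/(v - v, t - t') subrr.
Qed.

(** If some positive multiple of [v] is in the domain, the least one generates them all; its value,
    divided by m in [T], is compatible at [v]. Otherwise 0 will do. *)
Lemma graph_value G v : graph G -> exists s, forall n t, (0 < n)%N -> G (v *+ n, t) -> t = s *+ n.
Proof.
move=> gG; have [G0 GB G1] := gG.
pose P n := `[< (0 < n)%N /\ exists t, G (v *+ n, t) >].
have [[n Pn]|nP] := pselect (exists n, P n); last first.
  by exists 0 => n t n0 Gt; case: nP; exists n; apply/asboolP; split=> //; exists t.
case: (ex_minnP (ex_intro _ n Pn)) => m /asboolP[m0 [t0 Gt0]] minm.
have [s es] := T_div t0 m0; exists s => k t k0 Gt.
have Gq := graphMn (k %/ m) gG Gt0; rewrite pairMnE /= in Gq.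
have ek : v *+ k = v *+ m *+ (k %/ m) + v *+ (k %% m).
  by rewrite -mulrnA -mulrnDr mulnC -divn_eq.
have Gr : G (v *+ (k %% m), t - t0 *+ (k %/ m)).
  by have := GB _ _ Gt Gq; rewrite -[(_, _) - _]/(v *+ k - _, t - _) ek addrC addrA addNr add0r.
have r0 : (k %% m = 0)%N.
  apply/eqP; rewrite -leqn0 leqNgt; apply/negP => r0.
  have : P (k %% m)%N by apply/asboolP; split=> //; exists (t - t0 *+ (k %/ m)).
  by move/minm; rewrite leqNgt ltn_mod m0.
rewrite r0 mulr0n in Gr; move/G1/eqP: Gr; rewrite subr_eq0 => /eqP->.
by rewrite -es -mulrnA; congr (_ *+ _); rewrite {2}(divn_eq k m) r0 addn0 mulnC.
Qed.

Lemma baer (G0 : set (V * T)) : graph G0 -> exists psi : V -> T,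
  (forall u v, psi (u + v) = psi u + psi v) /\ forall v t, G0 (v, t) -> psi v = t.
Proof.
move=> gG0.
pose Tp := {G : set (V * T) | graph G /\ G0 `<=` G}.
pose Rr (a b : Tp) := `[< sval a `<=` sval b >].
have [|a b c /asboolP ab /asboolP bc|a b /asboolP ab /asboolP ba|A totA|[G [gG G0G]] Gmax] := @Zorn Tp Rr.
- by move=> t; apply/asboolP.
- by apply/asboolP => x /ab /bc.
- case: a b ab ba => [a ha] [b hb] /= ab ba.
  have e : a = b by apply/seteqP.
  by subst b; congr exist; apply: Prop_irrelevance.
- have [[a0 Aa0]|nA] := pselect (exists a, A a); last first.
    by exists (exist _ G0 (conj gG0 (fun _ h => h))) => s As; case: nA; exists s.
  pose B := [set x | exists2 a, A a & sval a x].
  have gB : graph B /\ G0 `<=` B.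
    split; last by move=> x G0x; exists a0 => //; apply: (svalP a0).2.
    split.
    + by exists a0 => //; case: (svalP a0) => -[].
    + move=> x y [a Aa ax] [b Ab bY].
      have [/asboolP ab|/asboolP ba] := totA _ _ Aa Ab.
        by exists b => //; case: (svalP b) => -[_ h _] _; apply: h => //; apply: ab.
      by exists a => //; case: (svalP a) => -[_ h _] _; apply: h => //; apply: ba.
    + by move=> t [a Aa]; case: (svalP a) => -[_ _ h] _ /h.
  by exists (exist _ B gB) => s As; apply/asboolP => x sx; exists s.
have tot v : exists t, G (v, t).
  have [s sP] := graph_value v gG; exists s.
  pose e : V * T := (v, s).
  (* The subgroup generated by [G] and (v, s); a difference of two natural multiples stands for an
     integer multiple. *)
  pose G' := [set x | exists m n : nat, G (x - e *+ m + e *+ n)].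
  have GG' : G `<=` G' by move=> x Gx; exists 0%N, 0%N; rewrite !mulr0n subr0 addr0.
  have gG' : graph G'.
    have [g0 gB g1] := gG; split.
    + exact: GG'.
    + move=> a b [m [n h]] [m' [n' h']]; exists (m + n')%N, (n + m')%N.
      have := gB _ _ h h'; rewrite !mulrnDr; congr G.
      move: (e *+ m) (e *+ n) (e *+ m') (e *+ n') => x y z w.
      rewrite !opprD !opprK -!addrA; congr (_ + _); rewrite [RHS]addrCA; congr (_ + _).
      by rewrite [LHS]addrCA; congr (_ + _); rewrite addrA [RHS]addrC.
    + move=> t [m [n]]; rewrite !pairMnE /= => h.
      have {}h : G (v *+ n - v *+ m, t + (s *+ n - s *+ m)).
        move: h; rewrite -[_ - _ + _]/(0 - v *+ m + v *+ n, t - s *+ m + s *+ n).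
        by rewrite sub0r [- _ + _]addrC -addrA [- (s *+ m) + _]addrC.
      have [mn|nm] := leqP m n.
        rewrite -!mulrnBr // in h; case: (posnP (n - m)%N) => [e0|n0].
          by move: h; rewrite e0 !mulr0n addr0 => /g1.
        by have := sP _ _ n0 h => /eqP; rewrite -subr_eq0 addrK => /eqP.
      have := graphN gG h; rewrite -[- (_, _)]/(- (v *+ n - v *+ m), - (t + (s *+ n - s *+ m))).
      rewrite opprB opprD opprB -!mulrnBr ?(ltnW nm) // => h'.
      have n0 : (0 < m - n)%N by rewrite subn_gt0.
      have := sP _ _ n0 h' => /eqP; rewrite -subr_eq0 addrK oppr_eq0 => /eqP //.
  have := Gmax (exist _ G' (conj gG' (subset_trans G0G GG'))) (introT (asboolP _) GG').
  move=> /(congr1 sval) /= eG; rewrite -eG; exists 1%N, 0%N.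
  by rewrite mulr1n mulr0n addr0 subrr; have [] := gG.
have /choice[psi psiP] := tot; exists psi; split=> [u v|v t G0t].
  apply: (graph_fun gG (psiP _)).
  by have := graphD gG (psiP u) (psiP v).
exact: (graph_fun gG (psiP v) (G0G _ G0t)).
Qed.

End Baer.

Section PadicQuot.
Variables (p : nat) (Qp : padicField p).
Hypothesis p_pr : prime p.
Local Notation T := (padic_quot Qp).

Definition qproj (x : Qp) : T := \pi_({ideal_quot (@padic_int_pred p Qp)}) x.
Lemma qprojD x y : qproj (x + y) = qproj x + qproj y.
Proof. by rewrite /qproj raddfD. Qed.
Lemma qproj_repr (t : T) : qproj (repr t) = t. Proof. exact: reprK. Qed.
Lemma qproj_eq x y : (qproj x == qproj y) = (pabs (x - y) <= 1).
Proof.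
rewrite -[RHS]/(x - y \in @padic_int_pred p Qp).
by rewrite -Quotient.equivE -Quotient.idealrBE.
Qed.
Lemma qproj0 : qproj 0 = 0.
Proof. by apply: (@addIr _ (qproj 0)); rewrite -qprojD !add0r. Qed.
Lemma qprojMn x n : qproj (x *+ n) = qproj x *+ n.
Proof. by elim: n => [|n IHn]; rewrite ?mulr0n ?qproj0 // !mulrS qprojD IHn. Qed.

Lemma divMn (x : Qp) n : n%:R != 0 :> Qp -> (x / n%:R) *+ n = x.
Proof. by move=> n0; rewrite -[LHS]mulr_natr mulfVK. Qed.

Lemma pq_div n (t : T) : (0 < n)%N -> exists s, s *+ n = t.
Proof.
move=> n0; exists (qproj (repr t / n%:R)); rewrite -qprojMn divMn ?qproj_repr //.
by rewrite padic_nat_eq0 // -lt0n.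
Qed.

Lemma pq_torsion : exists L : seq T, forall t, t *+ p = 0 -> t \in L.
Proof.
exists [seq qproj (c%:R / p%:R) | c <- seq.iota 0 p] => t; rewrite -[t]qproj_repr -qprojMn.
set x := repr t => /eqP; rewrite -qproj0 qproj_eq subr0 => xp.
have [c cp xc] := padic_approx p_pr 1 xp.
apply/mapP; exists c; first by rewrite mem_iota add0n -(expn1 p).
apply/eqP; rewrite qproj_eq.
have p0 := p_neq0 Qp p_pr.
have -> : x - c%:R / p%:R = (x *+ p - c%:R) / p%:R by rewrite mulrBl -[x *+ p]mulr_natr mulfK.
rewrite pabsM pabsV // pabs_p invrK; rewrite expr1 in xc.
by rewrite -ler_pdivlMr ?ltr0n ?prime_gt0 // mul1r.
Qed.

Lemma pq_nonzero : exists2 t : T, t != 0 & t *+ p = 0.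
Proof.
have p0 := p_neq0 Qp p_pr.
exists (qproj p%:R^-1).
  rewrite -qproj0 qproj_eq subr0 pabsV // pabs_p invrK -ltNge.
  by rewrite ltr1n prime_gt1.
rewrite -qprojMn -[p%:R^-1]mul1r divMn //; apply/eqP; rewrite -qproj0 qproj_eq subr0.
by rewrite pabs1.
Qed.
End PadicQuot.

Lemma finite_quotient (V : zmodType) (Z N : set V) (ls : seq V) :
  N 0 -> (forall a b, N a -> N b -> N (a - b)) ->
  (forall z, Z z -> exists2 c, c \in ls & N (z - c)) -> finite_set (quotient_set Z N).
Proof.
move=> N0 NB h; apply: (@sub_finite_set _ _ [set` [seq [set z | N (z - c)] | c <- ls]]); last exact: finite_seq.
move=> _ [x Zx <-]; have [c cl Nxc] := h x Zx; apply/mapP; exists c => //.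
apply/seteqP; split=> z /= Nz.
  have -> : z - c = (z - x) - (0 - (x - c)) by rewrite sub0r opprK addrA subrK.
  by apply: (NB _ _) => //; apply: (NB _ _).
have -> : z - x = (z - c) - (x - c) by rewrite opprB addrA subrK.
exact: NB.
Qed.

Lemma quotient_reps (V : zmodType) (Z N : set V) : N 0 -> finite_set (quotient_set Z N) ->
  exists ls : seq V, (forall c, c \in ls -> Z c) /\
   forall z, Z z -> exists2 c, c \in ls & N (z - c).
Proof.
move=> N0 /finite_seqP[s es].
have [|ts [tZ tP]] := @finite_reps V (set V) Z (fun x => [set z | N (z - x)]) s.
  move=> t Zt; have : quotient_set Z N [set z | N (z - t)] by exists t.
  by rewrite es.
exists ts; split=> // z Zz; have [c ct e] := tP z Zz; exists c => //.
have : [set y | N (y - z)] z by rewrite /= subrr.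
by rewrite e.
Qed.

Section Congruence.
Variables (G : zmodType) (D : set G).
Hypotheses (D0 : D 0) (DB : forall a b, D a -> D b -> D (a - b)).
Definition eqm a b := D (a - b).
Lemma eqm_refl a : eqm a a. Proof. by rewrite /eqm subrr. Qed.
Lemma eqm_sym a b : eqm a b -> eqm b a.
Proof. by move=> h; rewrite /eqm -opprB -sub0r; apply: (DB _ _). Qed.
Lemma eqm_sub a b c d : eqm a b -> eqm c d -> eqm (a - c) (b - d).
Proof.
move=> ab cd; rewrite /eqm (_ : _ - _ = (a - b) - (c - d)); first exact: (DB _ _).
by rewrite !opprB [d - b]addrC addrACA [- c + d]addrC.
Qed.
Lemma eqm_opp a b : eqm a b -> eqm (- a) (- b).
Proof. by move=> h; rewrite -[- a]sub0r -[- b]sub0r; apply: eqm_sub => //; apply: eqm_refl. Qed.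
Lemma eqm_add a b c d : eqm a b -> eqm c d -> eqm (a + c) (b + d).
Proof. by move=> ab cd; rewrite -[c]opprK -[d]opprK; apply: eqm_sub => //; apply: eqm_opp. Qed.
Lemma eqm_trans b a c : eqm a b -> eqm b c -> eqm a c.
Proof.
move=> ab bc; rewrite /eqm (_ : a - c = (a - b) - (c - b)); last by rewrite opprB addrA subrK.
by apply: (DB _ _) => //; apply: eqm_sym.
Qed.
Lemma eqm0 a : D a <-> eqm a 0. Proof. by rewrite /eqm subr0. Qed.
Lemma eqm_sum I (r : seq I) (F F' : I -> G) : (forall i, eqm (F i) (F' i)) ->
  eqm (\sum_(i <- r) F i) (\sum_(i <- r) F' i).
Proof.
move=> h; elim: r => [|i r IHr]; first by rewrite !big_nil; apply: eqm_refl.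
by rewrite !big_cons; apply: eqm_add.
Qed.
End Congruence.

(** [A] need not have decidable equality, so representatives are designated by positions in a
    list. *)
Lemma fin_prod (I : finType) (A : Type) (a0 : A) (Pr : I -> A -> Prop) (Q : I -> A -> A -> Prop) :
  (forall i, exists L : seq A, forall x, Pr i x -> exists2 k, (k < size L)%N & Q i x (nth a0 L k)) ->
  exists L : seq (I -> A), forall v, (forall i, Pr i (v i)) ->
    exists2 k, (k < size L)%N & forall i, Q i (v i) (nth (fun=> a0) L k i).
Proof.
move=> /choice[L LP]; pose m := \max_i size (L i).
pose mkf (g : {ffun I -> 'I_m.+1}) := fun i => nth a0 (L i) (g i).
exists [seq mkf g | g <- enum {ffun I -> 'I_m.+1}] => v vP.
have /choice[k kP] : forall i, exists k : 'I_m.+1, Q i (v i) (nth a0 (L i) k).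
  move=> i; have [k kl Qk] := LP i _ (vP i).
  have km : (k < m.+1)%N by rewrite ltnS (leq_trans (ltnW kl)) // leq_bigmax.
  by exists (Ordinal km).
pose g := [ffun i => k i]; exists (index g (enum {ffun I -> 'I_m.+1})).
  by rewrite size_map index_mem mem_enum.
move=> i; rewrite (nth_map g) ?index_mem ?mem_enum // nth_index ?mem_enum //.
by rewrite /mkf ffunE.
Qed.

Lemma fin_seqs (A : eqType) (L : seq A) n : exists LL : seq (seq A),
  forall s, size s = n -> (forall x, x \in s -> x \in L) -> s \in LL.
Proof.
elim: n => [|n [LL LP]].
  by exists [:: [::]] => -[].
exists [seq a :: s | a <- L, s <- LL] => -[|a s] //= [sn] h.
apply/allpairsP; exists (a, s); split=> //=; first by apply: h; rewrite inE eqxx.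
by apply: LP => // x xs; apply: h; rewrite inE xs orbT.
Qed.
End Quotients.

Section IwasawaMatrices.
Import Pdiv.RingMonic.

Lemma horner_trmx (S : comNzRingType) n (A : 'M[S]_n.+1) (P : {poly S}) :
  (horner_mx A P)^T = horner_mx A^T P.
Proof.
elim/poly_ind: P => [|P c IHP]; first by rewrite !rmorph0 trmx0.
rewrite [P * 'X]mulrC !(rmorphD, rmorphM) /= !horner_mx_X !horner_mx_C.
rewrite linearD /= tr_scalar_mx -!mulmxE trmx_mul IHP.
by congr (_ + _); apply/esym/comm_mx_horner.
Qed.

Lemma horner_mx_sum (S : comNzRingType) n (A : 'M[S]_n.+1) (P : {poly S}) k : (size P <= k)%N ->
  horner_mx A P = \sum_(i < k) P`_i *: A ^+ i.
Proof.
move=> sP; rewrite {1}(poly_wide sP) raddf_sum; apply: eq_bigr => i _.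
by rewrite /= horner_mxZ rmorphXn /= horner_mx_X.
Qed.

Lemma size_monicX (S : nzRingType) (P : {poly S}) k : P \is monic -> size (P ^+ k) = ((size P).-1 * k).+1.
Proof.
move=> mP; elim: k => [|k IHk]; first by rewrite muln0 expr0 size_poly1.
rewrite exprSr size_Mmonic ?monic_neq0 ?monic_exp // IHk mulnS.
have : (0 < size P)%N by rewrite size_poly_gt0 monic_neq0.
by case: (size P) => // m _; rewrite addSn /= addnS addnC.
Qed.

(** * Linear algebra producing the elementary module *)

Section Core.
Variables (p : nat) (Qp : padicField p) (K : fieldExtType Qp) (varpi : valring K).
Hypotheses (p_pr : prime p) (p_odd : odd p) (varpi_unif : uniformizer varpi).
Local Notation R := (valring K).
Local Notation vm := (map_mx (val : R -> K)).
Local Notation mp := (map_poly (val : R -> K)).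
Local Notation omg := (omg p R).

Lemma vm_inj m n : injective (vm : 'M[R]_(m, n) -> 'M[K]_(m, n)).
Proof.
move=> A B e; apply/matrixP => i j; apply: val_inj.
by have := congr1 (fun C : 'M[K]_(m, n) => C i j) e; rewrite /= !mxE.
Qed.

Lemma mx_denominator m n (w : 'M[K]_(m, n)) : exists c (w' : 'M[R]_(m, n)), vm w' = val varpi ^+ c *: w.
Proof.
have /choice[a aP] : forall ij : 'I_m * 'I_n, exists c, exists x : R, val varpi ^+ c * w ij.1 ij.2 = val x.
  by move=> ij; have [c [x e]] := K_denominator_varpi p_pr varpi_unif (w ij.1 ij.2); exists c, x.
pose c := \max_ij a ij.
have /choice[x xP] : forall ij : 'I_m * 'I_n, exists x : R, val varpi ^+ c * w ij.1 ij.2 = val x.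
  move=> ij; have [x e] := aP ij; exists (varpi ^+ (c - a ij) * x).
  by rewrite rmorphM rmorphXn /= -e mulrA -exprD subnK // leq_bigmax.
exists c, (\matrix_(i, j) x (i, j)); apply/matrixP => i j.
by rewrite !mxE -xP.
Qed.

Variables (d k : nat) (M B : 'M[R]_d.+1) (Rel : set 'rV[R]_d.+1).
Hypotheses (Rel0 : Rel 0) (RelD : forall a b, Rel a -> Rel b -> Rel (a + b)).
Hypothesis (RelZ : forall (c : R) a, Rel a -> Rel (c *: a)).
Hypothesis (RelM : forall a, Rel a -> Rel (a *m M)).
Hypothesis (RelB : forall a, Rel (a *m (horner_mx M (omg k) - varpi *: B))).

Lemma vmM m n q (A : 'M[R]_(m, n)) (C : 'M[R]_(n, q)) : vm (A *m C) = vm A *m vm C.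
Proof. exact: map_mxM. Qed.

(** Finitely many relations of maximal rank span all relations over [K]; over the valuation ring the
    loss is a power of varpi. *)
Lemma rel_span : exists m (B0 : 'M[R]_(m, d.+1)), (forall i, Rel (row i B0)) /\
  forall a, Rel a -> (vm a <= vm B0)%MS.
Proof.
pose P r := `[< exists m (B0 : 'M[R]_(m, d.+1)), (forall i, Rel (row i B0)) /\ \rank (vm B0) = r >].
have exP : exists r, P r.
  exists (\rank (vm (0 : 'M[R]_(1, d.+1)))); apply/asboolP; exists 1%N, 0; split=> // i.
  by rewrite row0.
have ubP r : P r -> (r <= d.+1)%N.
  by move=> /asboolP[m [B0 [_ <-]]]; apply: rank_leq_col.
case: (ex_maxnP exP ubP) => r /asboolP[m [B0 [B0R rB0]]] maxr.
exists m, B0; split=> // a Ra.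
have : P (\rank (vm (col_mx B0 a))).
  apply/asboolP; exists (m + 1)%N, (col_mx B0 a); split=> // i.
  by case: (split_ordP i) => j ->; rewrite ?rowKu ?rowKd ?ord1 ?row_id.
move/maxr; rewrite map_col_mx -addsmxE -rB0 => le.
have := mxrank_leqif_sup (addsmxSl (vm B0) (vm a)).
case=> le' /esym; rewrite eqn_leq le le' => h.
by apply: submx_trans (addsmxSr (vm B0) (vm a)) _; rewrite h.
Qed.

(** On the module R^(d+1)/Rel, [RelB] makes M^(p^k) - 1 divisible by varpi. Primary decomposition
    over [K] gives maps [A j] to R[X]/(f j)^(l j) that turn [M] into X; the two constants bound
    their joint kernel and cokernel by powers of varpi. *)
Lemma core : exists r (f : 'I_r -> {poly R}) (l : 'I_r -> nat) (Hp : {poly R})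
    (A : 'I_r -> 'rV[R]_d.+1 -> {poly R}),
  [/\ [/\ Hp \is monic & forall j, [/\ f j \is monic, irreducible_poly (mp (f j)) &
         exists e G, f j = ('X - 1) ^+ e + varpi *: G]],
      forall j, [/\ forall a b, A j (a - b) = A j a - A j b, forall c a, A j (c *: a) = c *: A j a &
         forall a, (size (A j a) < size (f j ^+ l j))%N],
      forall j a, [/\ forall P, exists Q, A j (a *m horner_mx M P) = P * A j a + f j ^+ l j * Q,
         A j (a *m horner_mx M Hp) = 0 & Rel a -> A j a = 0],
      exists c, forall a, (forall j, A j a = 0) -> Rel (varpi ^+ c *: a) &
      exists c, forall rr : 'I_r -> {poly R}, (forall j, (size (rr j) < size (f j ^+ l j))%N) ->
        exists a, forall j, A j a = varpi ^+ c *: rr j].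
Proof.
have [m [B0 [B0R B0P]]] := rel_span.
(* The functionals over [K] that kill the relations, with the transpose [g] of [M]. Decomposing this
   dual yields maps out of the module. *)
pose U := kermx (vm B0)^T; pose g := (vm M)^T.
have UP (u : 'rV[K]_d.+1) : (u <= U)%MS <-> u *m (vm B0)^T = 0.
  by split => /sub_kermxP.
have rel_mx q (X : 'M[R]_(q, d.+1)) (u : 'rV[K]_d.+1) : (forall i, Rel (row i X)) -> (u <= U)%MS -> u *m (vm X)^T = 0.
  move=> XR /UP u0; have /submxP[D ->] : (vm X <= vm B0)%MS.
    by apply/row_subP => i; rewrite -map_row; apply: B0P.
  by rewrite trmx_mul mulmxA u0 mul0mx.
have stU : stablemx U g.
  apply/row_subP => i; rewrite row_mul; apply/UP; rewrite -mulmxA -trmx_mul -vmM.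
  apply: rel_mx; last exact: row_sub.
  by move=> j; rewrite row_mul; apply: (RelM _).
have hg (P : {poly R}) : (vm (horner_mx M P))^T = horner_mx g (mp P).
  by rewrite map_horner_mx horner_trmx.
have stUh q (u : 'rV[K]_d.+1) : (u <= U)%MS -> (u *m horner_mx g q <= U)%MS.
  by move=> uU; apply: submx_trans (submxMr _ uU) (horner_mx_stable q stU).
pose Bt := (vm B)^T; pose G := horner_mx g (mp (omg k)).
have uG (u : 'rV[K]_d.+1) : (u <= U)%MS -> u *m G = val varpi *: (u *m Bt).
  move=> uU; have := rel_mx _ (horner_mx M (omg k) - varpi *: B) u _ uU.
  have -> : (vm (horner_mx M (omg k) - varpi *: B))^T = G - val varpi *: Bt.
    by apply/matrixP => i j; rewrite /G -hg !mxE rmorphB rmorphM.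
  rewrite mulmxBr -scalemxAr => h.
  apply/eqP; rewrite -subr_eq0; apply/eqP/h => i.
  by rewrite rowE; apply: RelB.
have uGi i (u : 'rV[K]_d.+1) : (u <= U)%MS -> u *m G ^+ i = val varpi ^+ i *: (u *m Bt ^+ i).
  elim: i u => [|i IHi] u uU; first by rewrite !expr0 scale1r.
  rewrite exprS -mulmxE mulmxA IHi; last exact: stUh.
  by rewrite uG // -scalemxAl scalerA -exprSr [Bt ^+ i.+1]exprS -mulmxE mulmxA.
pose h := char_poly B.
have sh : size h = d.+2 by apply: size_char_poly.
(* This is varpi^(d+1) h(omg/varpi). On [U], omg acts as varpi times the transpose of [B], so
   Cayley-Hamilton for [B] makes [Hp] kill [U]; modulo varpi it is omg^(d+1), hence
   distinguished. *)
pose Hp := \sum_(i < d.+2) (h`_i * varpi ^+ (d.+1 - i)) *: omg k ^+ i.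
have uHp (u : 'rV[K]_d.+1) : (u <= U)%MS -> u *m horner_mx g (mp Hp) = 0.
  move=> uU.
  have -> : mp Hp = \sum_(i < d.+2) (val h`_i * val varpi ^+ (d.+1 - i)) *: (mp (omg k)) ^+ i.
    rewrite /Hp raddf_sum; apply: eq_bigr => i _.
    by rewrite -[LHS]/(mp ((h`_i * varpi ^+ (d.+1 - i)) *: omg k ^+ i)) map_polyZ rmorphM !rmorphXn.
  rewrite raddf_sum mulmx_sumr.
  transitivity (val varpi ^+ d.+1 *: (u *m horner_mx Bt (mp h))).
    rewrite (horner_mx_sum _ (k := d.+2)); last by rewrite mp_size sh.
    rewrite mulmx_sumr scaler_sumr; apply: eq_bigr => i _.
    rewrite -[X in u *m X]/(horner_mx g ((val h`_i * val varpi ^+ (d.+1 - i)) *: mp (omg k) ^+ i)).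
    rewrite horner_mxZ rmorphXn -/G -!scalemxAr uGi // !scalerA coef_map /=.
    by congr (_ *: _); rewrite -mulrA -exprD subnK 1?mulrC // -ltnS.
  have -> : horner_mx Bt (mp h) = 0.
    have := horner_trmx (vm B) (mp h); rewrite -map_horner_mx Cayley_Hamilton map_mx0 trmx0.
    by move=> <-.
  by rewrite mulmx0 scaler0.
have momg : omg k \is monic by apply: omg_monic.
have [HpG HpE] : exists G1, Hp = omg k ^+ d.+1 + varpi *: G1.
  exists (\sum_(i < d.+1) (h`_i * varpi ^+ (d - i)) *: omg k ^+ i).
  rewrite /Hp big_ord_recr /= subnn mulr1 addrC; congr (_ + _).
    have : h`_d.+1 = 1 by have := char_poly_monic B; rewrite monicE /lead_coef -/h sh => /eqP.
    by move=> ->; rewrite scale1r.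
  rewrite scaler_sumr; apply: eq_bigr => i _; rewrite scalerA; congr (_ *: _).
  by rewrite subSn ?exprS; [rewrite mulrCA | rewrite -ltnS].
have mHp : Hp \is monic.
  rewrite /Hp big_ord_recr /= addrC subnn mulr1.
  have -> : h`_d.+1 = 1 by have := char_poly_monic B; rewrite monicE /lead_coef -/h sh => /eqP.
  rewrite scale1r monicE lead_coefDl; first by rewrite -monicE monic_exp.
  have somg := size_monicX d.+1 momg; rewrite omg_size // in somg.
  rewrite somg ltnS; apply: leq_trans (size_sum _ _ _) _; apply/bigmax_leqP => i _.
  apply: leq_trans (size_scale_leq _ _) _; rewrite size_monicX // omg_size //=.
  by rewrite ltn_pmul2l // expn_gt0 prime_gt0.
have [C eC] := omg_frob p_pr p_odd (varpi_p p_pr varpi_unif) k.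
have [HpG' HpE'] : exists G1, Hp = ('X - 1) ^+ (p ^ k * d.+1) + varpi *: G1.
  have eo : omg k = ('X - 1) ^+ (p ^ k) + varpi *: (- C) by rewrite scalerN eC addrK.
  have [G' e] := distinguished_exp eo d.+1.
  by exists (G' + HpG); rewrite HpE e scalerDr addrA.
have [s [sok srank sspan]] := primary_decomp stU.
pose r := size s; pose t0 : cyc K d := (0, 0%N, 0).
have tok (j : 'I_r) : cyc_ok g U (nth t0 s j) by apply: sok; apply: mem_nth.
have /choice[fw fwP] : forall j : 'I_r, exists q : {poly R} * 'rV[R]_d.+1,
    [/\ q.1 \is monic, mp q.1 = (nth t0 s j).1.1,
      exists e G1, q.1 = ('X - 1) ^+ e + varpi *: G1 &
      exists c, vm q.2 = val varpi ^+ c *: (nth t0 s j).2].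
  move=> j; have [mf irf w0 wU wF] := tok j; set t := nth t0 s j in mf irf w0 wU wF *.
  (* Otherwise [Hp], which kills [U], would be coprime to the annihilator of the generator, and the
     generator would be 0. *)
  have /dvdpP[q eq] : t.1.1 %| mp Hp.
    apply/negPn/negP => nd; case/eqP: w0.
    have /Bezout_eq1_coprimepP[[a b] /= ab] : coprimep (cyc_poly t) (mp Hp).
      by rewrite coprimep_expl // irreducible_poly_coprime.
    rewrite -[t.2]mulmx1 -(h1 g) -ab hD mulmxDr hMC hMC !mulmxA wF uHp //.
    by rewrite !mul0mx addr0.
  have [f' [mf' ef' shape]] := gauss_factor p_pr p_odd varpi_unif mf mHp HpE' (etrans (mulrC _ _) (esym eq)).
  have [c [w' ew']] := mx_denominator t.2.
  by exists (f', w'); split=> //; exists c.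
pose f j := (fw j).1; pose w j := (fw j).2; pose l (j : 'I_r) := (nth t0 s j).1.2.
pose F j := f j ^+ l j; pose E j := (size (F j)).-1.
have mF j : F j \is monic by apply: monic_exp; have [] := fwP j.
have sF j : size (F j) = (E j).+1 by rewrite prednK // size_poly_gt0 monic_neq0.
have FE j : (F j)`_(E j) = 1 by have := mF j; rewrite monicE /lead_coef => /eqP.
have wU j : (vm (w j) <= U)%MS.
  have [_ _ _ [c ->]] := fwP j; have [_ _ _ h' _] := tok j; exact: scalemx_sub.
have mpF j : mp (F j) = cyc_poly (nth t0 s j).
  by have [_ e _ _] := fwP j; rewrite /F rmorphXn /= e.
have transW (P : {poly R}) j : vm (w j) *m horner_mx g (mp P) = 0 -> horner_mx M P *m (w j)^T = 0.
  move=> e; apply: vm_inj; apply: trmx_inj; rewrite vmM trmx_mul hg -map_trmx trmxK.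
  by rewrite e [vm 0]map_mx0 trmx0.
have zF j : horner_mx M (F j) *m (w j)^T = 0.
  apply: transW; have [_ _ _ [c ->]] := fwP j; have [_ _ _ _ h'] := tok j.
  by rewrite mpF -scalemxAl h' scaler0.
have zH j : horner_mx M Hp *m (w j)^T = 0 by apply/transW/uHp/wU.
(* The values y_i of [a] at the functionals w g^i satisfy the linear recurrence of F. [A j a] below
   is the numerator of their generating function: the polynomial part of F times the sum of the y_i
   X^(-i-1). As [M] shifts the sequence, it acts as X modulo F. *)
pose y j (a : 'rV[R]_d.+1) i := (a *m (M ^+ i *m (w j)^T)) 0 0.
pose Cm j kk := \sum_(i < E j) (F j)`_(kk + i).+1 *: (M ^+ i *m (w j)^T).
pose A j (a : 'rV[R]_d.+1) := \poly_(kk < E j) (a *m Cm j kk) 0 0.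
have AE j a kk : (A j a)`_kk = \sum_(i < E j) (F j)`_(kk + i).+1 * y j a i.
  have e : (a *m Cm j kk) 0 0 = \sum_(i < E j) (F j)`_(kk + i).+1 * y j a i.
    rewrite /Cm mulmx_sumr summxE; apply: eq_bigr => i _.
    by rewrite -scalemxAr mxE.
  rewrite coef_poly e; case: ltnP => // Ek; rewrite big1 // => i _.
  by rewrite nth_default ?mul0r // sF ltnS (leq_trans Ek) // leq_addr.
have yB j a b i : y j (a - b) i = y j a i - y j b i.
  by rewrite /y mulmxBl [LHS]mxE [X in _ + X]mxE.
have yZ j c a i : y j (c *: a) i = c * y j a i by rewrite /y -scalemxAl mxE.
have AB j a b : A j (a - b) = A j a - A j b.
  apply/polyP => kk; rewrite coefB !AE -sumrB; apply: eq_bigr => i _.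
  by rewrite yB mulrBr.
have AZ j c a : A j (c *: a) = c *: A j a.
  apply/polyP => kk; rewrite coefZ !AE mulr_sumr; apply: eq_bigr => i _.
  by rewrite yZ mulrCA.
have As j a : (size (A j a) < size (F j))%N by rewrite sF ltnS size_poly.
have yM j a i : y j (a *m M) i = y j a i.+1.
  by rewrite /y -mulmxA [M *m (_ *m _)]mulmxA mulmxE -exprS.
have ysum j a : \sum_(i < (E j).+1) (F j)`_i * y j a i = 0.
  have : (a *m (horner_mx M (F j) *m (w j)^T)) 0 0 = 0 by rewrite zF mulmx0 mxE.
  rewrite (horner_mx_sum _ (k := (E j).+1)) ?sF // mulmx_suml mulmx_sumr summxE => e0.
  by rewrite -[RHS]e0; apply: eq_bigr => i _; rewrite -scalemxAl -scalemxAr mxE.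
have Aeq j a : A j (a *m M) = 'X * A j a + F j * (- (y j a 0%N)%:P).
  apply/polyP => kk; rewrite coefD mulrN coefN mulrC coefMX coefMC !AE.
  have e : \sum_(i < (E j).+1) (F j)`_(kk + i) * y j a i =
     (F j)`_kk * y j a 0%N + \sum_(i < E j) (F j)`_(kk + i).+1 * y j (a *m M) i.
    rewrite big_ord_recl addn0; congr (_ + _); apply: eq_bigr => i _.
    by rewrite yM lift0 addnS.
  case: kk e => [|kk] e /=.
    by rewrite add0r; move: e; rewrite ysum => /esym/eqP; rewrite addrC addr_eq0 => /eqP.
  move: e; rewrite big_ord_recr /= [(F j)`_(kk.+1 + E j)]nth_default; last by rewrite sF addSn ltnS leq_addl.
  have e2 : \sum_(i < E j) (F j)`_(kk + i).+1 * y j a i = \sum_(i < E j) (F j)`_(kk.+1 + i) * y j a i.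
    by apply: eq_bigr => i _; rewrite addSn.
  by rewrite mul0r addr0 e2 => ->; rewrite addrAC subrr add0r.
have Apoly j a P : exists Q, A j (a *m horner_mx M P) = P * A j a + F j * Q.
  elim/poly_ind: P => [|P c [Q IHP]].
    by exists 0; rewrite rmorph0 mulmx0 mul0r mulr0 addr0 -(scale0r 0) AZ scale0r.
  exists ('X * Q - (y j (a *m horner_mx M P) 0%N)%:P).
  rewrite rmorphD rmorphM /= horner_mx_X horner_mx_C mulmxDr -mulmxE mulmxA mul_mx_scalar.
  have AD a1 b1 : A j (a1 + b1) = A j a1 + A j b1.
    by rewrite -[b1]opprK -[- b1]scaleN1r AB AZ -[- (- (1 : R) *: b1)]scaleN1r scalerA mulrNN mulr1 scale1r scaleN1r opprK.
  by rewrite AD AZ Aeq IHP -mul_polyC; ring.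
have AH j a : A j (a *m horner_mx M Hp) = 0.
  apply/polyP => kk; rewrite coef0 AE big1 // => i _.
  suff -> : y j (a *m horner_mx M Hp) i = 0 by rewrite mulr0.
  rewrite /y -mulmxA [_ *m (M ^+ i *m _)]mulmxA.
  have -> : horner_mx M Hp *m M ^+ i = M ^+ i *m horner_mx M Hp.
    by rewrite -[M in M ^+ i](horner_mx_X M) -rmorphXn /= mulmxE -!rmorphM mulrC.
  by rewrite -mulmxA zH !mulmx0 mxE.
have valy j a i : val (y j a i) = (vm (w j) *m g ^+ i *m (vm a)^T) 0 0.
  have -> : val (y j a i) = (vm (a *m (M ^+ i *m (w j)^T)))^T 0 0 by rewrite [RHS]mxE [RHS]mxE.
  rewrite !vmM !trmx_mul -map_trmx trmxK.
  have -> : (vm (M ^+ i))^T = g ^+ i; last by [].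
  elim: (i) => [|i1 IHi]; first by rewrite !expr0 [vm 1]map_mx1 trmx1.
  by rewrite exprS exprSr -!mulmxE vmM trmx_mul IHi.
have Arel j a : Rel a -> A j a = 0.
  move=> Ra; apply/polyP => kk; rewrite coef0 AE big1 // => i _.
  suff -> : y j a i = 0 by rewrite mulr0.
  apply: val_inj; rewrite valy rel_mx ?mxE //; first by move=> i1; rewrite row_id.
  by have := stUh 'X^i _ (wU j); rewrite rmorphXn /= horner_mx_X.
have Aker a : (forall j, A j a = 0) -> (vm a <= vm B0)%MS.
  move=> A0.
  (* F being monic, the coefficients of [A j a], read from the top, determine the y_i with i < E one
     after the other. *)
  have y0 j i : (i < E j)%N -> y j a i = 0.
    elim/ltn_ind: i => i IHi iE.
    have := congr1 (fun q : {poly R} => q`_((E j).-1 - i)) (A0 j); rewrite coef0 AE.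
    rewrite (bigD1 (Ordinal iE)) //= subnK; last by rewrite -ltnS prednK // (leq_ltn_trans _ iE).
    rewrite prednK ?(leq_ltn_trans _ iE) // FE mul1r big1 ?addr0 // => i1 ni1.
    have [lt|gt|e] := ltngtP (i1 : nat) i; last by case/eqP: ni1; apply: val_inj.
      by rewrite (IHi _ lt) ?mulr0 // (ltn_trans lt).
    rewrite nth_default ?mul0r // sF; have := ltn_ord i1; lia.
  have y0' j i : vm (w j) *m g ^+ i *m (vm a)^T = 0.
    have -> : g ^+ i = horner_mx g 'X^i by rewrite rmorphXn /= horner_mx_X.
    have [_ _ _ [c ec]] := fwP j; have [_ _ _ _ h'] := tok j.
    rewrite (divp_eq 'X^i (mp (F j))) hD mulmxDr hMC mulmxA ec -scalemxAl mpF h' scaler0 mul0mx add0r.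
    rewrite -ec -/(w j) -mpF (horner_mx_sum _ (k := E j)); last first.
      by rewrite -ltnS -sF -(mp_size (F j)) ltn_modp -size_poly_gt0 mp_size sF.
    rewrite mulmx_sumr mulmx_suml big1 // => i1 _; rewrite -scalemxAr -scalemxAl.
    suff -> : vm (w j) *m g ^+ i1 *m (vm a)^T = 0 by rewrite scaler0.
    by apply/matrixP => b1 b2; rewrite !ord1 -valy y0 // mxE.
  have ua (u : 'rV[K]_d.+1) : (u <= U)%MS -> u *m (vm a)^T = 0.
    move=> uU; apply: (sspan u _ uU) => t i ts.
    pose j := Ordinal (introT idP (etrans (index_mem t s) ts) : (index t s < r)%N).
    have := y0' j i; have [_ _ _ [c]] := fwP j; rewrite -/(w j) nth_index // => ->.
    rewrite -!scalemxAl => /eqP; rewrite scaler_eq0 expf_eq0 (negPf (varpi_neq0 p_pr varpi_unif)) andbF /=.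
    by move/eqP.
  rewrite submxE; apply/eqP/trmx_inj; rewrite trmx0 trmx_mul.
  apply/row_matrixP => i; rewrite row_mul row0; apply: ua; apply/UP.
  by rewrite -row_mul -trmx_mul mulmx_coker trmx0 row0.
exists r, f, l, Hp, A; split.
- split=> // j; have [? e ? _] := fwP j; split=> //; rewrite e.
  by have [] := tok j.
- by move=> j; split.
- by move=> j a; split; [exact: Apoly | exact: AH | exact: Arel].
- have [c [Pm eP]] := mx_denominator (pinvmx (vm B0)).
  exists c => a /Aker aB.
  have -> : varpi ^+ c *: a = (a *m Pm) *m B0.
    apply: vm_inj; rewrite !vmM eP map_mxZ rmorphXn /= -scalemxAr -scalemxAl mulmxKpV //.
  rewrite mulmx_sum_row; elim/big_ind: _ => // i _; exact: (RelZ _ _).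
(* All coefficients of all [A j] form one matrix [Phi]. Its kernel lies in the span of the
   relations, so its rank is at least that of [U], which bounds the number of columns. An inverse,
   cleared of denominators, gives the second constant. *)
pose I : finType := {j : 'I_r & 'I_(E j)}%type.
have cI : #|I| = (\sum_(j < r) E j)%N.
  by rewrite card_tagged sumnE big_map big_enum /=; apply: eq_bigr => j _; rewrite card_ord.
pose eq0 (q : 'I_#|I|) : I := enum_val q.
pose Phi : 'M[R]_(d.+1, #|I|) := \matrix_(b, q) Cm (tag (eq0 q)) (tagged (eq0 q)) b 0.
have PhiE a q : (a *m Phi) 0 q = (A (tag (eq0 q)) a)`_(tagged (eq0 q)).
  rewrite coef_poly ltn_ord mxE [RHS]mxE; apply: eq_bigr => b _; by rewrite mxE.
have kerPhi : (kermx (vm Phi) <= vm B0)%MS.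
  apply/row_subP => i; set u := row i _.
  have uPhi : u *m vm Phi = 0 by apply/sub_kermxP/row_sub.
  have [c [u' eu]] := mx_denominator u.
  have : (vm u' <= vm B0)%MS.
    apply: Aker => j; apply/polyP => kk; rewrite coef0; have [kE|Ek] := ltnP kk (E j); last first.
      by rewrite nth_default // (leq_trans (size_poly _ _)).
    pose q := enum_rank (Tagged (fun j => 'I_(E j)) (Ordinal kE) : I).
    have := PhiE u' q; rewrite /eq0 enum_rankK /= => <-.
    apply: val_inj; have -> : val ((u' *m Phi) 0 q) = (vm (u' *m Phi)) 0 q by rewrite [RHS]mxE.
    by rewrite vmM eu -scalemxAl uPhi scaler0 !mxE.
  rewrite eu => h1'; have : (val varpi ^- c *: (val varpi ^+ c *: u) <= vm B0)%MS by apply: scalemx_sub.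
  by rewrite scalerA mulVf ?scale1r // expf_neq0 // varpi_neq0.
have full : row_full (vm Phi).
  suff le : (\sum_(j < r) E j <= \rank (vm Phi))%N.
    by apply/eqP/anti_leq; rewrite rank_leq_col; exact: leq_trans (eq_leq cI) le.
  have e1 : (\sum_(j < r) E j <= \rank U)%N.
    apply: leq_trans srank; rewrite (big_nth t0) big_mkord; apply: leq_sum => j _.
    by rewrite /E -mpF mp_size.
  apply: leq_trans e1 _; rewrite mxrank_ker mxrank_tr.
  by rewrite leq_subLR addnC -leq_subLR -mxrank_ker; apply: mxrankS kerPhi.
have [L eL] := row_fullP full.
have [c [L' eL']] := mx_denominator L.
exists c => rr srr; pose rho : 'rV[R]_#|I| := \row_q (rr (tag (eq0 q)))`_(tagged (eq0 q)).
have e : (rho *m L') *m Phi = varpi ^+ c *: rho.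
  by apply: vm_inj; rewrite !vmM eL' -scalemxAr -scalemxAl -mulmxA eL mulmx1 map_mxZ rmorphXn.
exists (rho *m L') => j; apply/polyP => kk; rewrite coefZ.
have [kE|Ek] := ltnP kk (E j); last first.
  rewrite !nth_default ?mulr0 //; first by rewrite -ltnS (leq_trans (srr j)) // -/(F j) sF.
  by rewrite (leq_trans (size_poly _ _)).
pose q := enum_rank (Tagged (fun j => 'I_(E j)) (Ordinal kE) : I).
have := PhiE (rho *m L') q; rewrite e mxE [X in _ * X]mxE /eq0 enum_rankK /= => <-.
by [].
Qed.

End Core.
End IwasawaMatrices.

(** [P] relates elements to finitely many classes and need not be functional; each element shares a
    class with its representative. *)
Lemma reps_dep (T : eqType) (A : set T) (P : T -> nat -> Prop) n :
  (forall t, A t -> exists2 k, (k < n)%N & P t k) -> exists ts : seq T,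
  (forall t, t \in ts -> A t) /\
  forall t, A t -> exists2 t', t' \in ts & exists2 k, (k < n)%N & P t k /\ P t' k.
Proof.
move=> h; have /choice[f fP] : forall t, exists k, A t -> (k < n)%N /\ P t k.
  move=> t; have [/h[k kn Pk]|nA] := pselect (A t); first by exists k.
  by exists 0%N.
have [|ts [tA tP]] := @finite_reps T nat A f (seq.iota 0 n).
  by move=> t /fP[]; rewrite mem_iota.
exists ts; split=> // t At; have [t' t't e] := tP t At; exists t' => //.
have [kn Pt] := fP t At; exists (f t) => //; split=> //.
by rewrite e; have [] := fP t' (tA _ t't).
Qed.

(** * Characters of a discrete module *)

Section Dual.
Variables (p : nat) (Qp : padicField p) (K : fieldExtType Qp) (varpi : valring K).
Hypotheses (p_pr : prime p) (p_odd : odd p) (varpi_unif : uniformizer varpi).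
Local Notation R := (valring K).
Local Notation H := (GQinf p).
Local Notation mk := (mk p_pr p_odd).
Local Notation gam := (gam p_pr).
Local Notation Un := (Un p_pr).
Local Notation iwfun := (iwfun R H).
Local Notation T := (padic_quot Qp).
Variables (V : lmodType R) (Z N : set V) (act : galQ -> V -> V).
Hypotheses (Z0 : Z 0) (ZB : forall u v, Z u -> Z v -> Z (u - v)).
Hypothesis (ZZ : forall (a : R) v, Z v -> Z (a *: v)).
Hypotheses (N0 : N 0) (NB : forall u v, N u -> N v -> N (u - v)).
Hypothesis (NZ : forall (a : R) v, N v -> N (a *: v)).
Hypothesis actD : forall g u v, act g (u + v) = act g u + act g v.
Hypothesis actZ : forall g (a : R) v, act g (a *: v) = a *: act g v.
Hypothesis act1 : forall v, act 1%g v = v.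
Hypothesis actM : forall g h v, act (g * h)%g v = act g (act h v).
Hypothesis Zact : forall g v, Z v -> Z (act g v).
Hypothesis Nact : forall g v, N v -> N (act g v).
Hypothesis smooth : forall v, Z v -> exists n, forall g, Un n g -> N (act g v - v).
Hypothesis tors : forall v, Z v -> exists k, N (varpi ^+ k *: v).

Local Notation "u == v" := (eqm N u v) : type_scope.

Lemma ZN v : Z v -> Z (- v). Proof. by move=> h; rewrite -sub0r; apply: (ZB _ _). Qed.
Lemma ZD u v : Z u -> Z v -> Z (u + v).
Proof. by move=> hu hv; rewrite -[v]opprK; apply: (ZB _ _) => //; apply: ZN. Qed.
Lemma ZMn v n : Z v -> Z (v *+ n).
Proof. by move=> h; rewrite -scaler_nat; apply: (ZZ _ _). Qed.
Lemma NMn v n : N v -> N (v *+ n).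
Proof. by move=> h; rewrite -scaler_nat; apply: (NZ _ _). Qed.
Lemma ND u v : N u -> N v -> N (u + v).
Proof. by move=> hu hv; rewrite -[v]opprK -[- v]sub0r; apply: (NB _ _) => //; apply: (NB _ _). Qed.
Lemma N0sub v : N (0 - v) -> N v.
Proof. by move=> h; have := NB N0 h; rewrite !sub0r opprK. Qed.
Lemma act0 g : act g 0 = 0. Proof. by rewrite -(scale0r 0) actZ !scale0r. Qed.
Lemma actN g v : act g (- v) = - act g v. Proof. by rewrite -scaleN1r actZ scaleN1r. Qed.

(** The inverse of gam appears because the algebra acts on characters through inversion; X will act
    as [tau]. *)
Definition tau v := act gam^-1%g v.
Definition ev (P : {poly R}) v := \sum_(i < size P) P`_i *: iter i tau v.

Lemma iter_tau i v : iter i tau v = act (gam ^+ i)^-1%g v.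
Proof.
elim: i => [|i IHi]; first by rewrite /= expg0 invg1 act1.
by rewrite iterS IHi /tau -actM -addn1 expgnDr invgM.
Qed.
Lemma iterD i u v : iter i tau (u + v) = iter i tau u + iter i tau v.
Proof. by rewrite !iter_tau actD. Qed.
Lemma iterZ i (a : R) v : iter i tau (a *: v) = a *: iter i tau v.
Proof. by rewrite !iter_tau actZ. Qed.
Lemma ev_wide k (P : {poly R}) v : (size P <= k)%N -> ev P v = \sum_(i < k) P`_i *: iter i tau v.
Proof.
move=> sP; rewrite /ev (big_ord_widen k (fun i => P`_i *: iter i tau v) sP).
rewrite big_mkcond; apply: eq_bigr => i _; case: ltnP => // h.
by rewrite nth_default // scale0r.
Qed.
Lemma evDl P Q v : ev (P + Q) v = ev P v + ev Q v.
Proof.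
pose k := maxn (size P) (size Q).
rewrite (ev_wide _ (size_polyD P Q)) (ev_wide (k := k) (P := P)) ?leq_maxl //.
rewrite (ev_wide (k := k) (P := Q)) ?leq_maxr // -big_split; apply: eq_bigr => i _.
by rewrite coefD scalerDl.
Qed.
Lemma evZl (a : R) P v : ev (a *: P) v = a *: ev P v.
Proof.
rewrite (ev_wide _ (size_scale_leq a P)) /ev scaler_sumr; apply: eq_bigr => i _.
by rewrite coefZ scalerA.
Qed.
Lemma evDr P u v : ev P (u + v) = ev P u + ev P v.
Proof. by rewrite /ev -big_split; apply: eq_bigr => i _; rewrite iterD scalerDr. Qed.
Lemma evZr P (a : R) v : ev P (a *: v) = a *: ev P v.
Proof. by rewrite /ev scaler_sumr; apply: eq_bigr => i _; rewrite iterZ !scalerA mulrC. Qed.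
Lemma evC (c : R) v : ev c%:P v = c *: v.
Proof. by rewrite (ev_wide (k := 1)) ?size_polyC_leq1 // big_ord1 coefC. Qed.
Lemma evMX P v : ev (P * 'X) v = ev P (tau v).
Proof.
rewrite (ev_wide (k := (size P).+1)); last first.
  have [->|P0] := eqVneq P 0; first by rewrite mul0r size_poly0.
  by rewrite size_mulX.
rewrite big_ord_recl coefMX scale0r add0r; apply: eq_bigr => i _.
by rewrite coefMX /= -iterSr.
Qed.
Lemma evB P Q v : ev (P - Q) v = ev P v - ev Q v.
Proof. by rewrite -[- Q]scaleN1r evDl evZl scaleN1r. Qed.
Lemma evM P Q v : ev (P * Q) v = ev P (ev Q v).
Proof.
elim/poly_ind: Q v => [|Q c IHQ] v.
  by rewrite mulr0 /ev size_poly0 big_ord0 big1 // => i _; rewrite iter_tau act0 scaler0.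
rewrite mulrDr mulrA !evDl !evMX IHQ evDr evC evZr -mulrC mul_polyC evZl //.
Qed.
Lemma evXn k v : ev 'X^k v = iter k tau v.
Proof.
elim: k v => [|k IHk] v; first by rewrite expr0 evC scale1r.
by rewrite exprSr evMX IHk -iterSr.
Qed.
Lemma ev_Z P v : Z v -> Z (ev P v).
Proof.
move=> Zv; rewrite /ev; elim/big_ind: _ => // [|i _]; first exact: ZD.
by apply: (ZZ _ _); rewrite iter_tau; apply: (Zact _ _).
Qed.
Lemma ev_N P v : N v -> N (ev P v).
Proof.
move=> Zv; rewrite /ev; elim/big_ind: _ => // [|i _]; first exact: ND.
by apply: (NZ _ _); rewrite iter_tau; apply: (Nact _ _).
Qed.
Definition fixd n v := forall g, Un n g -> N (act g v - v).
Lemma ev_omg n v : fixd n v -> N (ev (omg p R n) v).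
Proof.
move=> fv; rewrite /omg evB evXn iter_tau -[1 : {poly R}]/(1%:P) evC scale1r.
by apply: (fv _); apply: UnV; apply/Un_gam.
Qed.
Lemma ev_red n P v : fixd n v -> ev P v == ev (red p n P) v.
Proof.
move=> fv; have /(red_eq p_pr)[C e] : red p n P = red p n (red p n P) by rewrite red_red.
by rewrite {1}e evDl evM /eqm addrC addKr; apply/ev_N/ev_omg.
Qed.
Lemma ev_coh (P : nat -> {poly R}) m n v : coherent p P -> fixd m v -> fixd n v -> ev (P m) v == ev (P n) v.
Proof.
have key m' n' : coherent p P -> fixd m' v -> (m' <= n')%N -> ev (P m') v == ev (P n') v.
  move=> cP fm mn; apply: (eqm_trans N0 NB (b := ev (red p m' (P m')) v)); first exact: ev_red.
  by rewrite -(cP _ _ mn); apply: (eqm_sym N0 NB); apply: ev_red.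
move=> cP fm fn; apply: (eqm_trans N0 NB (b := ev (P (maxn m n)) v)).
  by apply: key; rewrite ?leq_maxl.
by apply: (eqm_sym N0 NB); apply: key; rewrite ?leq_maxr.
Qed.

(** A vector fixed modulo [N] by [Un n] sees only level n of the family. The subgroup chosen inside
    [iw_coact] may be a different one; coherence makes the results agree modulo [N]. *)
Lemma coactE (P : nat -> {poly R}) n v : coherent p P -> fixd n v ->
  iw_coact N act (mk P) v == ev (P n) v.
Proof.
move=> cP fn; rewrite /iw_coact; set U := xget _ _.
have UP : forall g, osub_set U g -> N (act g v - v).
  exact: (@xgetPex _ (osubT H) [set U : open_subgroup H | forall g, osub_set U g -> N (act g v - v)] (ex_intro _ (UnO p_pr p_odd n) fn)).
have [m eU] := UnO_all p_pr p_odd U; move: UP; rewrite {}eU => fm.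
rewrite (@reindex_fsbig _ _ _ _ _ (fun i => lcoset (Un m) (gam ^+ i)%g) `I_(p ^ m)); last first.
  split.
  - by move=> i _; exists (gam ^+ i)%g.
  - move=> i j; rewrite !inE /= => iI jI /(lcoset_eq p_pr p_odd).
    by rewrite !ix_gam !modn_small.
  move=> _ [g _ <-]; exists (ix p_pr p_odd m g); first exact: ix_lt.
  by apply/(lcoset_eq p_pr p_odd); rewrite ix_gam modn_small ?ix_lt.
rewrite -fsbig_ord.
apply: (eqm_trans N0 NB (b := ev (red p m (P m)) v)); last first.
  apply: (eqm_trans N0 NB (b := ev (P m) v)); first exact/(eqm_sym N0 NB)/ev_red.
  exact: ev_coh.
rewrite (ev_wide (k := (p ^ m)%N)) ?red_size //; apply: (eqm_sum N0 NB) => i /=.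
set r := coset_rep _; have er : ix p_pr p_odd m r = ix p_pr p_odd m (gam ^+ i)%g by apply: coset_repP.
rewrite mkU er ix_gam modn_small // /eqm -scalerBr; apply: (NZ _ _).
rewrite iter_tau; have -> : act r^-1%g v - act (gam ^+ i)^-1%g v =
    act (gam ^+ i)^-1%g (act (gam ^+ i * r^-1)%g v - v).
  by rewrite actD actN -!actM mulKg.
apply: (Nact _ _); apply: (fm _).
have /(ix_eq p_pr p_odd) h := er.
have := Un_normal (gam ^+ i)%g h; by rewrite -!mulgA mulgV mulg1.
Qed.

Lemma coact_const (a : R) v : Z v -> iw_coact N act (iwconst a : iwfun) v == a *: v.
Proof.
move=> Zv; have [n fn] := smooth Zv.
by rewrite mkC -(evC a v); exact: (@coactE (fun=> a%:P) n v (fun _ _ _ => erefl) fn).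
Qed.
Lemma coact_Z (lam : iwfun) v : Z v -> Z (iw_coact N act lam v).
Proof.
move=> Zv; rewrite /iw_coact; set U := xget _ _.
elim/big_ind: _ => [|u w|C _]; [exact: Z0 | exact: ZD | exact/(ZZ _ _)/(Zact _ _)].
Qed.

Definition isX (chi : V -> T) := (forall u v, Z u -> Z v -> chi (u + v) = chi u + chi v) /\
  (forall v, Z v -> N v -> chi v = 0).
Section Char.
Variable chi : V -> T.
Hypothesis chiX : isX chi.
Lemma X0 : chi 0 = 0. Proof. exact: chiX.2. Qed.
Lemma XB u v : Z u -> Z v -> chi (u - v) = chi u - chi v.
Proof.
move=> Zu Zv; apply: (@addIr _ (chi v)); rewrite subrK -chiX.1 ?subrK //.
exact: (ZB _ _).
Qed.
Lemma XN u v : Z u -> Z v -> u == v -> chi u = chi v.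
Proof.
move=> Zu Zv uv; apply/eqP; rewrite -subr_eq0 -XB //; apply/eqP/chiX.2 => //.
exact: (ZB _ _).
Qed.
Lemma XMn v n : Z v -> chi (v *+ n) = chi v *+ n.
Proof.
move=> Zv; elim: n => [|n IHn]; first by rewrite !mulr0n X0.
by rewrite !mulrS chiX.1 ?IHn //; apply: ZMn.
Qed.
End Char.

(** A character vanishing on the r-torsion of Z/N descends to the multiples of r, and extends from
    there because [T] is divisible. *)
Lemma Xdiv chi (r : R) : isX chi -> (forall v, Z v -> N (r *: v) -> chi v = 0) ->
  exists2 chi', isX chi' & forall v, Z v -> chi v = chi' (r *: v).
Proof.
move=> chiX h.
pose G := [set a : V * T | exists2 v, Z v & N (a.1 - r *: v) /\ a.2 = chi v].
have gG : graph G.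
  split.
  - by exists 0 => //; rewrite scaler0 subr0 /= (X0 chiX).
  - move=> [a a'] [b b'] [u Zu [/= Nu eu]] [v Zv [/= Nv ev']]; exists (u - v); first exact: (ZB _ _).
    split; last by rewrite /= eu ev' XB.
    rewrite scalerBr; exact: (eqm_sub NB).
  - move=> t [v Zv [/= Nv ->]]; apply: (h _) => //.
    exact: N0sub.
have [psi [psiD psiP]] := baer (@pq_div p Qp p_pr) gG.
exists psi.
  split=> // v Zv Nv; apply: (psiP _); exists 0 => //.
  by rewrite scaler0 subr0 (X0 chiX).
by move=> v Zv; apply/esym/(psiP _); exists v => //; rewrite subrr.
Qed.

(** [v] has order p modulo [N]; it is sent to an element of order p of Q_p/Z_p, and the map is
    extended by divisibility. *)
Lemma Xsep v : ~ N v -> N (v *+ p) -> exists2 chi, isX chi & chi v <> 0.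
Proof.
move=> nv pv; have [t0 t00 pt0] := pq_nonzero Qp p_pr.
have p0 := prime_gt0 p_pr.
pose G := [set a : V * T | exists k, N (a.1 - v *+ k) /\ a.2 = t0 *+ k].
have gG : graph G.
  split.
  - by exists 0%N; rewrite !mulr0n subr0.
  (* Multiples are indexed by natural numbers; as p kills both [v] modulo [N] and [t0], k + (p - 1)
     l represents k - l. *)
  - move=> [a a'] [b b'] [k [/= Nk ek]] [l [/= Nl el]]; exists (k + p.-1 * l)%N; split=> /=.
      apply: (eqm_trans N0 NB (b := v *+ k - v *+ l)); first exact: (eqm_sub NB).
      have e : v *+ l + v *+ (p.-1 * l) = v *+ p *+ l.
        by rewrite -mulrnDr -mulrnA; congr (_ *+ _); rewrite -{2}(prednK p0) mulSn.
      rewrite /eqm mulrnDr opprD addrACA subrr add0r -opprD e -mulNrn.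
      by apply: NMn; rewrite -sub0r; apply: (NB _ _).
    rewrite ek el mulrnDr; congr (_ + _); apply/eqP; rewrite eq_sym -addr_eq0.
    by rewrite -mulrnDr -mulSnr prednK // mulrnA pt0 mul0rn.
  - move=> t [k [/= Nk ->]]; have [/dvdnP[q ->]|nd] := boolP (p %| k)%N.
      by rewrite mulnC mulrnA pt0 mul0rn.
    case: nv; have co : coprime p k by rewrite prime_coprime.
    have k0 : (0 < k)%N by case: (k) nd; rewrite ?dvdn0.
    have Nk' : N (v *+ k) by apply: N0sub.
    case: (egcdnP p k0) => a b e _; rewrite gcdnC (eqP co) in e.
    have -> : v = v *+ k *+ a - v *+ p *+ b.
      by rewrite -!mulrnA mulnC e mulrnDr mulnC mulr1n addrC addKr.
    by apply: (NB _ _); apply: NMn.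
have [psi [psiD psiP]] := baer (@pq_div p Qp p_pr) gG.
exists psi.
  split=> // w Zw Nw; apply: (psiP _); exists 0%N; by rewrite !mulr0n subr0.
by rewrite (psiP v t0) => [e|]; [move/eqP: t00 | exists 1%N; rewrite !mulr1n subrr].
Qed.

Lemma pi_tors v : N (varpi *: v) -> N (v *+ p).
Proof.
move=> Nv; have [c pc] := varpi_p p_pr varpi_unif.
by rewrite -scaler_nat pc mulrC -scalerA; apply: (NZ _ _).
Qed.

Definition S1 := [set v | Z v /\ N (varpi *: v)].
Lemma X_S1 : exists L : seq T, forall chi v, isX chi -> S1 v -> chi v \in L.
Proof.
have [L LP] := pq_torsion Qp p_pr; exists L => chi v chiX [Zv Nv]; apply: LP.
by rewrite -XMn //; apply: chiX.2; [apply: ZMn | apply: pi_tors].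
Qed.


Lemma fixd_le m n v : (m <= n)%N -> fixd m v -> fixd n v.
Proof. by move=> mn fm g /(Un_le mn)/fm. Qed.
Lemma fixd_all n v : N v -> fixd n v.
Proof. by move=> Nv g _; apply: (NB _ _) => //; apply: (Nact _ _). Qed.
Lemma fixd_add n u v : fixd n u -> fixd n v -> fixd n (u + v).
Proof.
move=> fu fv g /[dup] /fu hu /fv hv.
by rewrite actD opprD addrACA; apply: ND.
Qed.

Lemma X_act chi (lam : iwfun) : isX chi -> iwasawa lam -> isX (fun v => chi (iw_coact N act lam v)).
Proof.
move=> chiX lamI; have [P cP eP] := iw_mk p_pr p_odd lamI; split=> [u v Zu Zv|v Zv Nv].
  have [m fm] := smooth Zu; have [n fn] := smooth Zv.
  pose k := maxn m n.
  have fu : fixd k u by apply: fixd_le fm; rewrite leq_maxl.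
  have fv : fixd k v by apply: fixd_le fn; rewrite leq_maxr.
  have Zuv := ZD Zu Zv.
  have Zc w : Z w -> Z (iw_coact N act lam w) by apply: coact_Z.
  rewrite -chiX.1; [|exact: Zc|exact: Zc].
  apply: (XN chiX); [exact: Zc | by apply: ZD; apply: Zc |].
  rewrite eP; apply: (eqm_trans N0 NB (b := ev (P k) (u + v))).
    exact: (coactE cP (fixd_add fu fv)).
  rewrite evDr; apply: (eqm_sym N0 NB); apply: (eqm_add N0 NB).
    exact: (coactE cP fu).
  exact: (coactE cP fv).
apply: chiX.2; first exact: coact_Z.
have := coactE cP (@fixd_all 0%N v Nv); rewrite -eP => h.
rewrite -(subrK (ev (P 0%N) v) (iw_coact N act lam v)).
by apply: ND => //; apply: ev_N.
Qed.

Lemma X_sub chi chi' : isX chi -> isX chi' -> isX (chi - chi').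
Proof.
move=> [hD hN] [hD' hN']; split=> [u v Zu Zv|v Zv Nv].
  rewrite -[LHS]/(chi (u + v) - chi' (u + v)) hD // hD' // opprD addrACA //.
by rewrite -[LHS]/(chi v - chi' v) hN // hN' // subrr.
Qed.
Lemma X_zero : isX 0.
Proof. by split=> [u v _ _|v _ _] //; rewrite -[RHS]/(0 + 0) addr0. Qed.
Lemma X_add chi chi' : isX chi -> isX chi' -> isX (chi + chi').
Proof.
move=> h h'; have -> : chi + chi' = chi - (0 - chi') by rewrite sub0r opprK.
by apply: X_sub => //; apply: X_sub => //; apply: X_zero.
Qed.

(** Values on [S1] lie in a finite set, so finitely many restrictions leave finitely many patterns
    of values; elements with the same pattern agree modulo [N] because characters separate them. *)
Lemma fin_of_chars (Lc : seq (V -> T)) : (forall c, c \in Lc -> isX c) ->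
  (forall x, isX x -> exists2 c, c \in Lc & forall v, S1 v -> x v = c v) ->
  finite_set (quotient_set S1 N).
Proof.
move=> LX LP; have [L0 L0P] := X_S1.
have [LL LLP] := fin_seqs L0 (size Lc).
have [|vs [vsS vsP]] := @finite_reps V _ S1 (fun v => [seq c v | c <- Lc]) LL.
  move=> v Sv; apply: LLP; first by rewrite size_map.
  by move=> _ /mapP[c cL ->]; apply: L0P => //; apply: LX.
apply: (@finite_quotient V S1 N vs N0 NB) => v Sv; have [u uv /eq_in_map e] := vsP v Sv.
exists u => //; apply: contrapT => nuv; have Su := vsS u uv.
have [] := Xsep nuv.
  apply: pi_tors; rewrite scalerBr; apply: (NB _ _); [exact: Sv.2 | exact: Su.2].
move=> x xX; apply; have [c cL cP] := LP x xX.
by rewrite (XB xX Sv.1 Su.1) (cP _ Sv) (cP _ Su) (e c cL) subrr.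
Qed.

Lemma iw1mul (x : iwfun) : iwasawa x -> iwmul (iwconst 1) x = x.
Proof.
by move=> /(iw_mk p_pr p_odd)[P cP ->]; rewrite mkC mkM; apply: mk_eq => n; rewrite mul1r.
Qed.
Lemma iwmulBr (x y z : iwfun) : iwasawa x -> iwasawa y -> iwasawa z ->
  iwmul x (y - z) = iwmul x y - iwmul x z.
Proof.
move=> /(iw_mk p_pr p_odd)[A cA ->] /(iw_mk p_pr p_odd)[B cB ->] /(iw_mk p_pr p_odd)[C cC ->].
by rewrite mkB !mkM mkB; apply: mk_eq => n; rewrite mulrBr.
Qed.

(** When all exponents of varpi are 0, the elementary module is finite modulo varpi. The
    pseudo-isomorphism carries this to the dual, and characters divisible by varpi vanish on [S1],
    so [S1] has finitely many characters. *)
Lemma mu0_fin : has_mu_invariant varpi (pontryagin_dual H Z N act T) 0 ->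
  finite_set (quotient_set S1 N).
Proof.
move=> [k [r [mus [f [l [fP [phi [pn pd pa pact pk pc]] e0]]]]]].
pose gen (i : 'I_k + 'I_r) : iwfun := match i with
  | inl i => iwconst (varpi ^+ mus i) | inr j => iwexp (f j) (l j) end.
have mus0 i : mus i = 0%N.
  by move/esym/eqP: e0; rewrite sum_nat_eq0 => /forallP/(_ i)/eqP.
have cI : iwasawa (iwconst varpi : iwfun) by apply: iwasawaC.
have genI i : iwasawa (gen i).
  by case: i => [i|j]; [apply: iwasawaC | apply: iwasawaX => //; have [[]] := fP j].
pose num (v : 'I_k + 'I_r -> iwfun) := forall i, iwasawa (v i).
pose D : set ('I_k + 'I_r -> iwfun) := fun v => forall i, iwdvd (gen i) (v i).
pose sc (v : 'I_k + 'I_r -> iwfun) : 'I_k + 'I_r -> iwfun := fun i => iwmul (iwconst varpi) (v i).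
have z0I : iwasawa (0 : iwfun) by rewrite -(mk0 p_pr p_odd); apply: mk_iwasawa.
have D0 : D 0.
  move=> i; exists 0 => //; rewrite -[LHS]/(0 : iwfun).
  by have [P cP ->] := iw_mk p_pr p_odd (genI i); rewrite -(mk0 p_pr p_odd) mkM; apply: mk_eq => n; rewrite mulr0.
have DB a b : D a -> D b -> D (a - b).
  by move=> Da Db i; apply: (iwdvdD p_pr p_odd) => //; apply: (iwdvdN p_pr p_odd).
have Dsc a : (forall i, iwasawa (a i)) -> D a -> D (sc a).
  by move=> aI Da i; rewrite /sc (iwmulC p_pr p_odd) //; apply: (iwdvdM p_pr p_odd).
have scI a : num a -> num (sc a) by move=> aI i; apply: iwasawaM.
have numB a b : num a -> num b -> num (a - b) by move=> aI bI i; apply: (iwasawaB p_pr p_odd).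
have scB a b : num a -> num b -> sc (a - b) = sc a - sc b.
  by move=> aI bI; apply/funext => i; apply: iwmulBr.
pose Q (i : 'I_k + 'I_r) (x c : iwfun) := exists2 y, iwasawa y & iwdvd (gen i) (x - (c + iwmul (iwconst varpi) y)).
have [|L1 L1P] := @fin_prod _ iwfun 0 (fun _ x => iwasawa x) Q.
  case=> [i|j].
    exists [:: 0] => x xI; exists 0%N => //; exists 0 => //=.
    exists (x - (0 + iwmul (iwconst varpi) 0)); last by rewrite mus0 expr0 iw1mul //; apply: (iwasawaB p_pr p_odd) => //; apply: (iwasawaD p_pr p_odd) => //; apply: iwasawaM.
    by apply: (iwasawaB p_pr p_odd) => //; apply: (iwasawaD p_pr p_odd) => //; apply: iwasawaM.
  have [[fI _ _ _] nd] := fP j.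
  have [L LP] := iw_fin p_pr p_odd varpi_unif (l j) fI nd.
  exists L => x /LP[c [y [z [cL yI zI e]]]]; exists (index c L); first by rewrite index_mem.
  exists y => //; exists z => //; rewrite nth_index // opprD addrA e addrC addKr //.
have phiD x y : isX x -> isX y -> eqm D (phi (x + y)) (phi x + phi y) := pa x y.
have phiB x y : isX x -> isX y -> eqm D (phi (x - y)) (phi x - phi y).
  move=> xX yX; have := phiD _ _ (X_sub xX yX) yX; rewrite subrK => h.
  have := eqm_sub DB h (eqm_refl D0 (phi y)); rewrite addrK => h'.
  exact: (eqm_sym D0 DB).
have phiI x : isX x -> num (phi x) := pn x.
pose P1 x kk := exists2 y, num y & eqm D (phi x) (nth (fun=> 0) L1 kk + sc y).
have [|ts1 [ts1X ts1P]] := @reps_dep (V -> T)%type isX P1 (size L1).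
  move=> x xX; have [kk kl h] := L1P (phi x) (phiI x xX); exists kk => //.
  have /choice[y yP] : forall i, exists y, iwasawa y /\ iwdvd (gen i) (phi x i - (nth (fun=> 0) L1 kk i + iwmul (iwconst varpi) y)).
    by move=> i; have [y] := h i; exists y.
  by exists y => i; have [] := yP i.
have [|L2 [L2I L2P]] := quotient_reps _ pc.
  exists 0; first exact: X_zero.
  have d0 : D (phi 0) by apply: pd => //; exact: X_zero.
  exact: (DB _ _ D0 d0).
have dX z : isX z -> isX (fun v => z (iw_coact N act (iwconst varpi : iwfun) v)) by move=> zX; apply: X_act.
(* Characters whose image is varpi times a representative of the cokernel: finitely many modulo the
   kernel of [phi]. *)
pose A3 (w : V -> T) := isX w /\ exists2 c, c \in L2 & eqm D (phi w) (sc c).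
have [|ts3 [ts3X ts3P]] := @reps_dep (V -> T)%type A3 (fun w kk => eqm D (phi w) (sc (nth (fun=> 0) L2 kk))) (size L2).
  move=> w [_ [c cL h]]; exists (index c L2); first by rewrite index_mem.
  by rewrite nth_index.
have [|L4 [L4X L4P]] := quotient_reps _ pk; first by [].
pose Lc := [seq a.1 + a.2 | a <- [seq (a, b) | a <- [seq a + b | a <- ts1, b <- ts3], b <- L4]].
apply: (@fin_of_chars [seq a + b | a <- [seq a + b | a <- ts1, b <- ts3], b <- L4]).
  move=> _ /allpairsP[[a b] [/allpairsP[[a1 a2] [/ts1X h1 /ts3X[h2 _] ->]] /L4X[h4 _] ->]] /=.
  by apply: X_add => //; apply: X_add.
move=> x xX; have [t tts [kk kl [[y yI ey] [y' y'I ey']]]] := ts1P x xX.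
have tX := ts1X t tts.
have [c cL [z zX ez]] := L2P (y - y') (numB _ _ yI y'I).
have {}ez : eqm D (y - y') (c + phi z) by move: ez; rewrite /eqm opprD addrA.
have cI' : num c by apply: L2I.
pose z' := fun v => z (iw_coact N act (iwconst varpi : iwfun) v).
have z'X : isX z' by apply: dX.
have ez' : eqm D (phi z') (sc (phi z)) := pact _ _ cI zX.
(* The images of [x] and [t] differ by varpi times c + phi z, with [c] a representative of the
   cokernel. Subtracting z', which is varpi z, leaves a character with image varpi c. *)
pose w := x - t - z'.
have wX : isX w by apply: X_sub => //; apply: X_sub.
have ew : eqm D (phi w) (sc c).
  apply: (eqm_trans D0 DB (phiB _ _ (X_sub xX tX) z'X)).
  have h1 : eqm D (phi (x - t)) (sc (y - y')).
    apply: (eqm_trans D0 DB (phiB _ _ xX tX)).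
    have := eqm_sub DB ey ey'; rewrite opprD addrACA subrr add0r -scB //.
  have h2 : eqm D (sc (y - y')) (sc c + sc (phi z)).
    have phzI := phiI z zX.
    have : D (sc (y - y' - (c + phi z))).
      by apply: Dsc => // i; apply: (iwasawaB p_pr p_odd); [apply: numB | apply: (iwasawaD p_pr p_odd)].
    have n1 : num (y - y') := numB _ _ yI y'I.
    have n2 : num (c + phi z) by move=> i; exact: (iwasawaD p_pr p_odd (cI' i) (phzI i)).
    rewrite (scB _ _ n1 n2).
    have -> : sc (c + phi z) = sc c + sc (phi z) :> ('I_k + 'I_r -> iwfun).
      have n0 : num 0 by move=> i.
      have nN : num (0 - phi z) by apply: numB.
      have -> : c + phi z = c - (0 - phi z) by rewrite sub0r opprK.
      have sc0 : sc 0 = 0 by have := scB _ _ n0 n0; rewrite !subrr.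
      rewrite (scB _ _ cI' nN) (scB _ _ n0 phzI) sc0.
      by rewrite sub0r opprK.
    by [].
  have := eqm_sub DB (eqm_trans D0 DB h1 h2) ez'; rewrite addrK; apply.
have [t3 t3ts [kk3 _ [e3 e3']]] := ts3P w (conj wX (ex_intro2 _ _ c cL ew)).
have [t3X _] := ts3X t3 t3ts.
have kerw : D (phi (w - t3)).
  apply/(@eqm0 _ D); apply: (eqm_trans D0 DB (phiB _ _ wX t3X)).
  by rewrite -(subrr (sc (nth (fun=> 0) L2 kk3))); apply: (eqm_sub DB).
have [k4 k4L e4] := L4P (w - t3) (conj (X_sub wX t3X) kerw).
exists (t + t3 + k4); first by apply/allpairsP; exists (t + t3, k4); split=> //; apply/allpairsP; exists (t, t3).
move=> v [Zv Nv]; have := e4 v Zv.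
rewrite -[LHS]/(x v - t v - z' v - t3 v - k4 v) -[(t + t3 + k4) v]/(t v + t3 v + k4 v).
have -> : z' v = 0.
  rewrite /z' (XN zX (v := varpi *: v)); [|exact: coact_Z|exact: (ZZ _ _)|exact: coact_const].
  by apply: zX.2 => //; apply: (ZZ _ _).
by rewrite subr0 => /eqP; rewrite -!addrA -!opprD subr_eq0 !addrA => /eqP.
Qed.


Lemma fix_list (ls : seq V) : (forall u, u \in ls -> Z u) -> exists k, forall u, u \in ls -> fixd k u.
Proof.
elim: ls => [|u ls IHls] h; first by exists 0%N.
have [|k kP] := IHls; first by move=> w wl; apply: h; rewrite inE wl orbT.
have [|n fn] := smooth (v := u); first by apply: h; rewrite inE eqxx.
exists (maxn k n) => w; rewrite inE => /orP[/eqP->|/kP fw].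
  by apply: fixd_le fn; rewrite leq_maxr.
by apply: fixd_le fw; rewrite leq_maxl.
Qed.

Lemma S1_fix : finite_set (quotient_set S1 N) -> exists k, forall v, S1 v -> fixd k v.
Proof.
move=> /(quotient_reps N0)[vs [vsS vsP]].
have [|k kP] := @fix_list vs; first by move=> u /vsS[].
exists k => v Sv; have [u uv Nuv] := vsP v Sv.
rewrite -(subrK u v); apply: fixd_add; [exact: fixd_all | exact: kP].
Qed.

Lemma char_reps : finite_set (quotient_set S1 N) -> exists ls : seq (V -> T),
  (forall c, c \in ls -> isX c) /\
  forall x, isX x -> exists2 c, c \in ls & forall v, S1 v -> x v = c v.
Proof.
move=> /(quotient_reps N0)[vs [vsS vsP]]; have [L0 L0P] := X_S1.
have [LL LLP] := fin_seqs L0 (size vs).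
have [|ls [lX lP]] := @finite_reps (V -> T)%type _ isX (fun x => [seq x v | v <- vs]) LL.
  move=> x xX; apply: LLP; first by rewrite size_map.
  by move=> _ /mapP[v vL ->]; apply: L0P => //; apply: vsS.
exists ls; split=> // x xX; have [c cl /eq_in_map e] := lP x xX; exists c => // v Sv.
have [u uv Nuv] := vsP v Sv; have cX := lX c cl; have [Zu _] := vsS u uv.
by rewrite (XN xX Sv.1 Zu Nuv) (XN cX Sv.1 Zu Nuv) e.
Qed.

Lemma X_ev x P : isX x -> isX (fun v => x (ev P v)).
Proof.
move=> xX; split=> [u v Zu Zv|v Zv Nv]; first by rewrite evDr xX.1 //; apply: ev_Z.
by apply: xX.2; [apply: ev_Z | apply: ev_N].
Qed.

Section Comb.
Variables (d : nat) (ch : 'I_d.+1 -> V -> T).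
Hypothesis chX : forall i, isX (ch i).
Definition comb (a : 'rV[R]_d.+1) v := \sum_i ch i (a 0 i *: v).

Lemma combD a b v : Z v -> comb (a + b) v = comb a v + comb b v.
Proof.
move=> Zv; rewrite /comb -big_split; apply: eq_bigr => i _.
by rewrite mxE scalerDl (chX i).1 //; apply: (ZZ _ _).
Qed.
Lemma combZ c a v : comb (c *: a) v = comb a (c *: v).
Proof. by apply: eq_bigr => i _; rewrite mxE scalerA mulrC. Qed.
Lemma comb0 v : comb 0 v = 0.
Proof. by rewrite /comb big1 // => i _; rewrite mxE scale0r (X0 (chX i)). Qed.
Lemma combB a b v : Z v -> comb (a - b) v = comb a v - comb b v.
Proof. by move=> Zv; apply: (@addIr _ (comb b v)); rewrite -combD // !subrK. Qed.
Lemma comb_sum I (r : seq I) (F : I -> 'rV[R]_d.+1) v : Z v ->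
  comb (\sum_(i <- r) F i) v = \sum_(i <- r) comb (F i) v.
Proof.
move=> Zv; elim: r => [|i r IHr]; first by rewrite !big_nil comb0.
by rewrite !big_cons combD // IHr.
Qed.
Lemma comb_X a : isX (comb a).
Proof.
split=> [u v Zu Zv|v Zv Nv].
  rewrite /comb -big_split; apply: eq_bigr => i _.
  by rewrite scalerDr (chX i).1 //; apply: (ZZ _ _).
rewrite /comb big1 // => i _; apply: (chX i).2; [exact: (ZZ _ _) | exact: (NZ _ _)].
Qed.
Lemma comb_mx (Mx : 'M[R]_d.+1) (op op2 : V -> V) : (forall v, Z v -> Z (op2 v)) ->
  (forall c v, op (c *: v) = c *: op v) -> (forall c v, op2 (c *: v) = c *: op2 v) ->
  (forall i v, Z v -> ch i (op v) = comb (row i Mx) (op2 v)) ->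
  forall a v, Z v -> comb a (op v) = comb (a *m Mx) (op2 v).
Proof.
move=> Zo oZ o2Z h a v Zv; rewrite mulmx_sum_row comb_sum; last exact: (Zo _).
apply: eq_bigr => i _; rewrite -oZ h; last exact: (ZZ _ _).
by rewrite o2Z combZ.
Qed.
Lemma comb_ev (Mx : 'M[R]_d.+1) : (forall a v, Z v -> comb a (tau v) = comb (a *m Mx) v) ->
  forall P a v, Z v -> comb a (ev P v) = comb (a *m horner_mx Mx P) v.
Proof.
move=> h P a; elim/poly_ind: P => [|P c IHP] v Zv.
  by rewrite /ev size_poly0 big_ord0 rmorph0 mulmx0 comb0 (X0 (comb_X a)).
have Zt : Z (tau v) by apply: (Zact _ _).
rewrite evDl evMX evC (comb_X a).1; [|exact: ev_Z|exact: (ZZ _ _)].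
rewrite IHP // h // -combZ -combD //; congr (comb _ v).
by rewrite rmorphD rmorphM /= horner_mx_X horner_mx_C mulmxDr -mulmxE mulmxA mul_mx_scalar.
Qed.
End Comb.

(** Nakayama: a character minus a representative of its restriction to [S1] is varpi times another
    character. Iteration gives coefficients with a limit by compactness, and the remainder vanishes
    on each vector because a power of varpi kills it modulo [N]. *)
Lemma fg : finite_set (quotient_set S1 N) -> exists d (ch : 'I_d.+1 -> V -> T),
  (forall i, isX (ch i)) /\ forall x, isX x -> exists a, forall v, Z v -> x v = comb ch a v.
Proof.
move=> fin; have [ls [lsX lsP]] := char_reps fin.
case: ls lsX lsP => [|c0 ls'] lsX lsP; first by have [] := lsP 0 X_zero.
pose d := size ls'; pose ch (i : 'I_d.+1) := nth 0 (c0 :: ls') i.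
have chX i : isX (ch i) by apply: lsX; apply: mem_nth.
have chP x : isX x -> exists i, forall v, S1 v -> x v = ch i v.
  move=> /lsP[c cl e]; have lt : (index c (c0 :: ls') < d.+1)%N by rewrite index_mem.
  by exists (Ordinal lt) => v Sv; rewrite /ch /= nth_index // e.
exists d, ch; split=> // x0 x0X.
have approx m x : isX x -> exists a, exists2 x', isX x' & forall v, Z v -> x v = comb ch a v + x' (varpi ^+ m *: v).
  elim: m => [|m IHm] xX.
    by exists 0, x => // v Zv; rewrite comb0 // add0r expr0 scale1r.
  have [a [x' x'X e]] := IHm xX; have [i iP] := chP x' x'X.
  have [||x'' x''X e''] := @Xdiv (x' - ch i) varpi; first exact: X_sub.
    by move=> v Zv Nv; rewrite -[LHS]/(x' v - ch i v) iP ?subrr.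
  exists (a + varpi ^+ m *: delta_mx 0 i), x'' => // v Zv.
  have Zm : Z (varpi ^+ m *: v) by apply: (ZZ _ _).
  rewrite e // combD // -addrA; congr (_ + _); rewrite combZ.
  have -> : comb ch (delta_mx 0 i) (varpi ^+ m *: v) = ch i (varpi ^+ m *: v).
    rewrite /comb (bigD1 i) //= mxE !eqxx scale1r big1 ?addr0 // => j ji.
    by rewrite mxE (negPf ji) scale0r (X0 (chX j)).
  by rewrite exprS -scalerA -e'' // -[(x' - ch i) _]/(x' _ - ch i _) addrC subrK.
have /choice[am amP] : forall m, exists a, exists2 x', isX x' & forall v, Z v -> x0 v = comb ch a v + x' (varpi ^+ m *: v).
  by move=> m; apply: approx.
have [UF [UU Ule]] := ultra_nat.
have /choice[al alP] : forall i : 'I_d.+1, exists y, forall n, UF [set m | exists z, am m 0 i - y = varpi ^+ n * z].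
  by move=> i; apply: (valring_compact p_pr varpi_unif UU (fun m => am m 0 i)).
exists (\row_i al i) => v Zv; have [kk Nk] := tors Zv.
have FF : Filter UF by case: UU => -[].
have [m [/= mP km]] := filter_ex (filterI (filter_all_fin FF (fun i => alP i kk)) (Ule kk)).
have [x' x'X ->] := amP m; last exact: Zv.
have -> : x' (varpi ^+ m *: v) = 0.
  apply: x'X.2; first exact: (ZZ _ _).
  by rewrite -(subnK km) exprD -scalerA; apply: (NZ _ _).
rewrite addr0; apply/eqP; rewrite -subr_eq0 -combB //; apply/eqP.
rewrite /comb big1 // => i _; rewrite !mxE; have [z ->] := mP i.
apply: (chX i).2; first exact: (ZZ _ _).
by rewrite mulrC -scalerA; apply: (NZ _ _).
Qed.

(** The dual is finitely generated over the valuation ring, with gam acting by a matrix, so [core]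
    applies. No summand is a quotient by a power of varpi, and the bounded defects become a finite
    kernel and a finite cokernel. *)
Lemma fin_mu0 : finite_set (quotient_set S1 N) ->
  has_mu_invariant varpi (pontryagin_dual H Z N act T) 0.
Proof.
move=> fin; have [d [ch [chX gen]]] := fg fin.
have tauZ v : Z v -> Z (tau v) by move=> Zv; apply: (Zact _ _).
have /choice[mr mrP] : forall i, exists a, forall v, Z v -> ch i (tau v) = comb ch a v.
  move=> i; have [|a aP] := gen (fun v => ch i (tau v)); last by exists a.
  split=> [u v Zu Zv|v Zv Nv]; first by rewrite /tau actD (chX i).1 //; apply: (Zact _ _).
  by apply: (chX i).2; [apply: (Zact _ _) | apply: (Nact _ _)].
pose M := \matrix_i mr i.
have combM : forall a v, Z v -> comb ch a (tau v) = comb ch (a *m M) v.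
  apply: (@comb_mx d ch chX M tau id) => // [c v|i v Zv]; first exact: actZ.
  by rewrite rowK mrP.
have combE := comb_ev chX combM.
have [k kP] := S1_fix fin.
(* At a level k fixing [S1], omg kills [S1] modulo [N]; a character composed with it is then
   divisible by varpi. This is the congruence between [M] and [B] that [core] assumes. *)
have /choice[br brP] : forall i, exists a, forall v, Z v -> ch i (ev (omg p R k) v) = comb ch a (varpi *: v).
  move=> i; have [||x' x'X e] := @Xdiv (fun v => ch i (ev (omg p R k) v)) varpi; first exact: X_ev.
    move=> v Zv Nv; apply: (chX i).2; first exact: ev_Z.
    by apply: ev_omg; apply: kP.
  by have [a aP] := gen x' x'X; exists a => v Zv; rewrite e // aP //; apply: (ZZ _ _).
pose B := \matrix_i br i.
have combB' : forall a v, Z v -> comb ch a (ev (omg p R k) v) = comb ch (a *m B) (varpi *: v).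
  apply: (@comb_mx d ch chX B (ev (omg p R k)) (fun v => varpi *: v)) => [v Zv|c v|c v|i v Zv].
  - exact: (ZZ _ _).
  - exact: evZr.
  - by rewrite !scalerA mulrC.
  - by rewrite rowK brP.
pose Rel : set 'rV[R]_d.+1 := [set a | forall v, Z v -> comb ch a v = 0].
have RelB a b : Rel a -> Rel b -> Rel (a - b).
  by move=> ha hb v Zv; rewrite combB // ha // hb // subrr.
have [r [f [l [Hp [A [[mHp fP] A1 A2 [c1 A3] [c2 A4]]]]]]] : exists r (f : 'I_r -> {poly R}) (l : 'I_r -> nat) (Hp : {poly R})
    (A : 'I_r -> 'rV[R]_d.+1 -> {poly R}),
  [/\ [/\ Hp \is monic & forall j, [/\ f j \is monic, irreducible_poly (map_poly (val : R -> K) (f j)) &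
         exists e G, f j = ('X - 1) ^+ e + varpi *: G]],
      forall j, [/\ forall a b, A j (a - b) = A j a - A j b, forall c a, A j (c *: a) = c *: A j a &
         forall a, (size (A j a) < size (f j ^+ l j))%N],
      forall j a, [/\ forall P, exists Q, A j (a *m horner_mx M P) = P * A j a + f j ^+ l j * Q,
         A j (a *m horner_mx M Hp) = 0 & Rel a -> A j a = 0],
      exists c, forall a, (forall j, A j a = 0) -> Rel (varpi ^+ c *: a) &
      exists c, forall rr : 'I_r -> {poly R}, (forall j, (size (rr j) < size (f j ^+ l j))%N) ->
        exists a, forall j, A j a = varpi ^+ c *: rr j].
  apply: (@core p Qp K varpi p_pr p_odd varpi_unif d k M B Rel).
  - by move=> v Zv; rewrite comb0.
  - by move=> a b ha hb v Zv; rewrite combD // ha // hb // addr0.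
  - by move=> c a ha v Zv; rewrite combZ ha //; apply: (ZZ _ _).
  - by move=> a ha v Zv; rewrite -combM // ha //; apply: tauZ.
  - move=> a v Zv; rewrite mulmxBr combB // -combE // combB' //.
    by rewrite -scalemxAr combZ subrr.
pose F j := f j ^+ l j.
have AB j a b : A j (a - b) = A j a - A j b by have [] := A1 j.
have AZ j c a : A j (c *: a) = c *: A j a by have [] := A1 j.
have As j a : (size (A j a) < size (F j))%N by have [] := A1 j.
have Arel j a b : Rel (a - b) -> A j a = A j b.
  by move=> h; have [_ _ /(_ h)] := A2 j (a - b); rewrite AB => /eqP; rewrite subr_eq0 => /eqP.
have mF j : F j \is monic by apply: monic_exp; have [] := fP j.
have Fsm j (q : {poly R}) : (size q < size (F j))%N -> iwdvd (mk (fun=> F j)) (mk (fun=> q)) -> q = 0.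
  have [mf _ [e [G eG]]] := fP j; have [G' e'] := distinguished_exp eG (l j).
  exact: (iwsmall varpi_unif (mF j) e').
have gF j : iwexp (mk (fun=> f j)) (l j) = mk (fun=> F j) by apply: mkX.
have FI j : iwasawa (mk (fun=> F j)) by apply: mk_iwasawa.
have dv j (q : {poly R}) : iwdvd (mk (fun=> F j)) (mk (fun=> F j * q)) by apply: iwdvd_gen.
have dv0 j : iwdvd (mk (fun=> F j)) (mk (fun=> 0)) by have := dv j 0; rewrite mulr0.
have /choice[co coP] : forall x, exists a, isX x -> forall v, Z v -> x v = comb ch a v.
  move=> x; have [xX|nx] := pselect (isX x); last by exists 0.
  by have [a aP] := gen x xX; exists a.
pose phi (x : V -> T) (i : 'I_0 + 'I_r) : iwfun :=
  match i with inl _ => 0 | inr j => mk (fun=> A j (co x)) end.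
have co_rel x a : isX x -> (forall v, Z v -> x v = comb ch a v) -> Rel (co x - a).
  by move=> xX h v Zv; rewrite combB // -coP // h // subrr.
have phi_add x y j : isX x -> isX y -> A j (co (x + y)) = A j (co x) + A j (co y).
  move=> xX yX; rewrite (Arel j _ (co x - (- co y))).
    by rewrite AB -[- co y]scaleN1r AZ scaleN1r opprK.
  apply: co_rel; first exact: X_add.
  by move=> v Zv; rewrite opprK combD // -!coP.
have phi_comb a j : A j (co (comb ch a)) = A j a.
  by apply: Arel; apply: co_rel => //; apply: comb_X.
exists 0%N, r, (fun=> 0%N), (fun j => mk (fun=> f j)), l; split; last by rewrite big_ord0.
  move=> j; have [mf irf [e [G eG]]] := fP j.
  split; [exact: (iwprime_mk p_pr p_odd varpi_unif mf eG) | exact: (pi_ndvd_mk varpi_unif mf)].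
exists phi; split.
- by move=> x _ [[]|j] //=; apply: mk_iwasawa.
- move=> x xX x0 [[]|j] //=; rewrite gF (Arel j (co x) 0).
    by rewrite -(scale0r 0) AZ scale0r.
  by apply: co_rel => // v Zv; rewrite comb0 // x0.
- move=> x y xX yX [[]|j] //=; rewrite gF.
  rewrite -[X in iwdvd _ X]/(mk (fun=> A j (co (x + y))) - (mk (fun=> A j (co x)) + mk (fun=> A j (co y)))).
  by rewrite phi_add // mkD subrr -(mk0 p_pr p_odd).
- move=> lam x lamI xX [[]|j] //=; rewrite gF.
  rewrite -[X in iwdvd _ X]/(mk (fun=> A j (co (fun v => x (iw_coact N act lam v)))) - iwmul lam (mk (fun=> A j (co x)))).
  (* [A j] vanishes on the image of [Hp], so only the remainder [q] of [lam] modulo the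
     distinguished [Hp] matters, and it acts as a polynomial in [M]. *)
  have [q sq [nu nuI enu]] := iw_div p_pr p_odd varpi_unif mHp lamI.
  have [NU cNU eNU] := iw_mk p_pr p_odd nuI.
  pose P n := q + Hp * NU n.
  have cP : coherent p P.
    by apply: (coherentD p_pr (P := fun=> q)) => //; apply: (coherentM p_pr (P := fun=> Hp)).
  have elam : lam = mk P.
    by rewrite -(subrK (mk (fun=> q)) lam) enu eNU mkM mkD; apply: mk_eq => n; rewrite addrC.
  have nuX := X_act xX nuI; pose b := co (fun v => x (iw_coact N act nu v)).
  have lamX := X_act xX lamI.
  have -> : A j (co (fun v => x (iw_coact N act lam v))) = A j (co x *m horner_mx M q).
    rewrite (Arel j _ (co x *m horner_mx M q - (- (b *m horner_mx M Hp)))).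
      rewrite AB -[- (b *m _)]scaleN1r AZ scaleN1r opprK.
      by have [_ -> _] := A2 j b; rewrite addr0.
    apply: co_rel => // v Zv; rewrite opprK combD // -!combE //.
    have [n1 f1] := smooth Zv; have ZH : Z (ev Hp v) by apply: ev_Z.
    have [n2 f2] := smooth ZH; pose n := maxn n1 n2.
    have f1' : fixd n v by apply: fixd_le f1; rewrite leq_maxl.
    have f2' : fixd n (ev Hp v) by apply: fixd_le f2; rewrite leq_maxr.
    rewrite -coP; [|exact: xX|exact: ev_Z]; rewrite -coP; [|exact: nuX|exact: ev_Z].
    rewrite -xX.1; [|exact: ev_Z|exact: coact_Z].
    apply: (XN xX); [exact: coact_Z|apply: ZD; [exact: ev_Z|exact: coact_Z]|].
    rewrite elam; apply: (eqm_trans N0 NB (b := ev (P n) v)); first exact: (coactE cP f1').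
    rewrite /P evDl mulrC evM; apply: (eqm_add N0 NB); first exact: eqm_refl.
    by apply: (eqm_sym N0 NB); rewrite eNU; apply: (coactE cNU f2').
  have [h1' hH _] := A2 j (co x); have [Q ->] := h1' q; have [Q' eQ'] := h1' Hp; rewrite hH in eQ'.
  rewrite elam mkM mkB.
  have -> : mk (fun n => q * A j (co x) + f j ^+ l j * Q - P n * A j (co x)) = mk (fun n => F j * (Q + Q' * NU n)).
    apply: mk_eq => n; congr red; rewrite /P /F.
    have e1 : Hp * A j (co x) = - (f j ^+ l j * Q') by apply/eqP; rewrite -addr_eq0 -eQ'.
    have -> : (q + Hp * NU n) * A j (co x) = q * A j (co x) + (Hp * A j (co x)) * NU n by ring.
    by rewrite e1; ring.
  exists (mk (fun n => Q + Q' * NU n)); last by rewrite mkM.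
  apply: mk_iwasawa; apply: (coherentD p_pr (P := fun=> Q)) => //.
  exact: (coherentM p_pr (P := fun=> Q')).
(* Kernel: two of its elements with coefficients congruent modulo varpi^c1 differ by varpi^c1 times
   a vector killed by all [A j], which is a relation. *)
- have [i|L LP] := @fin_prod 'I_d.+1 R 0 (fun _ _ => True) (fun _ x c => exists z, x - c = varpi ^+ c1 * z).
    have [ks kP'] := residue_pow_finite p_pr varpi_unif c1; exists ks => x _.
    have [c cl e] := kP' x; exists (index c ks); first by rewrite index_mem.
    by rewrite nth_index.
  have [|ts [tA tP]] := @reps_dep (V -> T)%type [set x | isX x /\ forall i, iwdvd (match i : 'I_0 + 'I_r with inl i => iwconst (varpi ^+ 0) | inr j => iwexp (mk (fun=> f j)) (l j) end) (phi x i)]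
     (fun x kk => forall i, exists z, co x 0 i - nth (fun=> 0) L kk i = varpi ^+ c1 * z) (size L).
    by move=> x _; apply: (LP (fun i => co x 0 i)).
  apply: (@finite_quotient _ _ _ ts) => [v Zv //|a b ha hb v Zv|x hx].
    by rewrite -[LHS]/(a v - b v) ha // hb // subrr.
  have [t tt [kk _ [h1' h2']]] := tP x hx; exists t => // v Zv.
  have [xX hxd] := hx; have [tX htd] := tA t tt.
  have /choice[z zP] : forall i, exists z, co x 0 i - co t 0 i = varpi ^+ c1 * z.
    move=> i; have [z1 e1] := h1' i; have [z2 e2] := h2' i; exists (z1 - z2).
    by rewrite mulrBr -e1 -e2 opprB addrA subrK.
  have e : co x - co t = varpi ^+ c1 *: \row_i z i.
    by apply/rowP => i; rewrite !mxE -zP.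
  have A0 y : isX y -> (forall i, iwdvd (match i : 'I_0 + 'I_r with inl i => iwconst (varpi ^+ 0) | inr j => iwexp (mk (fun=> f j)) (l j) end) (phi y i)) -> forall j, A j (co y) = 0.
    by move=> yX hy j; apply: (Fsm j) => //; have := hy (inr j); rewrite /= gF.
  have : Rel (co x - co t).
    rewrite e; apply: (A3 _) => j.
    have : varpi ^+ c1 *: A j (\row_i z i) = 0 by rewrite -AZ -e AB !A0 // subrr.
    move=> e0; apply/polyP => i; apply: (piX_inj p_pr varpi_unif (k := c1)).
    by have := congr1 (fun q : {poly R} => q`_i) e0; rewrite coefZ !coef0 mulr0.
  by move=> /(_ v Zv); rewrite combB // -!coP // => <-.
(* Cokernel: two families whose remainders are congruent modulo varpi^c2 differ by an element of the
   image, by the second constant of [core]. *)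
pose Nn := [set y : 'I_0 + 'I_r -> iwfun | exists2 x, isX x &
   forall i, iwdvd (match i : 'I_0 + 'I_r with inl i => iwconst (varpi ^+ 0) | inr j => iwexp (mk (fun=> f j)) (l j) end) ((y - phi x) i)].
have NnP (y : 'I_0 + 'I_r -> iwfun) a : (forall j, iwdvd (mk (fun=> F j)) (y (inr j) - mk (fun=> A j a))) -> Nn y.
  move=> h; exists (comb ch a); first exact: comb_X.
  move=> [[]|j] //=; rewrite gF -[X in iwdvd _ X]/(y (inr j) - mk (fun=> A j (co (comb ch a)))).
  by rewrite phi_comb; apply: h.
have NnP' (y : 'I_0 + 'I_r -> iwfun) : Nn y -> exists a, forall j, iwdvd (mk (fun=> F j)) (y (inr j) - mk (fun=> A j a)).
  by move=> [x xX h]; exists (co x) => j; have := h (inr j); rewrite /= gF.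
have Nn0 : Nn 0.
  apply: (NnP 0 0) => j; rewrite -[X in iwdvd _ X]/(0 - mk (fun=> A j 0)) -(mk0 p_pr p_odd) mkB.
  have A00 : A j 0 = 0 by rewrite -(scale0r (0 : 'rV[R]_d.+1)) AZ scale0r.
  by rewrite A00 subr0.
have NnB a b : Nn a -> Nn b -> Nn (a - b).
  move=> /NnP'[a1 h1'] /NnP'[b1 h2']; apply: (NnP _ (a1 - b1)) => j.
  have -> : (a - b) (inr j) - mk (fun=> A j (a1 - b1)) = (a (inr j) - mk (fun=> A j a1)) - (b (inr j) - mk (fun=> A j b1)).
    rewrite -[(a - b) (inr j)]/(a (inr j) - b (inr j)) AB -mkB !opprB.
    by rewrite [mk (fun=> A j b1) - _]addrC addrACA [- b (inr j) + _]addrC.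
  by apply: (iwdvdD p_pr p_odd) => //; apply: (iwdvdN p_pr p_odd).
pose Qj (j : 'I_r) (x : iwfun) (c : {poly R}) := exists2 q : {poly R}, (size q < size (F j))%N /\ (size c <= (size (F j)).-1)%N &
   iwdvd (mk (fun=> F j)) (x - mk (fun=> q)) /\ exists z, q - c = varpi ^+ c2 *: z.
have [L LP] : exists L : seq ('I_r -> {poly R}), forall v : 'I_r -> iwfun, (forall j, iwasawa (v j)) ->
   exists2 k, (k < size L)%N & forall j, Qj j (v j) (nth (fun=> 0) L k j).
  have /choice[Lj LjP] : forall j, exists L : seq {poly R}, forall x, iwasawa x -> exists2 k, (k < size L)%N & Qj j x (nth 0 L k).
    move=> j; have [ps pP] := poly_fin p_pr varpi_unif (size (F j)).-1 c2; exists ps => x xI.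
    have [q sq dq] := iw_div p_pr p_odd varpi_unif (mF j) xI.
    have sq' : (size q <= (size (F j)).-1)%N by rewrite -ltnS prednK // size_poly_gt0 monic_neq0.
    have [c cps [sc ez]] := pP q sq'; exists (index c ps); first by rewrite index_mem.
    by rewrite nth_index //; exists q.
  pose m := \max_j size (Lj j).
  exists [seq (fun j => nth 0 (Lj j) (g j)) | g : {ffun 'I_r -> 'I_m.+1} <- enum {ffun 'I_r -> 'I_m.+1}] => v vI.
  have /choice[kk kkP] : forall j, exists kk : 'I_m.+1, Qj j (v j) (nth 0 (Lj j) kk).
    move=> j; have [kk kl Qk] := LjP j _ (vI j).
    have km : (kk < m.+1)%N by rewrite ltnS (leq_trans (ltnW kl)) // leq_bigmax.
    by exists (Ordinal km).
  pose g := [ffun j => kk j]; exists (index g (enum {ffun 'I_r -> 'I_m.+1})).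
    by rewrite size_map index_mem mem_enum.
  move=> j; rewrite (nth_map g) ?index_mem ?mem_enum // nth_index ?mem_enum //.
  by rewrite ffunE.
have [|ts [tA tP]] := @reps_dep ('I_0 + 'I_r -> iwfun)%type [set y | forall i, iwasawa (y i)]
   (fun y kk => forall j, Qj j (y (inr j)) (nth (fun=> 0) L kk j)) (size L).
  by move=> y yI; apply: (LP (fun j => y (inr j))) => j; apply: (yI _).
apply: (@finite_quotient _ _ Nn ts Nn0 NnB) => y yI.
have [t tt [kk _ [h1' h2']]] := tP y yI; exists t => //.
have /choice[q qP] : forall j, exists q : {poly R} * {poly R} * {poly R},
   [/\ (size q.2 < size (F j))%N, q.1.1 - q.1.2 = varpi ^+ c2 *: q.2,
     iwdvd (mk (fun=> F j)) (y (inr j) - mk (fun=> q.1.1)) & iwdvd (mk (fun=> F j)) (t (inr j) - mk (fun=> q.1.2))].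
  move=> j; have [q1 [s1 _] [d1 [z1 e1]]] := h1' j; have [q2 [s2 _] [d2 [z2 e2]]] := h2' j.
  exists (q1, q2, z1 - z2) => /=.
  have e : q1 - q2 = varpi ^+ c2 *: (z1 - z2) by rewrite scalerBr -e1 -e2 opprB addrA subrK.
  split=> //; rewrite -(lreg_size (c := varpi ^+ c2)); last by move=> u1 u2; apply: (piX_inj p_pr varpi_unif).
  rewrite -e; apply: leq_ltn_trans (size_polyD _ _) _.
  by rewrite size_polyN gtn_max s1 s2.
have [a aP] := A4 (fun j => (q j).2) (fun j => let: And4 h _ _ _ := qP j in h).
apply: (NnP _ a) => j; rewrite aP; have [_ <- d1 d2] := qP j.
have -> : (y - t) (inr j) - mk (fun=> (q j).1.1 - (q j).1.2) = (y (inr j) - mk (fun=> (q j).1.1)) - (t (inr j) - mk (fun=> (q j).1.2)).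
  rewrite -[(y - t) (inr j)]/(y (inr j) - t (inr j)) -mkB !opprB.
  by rewrite [mk (fun=> (q j).1.2) - _]addrC addrACA [- t (inr j) + _]addrC.
by apply: (iwdvdD p_pr p_odd) => //; apply: (iwdvdN p_pr p_odd).
Qed.

Theorem mu0_iff : has_mu_invariant varpi (pontryagin_dual H Z N act T) 0 <->
  finite_set (quotient_set S1 N).
Proof. by split; [exact: mu0_fin | exact: fin_mu0]. Qed.

End Dual.

Lemma zmod_start (V : zmodType) (x y : V) : x - y + 0 == 0 -> x = y.
Proof. by rewrite addr0 subr_eq0 => /eqP. Qed.
(** [zmod] proves identities in abelian groups: the difference of the two sides becomes a sum whose
    first term is repeatedly cancelled against its opposite, which [zbring] moves next to it. *)
Ltac zbring v := lazymatch goal with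
  | |- is_true (v + _ == 0) => idtac
  | _ => rewrite (addrCA _ v); zbring v end.
Ltac zmod_step := lazymatch goal with
  | |- is_true (?t + _ == 0) => lazymatch t with
     | - ?u => zbring u; rewrite addrA subrr add0r
     | _ => zbring (- t); rewrite addrA addNr add0r end end.
Ltac zmod := apply: zmod_start; rewrite ?(opprD, opprK, oppr0) -?addrA ?add0r;
  repeat zmod_step; exact: eqxx.

(** * Finiteness modulo a subgroup *)

Section FiniteModulo.
Variable V : zmodType.
Implicit Types Z N : set V.

Definition finmod Z N := exists ls : seq V, (forall c, c \in ls -> Z c) /\
  forall z, Z z -> exists2 c, c \in ls & N (z - c).
Definition subclosed N := forall a b, N a -> N b -> N (a - b).

Lemma finmod_reps Z N (ls : seq V) : subclosed N ->
  (forall z, Z z -> exists2 c, c \in ls & N (z - c)) -> finmod Z N.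
Proof.
move=> NB lP; have [|ts [tZ tP]] := @reps_dep V Z (fun z k => N (z - nth 0 ls k)) (size ls).
  move=> z /lP[c cl Nc]; exists (index c ls); first by rewrite index_mem.
  by rewrite nth_index.
exists ts; split=> // z /tP[t tt [k _ [h1 h2]]]; exists t => //.
have -> : z - t = z - nth 0 ls k - (t - nth 0 ls k) by zmod.
exact: NB.
Qed.

Lemma finmodI Z N1 N2 : subclosed N1 -> subclosed N2 -> finmod Z N1 -> finmod Z N2 ->
  finmod Z (N1 `&` N2).
Proof.
move=> N1B N2B [l1 [_ P1]] [l2 [_ P2]].
(* The index codes a pair of classes by quotient and remainder. *)
have [|ts [tZ tP]] := @reps_dep V Z (fun z k => N1 (z - nth 0 l1 (k %/ size l2)) /\
    N2 (z - nth 0 l2 (k %% size l2))) (size l1 * size l2).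
  move=> z Zz; have [c1 h1 n1] := P1 z Zz; have [c2 h2 n2] := P2 z Zz.
  have i1 : (index c1 l1 < size l1)%N by rewrite index_mem.
  have i2 : (index c2 l2 < size l2)%N by rewrite index_mem.
  have s2 : (0 < size l2)%N by case: (size l2) i2.
  exists (index c1 l1 * size l2 + index c2 l2)%N.
    by apply: leq_trans (leq_mul i1 (leqnn _)); rewrite mulSn addnC ltn_add2r.
  by rewrite divnMDl // divn_small // addn0 modnMDl modn_small // !nth_index.
exists ts; split=> // z /tP[t tt [k _ [[h1 h2] [h3 h4]]]]; exists t => //.
have E (l : seq V) j : z - t = z - nth 0 l j - (t - nth 0 l j) by zmod.
by split; [rewrite (E l1 (k %/ size l2)%N); apply: N1B | rewrite (E l2 (k %% size l2)%N); apply: N2B].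
Qed.

Lemma finmod_sub Z N N' : finmod Z N -> (forall z t, Z z -> Z t -> N (z - t) -> N' (z - t)) ->
  finmod Z N'.
Proof.
move=> [ls [lZ lP]] NN; exists ls; split=> // z Zz; have [c cl Nc] := lP z Zz.
by exists c => //; apply: NN => //; apply: lZ.
Qed.

Lemma finmodT Z : finmod Z [set: V].
Proof.
have [[z0 Zz0]|nZ] := pselect (exists z, Z z).
  by exists [:: z0]; split=> [c|z _]; [rewrite inE => /eqP-> | exists z0; rewrite ?inE].
by exists [::]; split=> // z Zz; case: nZ; exists z.
Qed.

Lemma finmod_all (I : eqType) (s : seq I) Z (N : I -> set V) :
  (forall i, subclosed (N i)) -> (forall i, i \in s -> finmod Z (N i)) ->
  finmod Z [set c | forall i, i \in s -> N i c].
Proof.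
move=> NB; elim: s => [|i s IHs] fi; first by apply: finmod_sub (finmodT Z) _.
have h1 : finmod Z (N i) by apply: fi; rewrite inE eqxx.
have h2 : finmod Z [set c | forall i, i \in s -> N i c].
  by apply: IHs => j js; apply: fi; rewrite inE js orbT.
apply: finmod_sub (finmodI (NB i) _ h1 h2) _.
  by move=> a b ha hb j js; apply: (NB j); [apply: ha | apply: hb].
by move=> z t _ _ [n1 n2] j; rewrite inE => /orP[/eqP->|/n2].
Qed.
End FiniteModulo.

Lemma finmod_vals (T : Type) (V : zmodType) (Z : set (T -> V)) (ls : seq V) (gs : seq T) :
  (forall c g, Z c -> c g \in ls) ->
  exists cs : seq (T -> V), forall z, Z z -> exists2 c, c \in cs & map z gs = map c gs.
Proof.
move=> cl; have [L LP] := @fin_seqs V ls (size gs).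
have [|ts [_ tP]] := @finite_reps (T -> V) _ Z (fun c => map c gs) L.
  move=> c Zc; apply: LP; first by rewrite size_map.
  by move=> x; elim: gs => //= g gs IHs; rewrite inE => /orP[/eqP->|/IHs//]; apply: cl.
by exists ts => z /tP[t tt ee]; exists t.
Qed.

(** * Selmer groups *)

Section SelmerGroups.
Variables (p : nat) (Qp : padicField p) (Qpb : padicClosure Qp).
Variable iota : {rmorphism algC -> Qpb}.
Variables (K : fieldExtType Qp) (varpi : valring K).
Variables (n : nat) (MK : vectType K) (e : n.-tuple MK) (rho : galQ -> 'End(MK)).
Variables (W : {vspace MK}) (Sigma : seq nat).
Hypotheses (p_pr : prime p) (p_odd : odd p) (varpi_unif : uniformizer varpi).
Hypothesis e_basis : basis_of fullv e.
Hypothesis rho_cont : continuous_action e varpi rho.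
Hypothesis W_stable : forall g, Gp iota g -> (rho g @: W <= W)%VS.
Hypothesis W_unram : forall g v, Ip iota g -> rho g v - v \in W.
Hypothesis Sigma_prime : all prime Sigma.
Hypothesis Sigma_ram : forall l, prime l -> ~ unramified_at rho l -> l \in Sigma.
Local Notation R := (valring K).
Local Notation A := (Amod e).
Local Notation act := (@Aact p Qp K n MK e rho).
Local Notation Apr := (Aproj e).
Local Notation H := (GQinf p).
Local Notation pi := (val varpi : K).
Local Notation bar := (Abar e varpi).
Local Notation GL := (GLinf e rho varpi).
Local Notation coc := (cocycle rho H (GQSigma Sigma)).

Lemma AactE g v : act g (Apr v) = Apr (rho g v).
Proof.
apply/eqP; rewrite /Aact Aproj_eq -linearB; apply: (action_lattice rho_cont).
by rewrite -Aproj_eq Aproj_repr.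
Qed.
Lemma AscE (x : R) v : x *: Apr v = Apr (val x *: v).
Proof. exact: AscaleE. Qed.
Lemma AactD g a b : act g (a + b) = act g a + act g b.
Proof. by rewrite -[a]Aproj_repr -[b]Aproj_repr -AprojD !AactE linearD AprojD. Qed.
Lemma AactZ g (x : R) a : act g (x *: a) = x *: act g a.
Proof. by rewrite -[a]Aproj_repr AscE !AactE AscE linearZ. Qed.
Lemma Aact1 a : act 1%g a = a.
Proof. by rewrite -[a]Aproj_repr AactE (action1 rho_cont). Qed.
Lemma AactM g h a : act (g * h)%g a = act g (act h a).
Proof. by rewrite -[a]Aproj_repr !AactE (actionM rho_cont). Qed.
Lemma Aact0 g : act g 0 = 0.
Proof. by rewrite -(scale0r (0 : A)) AactZ !scale0r. Qed.
Lemma AactN g a : act g (- a) = - act g a.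
Proof. by rewrite -scaleN1r AactZ scaleN1r. Qed.
Lemma AactB g a b : act g (a - b) = act g a - act g b.
Proof. by rewrite AactD AactN. Qed.
Lemma AactVK g a : act g (act g^-1%g a) = a.
Proof. by rewrite -AactM mulgV Aact1. Qed.
Lemma AactKV g a : act g^-1%g (act g a) = a.
Proof. by rewrite -AactM mulVg Aact1. Qed.

Lemma Apr0 : Apr 0 = 0.
Proof. by apply: (@addIr _ (Apr 0)); rewrite -AprojD !add0r. Qed.
Lemma Apr_eq0 v : Apr v = 0 <-> v \in lattice e.
Proof. by rewrite -Apr0; split=> [/eqP|h]; [|apply/eqP]; rewrite Aproj_eq subr0. Qed.
Lemma latticeP v : v \in lattice e <-> forall i, coord e i v \in valring_pred K.
Proof. by split=> [/forallP|h]; [|apply/forallP]. Qed.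
Lemma pi0 : pi != 0. Proof. exact: varpi_neq0. Qed.
Lemma valX k : val (varpi ^+ k) = pi ^+ k. Proof. exact: rmorphXn. Qed.

Lemma lattice_tors v : exists k, pi ^+ k *: v \in lattice e.
Proof.
have /choice[a aP] : forall i : 'I_n, exists c, exists x : R, pi ^+ c * coord e i v = val x.
  by move=> i; have [c [x ex]] := K_denominator_varpi p_pr varpi_unif (coord e i v); exists c, x.
pose k := \max_i a i; exists k; apply/latticeP => i; rewrite linearZ /=.
have [x ex] := aP i; have aN : (a i <= k)%N by apply: leq_bigmax.
rewrite -(subnK aN) exprD -mulrA ex -valX -rmorphM; exact: valP.
Qed.
Lemma Ators (a : A) : exists k, varpi ^+ k *: a = 0.
Proof.
have [k kP] := lattice_tors (repr a); exists k; rewrite -[a]Aproj_repr AscE valX.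
exact/Apr_eq0.
Qed.
Lemma Adiv (b : A) : exists b' : A, varpi *: b' = b.
Proof.
exists (Apr (pi^-1 *: repr b)); rewrite AscE scalerA mulfV ?scale1r ?Aproj_repr //.
exact: pi0.
Qed.

Lemma Afin k : exists ls : seq A, forall a : A, varpi ^+ k *: a = 0 -> a \in ls.
Proof.
have [i|L LP] := @fin_prod 'I_n R 0 (fun _ _ => True) (fun _ x c => exists z, x - c = varpi ^+ k * z).
  have [ks kP] := residue_pow_finite p_pr varpi_unif k; exists ks => x _.
  have [c cl ez] := kP x; exists (index c ks); first by rewrite index_mem.
  by rewrite nth_index.
pose mkA (r : 'I_n -> R) := Apr (\sum_i (pi ^- k * val (r i)) *: e`_i).
exists [seq mkA r | r <- L] => a; rewrite -[a]Aproj_repr AscE valX => /Apr_eq0/latticeP aL.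
have /choice[r rP] : forall i : 'I_n, exists r : R, pi ^+ k * coord e i (repr a) = val r.
  by move=> i; have := aL i; rewrite linearZ => h; exists (ValRing h).
have [m ml mP] := LP r (fun=> I); apply/mapP; exists (nth (fun=> 0) L m); first exact: mem_nth.
apply/eqP; rewrite Aproj_eq; apply/latticeP => i.
have fe := basis_free e_basis.
rewrite linearB /= coord_sum_free //; have [z ez] := mP i.
have pk : pi ^+ k != 0 by rewrite expf_neq0 // pi0.
have -> : coord e i (repr a) = pi ^- k * val (r i) by rewrite -rP mulKf.
rewrite -[X in X \in _]/(pi ^- k * val (r i) - pi ^- k * val (nth (fun=> 0) L m i)).
have vB : val (r i - nth (fun=> 0) L m i) = val (r i) - val (nth (fun=> 0) L m i) by exact: rmorphB.
have vz : val (r i) - val (nth (fun=> 0) L m i) = pi ^+ k * val (z : R).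
  by rewrite -vB ez -valX; apply: rmorphM.
by rewrite -mulrBr vz mulKf //; apply: valP.
Qed.

Lemma Asmooth (a : A) : exists s, forall g, agree s g 1%g -> act g a = a.
Proof.
have [k kP] := lattice_tors (repr a); set v := repr a in kP.
have [s [j h]] := action_continuous rho_cont (1%g : galQ) k kP.
exists s => g ag; rewrite -[a]Aproj_repr -/v AactE; apply/eqP; rewrite Aproj_eq.
have := h g _ kP ag; rewrite /lattice_pow subrr scaler0 rpred0 => /(_ isT).
rewrite (action1 rho_cont) linearZ /= -scalerBr scalerA mulVf ?scale1r //.
by rewrite expf_neq0 // pi0.
Qed.
Lemma Asmooth_seq (ls : seq A) : exists s, forall g, agree s g 1%g -> forall a, a \in ls -> act g a = a.
Proof.
elim: ls => [|a ls [s sP]]; first by exists [::].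
have [s' s'P] := Asmooth a; exists (s' ++ s) => g ag b; rewrite inE => /orP[/eqP->|bl].
  by apply: s'P => x xs; apply: ag; rewrite mem_cat xs.
by apply: sP => // x xs; apply: ag; rewrite mem_cat xs orbT.
Qed.

(** Inertia at primes outside Sigma acts trivially, and the stabiliser of [a] is open; by
    [Krull_open] it contains everything that fixes the maximal extension. *)
Lemma Sigma_triv g a : GQSigma Sigma g -> act g a = a.
Proof.
have [s sP] := Asmooth a.
apply: (@Krull_open [set g | act g a = a] _ s) => //=; first exact: Aact1.
  by move=> x y xa ya; rewrite AactM ya.
move=> x [l [P [l_pr lS PP xP]]]; rewrite /= -[a]Aproj_repr AactE.
have ur : unramified_at rho l.
  by apply: contrapT => nu; have := Sigma_ram l_pr nu; rewrite (negPf lS).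
by rewrite (ur P x _ PP xP).
Qed.

Lemma bar_fin : exists ls : seq A, forall a, bar a -> a \in ls.
Proof. by have [ls lP] := Afin 1; exists ls => a ba; apply: lP; rewrite expr1. Qed.
Lemma bar_act g a : bar a -> bar (act g a).
Proof. by rewrite /Abar /= => ba; rewrite -AactZ ba Aact0. Qed.

Definition triv_bar : set galQ := [set g | forall a, bar a -> act g a = a].
(** A[varpi] is finite, so its pointwise stabiliser is open and contains all that fixes its fixed
    field L. *)
Lemma GL_triv : GL `<=` triv_bar.
Proof.
move=> g gL; have [ls lP] := bar_fin; have [s sP] := Asmooth_seq ls.
apply: (@Krull_open triv_bar triv_bar s) => //.
- by move=> a _; apply: Aact1.
- by move=> x y xa ya a ba; rewrite AactM ya // xa.
- by move=> x ax a ba; apply: sP => //; apply: lP.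
- by move=> x xf; apply: gL; left.
Qed.
Lemma GL_H : GL `<=` H. Proof. by move=> g gL x xQ; apply: gL; right. Qed.
Lemma GL_intro g : H g -> triv_bar g -> GL g.
Proof. by move=> gH gt x [xL|xQ]; [apply: xL | apply: gH]. Qed.

Definition okB (B : set A) := [/\ B 0, forall a b, B a -> B b -> B (a - b),
  forall (x : R) a, B a -> B (x *: a) & forall g a, B a -> B (act g a)].
Lemma okT : okB [set: A]. Proof. by []. Qed.
Lemma okbar : okB bar.
Proof.
split; first by rewrite /Abar /= scaler0.
- by rewrite /Abar => a b /= ha hb; rewrite scalerBr ha hb subrr.
- by rewrite /Abar => x a /= ha; rewrite scalerA mulrC -scalerA ha scaler0.
- exact: bar_act.
Qed.


Section Cocycle.
Variables (B : set A) (c : galQ -> A).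
Hypothesis cc : coc B c.
Lemma coc1 : c 1%g = 0.
Proof.
have := cocycleM cc (@H1 p) (@H1 p); rewrite mulg1 Aact1 => /eqP.
by rewrite -subr_eq0 opprD addrA subrr sub0r oppr_eq0 => /eqP.
Qed.
Lemma cocV g : H g -> c g^-1%g = - act g^-1%g (c g).
Proof.
move=> gH; have := cocycleM cc (HV gH) gH; rewrite mulVg coc1 => /esym/eqP.
by rewrite addr_eq0 => /eqP.
Qed.
Lemma cocJ g x : H g -> H x -> c (g * x * g^-1)%g = c g + act g (c x) - act (g * x * g^-1)%g (c g).
Proof.
move=> gH xH; rewrite (cocycleM cc (HM gH xH) (HV gH)) (cocycleM cc gH xH) cocV //.
by rewrite AactN !AactM.
Qed.
(** By the cocycle relation, a neighbourhood of 1 on which [c] is constant works at every point;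
    hence continuity is uniform and [c] takes finitely many values. *)
Lemma coc_loc : exists s, forall x y, H x -> H y -> agree s y x -> c y = c x.
Proof.
have [s sP] := cocycle_cont cc (@H1 p); exists s => x y xH yH yx.
have zH : H (x^-1 * y)%g by apply: HM => //; apply: HV.
rewrite -{1}(mulVKg x y) (cocycleM cc xH zH) (sP _ zH (agree_mulV yx)) coc1.
by rewrite Aact0 addr0.
Qed.
Lemma coc_vals : exists ls : seq A, forall x, H x -> c x \in ls.
Proof.
have [s sP] := coc_loc; have [gs gsP] := galQ_reps s.
have [|ts [tH tP]] := @reps_dep galQ H (fun x k => agree s x (nth 1%g gs k)) (size gs).
  move=> x _; have [h hg xh] := gsP x; exists (index h gs); first by rewrite index_mem.
  by rewrite nth_index.
exists (map c ts) => x xH; have [t tt [k _ [h1 h2]]] := tP x xH.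
rewrite (sP t x) //; [exact: map_f | exact: tH |].
by move=> z zs; rewrite h1 // h2.
Qed.
End Cocycle.

Lemma coc_sub B c c' : okB B -> coc B c -> coc B c' -> coc B (c - c').
Proof.
move=> [B0 BB BZ BA] cc cc'; split.
- by move=> g gH; apply: BB; [apply: (cocycle_val cc) | apply: (cocycle_val cc')].
- move=> g h gH hH; rewrite -[LHS]/(c (g * h)%g - c' (g * h)%g) -[(c - c') g]/(c g - c' g).
  rewrite -[(c - c') h]/(c h - c' h) (cocycleM cc) // (cocycleM cc') // AactB.
  by rewrite opprD addrACA.
- move=> g h gH hS; rewrite -[LHS]/(c (g * h)%g - c' (g * h)%g).
  by rewrite (cocycle_inf cc) // (cocycle_inf cc').
- move=> g gH; have [s sP] := cocycle_cont cc gH; have [s' s'P] := cocycle_cont cc' gH.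
  exists (s ++ s') => h hH ag; rewrite -[LHS]/(c h - c' h) (sP h) ?(s'P h) //.
    by move=> x xs; apply: ag; rewrite mem_cat xs orbT.
  by move=> x xs; apply: ag; rewrite mem_cat xs.
Qed.
Lemma coc_scale B (x : R) c : okB B -> coc B c -> coc B (x *: c).
Proof.
move=> [B0 BB BZ BA] cc; split.
- by move=> g gH; apply: BZ; apply: (cocycle_val cc).
- move=> g h gH hH; rewrite -[LHS]/(x *: c (g * h)%g) (cocycleM cc) // scalerDr.
  by rewrite -AactZ.
- by move=> g h gH hS; rewrite -[LHS]/(x *: c (g * h)%g) (cocycle_inf cc).
- move=> g gH; have [s sP] := cocycle_cont cc gH; exists s => h hH ag.
  by rewrite -[LHS]/(x *: c h) (sP h).
Qed.
Definition cobd (b : A) : galQ -> A := fun g => act g b - b.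
Lemma coc_cobd b : coc [set: A] (cobd b).
Proof.
split=> //.
- by move=> g h gH hH; rewrite /cobd AactM AactB [RHS]addrC addrA subrK.
- by move=> g h gH hS; rewrite /cobd AactM (Sigma_triv _ hS).
- move=> g gH; have [s sP] := Asmooth b; exists s => h hH hg; rewrite /cobd.
  have e1 : act (g^-1 * h)%g b = b by apply/sP/agree_mulV.
  by rewrite -{1}(mulVKg g h) AactM e1.
Qed.
Lemma coc_vals_bar c : coc [set: A] c -> (forall g, H g -> bar (c g)) -> coc bar c.
Proof. by move=> [_ h1 h2 h3] cb; split. Qed.
Lemma coc_okT B c : coc B c -> coc [set: A] c.
Proof. by move=> [_ h1 h2 h3]; split. Qed.


Local Notation N := (coboundary rho H [set: A]).
Local Notation IH := (Ip iota `&` H).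
Local Notation GH := (Gp iota `&` H).

Lemma H_conj g h : H h -> H (g^-1 * h * g)%g.
Proof. by move=> hH; have := H_normal p_pr p_odd g^-1%g hH; rewrite invgK. Qed.

(** The Selmer and fine Selmer conditions differ only in the local group [D] at p and in the
    subgroup [C] modulo which the cocycle has to be trivial there; both are instances. *)
Definition sel (D : set galQ) (C B : set A) : set (galQ -> A) :=
  [set c | away_from_p rho Sigma B c /\ coboundary_mod rho D B C c].

Lemma fineE B : fine_selmer iota rho Sigma B = sel GH [set 0] B.
Proof.
apply/seteqP; split=> c [ca [b Bb cb]]; split=> //; exists b => // g gD.
  by rewrite /= cb // subrr.
by apply/eqP; rewrite -subr_eq0; apply/eqP; apply: cb.
Qed.

Definition okloc (D : set galQ) (C : set A) :=
  [/\ D `<=` H, forall d x, Gp iota d -> D x -> D (d^-1 * x * d)%g,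
   [/\ C 0, (forall a b, C a -> C b -> C (a - b)) & forall (x : R) a, C a -> C (x *: a)] &
   forall d a, Gp iota d -> C a -> C (act d a)].

Lemma IH_conj d x : Gp iota d -> IH x -> IH (d^-1 * x * d)%g.
Proof.
move=> dG [xI xH]; split; last exact: H_conj.
by have := Ip_normal (GpV dG) xI; rewrite invgK.
Qed.

Lemma Csub0 : Csub e W 0.
Proof. by exists 0; [apply: mem0v | apply: Apr0]. Qed.
Lemma CsubB a b : Csub e W a -> Csub e W b -> Csub e W (a - b).
Proof.
move=> [w wW <-] [w' wW' <-]; exists (w - w'); first exact: memvB.
by apply/eqP; rewrite eq_sym subr_eq -AprojD subrK.
Qed.
Lemma CsubZ (x : R) a : Csub e W a -> Csub e W (x *: a).
Proof. by move=> [w wW <-]; exists (val x *: w); [apply: memvZ | rewrite AscE]. Qed.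
Lemma Csub_act d a : Gp iota d -> Csub e W a -> Csub e W (act d a).
Proof.
move=> dG [w wW <-]; exists (rho d w); last by rewrite AactE.
exact: (subvP (W_stable dG)) _ (memv_img _ wW).
Qed.
Lemma Csub_unram x a : Ip iota x -> Csub e W (act x a - a).
Proof.
move=> xI; rewrite -[a]Aproj_repr AactE; exists (rho x (repr a) - repr a); first exact: W_unram.
by apply/eqP; rewrite eq_sym subr_eq -AprojD subrK.
Qed.

Lemma okloc_sel : okloc IH (Csub e W).
Proof.
split; [by move=> x [] | exact: IH_conj | | exact: Csub_act].
by split; [exact: Csub0 | exact: CsubB | exact: CsubZ].
Qed.
Lemma okloc_bar : okloc IH (Cbar e varpi W).
Proof.
have [b0 bB bZ bA] := okbar.
split; [by move=> x [] | exact: IH_conj | |].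
  split; first by split; [exact: Csub0 | exact: b0].
    by move=> a b [h1 h2] [h3 h4]; split; [apply: CsubB | apply: bB].
  by move=> x a [h1 h2]; split; [apply: CsubZ | apply: bZ].
by move=> d a dG [h1 h2]; split; [apply: Csub_act | apply: bA].
Qed.
Lemma okloc_fine : okloc GH [set 0].
Proof.
split; first by move=> x [].
- move=> d x dG [xG xH]; split; last exact: H_conj.
  by apply: GpM => //; apply: GpM => //; apply: GpV.
- by split=> // [a b /= -> ->|x a /= ->]; rewrite ?subr0 ?scaler0.
- by move=> d a _ /= ->; apply: Aact0.
Qed.

Lemma cob_sub D B c c' : okB B -> coboundary rho D B c -> coboundary rho D B c' ->
  coboundary rho D B (c - c').
Proof.
move=> [B0 BB BZ BA] [b Bb cb] [b' Bb' cb']; exists (b - b'); first exact: BB.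
move=> g gD; rewrite -[LHS]/(c g - c' g) cb // cb' // AactB; zmod.
Qed.
Lemma cob_scale D B (x : R) c : okB B -> coboundary rho D B c -> coboundary rho D B (x *: c).
Proof.
move=> [B0 BB BZ BA] [b Bb cb]; exists (x *: b); first exact: BZ.
by move=> g gD; rewrite -[LHS]/(x *: c g) cb // scalerBr -AactZ.
Qed.
Lemma cob0 D B : okB B -> coboundary rho D B 0.
Proof. by move=> [B0 _ _ _]; exists 0 => // g _; rewrite Aact0 subrr. Qed.
Lemma cob_cobd D b : coboundary rho D [set: A] (cobd b).
Proof. by exists b. Qed.
Lemma coc0 B : okB B -> coc B 0.
Proof.
move=> [B0 _ _ _]; split=> //.
- by move=> g h _ _; rewrite -[RHS]/(0 + act g 0) Aact0 addr0.
- by move=> g _; exists [::].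
Qed.

Section Local.
Variables (D : set galQ) (C : set A).
Hypothesis DC : okloc D C.

Lemma sel0 B : okB B -> sel D C B 0.
Proof.
move=> oB; have [_ _ [C0 _ _] _] := DC; split.
  by split; [exact: coc0 | move=> *; apply: cob0].
have [B0 _ _ _] := oB.
by exists 0 => // g _; rewrite Aact0 !subr0.
Qed.
Lemma sel_sub B c c' : okB B -> sel D C B c -> sel D C B c' -> sel D C B (c - c').
Proof.
move=> oB [[cc ca] [b Bb cb]] [[cc' ca'] [b' Bb' cb']]; split.
  split; first exact: coc_sub.
  by move=> l P lS lp PP; apply: cob_sub => //; [apply: (ca l) | apply: (ca' l)].
have [_ _ [_ CB _] _] := DC; have [_ BB _ _] := oB.
exists (b - b'); first exact: BB.
move=> g gD; have -> : (c - c') g - (act g (b - b') - (b - b')) =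
  c g - (act g b - b) - (c' g - (act g b' - b')).
  rewrite -[(c - c') g]/(c g - c' g) AactB; zmod.
by apply: CB; [apply: cb | apply: cb'].
Qed.
Lemma sel_scale B (x : R) c : okB B -> sel D C B c -> sel D C B (x *: c).
Proof.
move=> oB [[cc ca] [b Bb cb]]; split.
  split; first exact: coc_scale.
  by move=> l P lS lp PP; apply: cob_scale => //; apply: (ca l).
have [_ _ [_ _ CZ] _] := DC; have [_ _ BZ _] := oB.
exists (x *: b); first exact: BZ.
move=> g gD; rewrite -[(x *: c) g]/(x *: c g) AactZ -!scalerBr; apply: CZ; exact: cb.
Qed.

Lemma prime_above_pre l P (g : galQ) : Defs.prime_above l P ->
  Defs.prime_above l [set y | P (g y)].
Proof.
move=> [h1 h2 h3 h4 h5 h6]; split=> /=.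
- by move=> x /h1; rewrite galQ_Aint.
- by rewrite autom_morphE rmorph_nat.
- by move=> x y Px Py; rewrite aut_add; apply: h3.
- by move=> x y xA Py; rewrite aut_mul; apply: h4; rewrite ?galQ_Aint.
- by rewrite autom1.
- by move=> x y xA yA; rewrite aut_mul; apply: h6; rewrite galQ_Aint.
Qed.
Lemma dec_pre P (g x : galQ) : decomposition P x -> decomposition [set y | P (g y)] (g^-1 * x * g)%g.
Proof. move=> xP y; change (P (g ((g^-1 * x * g)%g y)) <-> P (g y)).
by rewrite !automM automVK; apply: xP. Qed.

Lemma GQS_normal (g h : galQ) : GQSigma Sigma h -> GQSigma Sigma (g^-1 * h * g)%g.
Proof.
move=> hS x xM; rewrite !automM hS ?automKV // => s [l [P [l_pr lS PP [sD sI]]]].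
have /(_ _) gx := xM (g^-1 * s * g)%g.
rewrite -{2}gx; first by rewrite !automM automVK.
exists l, [set y | P (g y)]; split=> //; first exact: prime_above_pre.
split; first exact: dec_pre.
move=> y yA; change (P (g ((g^-1 * s * g)%g y - y))).
by rewrite automB !automM automVK; apply: sI; rewrite galQ_Aint.
Qed.

Lemma coc_conj g c : coc [set: A] c -> coc [set: A] (conj_act rho g c).
Proof.
move=> cc; split=> //.
- move=> x y xH yH; rewrite /conj_act.
  have -> : (g^-1 * (x * y) * g = (g^-1 * x * g) * (g^-1 * y * g))%g by rewrite !mulgA mulgK.
  rewrite (cocycleM cc); [|exact: H_conj|exact: H_conj].
  rewrite AactD; congr (_ + _).
  by rewrite -!AactM; congr (act _ _); rewrite !mulgA mulgV mul1g.
- move=> x h xH hS; rewrite /conj_act.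
  have -> : (g^-1 * (x * h) * g = (g^-1 * x * g) * (g^-1 * h * g))%g by rewrite !mulgA mulgK.
  by rewrite (cocycle_inf cc) //; [apply: H_conj | apply: GQS_normal].
- move=> x xH; have [s sP] := coc_loc cc; exists (map g s) => h hH ag; rewrite /conj_act.
  congr (act _ _); apply: sP; [exact: H_conj | exact: H_conj|].
  by move=> z zs; rewrite !automM ag // map_f.
Qed.

Lemma conjH c g x : coc [set: A] c -> H g -> H x ->
  act g (c (g^-1 * x * g)%g) = c x + act x (c g) - c g.
Proof.
move=> cc gH xH; have := cocJ cc (HV gH) xH; rewrite invgK => ->.
rewrite (cocV cc gH) !(AactB, AactD, AactN) AactVK.
have -> : act g (act (g^-1 * x * g)%g (act g^-1%g (c g))) = act x (c g).
  by rewrite -!AactM; congr (act _ _); rewrite !mulgA mulgV mul1g mulgK.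
by rewrite AactVK; zmod.
Qed.

(** At p, g is written d h with d in the decomposition group and h in H. Conjugation by h changes a
    cocycle by a coboundary, and d preserves the local condition. *)
Lemma sel_conj g c : sel D C [set: A] c -> sel D C [set: A] (conj_act rho g c).
Proof.
move=> [[cc ca] [b _ cb]]; have [DH DJ [C0 CB CZ] CA] := DC; split.
  split; first exact: coc_conj.
  move=> l P lS lp PP; have [a _ aP] := ca l _ lS lp (prime_above_pre g PP).
  exists (act g a) => // x [xD xH]; rewrite /conj_act aP; last first.
    by split; [apply: dec_pre | apply: H_conj].
  rewrite AactB -!AactM; congr (act _ _ - _); by rewrite !mulgA mulgV mul1g.
have [d dG] := Gp_H iota p_pr g; set h := (d^-1 * g)%g => hH.
exists (act d b + act d (c h)) => // x xD.
pose y := (d^-1 * x * d)%g; have yD : D y by apply: DJ.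
have eg : g = (d * h)%g by rewrite /h mulVKg.
have E u : act d (act y u) = act x (act d u).
  by rewrite -!AactM; congr (act _ _); rewrite /y !mulgA mulgV mul1g.
have -> : conj_act rho g c x - (act x (act d b + act d (c h)) - (act d b + act d (c h))) =
  act d (c y - (act y b - b)).
  rewrite /conj_act {1}eg AactM.
  have -> : (g^-1 * x * g = h^-1 * y * h)%g by rewrite eg /y invgM !mulgA.
  rewrite conjH //; last exact: DH.
  rewrite !(AactN, AactD) !E.
  zmod.
by apply: CA => //; apply: cb.
Qed.
End Local.

Lemma conjD g (u v : galQ -> A) : conj_act rho g (u + v) = conj_act rho g u + conj_act rho g v.
Proof. by apply/funext => x; rewrite /conj_act -[RHS]/(act g (u _) + act g (v _)) -AactD. Qed.
Lemma conjZ g (x : R) (u : galQ -> A) : conj_act rho g (x *: u) = x *: conj_act rho g u.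
Proof. by apply/funext => y; rewrite /conj_act -[RHS]/(x *: act g (u _)) -AactZ. Qed.
Lemma conj1 (u : galQ -> A) : conj_act rho 1%g u = u.
Proof. by apply/funext => y; rewrite /conj_act Aact1 invg1 mul1g mulg1. Qed.
Lemma conjM g h (u : galQ -> A) : conj_act rho (g * h)%g u = conj_act rho g (conj_act rho h u).
Proof. by apply/funext => y; rewrite /conj_act AactM invgM !mulgA. Qed.
Lemma conjN g (u : galQ -> A) : conj_act rho g (- u) = - conj_act rho g u.
Proof. by rewrite -scaleN1r conjZ scaleN1r. Qed.

Lemma N_conj g c : N c -> N (conj_act rho g c).
Proof.
move=> [b _ cb]; exists (act g b) => // x xH; rewrite /conj_act cb; last exact: H_conj.
rewrite AactB -!AactM; congr (act _ _ - _); by rewrite !mulgA mulgV mul1g.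
Qed.
Lemma cobHB c c' : N c -> N c' -> N (c - c').
Proof. by move=> h h'; apply: cob_sub => //; apply: okT. Qed.
Lemma cobH0 : N 0. Proof. by apply: cob0; apply: okT. Qed.
Lemma cobHD c c' : N c -> N c' -> N (c + c').
Proof. move=> h h'; have -> : c + c' = c - (0 - c') by rewrite sub0r opprK.
by apply: cobHB => //; apply: cobHB => //; apply: cobH0. Qed.

(** The stabiliser of the class of [c] is an open subgroup containing H, hence one of the [Un k]. *)
Lemma coc_smooth c : coc [set: A] c ->
  exists k, forall g, Un p_pr k g -> N (conj_act rho g c - c).
Proof.
move=> cc; pose KK : set galQ := [set g | N (conj_act rho g c - c)].
have K1 : KK 1%g by rewrite /KK /= conj1 subrr; apply: cobH0.
have KM g h : KK g -> KK h -> KK (g * h)%g.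
  rewrite /KK /= => kg kh; rewrite conjM.
  have -> : conj_act rho g (conj_act rho h c) - c =
    conj_act rho g (conj_act rho h c - c) + (conj_act rho g c - c).
    by rewrite conjD conjN addrA subrK.
  by apply: cobHD => //; apply: N_conj.
have KV g : KK g -> KK g^-1%g.
  rewrite /KK /= => kg; have -> : conj_act rho g^-1%g c - c =
    0 - conj_act rho g^-1%g (conj_act rho g c - c).
    by rewrite conjD conjN -conjM mulVg conj1 sub0r opprB.
  by apply: cobHB; [apply: cobH0 | apply: N_conj].
have KH : H `<=` KK.
  move=> g gH; exists (c g) => // x xH.
  rewrite -[LHS]/(act g (c (g^-1 * x * g)%g) - c x) conjH //; zmod.
have KO : exists s, forall g, agree s g 1%g -> KK g.
  have [ls lP] := coc_vals cc; have [sA sAP] := Asmooth_seq ls.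
  have [s0 s0P] := coc_loc cc; have [gs gP] := galQ_reps s0.
  (* Fixing all conjugates of [s0] makes g^-1 x g agree with x on [s0]; with [sA], g fixes the
     values of [c] as well. *)
  exists (sA ++ s0 ++ [seq (h : galQ) z | h <- gs, z <- s0]) => g ag.
  exists 0 => // x xH; rewrite Aact0 subrr -[LHS]/(act g (c (g^-1 * x * g)%g) - c x).
  have -> : c (g^-1 * x * g)%g = c x.
    apply: s0P => //; first exact: H_conj.
    move=> z zs; rewrite !automM (ag z) ?mem_cat ?zs ?orbT // automI.
    have [h hg xh] := gP x; apply: (@autom_inj _ g); rewrite automVK.
    rewrite (ag (x z)) // !mem_cat; apply/orP; right; apply/orP; right.
    by apply/allpairsP; exists (h, z); split=> //=; apply: xh.
  rewrite sAP ?subrr //; last exact: lP.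
  by move=> z zs; apply: ag; rewrite mem_cat zs.
have [k ek] := UnO_all p_pr p_odd (OpenSubgroup K1 KM KV KH KO).
exists k => g gU; have : osub_set (UnO p_pr p_odd k) g by exact: gU.
by rewrite -ek.
Qed.

Lemma Ators_seq (ls : seq A) : exists k, forall a, a \in ls -> varpi ^+ k *: a = 0.
Proof.
elim: ls => [|a ls [k kP]]; first by exists 0%N.
have [j ja] := Ators a; exists (k + j)%N => b; rewrite inE => /orP[/eqP->|bl].
  by rewrite exprD -scalerA ja scaler0.
by rewrite addnC exprD -scalerA kP // scaler0.
Qed.

Lemma mu0_sel D C : okloc D C ->
  has_mu_invariant varpi (cocycle_dual rho (sel D C [set: A])) 0 <->
  finite_set (quotient_set (S1 varpi (sel D C [set: A]) N) N).
Proof.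
move=> DC; apply: (@mu0_iff p Qp K varpi p_pr p_odd varpi_unif).
- by apply: sel0 => //; apply: okT.
- by move=> u v; apply: sel_sub => //; apply: okT.
- by move=> x u; apply: sel_scale => //; apply: okT.
- exact: cobH0.
- exact: cobHB.
- by move=> x u; apply: cob_scale; apply: okT.
- exact: conjD.
- exact: conjZ.
- exact: conj1.
- exact: conjM.
- by move=> g u; apply: sel_conj.
- by move=> g u; apply: N_conj.
- by move=> c [[cc _] _]; apply: coc_smooth.
- move=> c [[cc _] _]; have [ls lP] := coc_vals cc; have [k kP] := Ators_seq ls.
  exists k; exists 0 => // x xH; rewrite Aact0 subrr -[LHS]/(varpi ^+ k *: c x).
  by apply: kP; apply: lP.
Qed.

(** * The local condition at p and the fine Selmer group *)

Hypothesis image_hyp : finite_set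
     [set restrict_Ibeta iota rho varpi psi
       | psi in selmer_L_invariant iota rho Sigma varpi W (e := e)].
Local Notation SB := (selmer iota rho Sigma bar (Cbar e varpi W)).
Local Notation Ib := (Ibeta iota e rho varpi).

(** On the subgroup acting trivially on A[varpi], cocycles are homomorphisms and coboundaries
    vanish; invariance under G is the conjugation formula for cocycles. *)
Lemma selmer_restrict c : SB c -> selmer_L_invariant iota rho Sigma varpi W c.
Proof.
move=> [[cc ca] [b bb cb]]; split.
  split.
  - by move=> x xL; apply: (cocycle_val cc); apply: GL_H xL.
  - move=> x y xL yL; have xH := GL_H xL; have yH := GL_H yL.
    by rewrite (cocycleM cc) // (GL_triv xL) //; apply: (cocycle_val cc).
  - by move=> x y xL yS; apply: (cocycle_inf cc) => //; apply: GL_H xL.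
  - move=> x xL; have [s sP] := cocycle_cont cc (GL_H xL).
    by exists s => y yL; apply: sP; apply: GL_H yL.
  - move=> l P x lS lp PP xD xL; have [a ba aP] := ca l P lS lp PP.
    by rewrite aP ?(GL_triv xL) ?subrr //; split=> //; apply: GL_H xL.
  - move=> x [xI xL]; have := cb x (conj xI (GL_H xL)).
    by rewrite (GL_triv xL) // subrr subr0.
move=> g x gH xL; have xH := GL_H xL.
rewrite (cocJ cc gH xH).
have -> : act (g * x * g^-1)%g (c g) = c g.
  have bcg : bar (c g) by apply: (cocycle_val cc).
  by rewrite !AactM (GL_triv xL) ?AactVK //; apply: bar_act.
have -> : c g + act g (c x) - c g = act g (c x) by zmod.
exact: AactKV.
Qed.

Definition zeroIb : set (galQ -> A) := [set c | forall x, Ib x -> c x = 0].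
Lemma finmod_Ib : finmod SB zeroIb.
Proof.
have B : subclosed zeroIb.
  by move=> a b ha hb x xI; rewrite -[LHS]/(a x - b x) ha // hb // subrr.
have fq : finite_set (quotient_set SB zeroIb).
  pose G (r : {x | Ib x} -> A) := [set z : galQ -> A | restrict_Ibeta iota rho varpi z = r].
  apply: (@sub_finite_set _ _ _ _ (finite_image G image_hyp)) => _ [z Zz <-].
  exists (restrict_Ibeta iota rho varpi z); first by exists z => //; apply: selmer_restrict.
  apply/seteqP; split=> y /=.
    by move=> E x xI; have := congr1 (fun r => r (exist _ x xI)) E;
      rewrite -[(y - z) x]/(y x - z x) /restrict_Ibeta /= => ->; rewrite subrr.
  move=> E; apply/funext => -[x xI]; rewrite /restrict_Ibeta /=.
  by apply/eqP; rewrite -subr_eq0; apply/eqP; apply: E.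
have [|ls [lZ lP]] := quotient_reps _ fq; first by [].
by exists ls.
Qed.

(** Elements of inertia with the same action on the finite group A[varpi] differ by an element of
    [Ib]. *)
Lemma reps_Ib : exists ts : seq galQ, (forall t, t \in ts -> IH t) /\
  forall x, IH x -> exists2 t, t \in ts & Ib (t^-1 * x)%g.
Proof.
have [ls lP] := bar_fin; pose ls' := [seq a <- ls | `[< bar a >]].
have [L LP] := @fin_seqs A ls (size ls').
have [|ts [tI tP]] := @finite_reps galQ _ IH (fun g => map (act g) ls') L.
  move=> g _; apply: LP; first by rewrite size_map.
  move=> y /mapP[a]; rewrite mem_filter => /andP[/asboolP ba _] ->.
  by apply: lP; apply: bar_act.
exists ts; split=> // x xI; have [t tt /eq_in_map xt] := tP x xI; exists t => //.
have [tIp tH] := tI t tt; have [xIp xH] := xI.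
split; first exact: Ip_div.
apply: GL_intro; first by apply: HM => //; apply: HV.
move=> a ba; rewrite AactM xt ?AactKV // mem_filter lP // andbT.
exact/asboolP.
Qed.

(** Vanishing on [Ib] and on coset representatives gives vanishing on inertia over Q_oo; vanishing
    at [f] extends to its powers, and by uniform continuity to their limits. *)
Lemma coc_zero_Gp c (f : galQ) (ts : seq galQ) : coc bar c -> zeroIb c ->
  (forall x, IH x -> exists2 t, t \in ts & Ib (t^-1 * x)%g) ->
  (forall t, t \in ts -> IH t /\ c t = 0) -> H f -> c f = 0 ->
  (forall g, Gp iota g -> H g -> exists psi u, [/\ g = (psi * u)%g,
     Gp iota psi /\ H psi, Ip iota u /\ H u & forall s, exists k, agree s (f ^+ k)%g psi]) ->
  forall g, GH g -> c g = 0.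
Proof.
move=> cc cI tP ct fH cf fP.
have cIH x : IH x -> c x = 0.
  move=> xI; have [t tt iI] := tP x xI; have [[_ tH] t0] := ct t tt.
  have [_ iL] := iI; have iH := GL_H iL.
  by rewrite -(mulVKg t x) (cocycleM cc tH iH) t0 cI // Aact0 addr0.
have cX k : H (f ^+ k)%g /\ c (f ^+ k)%g = 0.
  elim: k => [|k [kH k0]]; first by split; [exact: H1 | exact: (coc1 cc)].
  split; rewrite expgS; first exact: HM.
  by rewrite (cocycleM cc fH kH) cf k0 Aact0 addr0.
move=> g [gG gH]; have [psi [u [-> [_ pH] uI pP]]] := fP g gG gH.
have [_ uH] := uI.
rewrite (cocycleM cc pH uH) (cIH u) // Aact0 addr0.
have [s sP] := coc_loc cc; have [k kP] := pP s; have [kH k0] := cX k.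
by rewrite -k0; apply: esym; apply: sP.
Qed.

Lemma fine_subclosed B : okB B -> subclosed (fine_selmer iota rho Sigma B).
Proof. by move=> oB a b; rewrite fineE; apply: sel_sub => //; apply: okloc_fine. Qed.

Lemma finmod_fine : finmod SB (fine_selmer iota rho Sigma bar).
Proof.
have [ls lP] := bar_fin; have [ts [tI tP]] := reps_Ib.
have [f [fG fH fP]] := frobenius_generator iota p_pr.
pose N2 : set (galQ -> A) := [set c | forall g, g \in f :: ts -> c g = 0].
have gH g : g \in f :: ts -> H g by rewrite inE => /orP[/eqP->//|/tI[]].
have N2B : subclosed N2.
  by move=> a b ha hb x xI; rewrite -[LHS]/(a x - b x) ha // hb // subrr.
have IbB : subclosed zeroIb.
  by move=> a b ha hb x xI; rewrite -[LHS]/(a x - b x) ha // hb // subrr.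
have F2 : finmod SB N2.
  (* Cut off outside the list, so that all values lie in one finite set, cocycles being arbitrary
     off H. *)
  pose cut (c : galQ -> A) : galQ -> A := fun g => if g \in f :: ts then c g else 0.
  have [|cs cP] := @finmod_vals galQ A (cut @` SB) (0 :: ls) (f :: ts).
    move=> _ g [c [[cc _] _] <-]; rewrite /cut; case: ifP => gt; rewrite inE ?eqxx //.
    by rewrite lP ?orbT //; apply: (cocycle_val cc); apply: gH.
  apply: (@finmod_reps _ SB N2 cs N2B) => z Zz.
  have [|c cc /eq_in_map E] := cP (cut z); first by exists z.
  exists c => // g gt; rewrite -[LHS]/(z g - c g) -E // /cut gt subrr //.
apply: finmod_sub (finmodI IbB N2B finmod_Ib F2) _ => z t Zz Zt [w1 w2].
have ob := okbar.
have [[cc ca] _] : SB (z - t) by apply: (@sel_sub IH (Cbar e varpi W) okloc_bar).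
split=> //; exists 0; first by case: ob.
move=> g gG; rewrite Aact0 subrr.
apply: (@coc_zero_Gp _ f ts) => //.
  by move=> x xt; split; [apply: tI | apply: w2; rewrite inE xt orbT].
by apply: w2; rewrite inE eqxx.
Qed.

(* The subgroups (varpi^k M)[varpi] of the finite group A[varpi] decrease, hence
   become stationary. *)
Lemma finite_mod_varpi (M : set A) : (forall a b, M a -> M b -> M (a - b)) ->
  (forall a, M a -> M (varpi *: a)) -> M 0 ->
  exists ls : seq A, forall m, M m -> exists2 m0, m0 \in ls & exists2 m', M m' & m - m0 = varpi *: m'.
Proof.
move=> MB MZ M0; have [bs bP] := bar_fin.
have MD a b : M a -> M b -> M (a + b).
  move=> Ma Mb; have -> : a + b = a - (0 - b) by rewrite sub0r opprK.
  by apply: (MB) => //; apply: (MB).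
pose V k : set A := [set x | bar x /\ exists2 m, M m & x = varpi ^+ k *: m].
have VS k x : V k.+1 x -> V k x.
  move=> [bx [m Mm ex]]; split=> //; exists (varpi *: m); first exact: MZ.
  by rewrite ex scalerA -exprSr.
have Vle j k x : (j <= k)%N -> V k x -> V j x.
  by move=> /subnK <-; elim: (k - j)%N => // i IHi; rewrite addSn => /VS.
have [k0 k0P] : exists k0, forall k x, V k0 x -> V k x.
  suff [k0 h] : exists k0, forall x, x \in bs -> V k0 x -> forall k, V k x.
    by exists k0 => k x Vx; apply: (h x _ Vx); apply: bP; case: Vx.
  elim: bs {bP} => [|x bs [k1 IHb]]; first by exists 0%N.
  have [all|/existsNP[k2 nk]] := pselect (forall k, V k x).
    by exists k1 => y; rewrite inE => /orP[/eqP->//|yb]; apply: IHb.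
  exists (maxn k1 k2) => y; rewrite inE => /orP[/eqP->|yb] Vy.
    by case: nk; apply: Vle (leq_maxr _ _) Vy.
  by apply: IHb => //; apply: Vle (leq_maxl _ _) Vy.
have [ls lP] := Afin k0; exists ls.
(* By stationarity, varpi^(k0+j) m killed by varpi is also varpi^(k0+j+1) m2 with m2 in [M].
   Subtracting varpi m2 lowers the exponent, until m is killed by varpi^k0 and lies in a finite
   list. *)
have main j m : M m -> varpi ^+ (k0 + j) *: m = 0 ->
    exists2 m0, m0 \in ls & exists2 m', M m' & m - m0 = varpi *: m'.
  elim: j m => [|j IHj] m Mm.
    by rewrite addn0 => m0; exists m; [apply: lP | exists 0; rewrite ?subrr ?scaler0].
  rewrite addnS exprS -scalerA => e0.
  have Vx : V (k0 + j)%N (varpi ^+ (k0 + j) *: m) by split=> //; exists m.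
  have [_ [m2 Mm2 e2]] := k0P (k0 + j).+1 _ (Vle k0 _ _ (leq_addr _ _) Vx).
  have M3 : M (m - varpi *: m2) by apply: (MB) => //; apply: MZ.
  have [|m0 ml [m' Mm' e']] := IHj _ M3.
    by rewrite scalerBr e2 scalerA -exprSr subrr.
  exists m0 => //; exists (m' + m2); first exact: MD.
  by rewrite scalerDr -e'; zmod.
move=> m Mm; have [j ej] := Ators m; apply: (main j) => //.
by rewrite exprD -scalerA ej scaler0.
Qed.

(* Away from p the classes are only required to be trivial in A, not in
   A[varpi]. *)
Definition Sb : set (galQ -> A) := [set c | [/\ coc bar c,
   forall x, IH x -> Cbar e varpi W (c x) &
   forall l P, l \in Sigma -> l != p -> Defs.prime_above l P ->
     coboundary rho (decomposition P `&` H) [set: A] c]].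

(** If varpi c is the coboundary of b, dividing b by varpi corrects c to values in A[varpi]. Inertia
    acts trivially modulo W, so coboundaries of inertia elements lie in [C], and the local condition
    at p holds for the values themselves. *)
Lemma Sb_reduce c : S1 varpi (sel IH (Csub e W) [set: A]) N c -> exists2 c', Sb c' & N (c - c').
Proof.
move=> [[[cc ca] [b0 _ cb]] [b _ Nb]]; have [b' eb] := Adiv b.
have cbar x : H x -> bar ((c - cobd b') x).
  move=> xH; rewrite /Abar /= -[(c - cobd b') x]/(c x - (act x b' - b')) !scalerBr -AactZ eb.
  by have := Nb x xH; rewrite -[LHS]/(varpi *: c x) => <-; rewrite subrr.
have cc' : coc [set: A] (c - cobd b') by apply: coc_sub => //; apply: coc_cobd.
exists (c - cobd b'); last first.
  by exists b' => // x _; rewrite -[LHS]/(c x - (c x - (act x b' - b'))); zmod.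
split; first exact: coc_vals_bar.
- move=> x [xI xH]; split; last exact: cbar.
  have -> : (c - cobd b') x = (c x - (act x b0 - b0)) - ((act x b' - b') - (act x b0 - b0)).
    by rewrite -[LHS]/(c x - (act x b' - b')); zmod.
  by apply: CsubB; [apply: cb | apply: CsubB; apply: Csub_unram].
- move=> l P lS lp PP; apply: cob_sub; [exact: okT | exact: (ca l) | exact: cob_cobd].
Qed.

(** If c is the coboundary of a on [D], then varpi a is invariant; its class modulo varpi times the
    invariants is the obstruction to choosing a in A[varpi]. *)
Lemma Sb_local (D : set galQ) : (forall c, Sb c -> coboundary rho D [set: A] c) -> D `<=` H ->
  finmod Sb (coboundary rho D bar).
Proof.
move=> Sc DH; pose M : set A := [set a | forall x, D x -> act x a = a].
have [|||ms mP] := @finite_mod_varpi M.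
- by move=> a b Ma Mb x xD; rewrite AactB (Ma x xD) (Mb x xD).
- by move=> a Ma x xD; rewrite AactZ (Ma x xD).
- by move=> x xD; rewrite Aact0.
have [|ts [tS tP]] := @reps_dep (galQ -> A) Sb (fun c k =>
    exists2 a, (forall x, D x -> c x = act x a - a) &
    exists2 m', M m' & varpi *: a - nth 0 ms k = varpi *: m') (size ms).
  move=> c cS; have [a _ aP] := Sc c cS; have [cc _ _] := cS.
  have [|m0 ml [m' Mm' em]] := mP (varpi *: a).
    move=> x xD; have : bar (c x) by apply: (cocycle_val cc); apply: DH.
    by rewrite /Abar /= aP // scalerBr -AactZ => /eqP; rewrite subr_eq0 => /eqP.
  exists (index m0 ms); first by rewrite index_mem.
  by exists a => //; exists m' => //; rewrite nth_index.
exists ts; split=> // z /tP[t tt [k _ [[a aP [m Mm em]] [a' aP' [m' Mm' em']]]]].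
(* Subtracting the invariant m - m' leaves the coboundary unchanged and brings the vector into
   A[varpi]. *)
exists t => //; exists (a - a' - (m - m')).
  by rewrite /Abar /= !scalerBr -em -em'; zmod.
move=> x xD; rewrite -[LHS]/(z x - t x) aP // aP' // !AactB (Mm x xD) (Mm' x xD); zmod.
Qed.

(** By the cocycle relation, conjugation by an element of H turns a coboundary into a coboundary;
    triviality at one prime thus passes to its whole H-orbit. *)
Lemma dec_transport w (P Q : set algC) (h r : galQ) : coc bar w -> H h ->
  (forall x, Q x <-> P ((h * r)^-1%g x)) ->
  coboundary rho (decomposition [set y | P (r^-1%g y)] `&` H) bar w ->
  coboundary rho (decomposition Q `&` H) bar w.
Proof.
move=> cc hH QP [b bb wb]; have bwh : bar (w h) by apply: (cocycle_val cc).
have [_ bB _ bA] := okbar.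
exists (act h b - w h); first by apply: bB => //; apply: bA.
move=> x [xD xH]; pose y := (h^-1 * x * h)%g; have yH : H y by apply: H_conj.
have ex : x = (h * y * h^-1)%g by rewrite /y !mulgA mulgV mul1g mulgK.
have QP' z : Q z = P ((h * r)^-1%g z) by apply/propext.
have Qr z : Q (h z) = P (r^-1%g z) by rewrite QP' invgM automM automKV.
have yD : decomposition [set y | P (r^-1%g y)] y.
  move=> z; change (P (r^-1%g (y z)) <-> P (r^-1%g z)).
  by rewrite -!Qr /y !automM automVK; apply: xD.
have E u : act h (act y u) = act x (act h u).
  by rewrite -!AactM; congr (act _ _); rewrite /y !mulgA mulgV mul1g.
have := cocJ cc hH yH; rewrite -ex => ->; rewrite (wb y (conj yD yH)) !AactB E; zmod.
Qed.

Definition awaybar : set (galQ -> A) := [set c | forall l P, l \in Sigma -> l != p ->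
  Defs.prime_above l P -> coboundary rho (decomposition P `&` H) bar c].

(** The primes above each l fall into finitely many H-orbits, so finitely many local obstructions
    are enough. *)
Lemma finmod_away : finmod Sb awaybar.
Proof.
pose Nl (l : nat) : set (galQ -> A) := [set c | l != p -> forall P,
  Defs.prime_above l P -> coboundary rho (decomposition P `&` H) bar c].
have cobB D : subclosed (coboundary rho D bar) by move=> a b; apply: cob_sub; exact: okbar.
have NlB l : subclosed (Nl l) by move=> a b ha hb lp P PP; apply: cobB; [apply: ha | apply: hb].
have F : finmod Sb [set c | forall l, l \in Sigma -> Nl l c]; last first.
  by apply: finmod_sub F _ => z t _ _ h l P lS lp PP; apply: (h l).
apply: (@finmod_all _ nat Sigma Sb Nl NlB) => l lS.
have [->|lp] := eqVneq l p.
  by apply: finmod_sub (finmodT Sb) _ => z t _ _ _; rewrite /Nl /= eqxx.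
have [[P PP]|nP] := pselect (exists P, Defs.prime_above l P); last first.
  by apply: finmod_sub (finmodT Sb) _ => z t _ _ _ _ P PP; case: nP; exists P.
have l_pr : prime l := allP Sigma_prime l lS.
have [rs rP] := finite_decomposition p_pr p_odd l_pr lp PP.
pose Nr (r : galQ) := coboundary rho (decomposition [set y | P (r^-1%g y)] `&` H) bar.
have fr r : r \in rs -> finmod Sb (Nr r).
  move=> _; apply: Sb_local; last by move=> x [].
  by move=> c [_ _ ca]; apply: (ca l) => //; apply: prime_above_pre.
apply: finmod_sub (@finmod_all _ galQ rs Sb Nr (fun r => cobB _) fr) _.
move=> z t [cz _ _] [ct _ _] h _ Q PQ.
have [g [r [gH rr QP]]] := rP Q PQ.
apply: (dec_transport _ gH QP); last exact: h.
by apply: coc_sub => //; exact: okbar.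
Qed.

Lemma fine_bar_S1 c : fine_selmer iota rho Sigma bar c ->
  S1 varpi (sel GH [set 0] [set: A]) N c.
Proof.
move=> [[cc ca] [b bb cb]]; split.
  split; last by exists b => // g gG; rewrite /= cb // subrr.
  split; first exact: coc_okT cc.
  by move=> l P lS lp PP; have [a _ aP] := ca l P lS lp PP; exists a.
exists 0 => // x xH; rewrite Aact0 subrr -[LHS]/(varpi *: c x).
exact: (cocycle_val cc xH).
Qed.

(** A class is corrected in turn to values in A[varpi], by a representative of the obstructions away
    from p, and by a representative of Selmer modulo fine Selmer; what remains is a fine class
    killed by varpi. *)
Lemma finmod_S1 : finmod (S1 varpi (sel GH [set 0] [set: A]) N) N ->
  finmod (S1 varpi (sel IH (Csub e W) [set: A]) N) N.
Proof.
move=> [vs [_ vP]]; have [ts [tS tP]] := finmod_away; have [us [uS uP]] := finmod_fine.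
apply: (@finmod_reps _ _ _ [seq t + x | t <- ts, x <- [seq u + v | u <- us, v <- vs]]).
  by move=> a b; apply: cobHB.
move=> c cS; have [c' Sc' Nc] := Sb_reduce cS; have [t tt ac] := tP c' Sc'.
have SBc : SB (c' - t).
  have [cc1 cp1 _] := Sc'; have [cc2 cp2 _] := tS t tt; split.
    by split; [apply: coc_sub => //; exact: okbar | exact: ac].
  exists 0; first by case: okbar.
  move=> x xI; rewrite Aact0 !subr0; have [_ _ [_ CB _] _] := okloc_bar.
  exact: CB (cp1 x xI) (cp2 x xI).
have [u uu fu] := uP _ SBc; have [v vv Nv] := vP _ (fine_bar_S1 fu).
exists (t + (u + v)).
  by apply/allpairsP; exists (t, u + v); split=> //=; apply/allpairsP; exists (u, v).
have -> : c - (t + (u + v)) = (c - c') + (c' - t - u - v) by zmod.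
exact: cobHD.
Qed.

Lemma finite_finmod (Z : set (galQ -> A)) : finite_set (quotient_set Z N) <-> finmod Z N.
Proof.
split=> [fq|[ls [_ lP]]]; last exact: (finite_quotient cobH0 cobHB lP).
by have [ls lP] := quotient_reps cobH0 fq; exists ls.
Qed.

(** Both sides become finiteness of varpi-torsion. One implication is the inclusion of fine classes
    among Selmer classes, since inertia lies in the decomposition group; the other is
    [finmod_S1]. *)
Lemma mu0_selmer_fine :
  has_mu_invariant varpi (cocycle_dual rho (sel IH (Csub e W) [set: A])) 0 <->
  has_mu_invariant varpi (cocycle_dual rho (sel GH [set 0] [set: A])) 0.
Proof.
apply: iff_trans (mu0_sel okloc_sel) _; apply: iff_trans _ (iff_sym (mu0_sel okloc_fine)).
rewrite !finite_finmod; split; last exact: finmod_S1.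
move=> [ls [_ lP]]; apply: (@finmod_reps _ _ _ ls); first by move=> a b; apply: cobHB.
move=> z [[za [b _ zb]] Nz]; apply: lP; split=> //; split=> //; exists b => // g [gI gH].
by rewrite (zb g) //; [apply: Csub0 | split=> //; apply: Ip_Gp].
Qed.

Lemma finite_fine : finite_set (quotient_set SB (fine_selmer iota rho Sigma bar)).
Proof.
have [ls [_ lP]] := finmod_fine; apply: finite_quotient lP.
  by rewrite fineE; apply: sel0; [apply: okloc_fine | apply: okbar].
by apply: fine_subclosed; apply: okbar.
Qed.
End SelmerGroups.

Theorem theorem5p4
  (p : nat) (Qp : padicField p) (Qpb : padicClosure Qp)
  (iota : {rmorphism algC -> Qpb})
  (K : fieldExtType Qp) (varpi : valring K)
  (n : nat) (MK : vectType K) (e : n.-tuple MK) (rho : galQ -> 'End(MK))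
  (W : {vspace MK}) (Sigma : seq nat)
  (p_prime : prime p) (p_odd : odd p)
  (varpi_unif : uniformizer varpi)
  (n_ge2 : (2 <= n)%N)
  (e_basis : basis_of fullv e)
  (rho_cont : continuous_action e varpi rho)
  (rho_ram : finite_set [set l | prime l /\ ~ unramified_at rho l])
  (rho_irr : irreducible_action rho)
  (W_stable : forall g, Gp iota g -> (rho g @: W <= W)%VS)
  (W_dim : \dim W = \dim (fixedSpace (rho complex_conj)))
  (W_unram : forall g v, Ip iota g -> rho g v - v \in W)
  (Sigma_prime : all prime Sigma)
  (Sigma_p : p \in Sigma)
  (Sigma_ram : forall l, prime l -> ~ unramified_at rho l -> l \in Sigma)
  (S_cotorsion : iw_torsion
     (cocycle_dual rho (selmer iota rho Sigma [set: Amod e] (Csub e W))))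
  (Cbar_hyp : forall B : set (Amod e), submodule rho (GQinf p) B ->
     B `<=` Cbar e varpi W -> B = [set 0])
  (image_hyp : finite_set
     [set restrict_Ibeta iota rho varpi psi
       | psi in selmer_L_invariant iota rho Sigma varpi W (e := e)]) :
  finite_set (quotient_set
    (selmer iota rho Sigma (Abar e varpi) (Cbar e varpi W))
    (fine_selmer iota rho Sigma (Abar e varpi)))
  /\
  (has_mu_invariant varpi
     (cocycle_dual rho (selmer iota rho Sigma [set: Amod e] (Csub e W))) 0
   <->
   has_mu_invariant varpi
     (cocycle_dual rho (fine_selmer iota rho Sigma [set: Amod e])) 0).
Proof.
split; first exact: (finite_fine p_prime p_odd varpi_unif e_basis rho_cont W_stable image_hyp).
rewrite fineE.
exact: (mu0_selmer_fine p_prime p_odd varpi_unif e_basis rho_cont W_stable W_unram Sigma_prime Sigma_ram image_hyp).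
Qed.
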